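(* Let $\alpha\in\,]0,1[$ and let $\Omega\subset\mathbb R^N$ be a bounded domain of class $C^{4,\alpha}$. Consider the eigenvalue problem $$\Delta^2u=\lambda u\ \text{in }\Omega,\qquad \Delta u=0\ \text{on }\partial\Omega,\qquad \frac{\partial\Delta u}{\partial\nu}=0\ \text{on }\partial\Omega,$$ understood as in the context. Then the set of its eigenvalues is contained in $[0,+\infty[$. The eigenspace corresponding to the eigenvalue $\lambda=0$ has infinite dimension and all harmonic functions in $H^2(\Omega)$ are eigenfunctions associated with $\lambda=0$. Moreover, the set of positive eigenvalues consists of a sequence increasing to $+\infty$. Each positive eigenvalue has finite multiplicity and the corresponding eigenfunctions form an orthonormal basis of $\Delta(H^4(\Omega)\cap H^2_0(\Omega))$.
   Context: A domain is a connected open set; $\nu$ is the outer unit normal to $\partial\Omega$; $H^2(\Omega)$, $H^4(\Omega)$, $H^2_0(\Omega)$ are the standard real Sobolev spaces; $\Delta(H^4(\Omega)\cap H^2_0(\Omega))$ is the image of $H^4(\Omega)\cap H^2_0(\Omega)$ under the Laplacian. One has the direct decomposition $H^2(\Omega)=H^2_h(\Omega)\oplus\Delta(H^4(\Omega)\cap H^2_0(\Omega))$, where $H^2_h(\Omega)=\{h\in H^2(\Omega):\Delta h=0\}$ is the space of harmonic functions in $H^2(\Omega)$. For $\lambda=0$ the solutions of the problem are exactly the harmonic functions in $H^2(\Omega)$. For $\lambda\neq0$ the problem is understood, as a problem in $\Delta(H^4(\Omega)\cap H^2_0(\Omega))$, through the following weak formulation: $$\int_\Omega\Delta^2u\,\Delta^2\varphi\,dx=\lambda\int_\Omega\Delta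 u\,\Delta\varphi\,dx\quad\text{for all }\varphi\in H^4(\Omega)\cap H^2_0(\Omega),$$ in the unknowns $u\in H^4(\Omega)\cap H^2_0(\Omega)$, $u\ne 0$, and $\lambda\in\mathbb R$; the corresponding eigenfunction of the problem is $\Delta u\in\Delta(H^4(\Omega)\cap H^2_0(\Omega))$. The bilinear form on the left-hand side defines on $H^4(\Omega)\cap H^2_0(\Omega)$ a scalar product whose induced norm is equivalent to the standard norm of $H^4(\Omega)$.
   Formalization: The claim that the eigenspace of λ=0 has infinite dimension is stated only for N ≥ 2, since for N = 1 (e.g. Ω = ]0,1[) the harmonic functions are affine and form a space of dimension 2; all other claims are stated for every N ≥ 1. *)

(* Defs.v *)
From HB Require Import structures.
From mathcomp Require Import all_boot all_order all_algebra.
From mathcomp Require Import all_classical all_reals all_analysis.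

Set Implicit Arguments.
Unset Strict Implicit.
Unset Printing Implicit Defensive.

Import Order.TTheory GRing.Theory Num.Theory.
Import numFieldNormedType.Exports.

Local Open Scope classical_set_scope.
Local Open Scope ring_scope.

Definition rV_display : measure_display -> measure_display.
Proof. exact. Qed.

Section measurable_rV.
Context (R : realType) (n : nat).

Let coors : 'I_n -> 'rV[R]_n -> measurableTypeR R := fun i x => x ord0 i.

Let rV_set0 : g_sigma_preimage coors set0.
Proof. exact: sigma_algebra0. Qed.

Let rV_setC A : g_sigma_preimage coors A -> g_sigma_preimage coors (~` A).
Proof. exact: sigma_algebraC. Qed.

Let rV_bigcup (F : (set 'rV[R]_n)^nat) :
  (forall i, g_sigma_preimage coors (F i)) ->
  g_sigma_preimage coors (\bigcup_i (F i)).
Proof. exact: sigma_algebra_bigcup. Qed.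

(* The sigma-algebra generated by the coordinates, as the library does for
   tuples; since R is second countable it is the Borel sigma-algebra. *)
HB.instance Definition _ := @isMeasurable.Build
  (rV_display default_measure_display)
  'rV[R]_n (g_sigma_preimage coors) rV_set0 rV_setC rV_bigcup.

End measurable_rV.

Section lebesgue_rV.
Context (R : realType).

Definition cons_rV (n : nat) (p : measurableTypeR R * 'rV[R]_n) :
    'rV[R]_n.+1 :=
  \row_i (if unlift ord0 i is Some j then p.2 ord0 j else p.1).

Definition uncons_rV (n : nat) (x : 'rV[R]_n.+1) :
    measurableTypeR R * 'rV[R]_n :=
  (x ord0 ord0, \row_j x ord0 (lift ord0 j)).

Lemma cons_rVK n : cancel (@cons_rV n) (@uncons_rV n).
Proof.
case=> a y; rewrite /uncons_rV /cons_rV mxE unlift_none; congr pair.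
by apply/rowP => j; rewrite !mxE liftK.
Qed.

Lemma measurable_coor n (i : 'I_n) :
  measurable_fun [set: 'rV[R]_n]
    (fun x : 'rV[R]_n => x ord0 i : measurableTypeR R).
Proof.
move=> _ Y mY; rewrite setTI; apply: sub_sigma_algebra => /=.
rewrite -bigcup_seq/=; exists i => /=; first by rewrite mem_index_enum.
by exists Y => //; rewrite setTI.
Qed.

Lemma measurable_fun_rVP d (T : measurableType d) n (f : T -> 'rV[R]_n) :
  (forall i, measurable_fun [set: T] (fun t => f t ord0 i : measurableTypeR R))
  -> measurable_fun [set: T] f.
Proof.
move=> mf _ A mA; rewrite setTI.
have : (preimage_set_system [set: T] f (@measurable _ 'rV[R]_n)) (f @^-1` A).
  by exists A => //; rewrite setTI.
rewrite /measurable/= /g_sigma_preimage -g_sigma_preimageE.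
apply: smallest_sub; first exact: sigma_algebra_measurable.
move=> _ [B] + <-; rewrite setTI -bigcup_seq/= => -[i _ [C mC <-]].
by rewrite setTI; have := mf i measurableT C mC; rewrite setTI.
Qed.

Lemma measurable_cons_rV n : measurable_fun setT (@cons_rV n).
Proof.
apply: measurable_fun_rVP => i; rewrite /cons_rV.
under [X in measurable_fun _ X]eq_fun do rewrite mxE.
case: (unlift ord0 i) => [j|]; last exact: measurable_fst.
exact: (measurableT_comp (measurable_coor j) measurable_snd).
Qed.

Lemma measurable_uncons_rV n : measurable_fun setT (@uncons_rV n).
Proof.
apply/measurable_fun_pairP; split => /=; first exact: measurable_coor.
apply: measurable_fun_rVP => j.
under [X in measurable_fun _ X]eq_fun do rewrite /= mxE.
exact: measurable_coor.
Qed.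

Section step.
Variables (n : nat) (mu : {sigma_finite_measure set 'rV[R]_n -> \bar R}).

Definition lebesgue_rV_step : set 'rV[R]_n.+1 -> \bar R :=
  pushforward (@lebesgue_measure R \x mu)%E (@cons_rV n).

Let step0 : lebesgue_rV_step set0 = 0%E.
Proof. by rewrite /lebesgue_rV_step /pushforward preimage_set0 measure0. Qed.

Let step_ge0 A : (0 <= lebesgue_rV_step A)%E.
Proof. by rewrite /lebesgue_rV_step /pushforward; exact: measure_ge0. Qed.

Let step_sigma_additive : semi_sigma_additive lebesgue_rV_step.
Proof.
have mc B : measurable B -> measurable (@cons_rV n @^-1` B).
  by move=> mB; rewrite -[X in measurable X]setTI; exact: measurable_cons_rV.
move=> F mF tF mUF; rewrite /lebesgue_rV_step /pushforward preimage_bigcup.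
apply: measure_semi_sigma_additive.
- by move=> k; exact: mc.
- apply/trivIsetP => /= i j _ _ ij; rewrite -preimage_setI.
  by move/trivIsetP : tF => /(_ _ _ _ _ ij) ->//; rewrite preimage_set0.
- by rewrite -preimage_bigcup; exact: mc.
Qed.

HB.instance Definition _ := isMeasure.Build _ _ _ lebesgue_rV_step
  step0 step_ge0 step_sigma_additive.

Let step_sigma_finite : sigma_finite setT lebesgue_rV_step.
Proof.
have /sigma_finiteP[F [TF ndF Foo]] := sigma_finiteT (@lebesgue_measure R).
have /sigma_finiteP[G [TG ndG Goo]] := sigma_finiteT mu.
exists (fun k => @uncons_rV n @^-1` (F k `*` G k)).
  rewrite -preimage_bigcup (_ : \bigcup_k _ = setT) ?preimage_setT//.
  rewrite -setXTT TF TG predeqE => -[x y]; split.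
    by move=> [k _ []/= ? ?]; split; exists k.
  move=> [/= [k _ Fkx] [l _ Gly]]; exists (maxn k l) => //; split.
  - by move: x Fkx; exact/subsetPset/ndF/leq_maxl.
  - by move: y Gly; exact/subsetPset/ndG/leq_maxr.
move=> k; have [mF Fk] := Foo k; have [mG Gk] := Goo k; split.
  rewrite -[X in measurable X]setTI; apply: measurable_uncons_rV => //.
  exact: measurableX.
rewrite /lebesgue_rV_step /pushforward -comp_preimage.
rewrite (_ : _ \o _ = id) ?preimage_id; last first.
  by apply/funext => p; exact: cons_rVK.
by rewrite product_measure1E// lte_mul_pinfty// ge0_fin_numE.
Qed.

HB.instance Definition _ := Measure_isSigmaFinite.Build _ _ _
  lebesgue_rV_step step_sigma_finite.

End step.

Fixpoint lebesgue_rV (n : nat) : {sigma_finite_measure set 'rV[R]_n -> \bar R} :=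
  match n with
  | 0 => dirac (0 : 'rV[R]_0)
  | n'.+1 => lebesgue_rV_step (lebesgue_rV n')
  end.

Lemma lebesgue_rV_box (n : nat) (A : 'I_n -> set (measurableTypeR R)) :
  (forall i, measurable (A i)) ->
  (lebesgue_rV n [set x | forall i, A i (x ord0 i)] =
   \big[mule/1]_(i < n) lebesgue_measure (A i))%E.
Proof.
elim: n A => [|n IHn] A mA.
  by rewrite big_ord0/= diracE mem_set//= => -[].
rewrite big_ord_recl -IHn; last by move=> i; exact: mA.
have mB : measurable [set y : 'rV[R]_n | forall i, A (lift ord0 i) (y ord0 i)].
  rewrite (_ : [set _ | _] = \bigcap_(i in [set: 'I_n])
      ((fun y : 'rV[R]_n => y ord0 i : measurableTypeR R) @^-1`
        A (lift ord0 i))); last first.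
    by apply/seteqP; split => [y Ay i _|y Ay i]; exact: Ay.
  apply: fin_bigcap_measurable => [|i _]; first exact: finite_finset.
  by rewrite -[X in measurable X]setTI; exact: measurable_coor.
rewrite -product_measure1E// /= /lebesgue_rV_step /pushforward.
congr (product_measure1 _ _ _); apply/seteqP; split => [[a y]|[a y]] /=.
  move=> Aay; split => [|i].
    by have := Aay ord0; rewrite mxE unlift_none.
  by have := Aay (lift ord0 i); rewrite mxE liftK.
move=> [Aa Ay] i; rewrite mxE.
by case: unliftP => [j ->|->] //=.
Qed.

End lebesgue_rV.

Section classical_derivatives.
Context (R : realType).

(* [pderiv [:: i1; ..; im] f] is the iterated partial derivative of f in the
   directions i1, .., im; lists of directions play the role of multi-indices. *)
Definition pderiv (n : nat) (s : seq 'I_n) (f : 'rV[R]_n -> R) :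
    'rV[R]_n -> R :=
  foldr (fun i g x => 'D_('e_i) g x) f s.

Definition C_k (n k : nat) (f : 'rV[R]_n -> R) : Prop :=
  (forall s : seq 'I_n, (size s < k)%N ->
     forall x i, derivable (pderiv s f) x 'e_i) /\
  (forall s : seq 'I_n, (size s <= k)%N -> continuous (pderiv s f)).

Definition C_kalpha (n k : nat) (alpha : R) (f : 'rV[R]_n -> R) : Prop :=
  C_k k f /\
  exists C : R, forall s : seq 'I_n, size s = k ->
    forall x y, `|pderiv s f x - pderiv s f y| <= C * `|x - y| `^ alpha.

Definition domain (n : nat) (Omega : set 'rV[R]_n) : Prop :=
  [/\ Omega !=set0, open Omega & connected Omega].

(* Up to a rigid motion, near every boundary point Omega is the strict
   epigraph of a C^{k,alpha} function of the first n coordinates. *)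
Definition class_C_kalpha (n k : nat) (alpha : R)
    (Omega : set 'rV[R]_n.+1) : Prop :=
  forall x0, (closure Omega `\` Omega^°) x0 ->
    exists (Q : 'M[R]_n.+1) (gamma : 'rV[R]_n -> R),
      [/\ Q *m Q^T = 1%:M, C_kalpha k alpha gamma &
        \forall x \near x0,
          let y := (x - x0) *m Q in
          Omega x <-> gamma (col' ord_max y) < y ord0 ord_max].

Definition test_function (n : nat) (Omega : set 'rV[R]_n)
    (phi : 'rV[R]_n -> R) : Prop :=
  (forall k, C_k k phi) /\
  (let supp := closure [set x | phi x != 0] in
   compact supp /\ supp `<=` Omega).

End classical_derivatives.

(* Elements of L^2(Omega) and of the Sobolev spaces are represented by
   functions on R^n considered up to equality almost everywhere on Omega. *)
Section sobolev.
Context (R : realType) (n : nat).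
Local Notation mu := (lebesgue_rV R n).
Implicit Types (Omega : set 'rV[R]_n) (u v w g : 'rV[R]_n -> R).

Definition L2 Omega u : Prop :=
  measurable_fun Omega u /\
  (\int[mu]_(x in Omega) ((u x) ^+ 2)%:E < +oo)%E.

Definition ae_eq_on Omega u v : Prop := u = v %[ae mu in Omega].

Definition is_weak_deriv Omega (s : seq 'I_n) u g : Prop :=
  forall phi, test_function Omega phi ->
    \int[mu]_(x in Omega) (u x * pderiv s phi x) =
    (-1) ^+ size s * \int[mu]_(x in Omega) (g x * phi x).

(* The weak derivative in L^2(Omega), which is unique up to a null set; the
   value is irrelevant when there is none. *)
Definition weak_deriv Omega (s : seq 'I_n) u : 'rV[R]_n -> R :=
  xget (cst 0) [set g | L2 Omega g /\ is_weak_deriv Omega s u g].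

Definition Hk (k : nat) Omega u : Prop :=
  L2 Omega u /\
  forall s : seq 'I_n, (size s <= k)%N ->
    exists2 g, L2 Omega g & is_weak_deriv Omega s u g.

(* The closure of the test functions in H^2(Omega). *)
Definition H20 Omega u : Prop :=
  Hk 2 Omega u /\
  exists phi : nat -> 'rV[R]_n -> R,
    (forall m, test_function Omega (phi m)) /\
    forall s : seq 'I_n, (size s <= 2)%N ->
      (\int[mu]_(x in Omega)
         ((weak_deriv Omega s u x - pderiv s (phi m) x) ^+ 2)%:E)%E
        @[m --> \oo] --> 0%E.

Definition lap Omega u : 'rV[R]_n -> R :=
  fun x => \sum_(i < n) weak_deriv Omega [:: i; i] u x.

Definition H2h Omega h : Prop :=
  Hk 2 Omega h /\ ae_eq_on Omega (lap Omega h) (cst 0).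

Definition H4_H20 Omega u : Prop := Hk 4 Omega u /\ H20 Omega u.

Definition lap_H4_H20 Omega v : Prop :=
  L2 Omega v /\ exists2 u, H4_H20 Omega u & ae_eq_on Omega v (lap Omega u).

Definition weak_solution Omega (lambda : R) u : Prop :=
  forall phi, H4_H20 Omega phi ->
    \int[mu]_(x in Omega) (lap Omega (lap Omega u) x *
                           lap Omega (lap Omega phi) x) =
    lambda * \int[mu]_(x in Omega) (lap Omega u x * lap Omega phi x).

(* For lambda = 0 the solutions are the harmonic functions in H^2(Omega); for
   lambda <> 0 the eigenfunctions are the functions v = Delta u where u solves
   the weak problem in H^4(Omega) \cap H^2_0(Omega). *)
Definition pb_eigenfunction Omega (lambda : R) v : Prop :=
  if lambda == 0 then H2h Omega v /\ ~ ae_eq_on Omega v (cst 0)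
  else L2 Omega v /\
    exists u, [/\ H4_H20 Omega u, ~ ae_eq_on Omega u (cst 0),
      weak_solution Omega lambda u & ae_eq_on Omega v (lap Omega u)].

Definition pb_eigenvalue Omega (lambda : R) : Prop :=
  exists v, pb_eigenfunction Omega lambda v.

Definition pb_eigenspace Omega (lambda : R) : set ('rV[R]_n -> R) :=
  [set v | pb_eigenfunction Omega lambda v \/
           (L2 Omega v /\ ae_eq_on Omega v (cst 0))].

(* For a vector space E of functions modulo null sets. *)
Definition finite_dim Omega (E : set ('rV[R]_n -> R)) : Prop :=
  exists (m : nat) (v : 'I_m -> 'rV[R]_n -> R),
    (forall i, E (v i)) /\
    forall w, E w -> exists c : 'I_m -> R,
      ae_eq_on Omega w (fun x => \sum_(i < m) c i * v i x).

(* The scalar product of H^4 \cap H^2_0 given by the left-hand side of the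
   weak formulation, transported to Delta(H^4 \cap H^2_0) by u |-> Delta u. *)
Definition lap_dot Omega v w : R :=
  \int[mu]_(x in Omega) (lap Omega v x * lap Omega w x).

Definition orthonormal_basis Omega (v : nat -> 'rV[R]_n -> R) : Prop :=
  [/\ forall k, lap_H4_H20 Omega (v k),
      forall j k, lap_dot Omega (v j) (v k) = (j == k)%:R &
      forall w, lap_H4_H20 Omega w ->
        let r m x := w x - \sum_(k < m) lap_dot Omega w (v k) * v k x in
        lap_dot Omega (r m) (r m) @[m --> \oo] --> (0 : R)].

End sobolev.

(* Main.v *)
(** Let [B(u,w)] and [b(u,w)] be the integrals of [D^2 u D^2 w] and [D u D w],
D being the Laplacian, on the space [V] of the functions of H^4 that lie in
H^2_0. The weak eigenvalue problem reads [B(u,.) = lambda b(u,.)], and its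
solutions are found by maximizing the quotient [b/B] on the [B]-orthogonal of
the eigenvectors already found. This needs that [V] is complete for [B] and
that [b] is [B]-compact; both follow from the a priori estimate
[|u|_{H^4} <= C |D^2 u|_{L^2}] and from the smallness of [u - K * u] for a
mollifier [K].

The a priori estimate is obtained by freezing coefficients. A shear flattens
the boundary near a point and turns the Laplacian into a small perturbation of
the constant coefficient operator [A], the sum of the squares of linearly
independent constant vector fields. On the half space, [u] being in H^2_0, its
derivatives with at least two tangential directions extend by [0] to
functions of H^2 of the whole space, where the second derivatives are
controlled by [A]; testing against such an extension bounds them by
[A^2 u]. A higher order reflection gives the interpolation inequality
[|D_i D_0 g|^2 <= C |D_i^2 g| |D_0^2 g|] that handles the derivatives with at
most one tangential direction.

The eigenvalue [0] has infinite multiplicity since the real parts of the powers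
of [x_0 + i x_1] are harmonic and linearly independent. *)
Require Import Defs.
From HB Require Import structures.
From mathcomp Require Import all_boot all_order all_algebra.
From mathcomp Require Import all_classical all_reals all_analysis.
From mathcomp Require Import measurable_realfun ring lra.
From mathcomp Require finmap.
Set Implicit Arguments.
Unset Strict Implicit.
Unset Printing Implicit Defensive.
Import Order.TTheory GRing.Theory Num.Theory.
Import numFieldNormedType.Exports.
Local Open Scope classical_set_scope.
Local Open Scope ring_scope.

(** Freezing coefficients leaves an error of top order with a small factor d. The patches are taken
    so small that the half space constant times the perturbation constant times d is at most 1/2,
    and the error is absorbed. The lower order norms that remain are not removed by a compactness
    argument: interpolation reduces order three to order two, and order two is bounded through |D
    u|^2 = (D^2 u, u), Poincare's inequality and Cauchy-Schwarz. The same identity gives b(u,u) <=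
    |D^2 u| |u|, so that the compactness of b only concerns the L^2 norm of u.

    Weak derivatives are handled through jets, families of functions indexed by lists of directions
    in which each member is a weak derivative of the one before. Products, compositions with charts
    and extensions of jets are given by formulas, and the arbitrary choice made by [weak_deriv]
    enters only when the result is carried back to the Sobolev spaces.

    The spectral theorem is proved for two forms on a subspace, so that no Hilbert space of classes
    modulo null sets has to be built. *)

Lemma sqr_normr (R : realDomainType) (x : R) : `|x| ^+ 2 = x ^+ 2.
Proof. by rewrite real_normK// num_real. Qed.

(** * Square-integrable functions with their scalar product and norm *)

Module Lsq.
Section sqi.
Context d (T : measurableType d) (R : realType).
Variables (mu : {measure set T -> \bar R}) (D : set T).
Hypothesis mD : measurable D.
Implicit Types f g h : T -> R.

Definition sqi f:= measurable_fun D f /\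
 (\int[mu]_(x in D) ((f x) ^+ 2)%:E < +oo)%E.

Definition dot f g : R:= \int[mu]_(x in D) (f x * g x).

Definition nrm f : R:= Num.sqrt (dot f f).

Lemma sqi_sqr f : sqi f -> mu.-integrable D (EFin \o (fun x=> f x ^+ 2)).
Proof.
move=> [mf foo];apply/integrableP;split.
 by apply/measurable_EFinP;exact:measurable_funX.
by under eq_integral=> x _ do rewrite /= ger0_norm ?sqr_ge0//.
Qed.

Lemma sqi_mul f g : sqi f -> sqi g ->
 mu.-integrable D (EFin \o (fun x=> f x * g x)).
Proof.
move=> sf sg;have i:= integrableD mD (sqi_sqr sf) (sqi_sqr sg).
apply:le_integrable i=> //.
 by apply/measurable_EFinP;apply:measurable_funM;[case:sf|case:sg].
move=> x Dx /=;rewrite lee_fin ler_norml ger0_norm ?addr_ge0 ?sqr_ge0//.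
have:= sqr_ge0 (f x + g x);have:= sqr_ge0 (f x - g x).
by have:= sqr_ge0 (f x);have:= sqr_ge0 (g x);nra.
Qed.

Lemma sqi_le f g : measurable_fun D f -> sqi g ->
 (forall x, D x -> `|f x| <= `|g x|) -> sqi f.
Proof.
move=> mf sg fg;split=> //;case:(sg)=> _;apply:le_lt_trans.
apply:ge0_le_integral=> //.
- by move=> x _;rewrite lee_fin sqr_ge0.
- by apply/measurable_EFinP;exact:measurable_funX.
- by apply/measurable_EFinP;apply:measurable_funX;case:sg.
by move=> x Dx;rewrite lee_fin -[leLHS]sqr_normr -[leRHS]sqr_normr lerXn2r ?nnegrE ?fg.
Qed.

Lemma sqi_integrable f : measurable_fun D f ->
 mu.-integrable D (EFin \o (fun x=> f x ^+ 2)) -> sqi f.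
Proof.
move=> mf fi;split=> //;exact:integrable_lty.
Qed.

Lemma sqiM (a f : T -> R) (C : R) : measurable_fun D a ->
 (forall x, D x -> `|a x| <= C) -> sqi f -> sqi (fun x=> a x * f x).
Proof.
move=> ma aC sf;apply:sqi_integrable.
 by apply:measurable_funM=> //;case:sf.
apply:(le_integrable mD _ _ (integrableZl mD (C ^+ 2) (sqi_sqr sf))).
 apply/measurable_EFinP;apply:measurable_funX;apply:measurable_funM=> //.
 by case:sf.
move=> x Dx /=;rewrite lee_fin normrX normrM exprMn normrM !normrX.
apply:ler_wpM2r;first exact:sqr_ge0.
have:= aC _ Dx=> h;rewrite lerXn2r ?nnegrE//.
by rewrite (le_trans h)// ler_norm.
Qed.

Lemma sqiZ (a : R) f : sqi f -> sqi (a *: f).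
Proof. by move=> sf;apply:(@sqiM (cst a) _ `|a|). Qed.

Lemma sqiD f g : sqi f -> sqi g -> sqi (f + g).
Proof.
move=> sf sg;apply:sqi_integrable.
 by apply:measurable_funD;[case:sf|case:sg].
have i:= integrableD mD (integrableZl mD 2 (sqi_sqr sf))
            (integrableZl mD 2 (sqi_sqr sg)).
apply:le_integrable i=> //.
 by apply/measurable_EFinP;apply:measurable_funX;apply:measurable_funD;
  [case:sf|case:sg].
move=> x Dx /=;rewrite lee_fin [leLHS]ger0_norm ?sqr_ge0// [leRHS]ger0_norm;last first.
 by have:= sqr_ge0 (f x);have:= sqr_ge0 (g x);rewrite /=;nra.
by rewrite /= fctE;have:= sqr_ge0 (f x - g x);nra.
Qed.

Lemma sqi0 : sqi 0.
Proof.
split;first exact:measurable_cst.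
by under eq_integral=> x _ do rewrite /= expr0n/=;rewrite integral0.
Qed.

Lemma sqiN f : sqi f -> sqi (- f).
Proof. by rewrite -scaleN1r;exact:sqiZ. Qed.

Lemma sqiB f g : sqi f -> sqi g -> sqi (f - g).
Proof. by move=> sf sg;apply:sqiD=> //;exact:sqiN. Qed.

Lemma sqi_sum (I : Type) (s : seq I) (P : pred I) (F : I -> T -> R) :
 (forall i, P i -> sqi (F i)) -> sqi (\sum_(i <- s | P i) F i).
Proof. by move=> h;apply:big_ind=> //;[exact:sqi0|exact:sqiD]. Qed.

Lemma dotC f g : dot f g = dot g f.
Proof. by apply:eq_Rintegral=> x _;rewrite mulrC. Qed.

Lemma dotDl f g h : sqi f -> sqi g -> sqi h ->
 dot (f + g) h = dot f h + dot g h.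
Proof.
move=> sf sg sh;rewrite /dot -RintegralD//;[|exact:sqi_mul..].
by apply:eq_Rintegral=> x _;rewrite /= fctE mulrDl.
Qed.

Lemma dotZl (a : R) f g : sqi f -> sqi g -> dot (a *: f) g = a * dot f g.
Proof.
move=> sf sg;rewrite /dot -RintegralZl//;last exact:sqi_mul.
by apply:eq_Rintegral=> x _;rewrite /= fctE mulrA.
Qed.

Lemma dotDr f g h : sqi f -> sqi g -> sqi h ->
 dot h (f + g) = dot h f + dot h g.
Proof. by move=> *;rewrite dotC dotDl// ![dot h _]dotC. Qed.

Lemma dotZr (a : R) f g : sqi f -> sqi g -> dot f (a *: g) = a * dot f g.
Proof. by move=> *;rewrite dotC dotZl// dotC. Qed.

Lemma dotNl f g : sqi f -> sqi g -> dot (- f) g = - dot f g.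
Proof. by move=> *;rewrite -scaleN1r dotZl// mulN1r. Qed.

Lemma dotBl f g h : sqi f -> sqi g -> sqi h ->
 dot (f - g) h = dot f h - dot g h.
Proof. by move=> *;rewrite dotDl ?dotNl//;exact:sqiN. Qed.

Lemma dotBr f g h : sqi f -> sqi g -> sqi h ->
 dot h (f - g) = dot h f - dot h g.
Proof. by move=> *;rewrite dotC dotBl// ![dot h _]dotC. Qed.

Lemma dot0l g : dot 0 g = 0.
Proof.
rewrite /dot (_ : (fun x=> _) = cst 0) ?Rintegral_cst ?mul0r//.
by apply/funext=> x /=;rewrite mul0r.
Qed.

Lemma dot_suml (I : Type) (s : seq I) (P : pred I) (F : I -> T -> R) g :
 (forall i, P i -> sqi (F i)) -> sqi g ->
 dot (\sum_(i <- s | P i) F i) g = \sum_(i <- s | P i) dot (F i) g.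
Proof.
move=> h sg;elim: s=> [|i s ih];first by rewrite !big_nil dot0l.
rewrite !big_cons;case:ifP=> // Pi.
by rewrite dotDl ?ih//;[exact:h|exact:sqi_sum].
Qed.

Lemma dot_ge0 f : 0 <= dot f f.
Proof. by apply:Rintegral_ge0=> x _;rewrite -expr2 sqr_ge0. Qed.

Lemma nrm0 : nrm 0 = 0.
Proof. by rewrite /nrm dot0l sqrtr0. Qed.

Lemma nrm_ge0 f : 0 <= nrm f. Proof. exact:sqrtr_ge0. Qed.

Lemma sqr_nrm f : nrm f ^+ 2 = dot f f.
Proof. by rewrite sqr_sqrtr// dot_ge0. Qed.

(** [q t] is the squared norm of f + t g, evaluated at its minimizer if g has positive norm.
    Otherwise it is affine in t and would equal -1 at the last value of t, unless [dot f g]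
    vanishes. *)
Lemma dot_CS f g : sqi f -> sqi g -> `|dot f g| <= nrm f * nrm g.
Proof.
move=> sf sg;rewrite -(ler_pXn2r (n:= 2)) ?nnegrE ?mulr_ge0 ?nrm_ge0//.
rewrite exprMn !sqr_nrm sqr_normr.
have q (t : R) : 0 <= dot f f + 2 * t * dot f g + t ^+ 2 * dot g g.
 have:= dot_ge0 (f + t *: g);have stg:= sqiZ t sg.
 have sft:= sqiD sf stg;rewrite dotDl ?dotDr// !(dotZl, dotZr)//.
 by rewrite (dotC g f);nra.
have:= dot_ge0 g;rewrite le_eqVlt=> /predU1P[g0|g0];last first.
 have:= q (- (dot f g / dot g g)).
 have -> : dot f f + 2 * - (dot f g / dot g g) * dot f g +
   (- (dot f g / dot g g)) ^+ 2 * dot g g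
   = dot f f - dot f g ^+ 2 / dot g g by field;rewrite gt_eqF.
 by rewrite subr_ge0 ler_pdivrMr.
rewrite -g0 mulr0;have /= [->|fg0] := eqVneq (dot f g) 0;first by rewrite expr0n.
have:= q (- (dot f f + 1) / (2 * dot f g));rewrite -g0 mulr0 addr0.
rewrite (_ : 2 * _ * _ = - (dot f f + 1));last by field.
by rewrite opprD addNKr lerNr oppr0 ler10.
Qed.

Lemma nrmD f g : sqi f -> sqi g -> nrm (f + g) <= nrm f + nrm g.
Proof.
move=> sf sg;rewrite -(ler_pXn2r (n:= 2)) ?nnegrE ?addr_ge0 ?nrm_ge0//.
have sfg:= sqiD sf sg;rewrite sqr_nrm sqrrD !sqr_nrm dotDl ?dotDr//.
rewrite (dotC g f);have:= dot_CS sf sg;rewrite ler_norml=> /andP[_];lra.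
Qed.

Lemma nrmZ (a : R) f : sqi f -> nrm (a *: f) = `|a| * nrm f.
Proof.
move=> sf;rewrite /nrm dotZl ?dotZr//;last exact:sqiZ.
by rewrite mulrA -expr2 sqrtrM ?sqr_ge0// sqrtr_sqr.
Qed.

Lemma nrmN f : nrm (- f) = nrm f.
Proof.
by congr Num.sqrt;apply:eq_Rintegral=> x _;rewrite /= fctE mulrNN.
Qed.

Lemma nrmB f g : sqi f -> sqi g -> nrm (f - g) <= nrm f + nrm g.
Proof. by move=> sf sg;rewrite -[nrm g]nrmN nrmD//;exact:sqiN. Qed.

Lemma nrmM (a f : T -> R) (C : R) : measurable_fun D a -> 0 <= C ->
 (forall x, D x -> `|a x| <= C) -> sqi f ->
 nrm (fun x=> a x * f x) <= C * nrm f.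
Proof.
move=> ma C0 aC sf;rewrite -(ler_pXn2r (n:= 2)) ?nnegrE ?mulr_ge0 ?nrm_ge0//.
have saf:= sqiM ma aC sf.
rewrite exprMn !sqr_nrm -RintegralZl//;last exact:sqi_mul.
apply:le_Rintegral=> //;first exact:sqi_mul.
 exact:(integrableZl mD _ (sqi_mul sf sf)).
move=> x Dx;rewrite mulrACA -!expr2 ler_wpM2r ?sqr_ge0//.
by rewrite -sqr_normr lerXn2r ?nnegrE ?aC.
Qed.

Lemma nrm_le f g : sqi f -> sqi g -> (forall x, D x -> `|f x| <= `|g x|) ->
 nrm f <= nrm g.
Proof.
move=> sf sg fg;rewrite ler_wsqrtr//;apply:le_Rintegral=> //.
- exact:sqi_mul.
- exact:sqi_mul.
move=> x Dx;rewrite -!expr2 -[leLHS]sqr_normr -[leRHS]sqr_normr.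
by rewrite lerXn2r ?nnegrE ?fg.
Qed.

Lemma ae_eq_dot f f' g : sqi f -> sqi f' -> sqi g ->
 ae_eq mu D f f' -> dot f g = dot f' g.
Proof.
move=> sf sf' sg ff';congr fine;apply:ae_eq_integral=> //.
- exact:(measurable_int mu (sqi_mul sf sg)).
- exact:(measurable_int mu (sqi_mul sf' sg)).
by apply:filterS ff' => x + Dx=> ->.
Qed.

Lemma ae_eq_nrm f f' : sqi f -> sqi f' -> ae_eq mu D f f' ->
 nrm f = nrm f'.
Proof.
move=> sf sf' ff';rewrite /nrm (ae_eq_dot sf sf' sf ff').
by rewrite dotC (ae_eq_dot sf sf' sf' ff').
Qed.

Lemma nrm0_ae f : sqi f -> nrm f = 0 -> ae_eq mu D f (cst 0).
Proof.
move=> sf f0;have : dot f f = 0 by rewrite -sqr_nrm f0 expr0n.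
have i:= sqi_mul sf sf.
rewrite /dot /Rintegral -[X in _ = X]/(fine 0)=> /eqP.
rewrite -(inj_eq (@EFin_inj _)) !fineK//;last exact:integrable_fin_num.
move=> /eqP h.
have /(ae_eq_integral_abs mu mD (measurable_int mu i)) :
  (\int[mu]_(x in D) `|(EFin \o (fun x=> f x * f x)%R) x| = 0)%E.
 by rewrite -h;apply:eq_integral=> x _ /=;rewrite ger0_norm// -expr2 sqr_ge0.
apply:filterS=> x /= h' Dx;have:= h' Dx=> -[] /eqP.
by rewrite mulf_eq0 orbb=> /eqP.
Qed.

End sqi.
Arguments dot {d T R} mu D f g.
Arguments nrm {d T R} mu D f.
Arguments sqi {d T R} mu D f.
End Lsq.
Export Lsq.

(** * Completeness of L^2 *)

Lemma cvg_sqr0 (R : realType) (u : nat -> R) : (forall m, 0 <= u m) ->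
 u m ^+ 2 @[m --> \oo] --> 0 -> u m @[m --> \oo] --> 0.
Proof.
move=> u0 /cvgrPdist_lt c;apply/cvgrPdist_lt=> e e0.
apply:filterS (c _ (exprn_gt0 2 e0))=> m;rewrite !sub0r !normrN normrX.
by rewrite ltr_pXn2r ?nnegrE// ltW.
Qed.

Section sqi_complete.
Context d (T : measurableType d) (R : realType).
Variables (mu : {measure set T -> \bar R}) (D : set T).
Hypothesis mD : measurable D.
Notation sqi:= (sqi mu D).
Notation nrm:= (nrm mu D).
Notation dot:= (dot mu D).

Lemma nrm_abs (f : T -> R) : nrm (fun x=> `|f x|) = nrm f.
Proof.
congr Num.sqrt;apply:eq_Rintegral=> x _.
by rewrite /= -!expr2 sqr_normr.
Qed.

Lemma sqi_abs (f : T -> R) : sqi f -> sqi (fun x=> `|f x|).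
Proof.
move=> sf;apply:(sqi_le mD _ sf);last by move=> x _;rewrite normr_id.
by apply:measurableT_comp=> //;case:sf.
Qed.

Lemma integral_sqr_nrm (f : T -> R) : sqi f ->
 (\int[mu]_(x in D) (f x ^+ 2)%:E = (nrm f ^+ 2)%:E)%E.
Proof.
move=> sf;rewrite sqr_nrm /dot /Rintegral fineK;last first.
 exact/integrable_fin_num/sqi_mul.
by apply:eq_integral=> x _;rewrite expr2.
Qed.

Section fast.
Variable w : nat -> T -> R.
Hypothesis sw : forall m, sqi (w m).
Hypothesis fast : forall k, nrm (w k.+1 - w k) <= 2^-1 ^+ k.

(** The partial sums G dominate all differences of the w m. Their norms stay below 2 by [nG], so
    that G^2 increases to a limit L which is integrable by monotone convergence and serves as the
    dominating function. *)
Let G m : T -> R:= \sum_(k < m) (fun x=> `|(w k.+1 - w k) x|).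

Let sG m : sqi (G m).
Proof. by apply:sqi_sum=> // k _;apply:sqi_abs;exact:sqiB. Qed.

Let nG m : nrm (G m) <= 2 - 2 * 2^-1 ^+ m.
Proof.
elim: m=> [|m ih].
 by rewrite /G big_ord0 expr0 mulr1 subrr nrm0.
rewrite /G big_ord_recr/=;apply:(le_trans (nrmD mD (sG m) _)).
 by apply:sqi_abs;exact:sqiB.
rewrite nrm_abs (le_trans (lerD ih (fast m)))// exprS;lra.
Qed.

Let GE m x : G m x = \sum_(k < m) `|w k.+1 x - w k x|.
Proof. by rewrite /G fct_sumE. Qed.

Let L x:= limn (fun m=> ((G m x) ^+ 2)%:E).

Let G0 m x : 0 <= G m x.
Proof. by rewrite GE sumr_ge0. Qed.

Let ndG x : {homo (fun m=> ((G m x) ^+ 2)%:E) : m n / (m <= n)%N >-> (m <= n)%E}.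
Proof.
move=> m n mn;rewrite lee_fin lerXn2r ?nnegrE//.
rewrite !GE -!(big_mkord xpredT (fun k=> `|w k.+1 x - w k x|)).
by rewrite [leRHS](big_cat_nat _ mn)//= lerDl sumr_ge0.
Qed.

Let cvgL x : ((G m x) ^+ 2)%:E @[m --> \oo] --> L x.
Proof. by apply:ereal_nondecreasing_is_cvgn;exact:ndG. Qed.

Let GL m x : (((G m x) ^+ 2)%:E <= L x)%E.
Proof.
apply:lime_ge;first exact:cvgL.
by exists m=> // n /= mn;exact:ndG.
Qed.

Let mL : measurable_fun D L.
Proof.
apply:(emeasurable_fun_cvg (fun m x=> ((G m x) ^+ 2)%:E))=> [m|x _].
 by apply/measurable_EFinP;apply:measurable_funX;case:(sG m).
exact:cvgL.
Qed.

Let L0 x : (0 <= L x)%E.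
Proof. by apply:le_trans (GL 0 x);rewrite lee_fin sqr_ge0. Qed.

Let intL : mu.-integrable D L.
Proof.
apply/integrableP;split=> //.
under eq_integral=> x _ do rewrite gee0_abs//.
have cv : (\int[mu]_(x in D) ((G m x) ^+ 2)%:E @[m --> \oo] -->
  \int[mu]_(x in D) L x)%E.
 apply:cvg_monotone_convergence=> //.
  by move=> m;apply/measurable_EFinP;apply:measurable_funX;case:(sG m).
 by move=> m x _;rewrite lee_fin sqr_ge0.
apply:(@le_lt_trans _ _ 4%:E);last exact:ltry.
rewrite -(cvg_lim _ cv)//;apply:lime_le;first exact:(cvgP _ cv).
apply:nearW=> m;rewrite integral_sqr_nrm// lee_fin.
have h : nrm (G m) <= 2.
 by apply:(le_trans (nG m));rewrite gerBl mulr_ge0.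
by rewrite (_ : 4 = 2 ^+ 2 :> R) ?lerXn2r ?nnegrE ?nrm_ge0//;ring.
Qed.

Let A:= D `&` (L @^-1` [set x | (x < +oo)%E]).

Let mA : measurable A.
Proof. rewrite /A;apply:emeasurable_fun_infty_o=> //. Qed.

Let wG m k x : (m <= k)%N -> (w m x - w k x) ^+ 2 <= G k x ^+ 2.
Proof.
move=> mk;rewrite -[leLHS]sqr_normr lerXn2r ?nnegrE//.
rewrite distrC -(telescope_sumr (fun i=> w i x) mk).
apply:le_trans (ler_norm_sum _ _ _) _.
rewrite GE -(big_mkord xpredT (fun k=> `|w k.+1 x - w k x|)).
by rewrite [leRHS](big_cat_nat _ mk)//= lerDr sumr_ge0.
Qed.

Let cvgw x : A x -> cvgn (fun m=> w m x).
Proof.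
move=> [Dx /= Lx].
pose g k:= w k.+1 x - w k x.
have cs : cvgn (series g).
 apply:normed_cvg;apply:nondecreasing_is_cvgn.
  apply/nondecreasing_seqP=> n;rewrite -subr_ge0 /normed_series_of seriesSB.
  exact:normr_ge0.
 (* A non-negative s with s^2 <= L is at most 1 + L. *)
 exists (1 + fine (L x))=> _ [n _ <-];rewrite /normed_series_of seriesEord.
 have:= GL n x;rewrite -[L x]fineK;last by rewrite ge0_fin_numE.
 rewrite lee_fin GE /=.
 set s:= \sum_(k < n) _;have : 0 <= s by exact:sumr_ge0.
 nra.
have -> : (fun m=> w m x) = (cst (w 0 x) + series g).
 by apply/funext=> m;rewrite [LHS](eq_sum_telescope (fun m=> w m x)).
by apply:is_cvgD=> //;exact:is_cvg_cst.
Qed.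

Lemma sqi_fast_complete :
 exists2 v, sqi v & nrm (w m - v) @[m --> \oo] --> 0.
Proof.
(* The indicator makes the sequence converge at every point of D, so that v is measurable. A has
   full measure in D because L is integrable. *)
pose v x:= limn (fun m=> \1_A x * w m x).
have cv x : D x -> \1_A x * w m x @[m --> \oo] --> v x.
 move=> Dx;rewrite /v;have [xA|xA] := boolP (x \in A).
  apply:is_cvgM;first exact:is_cvg_cst.
  by apply:cvgw;exact:set_mem.
 rewrite (_ : (fun m=> _) = cst 0);last first.
  by apply/funext=> m;rewrite indicE (negbTE xA) mul0r.
 exact:is_cvg_cst.
have mv : measurable_fun D v.
 apply:(measurable_fun_cvg (h:= fun m x=> \1_A x * w m x))=> // m.
 by apply:measurable_funM;[exact:measurable_indic|case:(sw m)].
have bd m x : A x -> (((w m x - v x) ^+ 2)%:E <= L x)%E.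
 move=> Ax;have [Dx _] := Ax;have:= cv _ Dx.
 rewrite indicE mem_set//;under eq_fun do rewrite mul1r.
 move=> c;have c2 : ((w m x - w k x) ^+ 2)%:E @[k --> \oo] --> ((w m x - v x) ^+ 2)%:E.
  apply:cvg_EFin;first by exact:nearW.
  by apply:(@cvg_comp _ _ _ _ (fun y=> y ^+ 2));[apply:cvgB;[exact:cvg_cst|exact:c]|exact:exprn_continuous].
 rewrite -(cvg_lim _ c2)//;apply:lime_le;first exact:(cvgP _ c2).
 exists m=> // k /= mk;apply:le_trans (GL k x).
 by rewrite lee_fin wG.
have aeA : {ae mu, forall x, D x -> A x}.
 have:= integrable_ae mD intL;apply:filterS=> x h Dx;split=> //=.
 by have:= h Dx;rewrite fin_numE=> /andP[_];rewrite ltey.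
have swv m : sqi (w m - v).
 split;first by apply:measurable_funB=> //;case:(sw m).
 move/integrableP : intL=> [_];apply:le_lt_trans.
 apply:ae_ge0_le_integral=> //.
 - by move=> x _;rewrite lee_fin sqr_ge0.
 - apply/measurable_EFinP;apply:measurable_funX;apply:measurable_funB=> //.
  by case:(sw m).
 - exact:measurableT_comp.
 apply:filterS aeA=> x h Dx;rewrite gee0_abs//.
 by apply:(bd m);exact:h.
exists v.
 by rewrite -[v](subKr (w 0%N));apply:sqiB.
have:= @dominated_convergence _ _ _ mu D mD
 (fun m x=> ((w m x - v x) ^+ 2)%:E) (cst 0%E) L.
move=> /(_ _ _ _ intL) [||||].
- move=> m;apply/measurable_EFinP;apply:measurable_funX.
 by apply:measurable_funB=> //;case:(sw m).
- exact:measurable_cst.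
- apply:filterS aeA=> x h Dx;have Ax:= h Dx.
 have:= cv _ Dx;rewrite indicE mem_set//;under eq_fun do rewrite mul1r.
 move=> c;apply:cvg_EFin;first exact:nearW.
 rewrite [X in _ --> X](_ : _ = (v x - v x) ^+ 2);last by rewrite subrr expr0n.
 by apply:(@cvg_comp _ _ _ _ (fun y=> y ^+ 2));[apply:cvgB;[exact:c|exact:cvg_cst]|exact:exprn_continuous].
- apply:filterS aeA=> x h m Dx;rewrite gee0_abs ?lee_fin ?sqr_ge0//.
 by apply:bd;exact:h.
move=> _ _;rewrite integral0=> c.
have {}c : ((nrm (w m - v)) ^+ 2)%:E @[m --> \oo] --> 0%E.
 by under eq_fun=> m do rewrite -integral_sqr_nrm//.
by apply:cvg_sqr0=> [m|];[exact:nrm_ge0|exact:(fine_cvg c)].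
Qed.

End fast.

Lemma sqi_complete (u : nat -> T -> R) : (forall m, sqi (u m)) ->
 (forall e, 0 < e -> exists N, forall m n, (N <= m)%N -> (N <= n)%N ->
   nrm (u m - u n) <= e) ->
 exists2 v, sqi v & nrm (u m - v) @[m --> \oo] --> 0.
Proof.
move=> su cau.
have /choice[N PN] (k : nat) : exists N, forall m n, (N <= m)%N -> (N <= n)%N ->
   nrm (u m - u n) <= 2^-1 ^+ k by apply:cau;rewrite exprn_gt0.
(* [phi k] lies beyond [N i] for every i up to k, and beyond k itself, so that it tends to
   infinity. *)
pose phi k:= (\max_(i < k.+1) (N i + i))%N.
have Nphi i k : (i <= k)%N -> (N i <= phi k)%N.
 move=> ik;rewrite -ltnS in ik;apply:leq_trans (leq_addr i _) _.
 exact:(leq_bigmax (Ordinal ik)).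
have kphi k : (k <= phi k)%N.
 by apply:leq_trans (leq_addl (N k) _) _;exact:(leq_bigmax (@ord_max k)).
have [v sv c] := @sqi_fast_complete (fun k=> u (phi k)) (fun k=> su _)
 (fun k=> PN k _ _ (Nphi k k.+1 (leqnSn _)) (Nphi k k (leqnn _))).
exists v=> //;apply/cvgrPdist_le=> e e0.
have /cau[M PM] : 0 < e / 2 by rewrite divr_gt0.
have [k [Mk ck]] : exists k, (M <= phi k)%N /\ nrm (u (phi k) - v) <= e / 2.
 have /cvgrPdist_le/(_ _ (divr_gt0 e0 (ltr0Sn _ 1)))[K _ hK] := c.
 exists (maxn K M);split;first by rewrite (leq_trans _ (kphi _))// leq_maxr.
 have /= := hK _ (leq_maxl K M).
 by rewrite sub0r normrN ger0_norm ?nrm_ge0.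
exists M=> // m /= Mm;rewrite sub0r normrN ger0_norm ?nrm_ge0//.
rewrite (_ : u m - v = (u m - u (phi k)) + (u (phi k) - v));last first.
 by rewrite addrA subrK.
apply:(le_trans (nrmD mD _ _));[exact:sqiB|exact:sqiB|].
by rewrite [leRHS]splitr lerD// PM.
Qed.
End sqi_complete.

(** * Integrals under maps that multiply the measure by a constant *)

Section transfer.
Context d1 d2 (X : measurableType d1) (Y : measurableType d2) (R : realType).
Variables (mu : {measure set X -> \bar R}) (nu : {measure set Y -> \bar R}).
Variables (phi : X -> Y) (mphi : measurable_fun setT phi) (c : R).
Hypothesis c0 : 0 <= c.
Hypothesis H : forall A, measurable A -> mu (phi @^-1` A) = (c%:E * nu A)%E.

Let push : {measure set Y -> \bar R} :=
 measure_function_pushforward__canonical__measure_function_Measure mu mphi.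

Lemma ge0_integral_transfer (f : Y -> \bar R) : measurable_fun setT f ->
 (forall y, (0 <= f y)%E) ->
 (\int[mu]_x f (phi x) = c%:E * \int[nu]_y f y)%E.
Proof.
move=> mf f0.
have:= ge0_integral_pushforward mphi mu measurableT mf (fun y _=> f0 y).
rewrite preimage_setT=> <-.
rewrite -(ge0_integral_mscale nu measurableT (NngNum c0) mf)//.
apply:(@eq_measure_integral _ _ _ _ (mscale (NngNum c0) nu) push)=> A mA _.
by rewrite /= /pushforward H.
Qed.

Lemma integrable_transfer (f : Y -> R) :
 nu.-integrable setT (EFin \o f) -> mu.-integrable setT (EFin \o (f \o phi)).
Proof.
move=> fi;have /integrableP[me foo] := fi;apply/integrableP;split.
 exact:(measurableT_comp me mphi).
have mae : measurable_fun setT (abse \o (EFin \o f)) by exact:measurableT_comp.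
have /= -> := ge0_integral_transfer mae (fun y=> abse_ge0 _).
by rewrite lte_mul_pinfty.
Qed.

Lemma integral_transfer (f : Y -> R) :
 nu.-integrable setT (EFin \o f) ->
 \int[mu]_x f (phi x) = c * \int[nu]_y f y.
Proof.
move=> fi;have /integrableP[me foo] := fi.
have hp:= ge0_integral_transfer (measurable_funepos me) (fun _=> funepos_ge0 _ _).
have hn:= ge0_integral_transfer (measurable_funeneg me) (fun _=> funeneg_ge0 _ _).
rewrite /Rintegral (integralE _ _ (fun x=> (f (phi x))%:E)).
rewrite (integralE _ _ (fun x=> (f x)%:E)).
transitivity (fine (\int[mu]_x ((EFin \o f)^\+ (phi x)) -
 \int[mu]_x ((EFin \o f)^\- (phi x))))%E.
 by congr (fine (_ - _)%E);apply:eq_integral=> y _;rewrite ?funeposE ?funenegE.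
have fp:= integrable_pos_fin_num measurableT fi.
have fn:= integrable_neg_fin_num measurableT fi.
rewrite hp hn -muleBr//;last exact:integrable_add_def.
by rewrite fineM// fin_numB fp fn.
Qed.

Lemma sqi_transfer (f : Y -> R) : sqi nu setT f -> sqi mu setT (f \o phi).
Proof.
move=> sf;apply:sqi_integrable=> //.
 by apply:measurableT_comp=> //;case:sf.
exact:(@integrable_transfer (fun y=> f y ^+ 2) (sqi_sqr sf)).
Qed.

Lemma dot_transfer (f g : Y -> R) : sqi nu setT f -> sqi nu setT g ->
 dot mu setT (f \o phi) (g \o phi) = c * dot nu setT f g.
Proof.
move=> sf sg;rewrite /dot -(integral_transfer (f:= fun y=> f y * g y))//.
exact:sqi_mul.
Qed.

End transfer.

(** * Lebesgue measure of boxes and its behaviour under affine maps, rotations and shears *)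

Lemma lebesgue_measure_itv_max (R : realType) (u v : R) (b1 b2 : bool) :
 lebesgue_measure [set` Interval (BSide b1 u) (BSide b2 v)] =
 (Num.max 0 (v - u))%:E.
Proof.
rewrite lebesgue_measure_itv/= lte_fin.
by case:ltP=> uv;rewrite /Num.max;case:ltP=> // h;congr EFin;lra.
Qed.

Section affine1.
Context (R : realType).
Notation lam:= (@lebesgue_measure R).

Lemma measurable_affine1 (s h : R) :
 measurable_fun setT (fun x : measurableTypeR R=> s * x + h : measurableTypeR R).
Proof. by apply:measurable_funD=> //;exact:measurable_funM. Qed.

(** By uniqueness of Lebesgue measure: [|s|] times the push-forward agrees with it on half-open
    intervals. A negative s exchanges the open end and the closed end, whence the formula for
    intervals with arbitrary ends. *)
Lemma lebesgue_affine1 (s h : R) (A : set (measurableTypeR R)) : s != 0 ->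
 measurable A ->
 (lam ((fun x=> s * x + h)%R @^-1` A) = (`|s|^-1)%:E * lam A)%E.
Proof.
move=> s0 mA.
have nz : 0 < `|s| by rewrite normr_gt0.
have nz' : 0 <= `|s| by [].
pose push : {measure set (measurableTypeR R) -> \bar R} :=
 measure_function_pushforward__canonical__measure_function_Measure lam
  (measurable_affine1 s h).
suff /(_ A mA) : forall A : set (measurableTypeR R), measurable A ->
  lam A = mscale (NngNum nz') push A.
 rewrite /mscale/= /pushforward=> ->.
 by rewrite muleA -EFinM mulVf ?mul1e// gt_eqF.
apply:lebesgue_measure_unique=> _ [[a b] _ <-]/=.
rewrite /mscale/= /pushforward.
rewrite lebesgue_measure_itv_max.
have [sp|sn|//] := ltgtP 0 s;last by move/eqP;rewrite eq_sym (negbTE s0).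
- rewrite (_ : _ @^-1` _ = `](a - h) / s, (b - h) / s]%classic);last first.
  apply/seteqP;split=> x /=;rewrite !in_itv/= ltr_pdivrMr// ler_pdivlMr//;
   by rewrite mulrC ltrBlDr lerBrDr.
 rewrite lebesgue_measure_itv_max -EFinM ger0_norm ?ltW// maxr_pMr ?ltW// mulr0.
 by congr (Num.max _ _)%:E;field;rewrite gt_eqF.
- rewrite (_ : _ @^-1` _ = `[(b - h) / s, (a - h) / s[%classic);last first.
  apply/seteqP;split=> x /=;rewrite !in_itv/= ler_ndivrMr// ltr_ndivlMr//;
   by rewrite mulrC ltrBlDr lerBrDr andbC.
 rewrite lebesgue_measure_itv_max -EFinM ltr0_norm// maxr_pMr ?oppr_ge0 ?ltW// mulr0.
 by congr (Num.max _ _)%:E;field;rewrite lt_eqF.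
Qed.

End affine1.

Section rVmeas.
Context (R : realType) (n : nat).
Notation mu:= (lebesgue_rV R n).
Implicit Types A : set 'rV[R]_n.

Definition box (B : 'I_n -> set (measurableTypeR R)) : set 'rV[R]_n :=
 [set x | forall i, B i (x ord0 i)].

Lemma measurable_box B : (forall i, measurable (B i)) -> measurable (box B).
Proof.
move=> mB;rewrite (_ : box B = \bigcap_(i in [set: 'I_n])
   ((fun y : 'rV[R]_n=> y ord0 i : measurableTypeR R) @^-1` B i));last first.
 by apply/seteqP;split=> [y Ay i _|y Ay i];exact:Ay.
apply:fin_bigcap_measurable=> [|i _];first exact:finite_finset.
by rewrite -[X in measurable X]setTI;exact:measurable_coor.
Qed.

Lemma lebesgue_box B : (forall i, measurable (B i)) ->
 mu (box B) = \big[mule/1%E]_(i < n) lebesgue_measure (B i).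
Proof. exact:lebesgue_rV_box. Qed.

Definition boxes : set (set 'rV[R]_n) :=
 [set A | exists2 B : 'I_n -> set (measurableTypeR R),
   (forall i, measurable (B i)) & A = box B].

Lemma measurable_boxes : @measurable _ 'rV[R]_n = <<s boxes >>.
Proof.
apply/seteqP;split;last first.
 apply:smallest_sub;first exact:sigma_algebra_measurable.
 by move=> _ [B mB ->];exact:measurable_box.
rewrite [X in X `<=` _]/measurable/= /g_sigma_preimage.
apply:smallest_sub;first exact:smallest_sigma_algebra.
rewrite -bigcup_seq/= => A [i _ [C mC <-]];apply:sub_sigma_algebra.
exists (fun j=> if j == i then C else setT);first by move=> j;case:ifP.
apply/seteqP;split=> [x [_ Cx] j|x /(_ i)] /=;rewrite ?eqxx//.
by case:eqP=> // ->.
Qed.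

Lemma setI_closed_boxes : setI_closed boxes.
Proof.
move=> _ _ [B mB ->] [C mC ->];exists (fun i=> B i `&` C i).
 by move=> i;exact:measurableI.
by apply/seteqP;split=> [x [? ?] i|x h];split=> // i;case:(h i).
Qed.

Lemma ball_box (x : 'rV[R]_n) (r : R) : 0 < r ->
 ball x r = box (fun i=> `](x ord0 i - r), (x ord0 i + r)[%classic).
Proof.
move=> r0;apply/seteqP;split=> y /=.
 by move=> [_ h] i;have:= h ord0 i;rewrite /ball/= in_itv/= ltr_distlC.
move=> h;split=> // i j;rewrite (ord1 i);have:= h j.
by rewrite /= /ball/= in_itv/= ltr_distlC.
Qed.

(** The boxes generate the sigma-algebra and are stable under intersection, and the cubes of side 2k
    exhaust the space with finite measure. *)
Lemma lebesgue_rV_uniq (m : {measure set 'rV[R]_n -> \bar R}) :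
 (forall B, (forall i, measurable (B i)) ->
   m (box B) = \big[mule/1%E]_(i < n) lebesgue_measure (B i)) ->
 forall A, measurable A -> m A = mu A.
Proof.
move=> H;pose g k:= box (fun i=> `[- k%:R, k%:R]%classic).
apply:(measure_unique boxes g)=> //.
- exact:measurable_boxes.
- exact:setI_closed_boxes.
- by move=> k;exists (fun i=> `[- k%:R, k%:R]%classic).
- apply/seteqP;split=> // x _.
 exists (\sum_i Num.bound (x ord0 i))%N=> // i /=.
 rewrite in_itv/= -ler_norml;apply:(@le_trans _ _ (Num.bound (x ord0 i))%:R).
  exact/ltW/unstable.ltr_norm_bound.
 by rewrite ler_nat (bigD1 i)//= leq_addr.
- by move=> _ [B mB ->];rewrite H//;apply/esym;exact:lebesgue_box.
move=> k;rewrite H//;under eq_bigr do rewrite lebesgue_measure_itv_max.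
by rewrite prodEFin ltry.
Qed.

Lemma meas_ball (x : 'rV[R]_n) r : 0 < r -> measurable (ball x r).
Proof. by move=> r0;rewrite ball_box//;apply:measurable_box. Qed.

Lemma leb_ball (x : 'rV[R]_n) r : 0 < r ->
 mu (ball x r) = ((2 * r) ^+ n)%:E.
Proof.
move=> r0;rewrite ball_box// lebesgue_box//.
under eq_bigr do rewrite lebesgue_measure_itv_max.
rewrite prodEFin (eq_bigr (fun=> 2 * r)) ?prodr_const ?card_ord// => i _.
by rewrite max_r;lra.
Qed.

(** An open set is the union of the countably many balls with rational centre and radius 1/(k+1)
    that it contains, and a ball of the sup norm is a box. *)
Lemma open_meas A : open A -> measurable A.
Proof.
move=> oA.
pose c (q : 'rV[rat]_n) : 'rV[R]_n:= \row_i ratr (q ord0 i).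
pose F (p : 'rV[rat]_n * nat) : set 'rV[R]_n :=
 if `[< ball (c p.1) p.2.+1%:R^-1 `<=` A >]
 then ball (c p.1) p.2.+1%:R^-1 else set0.
rewrite (_ : A = \bigcup_p F p);last first.
 apply/seteqP;split=> [x Ax|x [p _]];last first.
  by rewrite /F;case:asboolP=> // + h;exact.
 have /nbhs_ballP[e /= e0 eA] : nbhs x A by exact:open_nbhs_nbhs.
 have [k _ /(_ _ (leqnn _)) hk] := near_infty_natSinv_lt (PosNum (divr_gt0 e0 (ltr0Sn R 1))).
 have k0 : 0 < k.+1%:R^-1 :> R by rewrite invr_gt0.
 have /choice[q hq] (i : 'I_n) : exists q : rat,
   `|x ord0 i - ratr q| < k.+1%:R^-1.
  have [|q hq] := @rat_in_itvoo R (x ord0 i - k.+1%:R^-1) (x ord0 i + k.+1%:R^-1).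
   by rewrite ltrBlDr -addrA ltrDl addr_gt0.
  by exists q;move: hq;rewrite in_itv/= ltr_distlC.
 have xq : ball (c (\row_i q i)) k.+1%:R^-1 x.
  split=> // i j;rewrite (ord1 i) !mxE;apply:ball_sym;exact:hq.
 exists (\row_i q i, k)=> //=;rewrite /F asboolT//=.
 move=> y yq;apply:eA;rewrite (splitr e).
 apply:(ball_triangle (y:= c (\row_i q i))).
  by apply:ball_sym;apply:le_ball xq;exact:ltW.
 by apply:le_ball yq;exact:ltW.
apply:countable_bigcupT_measurable=> [|p];first exact:countableP.
rewrite /F;case:asboolP=> // _;apply:meas_ball.
by rewrite invr_gt0.
Qed.

Lemma closed_meas A : closed A -> measurable A.
Proof.
move=> cA;rewrite -(setCK A);apply:measurableC.
by apply:open_meas;exact:closed_openC.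
Qed.

Lemma continuous_meas (f : 'rV[R]_n -> R) :
 continuous f -> measurable_fun setT f.
Proof.
move=> cf;apply:(measurability (@RGenOInfty.G R)).
 exact:RGenOInfty.measurableE.
move=> _ [_ [x ->] <-];rewrite setTI;apply:open_meas.
by apply:open_comp=> // ? _;exact:cf.
Qed.

Lemma lebesgue_open_gt0 A : open A -> A !=set0 -> (0 < mu A)%E.
Proof.
move=> oA [x Ax];have /nbhs_ballP[e /= e0 eA] : nbhs x A by exact:open_nbhs_nbhs.
apply:(@lt_le_trans _ _ (mu (ball x e))).
 by rewrite leb_ball// lte_fin exprn_gt0// mulr_gt0.
apply:le_measure=> //;rewrite ?inE;first exact:meas_ball.
exact:open_meas.
Qed.

Lemma bounded_setP A :
 bounded_set A <-> exists2 M : R, 0 < M & forall x, A x -> `|x| < M.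
Proof.
split=> [/ex_strict_bound_gt0[M M0 hM]|[M M0 hM]];first by exists M.
exists M;split;first exact:num_real.
by move=> N MN x Ax /=;rewrite ltW// (lt_trans (hM _ Ax)).
Qed.

Lemma lebesgue_bounded A : measurable A -> bounded_set A -> (mu A < +oo)%E.
Proof.
move=> mA /bounded_setP[M M0 hM].
apply:(@le_lt_trans _ _ (mu (ball 0 M))).
 apply:le_measure;rewrite ?inE//;first exact:meas_ball.
 by move=> x Ax;have:= hM _ Ax;rewrite mx_norm_ball /ball_ /= sub0r normrN.
by rewrite leb_ball ?ltry.
Qed.

Definition affine_rV (s h : 'I_n -> R) (x : 'rV[R]_n) : 'rV[R]_n :=
 \row_i (s i * x ord0 i + h i).

Lemma measurable_affine_rV (s h : 'I_n -> R) :
 measurable_fun setT (affine_rV s h).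
Proof.
rewrite /affine_rV;apply:measurable_fun_rVP=> i.
under [X in measurable_fun _ X]eq_fun do rewrite mxE.
exact:(measurableT_comp (measurable_affine1 _ _) (measurable_coor i)).
Qed.

Lemma lebesgue_affine_rV (s h : 'I_n -> R) A : (forall i, s i != 0) ->
 measurable A ->
 (mu (affine_rV s h @^-1` A) =
 (\prod_i `|s i|^-1)%:E * mu A)%E.
Proof.
move=> s0 mA.
have nz : 0 < \prod_i `|s i| by apply:prodr_gt0=> i _;rewrite normr_gt0.
pose push : {measure set 'rV[R]_n -> \bar R} :=
 measure_function_pushforward__canonical__measure_function_Measure mu
  (measurable_affine_rV s h).
suff /(_ A mA) <- : forall A : set 'rV[R]_n, measurable A ->
  mscale (NngNum (ltW nz)) push A = mu A.
 rewrite /mscale/= /pushforward muleA -EFinM -big_split/=.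
 rewrite big1 ?mul1e// => i _;rewrite mulVf// normr_eq0//.
apply:lebesgue_rV_uniq=> B mB.
have E : affine_rV s h @^-1` box B = box (fun i=> (fun x=> s i * x + h i) @^-1` B i).
 by apply/seteqP;split=> x /= hx i;have:= hx i;rewrite /= mxE.
transitivity ((\prod_i `|s i|)%:E * mu (box (fun i=> (fun x=> (s i * x + h i)%R) @^-1` B i)))%E.
 by rewrite -E.
rewrite lebesgue_box;last first.
 by move=> i;rewrite -[X in measurable X]setTI;exact:measurable_affine1.
rewrite (eq_bigr (fun i=> (`|s i|^-1)%:E * lebesgue_measure (B i)))%E;last first.
 by move=> i _;rewrite lebesgue_affine1.
rewrite big_split/= prodEFin muleA -EFinM -big_split/= big1 ?mul1e// => i _.
by rewrite mulfV// normr_eq0.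
Qed.

Lemma addrV_affine (h : 'rV[R]_n) :
 (fun x : 'rV[R]_n=> x + h) = affine_rV (cst 1) (h ord0).
Proof. by apply/funext=> x;apply/rowP=> i;rewrite !mxE mul1r. Qed.

Lemma subrV_affine (h : 'rV[R]_n) :
 (fun x : 'rV[R]_n=> h - x) = affine_rV (cst (-1)) (h ord0).
Proof. by apply/funext=> x;apply/rowP=> i;rewrite !mxE mulN1r addrC. Qed.

Lemma measurable_addrV (h : 'rV[R]_n) :
 measurable_fun setT (fun x : 'rV[R]_n=> x + h).
Proof. by rewrite addrV_affine;exact:measurable_affine_rV. Qed.

Lemma measurable_subrV (h : 'rV[R]_n) :
 measurable_fun setT (fun x : 'rV[R]_n=> h - x).
Proof. by rewrite subrV_affine;exact:measurable_affine_rV. Qed.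

Lemma lebesgue_addrV (h : 'rV[R]_n) A : measurable A ->
 mu ((fun x : 'rV[R]_n=> x + h)%R @^-1` A) = (1%:E * mu A)%E.
Proof.
move=> mA;rewrite addrV_affine lebesgue_affine_rV//;last by move=> i;exact:oner_neq0.
by rewrite big1//= => i _;rewrite normr1 invr1.
Qed.

Lemma lebesgue_subrV (h : 'rV[R]_n) A : measurable A ->
 mu ((fun x : 'rV[R]_n=> h - x)%R @^-1` A) = (1%:E * mu A)%E.
Proof.
move=> mA;rewrite subrV_affine lebesgue_affine_rV//;last by move=> i;rewrite oppr_eq0 oner_eq0.
by rewrite big1//= => i _;rewrite normrN1 invr1.
Qed.

End rVmeas.

Lemma measurable_addrVV (R : realType) (n : nat) d (T : measurableType d)
  (f g : T -> 'rV[R]_n) :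
 measurable_fun setT f -> measurable_fun setT g ->
 measurable_fun setT (fun x=> f x + g x).
Proof.
move=> mf mg;apply:measurable_fun_rVP=> i.
under [X in measurable_fun _ X]eq_fun do rewrite mxE.
by apply:measurable_funD;exact:(measurableT_comp (measurable_coor i)).
Qed.

Lemma measurable_opprV (R : realType) (n : nat) d (T : measurableType d)
  (f : T -> 'rV[R]_n) :
 measurable_fun setT f -> measurable_fun setT (fun x=> - f x).
Proof.
move=> mf;apply:measurable_fun_rVP=> i.
under [X in measurable_fun _ X]eq_fun do rewrite mxE.
by apply:measurableT_comp=> //;exact:(measurableT_comp (measurable_coor i)).
Qed.

Lemma measurable_mulrV (R : realType) (m n : nat) (Q : 'M[R]_(m, n)) :
 measurable_fun setT (fun x : 'rV[R]_m=> x *m Q).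
Proof.
apply:measurable_fun_rVP=> i.
under [X in measurable_fun _ X]eq_fun do rewrite mxE.
apply:measurable_sum=> k;apply:measurable_funM=> //.
exact:measurable_coor.
Qed.

Section haar.
Context (R : realType) (n : nat).
Notation mu:= (lebesgue_rV R n).
Local Open Scope ereal_scope.

Lemma ge0_integral_addrV (h : 'rV[R]_n) (f : 'rV[R]_n -> \bar R) :
 measurable_fun setT f -> (forall y, 0 <= f y) ->
 \int[mu]_x f (x + h)%R = \int[mu]_x f x.
Proof.
move=> mf f0;rewrite (ge0_integral_transfer (measurable_addrV h) ler01
 (lebesgue_addrV h) mf f0).
by rewrite mul1e.
Qed.

Lemma ge0_integral_subrV (h : 'rV[R]_n) (f : 'rV[R]_n -> \bar R) :
 measurable_fun setT f -> (forall y, 0 <= f y) ->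
 \int[mu]_x f (h - x)%R = \int[mu]_x f x.
Proof.
move=> mf f0;rewrite (ge0_integral_transfer (measurable_subrV h) ler01
 (lebesgue_subrV h) mf f0).
by rewrite mul1e.
Qed.

Variables f g : 'rV[R]_n -> 'rV[R]_n.
Hypothesis mf : measurable_fun setT f.
Hypothesis fD : forall x y, f (x + y)%R = (f x + f y)%R.
Hypothesis gK : cancel g f.

(* The uniqueness of the Haar measure, by Tonelli: both sides are the integral
  of [1_A(f x) 1_B(y + f x)] in (x, y). *)
Lemma additive_measure_ratio (A B : set 'rV[R]_n) :
 measurable A -> measurable B ->
 mu (f @^-1` A) * mu B = mu (f @^-1` B) * mu A.
Proof.
move=> mA mB.
have mi (C : set 'rV[R]_n) : measurable C ->
  measurable_fun setT (fun x=> (\1_C x)%:E : \bar R).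
 by move=> mC;apply/measurable_EFinP;exact:measurable_indic.
have i0 (C : set 'rV[R]_n) x : 0 <= (\1_C x)%:E :> \bar R by rewrite lee_fin.
have mif (C : set 'rV[R]_n) : measurable C ->
  measurable_fun setT (fun x=> (\1_C (f x))%:E : \bar R).
 by move=> mC;exact:(measurableT_comp (mi _ mC) mf).
have muf (C : set 'rV[R]_n) : measurable C ->
  mu (f @^-1` C) = \int[mu]_x (\1_C (f x))%:E.
 move=> mC;rewrite -{1}(setIT (f @^-1` C)) -integral_indic//.
  by rewrite -[X in measurable X]setTI;exact:mf.
have mus (C : set 'rV[R]_n) : measurable C -> mu C = \int[mu]_x (\1_C x)%:E.
 by move=> mC;rewrite -{1}(setIT C) -integral_indic.
pose F (p : 'rV[R]_n * 'rV[R]_n) : \bar R:= (\1_A (f p.1))%:E * (\1_B (p.2 + f p.1)%R)%:E.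
have mf1 : measurable_fun setT (fun p : 'rV[R]_n * 'rV[R]_n=> f p.1).
 exact:(measurableT_comp mf measurable_fst).
have mF : measurable_fun setT F.
 apply:emeasurable_funM;first exact:(measurableT_comp (mi _ mA) mf1).
 apply:(measurableT_comp (mi _ mB)).
 by apply:measurable_addrVV=> //;exact:measurable_snd.
have F0 p : 0 <= F p by rewrite mule_ge0.
pose G (p : 'rV[R]_n * 'rV[R]_n) : \bar R:= (\1_B (f p.1))%:E * (\1_A (f p.1 - p.2)%R)%:E.
have mG : measurable_fun setT G.
 apply:emeasurable_funM;first exact:(measurableT_comp (mi _ mB) mf1).
 apply:(measurableT_comp (mi _ mA));apply:measurable_addrVV=> //.
 by apply:measurable_opprV;exact:measurable_snd.
have G0 p : 0 <= G p by rewrite mule_ge0.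
transitivity (\int[mu]_x \int[mu]_y F (x, y)).
 rewrite muf// -ge0_integralZr//;try exact:mif.
 apply:eq_integral=> x _;have mBx : measurable_fun setT (fun y : 'rV[R]_n=> (\1_B (y + f x)%R)%:E : \bar R).
  by apply:(measurableT_comp (mi _ mB));exact:measurable_addrV.
 rewrite /F/= ge0_integralZl// mus//.
 by rewrite (ge0_integral_addrV (f x) (mi _ mB) (i0 B)).
rewrite (fubini_tonelli F)//.
transitivity (\int[mu]_y \int[mu]_x G (x, y)).
 apply:eq_integral=> y _.
 have mFy : measurable_fun setT (fun x=> F (x, y)).
  by apply:(measurableT_comp mF);exact:measurable_pair2.
 rewrite -(ge0_integral_addrV (- g y)%R mFy)//.
 apply:eq_integral=> x _;rewrite /F /G/=.
 have -> : f (x - g y)%R = (f x - y)%R.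
  by apply:(addIr (f (g y)));rewrite -fD subrK gK subrK.
 by rewrite muleC addrC subrK.
rewrite -(fubini_tonelli G)// muf// -ge0_integralZr//;try exact:mif.
apply:eq_integral=> x _;have mAx : measurable_fun setT (fun y : 'rV[R]_n=> (\1_A (f x - y)%R)%:E : \bar R).
 by apply:(measurableT_comp (mi _ mA));exact:measurable_subrV.
rewrite /G/= ge0_integralZl// mus//.
by rewrite (ge0_integral_subrV (f x) (mi _ mA) (i0 A)).
Qed.

End haar.

Section orthogonal.
Context (R : realType) (n : nat).
Notation mu:= (lebesgue_rV R n).
Variable Q : 'M[R]_n.
Hypothesis QQ : Q *m Q^T = 1%:M.

Definition sqnorm (x : 'rV[R]_n) : R:= \sum_i x ord0 i ^+ 2.

Lemma sqnormE x : sqnorm x = (x *m x^T) ord0 ord0.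
Proof. by rewrite mxE;apply:eq_bigr=> i _;rewrite mxE expr2. Qed.

Lemma sqnorm_orth x : sqnorm (x *m Q) = sqnorm x.
Proof. by rewrite !sqnormE trmx_mul mulmxA -(mulmxA x) QQ mulmx1. Qed.

(** The Euclidean unit ball E is invariant under Q and has finite positive measure. As second set in
    [additive_measure_ratio] it shows that the factor by which Q changes the measure is 1. *)
Lemma lebesgue_orth A : measurable A ->
 mu ((fun x=> x *m Q) @^-1` A) = (1%:E * mu A)%E.
Proof.
move=> mA;pose E:= [set x | sqnorm x < 1].
have mE : measurable E.
 have ms : measurable_fun setT sqnorm.
  apply:measurable_sum=> i;apply:measurable_funX;exact:measurable_coor.
 by rewrite (_ : E = setT `&` sqnorm @^-1` `]-oo, 1[);[exact:ms|
  apply/seteqP;split=> x;rewrite /E/= in_itv/=//;case].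
have QK : cancel (fun x : 'rV[R]_n=> x *m Q^T) (fun x=> x *m Q).
 by move=> x;rewrite -mulmxA (mulmx1C QQ) mulmx1.
have:= additive_measure_ratio (measurable_mulrV Q) (fun x y=> mulmxDl x y Q) QK mA mE.
have -> : (fun x=> x *m Q) @^-1` E = E.
 by apply/seteqP;split=> x;rewrite /E /= sqnorm_orth.
have Efin : (mu E < +oo)%E.
 apply:lebesgue_bounded=> //;apply/bounded_setP;exists 2=> // x Ex.
 rewrite /Num.norm/= mx_normrE;apply:bigmax_lt=> // -[i j] _ /=.
 rewrite (ord1 i) (@le_lt_trans _ _ 1) ?ltr1n//.
 rewrite -(ler_pXn2r (n:= 2)) ?nnegrE// sqr_normr expr1n.
 apply:le_trans (ltW Ex);rewrite /sqnorm (bigD1 j)//= lerDl sumr_ge0// => k _.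
 exact:sqr_ge0.
have Epos : (0 < mu E)%E.
 (* The sup norm ball of radius r lies in E: each of the n squares is at most r^2 <= r, and n r <
    1. *)
 pose r : R:= n.+1%:R^-1;have r0 : 0 < r by rewrite invr_gt0.
 apply:(@lt_le_trans _ _ (mu (ball 0 r))).
  by rewrite leb_ball// lte_fin exprn_gt0// mulr_gt0.
 apply:le_measure;rewrite ?inE//;first exact:meas_ball.
 move=> x;rewrite ball_box// => xr;rewrite /E /= /sqnorm.
 apply:(@le_lt_trans _ _ (\sum_(i < n) r)).
  apply:ler_sum=> i _;have:= xr i;rewrite /= mxE in_itv/= sub0r add0r.
  rewrite -ltr_norml=> /ltW xi;rewrite -sqr_normr expr2.
  have r1 : r <= 1 by rewrite invf_le1// ler1n.
  by rewrite -[leRHS]mulr1 ler_pM// (le_trans xi).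
 by rewrite sumr_const card_ord -mulr_natl ltr_pdivrMr// mul1r ltr_nat.
have Ef : mu E \is a fin_num by rewrite ge0_fin_numE// ltW.
move=> H;rewrite mul1e;apply/eqP.
have e0 : fine (mu E) != 0 by rewrite gt_eqF// fine_gt0// Epos.
have:= congr1 (fun x=> x * ((fine (mu E))^-1)%:E)%E H.
rewrite -(fineK Ef) (muleC _ (mu A)) -!muleA -EFinM mulfV// !mule1=> ->.
by rewrite eqxx.
Qed.

End orthogonal.

Section shear.
Context (R : realType) (n : nat).
Variable gm : 'rV[R]_n -> R.
Hypothesis mgamma : measurable_fun setT gm.

Definition shear (x : 'rV[R]_n.+1) : 'rV[R]_n.+1 :=
 x + gm (col' ord0 x) *: 'e_ord0.

Lemma col'_shear x : col' ord0 (shear x) = col' ord0 x.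
Proof.
by apply/rowP=> j;rewrite !mxE eqxx/= mulr0 addr0.
Qed.

Lemma measurable_col' : measurable_fun setT (fun x : 'rV[R]_n.+1=> col' ord0 x).
Proof.
apply:measurable_fun_rVP=> i.
under [X in measurable_fun _ X]eq_fun do rewrite mxE.
exact:measurable_coor.
Qed.

Lemma measurable_shear : measurable_fun setT shear.
Proof.
apply:measurable_addrVV=> //;apply:measurable_fun_rVP=> i.
under [X in measurable_fun _ X]eq_fun do rewrite mxE.
apply:measurable_funM=> //;exact:(measurableT_comp mgamma measurable_col').
Qed.

Lemma shear_cons a (y : 'rV[R]_n) : shear (cons_rV (a, y)) = cons_rV (1 * a + gm y, y).
Proof.
have cy : col' ord0 (cons_rV (a, y)) = y.
 by apply/rowP=> j;rewrite !mxE liftK.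
rewrite /shear cy;apply/rowP=> i;rewrite !mxE/=.
case:unliftP=> [j ->|->] /=.
 by rewrite mulr0 addr0.
by rewrite mulr1 mul1r.
Qed.

(** On every line parallel to e_0 the shear is a translation, so that all one-dimensional sections
    keep their measure. The measure is first rewritten as the integral of the measures of these
    sections, which is the other order of integration than the one in its definition. *)
Lemma lebesgue_shear A : measurable A ->
 lebesgue_rV R n.+1 (shear @^-1` A) = (1%:E * lebesgue_rV R n.+1 A)%E.
Proof.
move=> mA;rewrite mul1e.
have E B : measurable B -> lebesgue_rV R n.+1 B =
  (\int[lebesgue_rV R n]_y (@lebesgue_measure R (ysection (@cons_rV R n @^-1` B) y)))%E.
 move=> mB;rewrite /= /lebesgue_rV_step /pushforward.
 have mcB : measurable (@cons_rV R n @^-1` B).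
  by rewrite -[X in measurable X]setTI;exact:measurable_cons_rV.
 rewrite (product_measure_unique
  (m' := (@lebesgue_measure R \x^ lebesgue_rV R n)%E))// => C D mC mD.
 exact:product_measure2E.
have mS : measurable (shear @^-1` A).
 by rewrite -[X in measurable X]setTI;exact:measurable_shear.
rewrite !E//;apply:eq_integral=> y _.
have mcA : measurable (@cons_rV R n @^-1` A).
 by rewrite -[X in measurable X]setTI;exact:measurable_cons_rV.
rewrite -[RHS]mul1e -[in X in (X%:E * _)%E](invr1 R) -[in X in (X%:E * _)%E](normr1 R).
rewrite -(lebesgue_affine1 (gm y) (oner_neq0 R))//;last exact:measurable_ysection.
congr (lebesgue_measure _);apply/seteqP;split=> a;rewrite /ysection/= !inE/=.
 by rewrite shear_cons.
by rewrite shear_cons.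
Qed.

End shear.

(** * Dominated convergence in the L^2 norm, and continuity of translations *)

Section dominated.
Context d (T : measurableType d) (R : realType).
Variables (mu : {measure set T -> \bar R}) (D : set T).
Hypothesis mD : measurable D.

Lemma dominated_nrm (f_ : nat -> T -> R) (f g : T -> R) :
 (forall m, measurable_fun D (f_ m)) -> measurable_fun D f ->
 sqi mu D g ->
 (forall x, D x -> f_ m x @[m --> \oo] --> f x) ->
 (forall m x, D x -> `|f_ m x| <= g x) ->
 sqi mu D f /\ nrm mu D (f_ m - f) @[m --> \oo] --> 0.
Proof.
move=> mf_ mf sg cf bf.
have fg x : D x -> `|f x| <= g x.
 move=> Dx;have c : `|f_ m x| @[m --> \oo] --> `|f x| by apply:cvg_norm;exact:cf.
 rewrite -(cvg_lim _ c)//;apply:limr_le;first exact:(cvgP _ c).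
 by apply:nearW=> m;exact:bf.
have g0 x : D x -> 0 <= g x by move=> Dx;exact:le_trans (fg _ Dx).
have sf : sqi mu D f.
 by apply:(sqi_le mD mf sg)=> x Dx;rewrite (le_trans (fg _ Dx))// ler_norm.
have sf_ m : sqi mu D (f_ m).
 by apply:(sqi_le mD (mf_ m) sg)=> x Dx;rewrite (le_trans (bf m _ Dx))// ler_norm.
split=> //.
have i : mu.-integrable D (fun x=> 4%:E * (EFin \o (fun x=> (g x ^+ 2)%R)) x)%E.
 exact:(integrableZl mD 4 (sqi_sqr sg)).
have:= @dominated_convergence _ _ _ mu D mD
 (fun m x=> ((f_ m x - f x) ^+ 2)%:E) (cst 0%E) _.
move=> /(_ _ _ _ _ i) [||||].
- move=> m;apply/measurable_EFinP;apply:measurable_funX.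
 exact:measurable_funB.
- exact:measurable_cst.
- apply:aeW=> x Dx;apply:cvg_EFin;first exact:nearW.
 rewrite [X in _ --> X](_ : _ = (f x - f x) ^+ 2);last by rewrite subrr expr0n.
 apply:(@cvg_comp _ _ _ _ (fun y=> y ^+ 2));last exact:exprn_continuous.
 by apply:cvgB;[exact:cf|exact:cvg_cst].
- apply:aeW=> x m Dx;rewrite /= ger0_norm ?sqr_ge0// lee_fin.
 have h : `|f_ m x - f x| <= 2 * g x.
  by have:= ler_normB (f_ m x) (f x);have:= bf m _ Dx;have:= fg _ Dx;lra.
 rewrite -sqr_normr (_ : 4 * g x ^+ 2 = (2 * g x) ^+ 2);last by ring.
 by rewrite lerXn2r ?nnegrE// mulr_ge0// g0.
move=> _ _;rewrite integral0=> c.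
apply:cvg_sqr0=> [m|];first exact:nrm_ge0.
have {}c : ((nrm mu D (f_ m - f)) ^+ 2)%:E @[m --> \oo] --> 0%E.
 by under eq_fun=> m do (rewrite -integral_sqr_nrm//;last exact:sqiB).
exact:(fine_cvg c).
Qed.

Lemma cvg_dot (f_ : nat -> T -> R) (f g : T -> R) :
 (forall m, sqi mu D (f_ m)) -> sqi mu D f -> sqi mu D g ->
 nrm mu D (f_ m - f) @[m --> \oo] --> 0 ->
 dot mu D (f_ m) g @[m --> \oo] --> dot mu D f g.
Proof.
move=> sf_ sf sg c;apply/cvgrPdist_le=> e e0.
have e1 : 0 < e / (nrm mu D g + 1) by rewrite divr_gt0// ltr_wpDl// nrm_ge0.
move/cvgrPdist_le : c=> /(_ _ e1);apply:filterS=> m.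
rewrite sub0r normrN (ger0_norm (nrm_ge0 _ _ _))=> h.
rewrite distrC -dotBl//;apply:(le_trans (dot_CS mD _ sg));first exact:sqiB.
apply:(le_trans (ler_wpM2r (nrm_ge0 _ _ _) h)).
rewrite -mulrA;apply:ler_piMr;first exact:ltW.
by rewrite ler_pdivrMl ?mulr1 ?lerDl// ltr_wpDl// nrm_ge0.
Qed.

End dominated.

Lemma mono_cvg0 (R : realType) (u v : nat -> R) :
 (forall m, 0 <= u m <= v m) -> v m @[m --> \oo] --> 0 ->
 u m @[m --> \oo] --> 0.
Proof.
move=> h c;apply:(@squeeze_cvgr _ _ _ _ (cst 0) v)=> //;last exact:cvg_cst.
exact:nearW.
Qed.

Import HBNNSimple.

Section translation.
Context (R : realType) (n : nat).
Notation V:= 'rV[R]_n.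
Notation mu:= (lebesgue_rV R n).
Notation sqi:= (sqi mu setT).
Notation dot:= (dot mu setT).
Notation nrm:= (nrm mu setT).
Implicit Types (f g : V -> R) (h : V).

Definition tr h f : V -> R:= fun x=> f (x + h).

Lemma sqi_tr h f : sqi f -> sqi (tr h f).
Proof. exact:(sqi_transfer (measurable_addrV h) ler01 (lebesgue_addrV h)). Qed.

Lemma dot_tr h f g : sqi f -> sqi g -> dot (tr h f) (tr h g) = dot f g.
Proof.
move=> sf sg.
by rewrite [LHS](dot_transfer (measurable_addrV h) ler01 (lebesgue_addrV h))// mul1r.
Qed.

Lemma nrm_tr h f : sqi f -> nrm (tr h f) = nrm f.
Proof. by move=> sf;rewrite /Lsq.nrm dot_tr. Qed.

Lemma sqi_refl h f : sqi f -> sqi (fun x=> f (h - x)).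
Proof. exact:(sqi_transfer (measurable_subrV h) ler01 (lebesgue_subrV h)). Qed.

Lemma dot_refl h f g : sqi f -> sqi g ->
 dot (fun x=> f (h - x)) (fun x=> g (h - x)) = dot f g.
Proof.
move=> sf sg.
by rewrite [LHS](dot_transfer (measurable_subrV h) ler01 (lebesgue_subrV h))// mul1r.
Qed.

Lemma nrm_refl h f : sqi f -> nrm (fun x=> f (h - x)) = nrm f.
Proof. by move=> sf;rewrite /Lsq.nrm dot_refl. Qed.

Lemma sqi_indic (A : set V) : measurable A -> (mu A < +oo)%E -> sqi (\1_A).
Proof.
move=> mA Aoo;split;first exact:measurable_indic.
rewrite (_ : (\int[mu]_x _)%E = mu A)//.
rewrite -[in RHS](setIT A) -integral_indic//;apply:eq_integral=> x _.
by rewrite indicE;case:(_ \in _);rewrite /= ?expr1n ?expr0n.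
Qed.

Definition trcont f:= sqi f /\ forall h : nat -> V, h m @[m --> \oo] --> (0 : V) ->
 nrm (tr (h m) f - f) @[m --> \oo] --> 0.

Lemma trcontD f g : trcont f -> trcont g -> trcont (f + g).
Proof.
move=> [sf cf] [sg cg];split=> [|h h0];first exact:sqiD.
apply:(@mono_cvg0 _ _ (fun m=> nrm (tr (h m) f - f) + nrm (tr (h m) g - g))).
 move=> m;rewrite nrm_ge0/=.
 rewrite (_ : tr (h m) (f + g) - (f + g) = (tr (h m) f - f) + (tr (h m) g - g)).
  by apply:nrmD=> //;apply:sqiB=> //;exact:sqi_tr.
 by apply/funext=> x;rewrite /tr !fctE;ring.
by rewrite -[X in _ --> X](addr0 0);apply:cvgD;[exact:cf|exact:cg].
Qed.

Lemma trcontZ a f : trcont f -> trcont (a *: f).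
Proof.
move=> [sf cf];split=> [|h h0];first exact:sqiZ.
have -> : (fun m=> nrm (tr (h m) (a *: f) - a *: f)) =
     (fun m=> `|a| * nrm (tr (h m) f - f)).
 apply/funext=> m;rewrite -nrmZ//;last by apply:sqiB=> //;exact:sqi_tr.
 by congr nrm;apply/funext=> x;rewrite /tr !fctE /= /GRing.scale/=;ring.
by rewrite -[X in _ --> X](mulr0 `|a|);apply:cvgMr;exact:cf.
Qed.

Lemma trcont_lim (f_ : nat -> V -> R) f : (forall m, trcont (f_ m)) -> sqi f ->
 nrm (f_ m - f) @[m --> \oo] --> 0 -> trcont f.
Proof.
move=> tf sf c;split=> // h h0;apply/cvgrPdist_le=> e e0.
have e3 : 0 < e / 3 by rewrite divr_gt0.
move/cvgrPdist_le : (c)=> /(_ _ e3)[k _ /(_ k (leqnn k))].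
rewrite /= sub0r normrN (ger0_norm (nrm_ge0 _ _ _))=> hk.
have [sk ck] := tf k.
move/cvgrPdist_le : (ck _ h0)=> /(_ _ e3);apply:filterS=> m.
rewrite !sub0r !normrN !(ger0_norm (nrm_ge0 _ _ _))=> hm.
have sd : sqi (f_ k - f) by exact:sqiB.
have sd' : sqi (tr (h m) (f_ k) - f_ k) by apply:sqiB=> //;exact:sqi_tr.
rewrite (_ : tr (h m) f - f = (tr (h m) (f_ k) - f_ k) + ((f_ k - f) - tr (h m) (f_ k - f))).
 apply:(le_trans (nrmD measurableT sd' (sqiB measurableT sd (sqi_tr (h m) sd)))).
 have:= nrmB measurableT sd (sqi_tr (h m) sd);rewrite nrm_tr//;lra.
by apply/funext=> x;rewrite /tr !fctE;ring.
Qed.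

(** Expanding the square leaves the integral of 1_U(x+h) 1_U(x). It tends to that of 1_U by
    dominated convergence: if x is in the open set U then so is x+h eventually, and if not the
    product vanishes. *)
Lemma trcont_open (U : set V) : open U -> (mu U < +oo)%E -> trcont (\1_U).
Proof.
move=> oU Uoo;have mU:= open_meas oU;have sU:= sqi_indic mU Uoo.
split=> // h h0;apply:cvg_sqr0=> [m|];first exact:nrm_ge0.
have E m : nrm (tr (h m) \1_U - \1_U) ^+ 2 =
  2 * dot \1_U \1_U - 2 * dot (fun x=> \1_U (x + h m) * \1_U x) \1_U.
 have st:= sqi_tr (h m) sU.
 rewrite sqr_nrm dotBl ?dotBr//;last exact:sqiB.
 rewrite dot_tr// (dotC _ _ \1_U (tr _ _)).
 have -> : dot (fun x=> \1_U (x + h m) * \1_U x) \1_U = dot (tr (h m) \1_U) \1_U.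
  apply:eq_Rintegral=> x _;rewrite /tr -mulrA;congr (_ * _).
  by rewrite indicE;case:(_ \in _);rewrite ?mulr1 ?mulr0.
 ring.
under eq_fun do rewrite E.
have mt m : measurable_fun setT (fun x : V=> \1_U (x + h m) * \1_U x : R).
 apply:measurable_funM;last exact:measurable_indic.
 by apply:(measurableT_comp (measurable_indic mU));exact:measurable_addrV.
have bd m x : setT x -> `|\1_U (x + h m) * \1_U x| <= \1_U x :> R.
 by move=> _;rewrite !indicE;do 2 case:(_ \in _);rewrite ?mulr1 ?mulr0 ?normr0 ?normr1.
have [] := @dominated_nrm _ _ _ mu setT measurableT
 (fun m x=> \1_U (x + h m) * \1_U x) (\1_U) (\1_U) mt (measurable_indic mU) sU _ bd.
 move=> x _;have [xU|xU] := boolP (x \in U);last first.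
  rewrite indicE (negbTE xU);under eq_fun do rewrite mulr0;exact:cvg_cst.
 apply:(@cvg_near_cst).
 have : \forall y \near x, U y by apply:open_nbhs_nbhs;split=> //;exact:set_mem.
 move=> nU;have : x + h m @[m --> \oo] --> x.
  by rewrite -[X in _ --> X]addr0;apply:cvgD=> //;exact:cvg_cst.
 move=> /(_ _ nU) H;have {}H : \forall m \near \oo, U (x + h m) by exact:H.
 apply:filterS H=> m Um.
 by rewrite !indicE xU mem_set// mulr1.
move=> _ c.
have st m : sqi (fun x=> \1_U (x + h m) * \1_U x).
 by apply:(sqi_le measurableT (mt m) sU)=> x _;rewrite (le_trans (bd m x I))// ler_norm.
have:= cvg_dot measurableT st sU sU c.
move=> c2.
suff : 2 * dot \1_U \1_U - 2 * dot (fun x=> \1_U (x + h m) * \1_U x) \1_U @[m --> \oo]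
  --> 2 * dot \1_U \1_U - 2 * dot \1_U \1_U by rewrite subrr.
by apply:cvgB;[exact:cvg_cst|apply:cvgMr].
Qed.

Lemma measurable_open_rV : @measurable _ V = <<s (@open V) >>.
Proof.
apply/seteqP;split;last first.
 apply:smallest_sub;first exact:sigma_algebra_measurable.
 by move=> A;exact:open_meas.
rewrite [X in X `<=` _]/measurable/= /g_sigma_preimage.
apply:smallest_sub;first exact:smallest_sigma_algebra.
rewrite -bigcup_seq/= => A [i _ [C mC <-]];rewrite setTI.
have mi : measurable_fun setT
  (fun x : g_sigma_algebraType (@open V)=> (x : V) ord0 i : measurableTypeR R).
 apply:(measurability (@RGenOInfty.G R));first exact:RGenOInfty.measurableE.
 move=> _ [_ [x ->] <-];rewrite setTI;apply:sub_sigma_algebra.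
 by apply:open_comp=> // y _;exact:coord_continuous.
by have:= mi measurableT _ mC;rewrite setTI.
Qed.

(** Induction over the Dynkin system generated by the open sets. The intersection with a fixed ball
    keeps all the indicators in L^2, also those of complements. *)
Lemma trcont_indic (M : R) (A : set V) : 0 < M -> measurable A ->
 trcont (\1_(A `&` ball (0 : V) M)).
Proof.
move=> M0 mA;have mB:= meas_ball (0 : V) M0.
have Boo : (mu (ball (0%R : V) M) < +oo)%E by rewrite leb_ball// ltry.
have fin (C : set V) : measurable C -> (mu (C `&` ball (0%R : V) M) < +oo)%E.
 move=> mC;apply:le_lt_trans Boo;apply:le_measure;rewrite ?inE//.
 exact:measurableI.
have oB : open (ball (0 : V) M) by exact:ball_open.
have sB (C : set V) : measurable C -> sqi (\1_(C `&` ball (0%R : V) M)).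
 by move=> mC;apply:sqi_indic;[exact:measurableI|exact:fin].
move: A mA;rewrite measurable_open_rV.
apply:dynkin_induction.
- exact:measurable_open_rV.
- by move=> U W;exact:openI.
- by rewrite setTI;exact:trcont_open.
- by move=> U oU;apply:trcont_open;[exact:openI|apply:fin;exact:open_meas].
- move=> C mC tC;rewrite (_ : \1__ = \1_(ball (0%R : V) M) + (-1) *: \1_(C `&` ball (0%R : V) M)).
  by apply:trcontD;[exact:trcont_open|exact:trcontZ].
 apply/funext=> x;rewrite !fctE !indicE !in_setI in_setC /GRing.scale/=.
 by do 2 case:(_ \in _);rewrite /=;ring.
move=> F mF tF PF.
apply:(@trcont_lim (fun m=> \sum_(k < m) \1_(F k `&` ball (0%R : V) M)))=> [m||].
- elim/big_ind : _=> //;last by move=> f g;exact:trcontD.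
 have:= trcontZ 0 (trcont_open oB Boo);by rewrite scale0r.
- by apply:sB;exact:bigcupT_measurable.
have E m x : (\sum_(k < m) \1_(F k `&` ball (0%R : V) M)) x =
  \1_((\big[setU/set0]_(k < m) F k) `&` ball (0%R : V) M) x :> R.
 elim: m x=> [|m ih] x;first by rewrite !big_ord0 set0I indic0.
 rewrite !big_ord_recr/= fctE ih !indicE !in_setI in_setU.
 have [xm|xm] := boolP (x \in F m);last by rewrite orbF addr0.
 have /negbTE -> : x \notin \big[setU/set0]_(k < m) F k.
  apply/negP;rewrite inE -bigcup_mkord=> -[k /= km Fkx].
  move/trivIsetP : (tF)=> /(_ k m I I);rewrite neq_ltn km=> /(_ isT) h.
  have : (F k `&` F m) x by split=> //;exact:set_mem.
  by rewrite h.
 by rewrite add0r.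
have mS m : measurable (\big[setU/set0]_(k < m) F k) by exact:bigsetU_measurable.
pose g m:= \1_((\big[setU/set0]_(k < m) F k) `&` ball (0%R : V) M) : V -> R.
rewrite (_ : (fun m=> _) = (fun m=> nrm (g m - \1_((\bigcup_k F k) `&` ball (0%R : V) M))));last first.
 by apply/funext=> m;congr nrm;congr (_ - _);apply/funext=> x;rewrite E.
apply:(dominated_nrm (g:= \1_(ball (0%R : V) M)) measurableT _ _ _ _ _).2.
- by move=> m;apply:measurable_indic;exact:measurableI.
- by apply:measurable_indic;apply:measurableI=> //;exact:bigcupT_measurable.
- exact:sqi_indic.
- move=> x _;have [xU|xU] := boolP (x \in \bigcup_k F k);last first.
  rewrite (_ : (fun m=> g m x) = cst (\1_((\bigcup_k F k) `&` ball (0%R : V) M) x));first exact:cvg_cst.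
  apply/funext=> m;rewrite /g !indicE !in_setI (negbTE xU).
  rewrite (_ : (x \in _) = false)//;apply/negbTE;apply:contra xU.
  by rewrite !inE -bigcup_mkord=> -[k _ Fkx];exists k.
 have [k _ Fk] := set_mem xU;apply:cvg_near_cst;exists k.+1=> // m /= km.
 rewrite /g !indicE !in_setI xU;congr ((_ && _)%:R).
 by apply/mem_set;rewrite -bigcup_mkord;exists k.
- move=> m x _;rewrite /g !indicE in_setI.
 by do 2 case:(_ \in _);rewrite /= ?normr0 ?normr1.
Qed.

(** Indicators give simple functions on a ball, these give non-negative functions cut to a ball,
    then non-negative functions, and f is the difference of its positive and negative parts. Every
    passage to the limit is [trcont_lim]. *)
Lemma trcont_sqint f : sqi f -> trcont f.
Proof.
move=> sf;have [mf _] := sf.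
have ge0 M (g : V -> R) : 0 < M -> sqi g -> (forall x, 0 <= g x) ->
  trcont (fun x=> g x * \1_(ball (0%R : V) M) x).
 move=> M0 sg g0;have [mg _] := sg;have mB:= meas_ball (0 : V) M0.
 have meg : measurable_fun setT (EFin \o g) by exact/measurable_EFinP.
 pose A k:= nnsfun_approx measurableT meg k.
 pose a k:= (A k : _ -> R).
 have ca (x : V) : a k x @[k --> \oo] --> g x.
  exact:(fine_cvg (cvg_nnsfun_approx measurableT meg (fun y _=> g0 y) I)).
 have ag k (x : V) : a k x <= g x.
  rewrite /a /A nnsfun_approxE -lee_fin.
  by apply:(@le_approx _ _ _ setT (EFin \o g))=> // y _;rewrite lee_fin.
 have sgB : sqi (fun x=> g x * \1_(ball (0%R : V) M) x).
  apply:(sqi_le measurableT _ sg).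
   by apply:measurable_funM=> //;exact:measurable_indic.
  by move=> x _;rewrite indicE;case:(_ \in _);rewrite ?mulr1 ?mulr0 ?normr0.
 apply:(@trcont_lim (fun k x=> a k x * \1_(ball (0%R : V) M) x))=> // [k|].
  rewrite (_ : (fun x=> _) = \sum_(y <- finmap.enum_fset (fset_set (range (a k))))
    y *: \1_((a k @^-1` [set y]) `&` ball (0%R : V) M)).
   elim/big_ind : _=> [||y _].
   - by have:= trcontZ 0 (trcont_indic M0 measurableT);rewrite scale0r.
   - by move=> f' g';exact:trcontD.
   - by apply:trcontZ;apply:trcont_indic=> //;exact:measurable_sfunP.
  apply/funext=> x;rewrite fct_sumE /a (fimfunE (A k) x) fsbig_finite//= mulr_suml.
  apply:eq_bigr=> y _;rewrite fctE /= /GRing.scale/= !indicE in_setI.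
  by rewrite -mulrA;congr (_ * _);case:(_ \in _);case:(_ \in _);rewrite ?mulr1 ?mulr0.
 apply:(dominated_nrm (g:= g) measurableT _ _ _ _ _).2=> //.
 - by move=> k;apply:measurable_funM=> //;exact:measurable_indic.
 - by case:sgB.
 - by move=> x _;apply:cvgMl;exact:ca.
 - move=> k x _;rewrite indicE;case:(_ \in _);rewrite ?mulr1 ?mulr0 ?normr0//.
  by rewrite ger0_norm// ag.
have ge0' (g : V -> R) : sqi g -> (forall x, 0 <= g x) -> trcont g.
 move=> sg g0;have [mg _] := sg.
 apply:(@trcont_lim (fun k x=> g x * \1_(ball (0%R : V) k.+1%:R) x))=> // [k|].
  exact:ge0.
 apply:(dominated_nrm (g:= g) measurableT _ _ _ _ _).2=> //.
 - move=> k;apply:measurable_funM=> //;apply:measurable_indic.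
  exact:meas_ball.
 - move=> x _;apply:cvg_near_cst;exists (Num.bound `|x|)=> // k /= hk.
  rewrite indicE mem_set ?mulr1// mx_norm_ball /ball_ /= sub0r normrN.
  apply:(le_lt_trans (ler_norm `|x|)).
  apply:(lt_le_trans (unstable.ltr_norm_bound `|x|)).
  by rewrite ler_nat (leq_trans hk).
 - move=> k x _;rewrite indicE;case:(_ \in _);rewrite ?mulr1 ?mulr0 ?normr0//.
  by rewrite ger0_norm.
rewrite (_ : f = f^\+ + (-1) *: f^\-);last first.
 rewrite scaleN1r;apply/funext=> x.
 have -> : (f^\+ - f^\-) x = Num.max (f x) 0 - Num.max (- f x) 0 by [].
 by rewrite /Num.max/=;case:(ltP (f x) 0)=> h;case:(ltP (- f x) 0)=> h';lra.
apply:trcontD;last apply:trcontZ;apply:ge0' => //.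
- apply:(sqi_le measurableT _ sf);first exact:measurable_funrpos.
 by move=> x _;rewrite /funrpos;case:(leP 0 (f x))=> h;rewrite ?normr0// ?max_l.
- apply:(sqi_le measurableT _ sf);first exact:measurable_funrneg.
 move=> x _;rewrite /funrneg;case:(leP 0 (f x))=> h.
  by rewrite max_r ?normr0// oppr_le0.
 by rewrite max_l ?normrN// oppr_ge0 ltW.
Qed.

End translation.

(** * Functions of class C^k: differentiability and symmetry of second derivatives *)

Section Ck.
Context (R : realType) (n : nat).
Notation V:= 'rV[R]_n.
Implicit Types (f g : V -> R) (k : nat).

Lemma C_k0 f : C_k 0 f <-> continuous f.
Proof.
split=> [[_ /(_ [::])]|cf];first exact.
by split=> // -[|//] _.
Qed.

(** Splits off the innermost derivative, so that facts about class C^k follow by induction on k for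
    all functions at once. *)
Lemma C_kS k f : C_k k.+1 f <->
 [/\ continuous f, forall x i, derivable f x 'e_i &
   forall i, C_k k (fun x=> 'D_('e_i) f x)].
Proof.
have E s i : pderiv (rcons s i) f = pderiv s (fun x=> 'D_('e_i) f x).
 by rewrite /pderiv foldr_rcons.
split=> [[df cf]|[cf df Df]].
 split;first exact:(cf [::]).
  by move=> x i;exact:(df [::]).
 move=> i;split=> s sk.
  by move=> x j;rewrite -E;apply:df;rewrite size_rcons ltnS.
 by rewrite -E;apply:cf;rewrite size_rcons.
split;(case/lastP=> [|s i];first by move=> _).
 by rewrite size_rcons ltnS=> sk x j;rewrite E;have [+ _] := Df i;exact.
by rewrite size_rcons ltnS=> sk;rewrite E;have [_] := Df i;exact.
Qed.

Lemma C_kW k l f : (k <= l)%N -> C_k l f -> C_k k f.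
Proof.
move=> kl [df cf];split=> s sk;first by apply:df;exact:leq_trans kl.
by apply:cf;exact:leq_trans kl.
Qed.

Lemma C_k_cont k f : C_k k f -> continuous f.
Proof. by move=> /(C_kW (leq0n k))/C_k0. Qed.

Lemma C_k_derivable k f x i : C_k k.+1 f -> derivable f x 'e_i.
Proof. by move=> /C_kS[_ + _];exact. Qed.

Lemma C_k_D k f i : C_k k.+1 f -> C_k k (fun x=> 'D_('e_i) f x).
Proof. by move=> /C_kS[_ _];exact. Qed.

Lemma C_k_cst k (c : R) : C_k k (fun _ : V=> c).
Proof.
elim: k c=> [|k ih] c;first by apply/C_k0=> x;exact:cst_continuous.
apply/C_kS;split=> [x|x i|i];[exact:cst_continuous|exact:derivable_cst|].
have -> : (fun x : V=> 'D_('e_i) (fun _ : V=> c) x) = (fun _=> 0).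
 by apply/funext=> x;rewrite derive_cst.
exact:ih.
Qed.

Lemma C_kD k f g : C_k k f -> C_k k g -> C_k k (f + g).
Proof.
elim: k f g=> [|k ih] f g.
 by move=> /C_k0 cf /C_k0 cg;apply/C_k0=> x;exact:(cvgD (cf x) (cg x)).
move=> /C_kS[cf df Df] /C_kS[cg dg Dg];apply/C_kS;split=> [x|x i|i].
- exact:(cvgD (cf x) (cg x)).
- exact:derivableD.
have -> : (fun x=> 'D_('e_i) (f + g) x) = (fun x=> 'D_('e_i) f x) + (fun x=> 'D_('e_i) g x).
 by apply/funext=> x;rewrite deriveD.
exact:ih.
Qed.

Lemma C_kM k f g : C_k k f -> C_k k g -> C_k k (f * g).
Proof.
elim: k f g=> [|k ih] f g.
 by move=> /C_k0 cf /C_k0 cg;apply/C_k0=> x;exact:(cvgM (cf x) (cg x)).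
move=> Sf Sg;have [cf df Df] := (C_kS _ _).1 Sf;have [cg dg Dg] := (C_kS _ _).1 Sg.
apply/C_kS;split=> [x|x i|i].
- exact:(cvgM (cf x) (cg x)).
- exact:derivableM.
have -> : (fun x=> 'D_('e_i) (f * g) x) =
  f * (fun x=> 'D_('e_i) g x) + g * (fun x=> 'D_('e_i) f x).
 by apply/funext=> x;rewrite deriveM.
by apply:C_kD;apply:ih=> //;[exact:C_kW Sf|exact:C_kW Sg].
Qed.

Lemma C_kZ k (c : R) f : C_k k f -> C_k k (c *: f).
Proof. by move=> Sf;have:= C_kM (C_k_cst k c) Sf. Qed.

Lemma C_kN k f : C_k k f -> C_k k (- f).
Proof. by move=> Sf;rewrite -scaleN1r;exact:C_kZ. Qed.

Lemma C_k_sum k (I : Type) (s : seq I) (P : pred I) (F : I -> V -> R) :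
 (forall i, P i -> C_k k (F i)) -> C_k k (\sum_(i <- s | P i) F i).
Proof.
move=> h;elim/big_ind : _=> //;first exact:(C_k_cst k 0).
by move=> ? ?;exact:C_kD.
Qed.

Lemma C_k_prod k (I : Type) (s : seq I) (P : pred I) (F : I -> V -> R) :
 (forall i, P i -> C_k k (F i)) -> C_k k (\prod_(i <- s | P i) F i).
Proof.
move=> h;elim/big_ind : _=> //;first exact:(C_k_cst k 1).
by move=> ? ?;exact:C_kM.
Qed.

Lemma is_derive_line f (x v : V) (t : R) : derivable f (x + t *: v) v ->
 is_derive t 1 (fun s=> f (x + s *: v)) ('D_v f (x + t *: v)).
Proof.
move=> df.
have E (h : R) : h^-1 *: (((fun s=> f (x + s *: v)) \o shift t) (h *: 1) - f (x + t *: v)) =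
  h^-1 *: ((f \o shift (x + t *: v)) (h *: v) - f (x + t *: v)).
 by rewrite /= [h *: 1]mulr1 scalerDl addrA (addrC x) addrAC [RHS]/= -?addrA ?(addrC x).
apply:DeriveDef.
 by rewrite /derivable;under eq_fun do rewrite E.
by rewrite /derive;under eq_fun do rewrite E.
Qed.

Lemma MVT_line f (x v : V) (t : R) : (forall y, derivable f y v) ->
 exists2 c, `|c| <= `|t| & f (x + t *: v) - f x = t * 'D_v f (x + c *: v).
Proof.
move=> df.
have dl (s : R) : is_derive s (1 : R) (fun s=> f (x + s *: v)) ('D_v f (x + s *: v)).
 exact:is_derive_line.
have cl : continuous (fun s : R=> f (x + s *: v)).
 move=> s;apply:differentiable_continuous;apply/derivable1_diffP.
 by case:(dl s).
have [t0|t0] := leP 0 t.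
 have [c] := @MVT_segment R (fun s=> f (x + s *: v)) (fun s=> 'D_v f (x + s *: v)) 0 t t0
  (fun s _=> dl s) (continuous_subspaceT cl).
 rewrite in_itv/= scale0r addr0 subr0 mulrC=> /andP[c0 ct] E.
 by exists c=> //;rewrite !ger0_norm.
have [c] := @MVT_segment R (fun s=> f (x + s *: v)) (fun s=> 'D_v f (x + s *: v)) t 0 (ltW t0)
 (fun s _=> dl s) (continuous_subspaceT cl).
rewrite in_itv/= scale0r addr0 sub0r=> /andP[ct c0] E.
exists c;last by rewrite -opprB E mulrN opprK mulrC.
by rewrite !ler0_norm ?lerN2// ltW.
Qed.

Lemma coord_le (x : V) i : `|x ord0 i| <= `|x|.
Proof. by rewrite [leRHS]/Num.norm/= mx_normrE (le_bigmax _ _ (ord0, i)). Qed.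

Lemma norm_le_coord (x : V) (c : R) : 0 <= c -> (forall i, `|x ord0 i| <= c) -> `|x| <= c.
Proof.
move=> c0 h;rewrite [leLHS]/Num.norm/= mx_normrE;apply:bigmax_le=> // -[i j] _.
by rewrite /= (ord1 i).
Qed.

(** The vertices of the path from 0 to h that runs along one coordinate at a time. *)
Let trunc (h : V) (i : nat) : V:= \row_j (if (j < i)%N then h ord0 j else 0).

(** The increment of f is split along the path [trunc]. On each of the n edges the mean value
    theorem and the continuity of the partial derivatives leave an error of at most [e' * |h|], with
    e' = e / (n + 1). *)
Lemma C1_differentiable f x : C_k 1 f -> differentiable f x /\
 forall v, 'd f x v = \sum_i v ord0 i * 'D_('e_i) f x.
Proof.
move=> Sf;have [cf df Df] := (C_kS _ _).1 Sf.
pose L (v : V) : R:= \sum_i v ord0 i * 'D_('e_i) f x.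
have Llin : linear L.
 move=> a u v;rewrite /L scaler_sumr -big_split/=;apply:eq_bigr=> i _.
 by rewrite !mxE /= mulrDl scalerAl.
pose Lm:= GRing.isLinear.Build _ _ _ _ L Llin.
pose LL : {linear V -> R} := HB.pack L Lm.
have cL : continuous LL.
 have -> : (LL : V -> R) = \sum_(i < n) ('D_('e_i) f x *: (fun v : V=> v ord0 i : R)).
  apply/funext=> v;rewrite fct_sumE;apply:eq_bigr=> i _.
  by rewrite fctE /GRing.scale/= mulrC.
 move=> v;apply:differentiable_continuous;apply:differentiable_sum=> i.
 by apply:differentiableZ;exact:differentiable_coord.
have Lo : f \o shift x = cst (f x) + LL +o_ 0 id.
 apply/eqaddoP=> _/posnumP[e].
 pose e' := e%:num / (n%:R + 1).
 have e'0 : 0 < e' by rewrite divr_gt0// ltr_wpDl.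
 have : \forall y \near x, forall i, `|'D_('e_i) f x - 'D_('e_i) f y| <= e'.
  have h i : \forall y \near x, `|'D_('e_i) f x - 'D_('e_i) f y| <= e'.
   have:= (C_k0 _).1 (Df i) x;move=> /cvgrPdist_le;exact.
  exact:(@filter_forall _ _ (fun i y=> `|'D_('e_i) f x - 'D_('e_i) f y| <= e') _ _ h).
 move=> /nbhs_ballP[d /= d0 hd].
 near=> h.
 have hd' : `|h| < d by near: h;apply/nbhs_ballP;exists d=> // y;rewrite mx_norm_ball /ball_/= sub0r normrN.
 have truncS (i : 'I_n) : trunc h i.+1 = trunc h i + h ord0 i *: 'e_i.
  apply/rowP=> j;rewrite !mxE eqxx/= ltnS leq_eqVlt.
  have [->|ji] := eqVneq j i;first by rewrite eqxx ltnn/= add0r mulr1.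
  by rewrite (negbTE (ji : (j : nat) != i)) /= mulr0 addr0.
 have step (i : 'I_n) : `|f (x + trunc h i.+1) - f (x + trunc h i)
    - h ord0 i * 'D_('e_i) f x| <= e' * `|h|.
  have [c cle E] := @MVT_line f (x + trunc h i) 'e_i (h ord0 i) (fun y=> df y i).
  rewrite truncS addrA E -mulrBr normrM mulrC.
  apply:ler_pM=> //;last exact:coord_le.
  rewrite distrC;apply:hd;rewrite mx_norm_ball /ball_/=.
  apply:le_lt_trans hd';rewrite opprD addrA opprD addrA subrr sub0r -opprD normrN.
  apply:norm_le_coord=> // j;rewrite !mxE eqxx/=.
  have [->|ji] := eqVneq j i.
   by rewrite ltnn add0r mulr1 (le_trans cle)// coord_le.
  by rewrite mulr0 addr0;case:ifP=> _;[exact:coord_le|rewrite normr0].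
 have E0 : trunc h 0 = 0 by apply/rowP=> j;rewrite !mxE.
 have En : trunc h n = h by apply/rowP=> j;rewrite !mxE ltn_ord.
 have -> : (f \o shift x - (cst (f x) + LL)) h =
   \sum_(i < n) (f (x + trunc h i.+1) - f (x + trunc h i) - h ord0 i * 'D_('e_i) f x).
  transitivity (f (x + h) - f x - L h);first by rewrite (addrC x h) -addrA -opprD.
  rewrite sumrB;have:= telescope_sumr (fun i=> f (x + trunc h i)) (leq0n n).
  rewrite big_mkord=> ->;by rewrite E0 En addr0.
 apply:(le_trans (ler_norm_sum _ _ _)).
 apply:(@le_trans _ _ (\sum_(i < n) e' * `|h|));first exact:ler_sum.
 rewrite sumr_const card_ord -mulr_natl mulrA ler_wpM2r// /e' mulrA ler_pdivrMr.
  by rewrite mulrC ler_wpM2l// lerDl.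
 by rewrite ltr_wpDl.
have dE : 'd f x = LL :> (V -> R) by apply:diff_unique.
by split;[apply/diff_locallyP;rewrite dE|move=> v;rewrite dE].
Unshelve. all: by end_near. Qed.

End Ck.

Section Ck2.
Context (R : realType) (n : nat).
Notation V:= 'rV[R]_n.
Implicit Types (f g : V -> R) (k : nat).

Lemma C1_derivable f x v : C_k 1 f -> derivable f x v.
Proof. by move=> Sf;apply:diff_derivable;have [] := C1_differentiable x Sf. Qed.

Lemma C1_deriveE f x v : C_k 1 f -> 'D_v f x = \sum_i v ord0 i * 'D_('e_i) f x.
Proof. by move=> Sf;have [df dE] := C1_differentiable x Sf;rewrite deriveE. Qed.

Lemma C_k_Dv k f v : C_k k.+1 f -> C_k k (fun x=> 'D_v f x).
Proof.
move=> Sf;have S1 : C_k 1 f by exact:C_kW Sf.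
have -> : (fun x=> 'D_v f x) = \sum_i v ord0 i *: (fun x=> 'D_('e_i) f x).
 by apply/funext=> x;rewrite C1_deriveE// fct_sumE.
by apply:C_k_sum=> i _;apply:C_kZ;exact:C_k_D.
Qed.

Lemma derive_trE f (a v y : V) : 'D_v (fun z=> f (z + a)) y = 'D_v f (y + a).
Proof.
rewrite /derive;congr (lim _).
have -> // : (fun h : R=> h^-1 *: (((fun z=> f (z + a)) \o shift y) (h *: v) - f (y + a))) =
  (fun h : R=> h^-1 *: ((f \o shift (y + a)) (h *: v) - f (y + a))).
by apply/funext=> h;rewrite /= addrA.
Qed.

Lemma derivable_tr f (a v y : V) : derivable f (y + a) v ->
 derivable (fun z=> f (z + a)) y v.
Proof.
rewrite /derivable.
have -> // : (fun h : R=> h^-1 *: (((fun z=> f (z + a)) \o shift y) (h *: v) - f (y + a))) =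
  (fun h : R=> h^-1 *: ((f \o shift (y + a)) (h *: v) - f (y + a))).
by apply/funext=> h;rewrite /= addrA.
Qed.

Lemma second_difference f x i j (t : R) : C_k 2 f ->
 exists c c', [/\ `|c| <= `|t|, `|c'| <= `|t| &
  f (x + t *: 'e_i + t *: 'e_j) - f (x + t *: 'e_i) - f (x + t *: 'e_j) + f x =
  t ^+ 2 * 'D_('e_j) (fun y=> 'D_('e_i) f y) (x + c *: 'e_i + c' *: 'e_j)].
Proof.
move=> Sf;have Sf1 : C_k 1 f by exact:C_kW Sf.
pose g1 (y : V) := f (y + t *: 'e_j).
have d1 y : derivable g1 y 'e_i by apply:derivable_tr;exact:C1_derivable.
have d2 y : derivable f y 'e_i by exact:C1_derivable.
have dg y : derivable (g1 - f) y 'e_i by exact:derivableB.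
have [c cle E1] := @MVT_line _ _ (g1 - f) x 'e_i t dg.
have [c' cle' E2] := @MVT_line _ _ (fun y=> 'D_('e_i) f y) (x + c *: 'e_i) 'e_j t
 (fun y=> @C_k_derivable _ _ _ _ y j (C_k_D i Sf)).
exists c, c';split=> //.
transitivity ((g1 - f) (x + t *: 'e_i) - (g1 - f) x).
 by rewrite /g1 !fctE;ring.
rewrite E1 (deriveB (d1 _) (d2 _)) derive_trE E2;ring.
Qed.

(** The second difference is symmetric in i and j, and by [second_difference] it is t^2 times either
    mixed derivative at a point close to x; continuity of both derivatives does the rest. *)
Lemma Schwarz f x i j : C_k 2 f ->
 'D_('e_i) (fun y=> 'D_('e_j) f y) x = 'D_('e_j) (fun y=> 'D_('e_i) f y) x.
Proof.
move=> Sf;apply/eqP;rewrite -subr_eq0 -normr_le0;apply/ler_addgt0Pr=> e e0.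
rewrite add0r;have e2 : 0 < e / 2 by rewrite divr_gt0.
have near_ (p q : 'I_n) : \forall y \near x, `|'D_('e_q) (fun y=> 'D_('e_p) f y) x -
  'D_('e_q) (fun y=> 'D_('e_p) f y) y| <= e / 2.
 by have:= (C_k0 _).1 (C_k_D q (C_k_D p Sf)) x;move=> /cvgrPdist_le;exact.
have /nbhs_ballP[d1 /= d10 hd1] := near_ i j.
have /nbhs_ballP[d2 /= d20 hd2] := near_ j i.
pose d:= Num.min d1 d2.
have d0 : 0 < d by rewrite lt_min d10.
(* The intermediate points are at distance at most 2t < d from x. *)
pose t:= d / 3.
have t0 : 0 < t by rewrite divr_gt0.
have pt (c c' : R) (p q : 'I_n) : `|c| <= `|t| -> `|c'| <= `|t| ->
  `|x - (x + c *: 'e_p + c' *: 'e_q)| < d.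
 move=> hc hc';rewrite !opprD !addrA subrr sub0r.
 have e1 (m : 'I_n) : `|'e_m : V| <= 1.
  by apply:norm_le_coord=> // m';rewrite !mxE eqxx/=;case:eqP;rewrite ?normr1 ?normr0.
 apply:(@le_lt_trans _ _ (t + t));last by rewrite /t;lra.
 apply:(le_trans (ler_normB _ _));rewrite normrN !normrZ.
 by rewrite lerD// (le_trans (ler_wpM2l _ (e1 _)))// mulr1 -[leRHS](gtr0_norm t0).
have [c1 [c1' [h1 h1' E1]]] := second_difference x i j t Sf.
have [c2 [c2' [h2 h2' E2]]] := second_difference x j i t Sf.
have EE : 'D_('e_j) (fun y=> 'D_('e_i) f y) (x + c1 *: 'e_i + c1' *: 'e_j) =
     'D_('e_i) (fun y=> 'D_('e_j) f y) (x + c2 *: 'e_j + c2' *: 'e_i).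
 apply:(@mulfI _ (t ^+ 2));first by rewrite expf_neq0// gt_eqF.
 apply:(etrans (esym E1));apply:(etrans _ E2).
 by congr (_ + _);rewrite [LHS]addrAC;congr (f _ - _ - _);exact:addrAC.
have b1 : `|x - (x + c1 *: 'e_i + c1' *: 'e_j)| < d1.
 by apply:(lt_le_trans (pt _ _ _ _ h1 h1'));rewrite ge_min lexx.
have b2 : `|x - (x + c2 *: 'e_j + c2' *: 'e_i)| < d2.
 by apply:(lt_le_trans (pt _ _ _ _ h2 h2'));rewrite ge_min lexx orbT.
have q1:= hd1 (x + c1 *: 'e_i + c1' *: 'e_j);rewrite mx_norm_ball /ball_/= in q1.
have q2:= hd2 (x + c2 *: 'e_j + c2' *: 'e_i);rewrite mx_norm_ball /ball_/= in q2.
have {}q1:= eq_ind _ (fun z=> `|'D_('e_j) (fun y=> 'D_('e_i) f y) x - z| <= e / 2) (q1 b1) _ EE.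
apply:(le_trans (ler_distD _ _ _));rewrite (splitr e);apply:lerD;first exact:(q2 b2).
by rewrite distrC.
Qed.

End Ck2.

Lemma lipschitz_dist_continuous (R : realType) (V W : normedModType R)
  (f : V -> W) (C : R) : 0 <= C ->
 (forall x y, `|f x - f y| <= C * `|x - y|) -> continuous f.
Proof.
move=> C0 lip x;apply/cvgrPdist_lt=> e e0;near=> y;apply:(le_lt_trans (lip x y)).
apply:(@le_lt_trans _ _ ((C + 1) * `|x - y|));first by rewrite ler_wpM2r// lerDl.
rewrite -ltr_pdivlMl ?ltr_wpDl//;near: y.
apply/nbhs_ballP;exists ((C + 1)^-1 * e);first by rewrite /= mulr_gt0// invr_gt0 ltr_wpDl.
by move=> y;rewrite -ball_normE.
Unshelve. all: by end_near. Qed.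

Lemma C_k_affine (R : realType) (m n k : nat) (A : 'M[R]_(m, n)) (b : 'rV[R]_n)
  (f : 'rV[R]_n -> R) : C_k k f -> C_k k (fun x : 'rV[R]_m=> f (x *m A + b)).
Proof.
have caff : continuous (fun x : 'rV[R]_m=> x *m A + b).
 pose C:= \sum_i \sum_j `|A i j|.
 have C0 : 0 <= C by do 2 (apply:sumr_ge0=> ? _).
 have lip (x y : 'rV[R]_m) : `|x *m A - y *m A| <= C * `|x - y|.
  rewrite -mulmxBl. apply:(@norm_le_coord R n)=> [|j];first by rewrite mulr_ge0.
  rewrite mxE (le_trans (ler_norm_sum _ _ _))// /C mulr_suml;apply:ler_sum=> i _.
  rewrite normrM mulrC ler_pM// ?coord_le//.
  by rewrite (bigD1 j)//= lerDl sumr_ge0.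
 apply:(@lipschitz_dist_continuous R 'rV[R]_m 'rV[R]_n _ C C0)=> x y.
 by rewrite opprD addrACA subrr addr0 lip.
elim: k f=> [|k ih] f;first move=> /C_k0 cf.
 by apply/C_k0=> x;apply:continuous_comp;[exact:caff|exact:cf].
move=> Sf;have S1 : C_k 1 f by exact:C_kW Sf.
have E (x : 'rV[R]_m) i (h : R) : h^-1 *: (((fun x=> f (x *m A + b)) \o shift x) (h *: 'e_i) - f (x *m A + b)) =
  h^-1 *: ((f \o shift (x *m A + b)) (h *: ('e_i *m A)) - f (x *m A + b)).
 by rewrite /= mulmxDl scalemxAl addrA.
apply/C_kS;split=> [x|x i|i].
- apply:continuous_comp;first exact:caff.
 exact:(C_k_cont S1).
- by rewrite /derivable;under eq_fun do rewrite E;exact:C1_derivable.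
have -> : (fun x=> 'D_('e_i) (fun x=> f (x *m A + b)) x) =
  (fun x=> 'D_('e_i *m A) f (x *m A + b)).
 by apply/funext=> x;rewrite /derive;under eq_fun do rewrite E.
by apply:(ih (fun y=> 'D_('e_i *m A) f y));exact:C_k_Dv.
Qed.

(** * Smooth functions with bounded support *)

Section bump.
Context (R : realType).

(** The family p(1/s) exp(-1/s) is stable under differentiation. Smoothness of the member with p = 1
    thus becomes an induction over the order for all polynomials p. *)
Definition flat (p : {poly R}) (s : R) : R :=
 if 0 < s then p.[s^-1] * expR (- s^-1) else 0.

Lemma expR_ge_Xn (m : nat) (y : R) : 0 <= y -> y ^+ m <= m%:R ^+ m * expR y.
Proof.
case:m=> [|m] y0;first by rewrite !expr0 mul1r -expR0 ler_expR.
have -> : y = m.+1%:R * (y / m.+1%:R) by field.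
rewrite exprMn ler_wpM2l ?exprn_ge0// expRM_natl lerXn2r ?nnegrE ?divr_ge0 ?expR_ge0//.
by apply:le_trans (expR_ge1Dx _);rewrite lerDr.
Qed.

(** With y = 1/s, the bound y^(i+1) exp(-y) <= (i+1)^(i+1) has one power of y more than the term of
    degree i, and this power is traded for the factor s. *)
Lemma flat_le p : exists C, forall s, `|flat p s| <= C * `|s|.
Proof.
exists (\sum_(i < size p) `|p`_i| * i.+1%:R ^+ i.+1)=> s;rewrite /flat.
case:ifPn=> [s0|_];last first.
 by rewrite normr0 mulr_ge0// sumr_ge0// => i _;rewrite mulr_ge0// exprn_ge0.
rewrite horner_coef normrM (ger0_norm (expR_ge0 _)) (gtr0_norm s0).
rewrite expRN ler_pdivrMr ?expR_gt0//.
apply:(le_trans (ler_norm_sum _ _ _));rewrite mulr_suml mulr_suml;apply:ler_sum=> i _.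
rewrite normrM -!mulrA ler_wpM2l// normrX [`|s^-1|]ger0_norm;last by rewrite invr_ge0 ltW.
have -> : s^-1 ^+ i = s^-1 ^+ i.+1 * s by rewrite exprSr -mulrA mulVf ?mulr1// gt_eqF.
have y0 : 0 <= s^-1 by rewrite invr_ge0 ltW.
apply:(le_trans (ler_wpM2r (ltW s0) (expR_ge_Xn i.+1 y0))).
by rewrite le_eqVlt;apply/orP;left;apply/eqP;ring.
Qed.

Lemma flat_mulX p s : flat p s = s * flat (p * 'X) s.
Proof.
rewrite /flat;case:ifP=> s0;last by rewrite mulr0.
by rewrite hornerMX;field;rewrite gt_eqF.
Qed.

(** At 0 the difference quotient with step h is the value of [flat (p * 'X)] at h, and [flat_le]
    makes it tend to 0. *)
Lemma is_derive_flat p s : is_derive s (1 : R) (flat p) (flat ('X^2 * (p - p^`())) s).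
Proof.
have [s0|s0|s0] := ltgtP 0 s.
- apply:(@near_eq_is_derive R R R (fun s : R=> p.[s^-1] * expR (- s^-1))).
  by near=> t;rewrite /flat ifT//;near: t;exact:lt_nbhsr.
 have sn : s != 0 by rewrite gt_eqF.
 have dV : is_derive s (1 : R) (fun s : R=> s^-1) (- s ^- 2).
  by apply:is_derive_eq;first exact:is_deriveV;rewrite /GRing.scale/= mulr1.
 have hp : is_derive (s^-1) (1 : R) (horner p) (p^`().[s^-1]).
  apply:DeriveDef;first exact:derivable_horner.
  by rewrite -derive1E -derivE.
 have c1:= @is_derive1_comp R (horner p) (fun s=> s^-1) s _ _ hp dV.
 have dVN : is_derive s (1 : R) (fun s : R=> - s^-1) (s ^- 2).
  by rewrite -[X in is_derive _ _ _ X]opprK;exact:is_deriveN.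
 have c2:= @is_derive1_comp R expR (fun s=> - s^-1) s _ _ (is_derive_expR _) dVN.
 suff -> : flat ('X^2 * (p - p^`())) s =
   p.[s^-1] *: (expR (- s^-1) * s ^- 2) + expR (- s^-1) *: (p^`().[s^-1] * - s ^- 2).
  exact:(is_deriveM c1 c2).
 rewrite /flat s0 hornerM hornerXn hornerD hornerN /GRing.scale/=.
 by rewrite exprVn;ring.
- apply:(@near_eq_is_derive R R R (cst 0)).
  near=> t;rewrite /flat ifF//;apply/negbTE;rewrite -leNgt ltW//;near: t.
  exact:lt_nbhsl.
 by rewrite /flat ltNge ltW//=;exact:is_derive_cst.
have [C hC] := flat_le (p * 'X).
rewrite -s0 [X in is_derive _ _ _ X]/flat ltxx.
have c : h^-1 *: ((flat p \o shift 0) (h *: (1 : R)) - flat p 0) @[h --> (0 : R)^'] --> (0 : R).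
 apply/cvgrPdist_le=> e e0;near=> h.
 have h0 : h != 0 by near: h;exact:nbhs_dnbhs_neq.
 rewrite /= addr0 [h *: 1]mulr1 {2}/flat ltxx subr0 sub0r normrN flat_mulX.
 rewrite /GRing.scale/= mulKf//;apply:(le_trans (hC h)).
 apply:(@le_trans _ _ ((`|C| + 1) * `|h|)).
  by rewrite ler_wpM2r// (le_trans (ler_norm _))// lerDl.
 rewrite -ler_pdivlMl ?ltr_wpDl// ltW//;near: h;apply:dnbhs0_lt.
 by rewrite mulr_gt0// invr_gt0 ltr_wpDl.
by apply:DeriveDef;[apply/cvg_ex;exists 0|exact:cvg_lim].
Unshelve. all: by end_near. Qed.

End bump.

Section bump_rV.
Context (R : realType) (n : nat).
Notation V:= 'rV[R]_n.
Notation mu:= (lebesgue_rV R n).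
Notation sqi:= (sqi mu setT).
Notation dot:= (dot mu setT).
Notation nrm:= (nrm mu setT).
Implicit Types (f g : V -> R).

Definition smooth f:= forall k, C_k k f.

Definition csupp (M : R) f:= forall x, M < `|x| -> f x = 0.

Lemma is_derive_lineP f (x v : V) (d : R) :
 is_derive (0 : R) (1 : R) (fun s=> f (x + s *: v)) d -> is_derive x v f d.
Proof.
case;rewrite /derivable /derive.
have -> : (fun h : R=> h^-1 *: (((fun s : R=> f (x + s *: v)) \o shift 0) (h *: 1) - f (x + 0 *: v))) =
 (fun h : R=> h^-1 *: ((f \o shift x) (h *: v) - f x)).
 apply/funext=> h;rewrite /= addr0 scale0r addr0 (addrC x).
 by congr (_ *: (f (_ *: _ + _) - _));exact:mulr1.
by move=> h1 h2;apply:DeriveDef.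
Qed.

Lemma is_derive_flat_coord p (a b : R) (i j : 'I_n) (x : V) :
 is_derive x 'e_j (fun x : V=> flat p (a + b * x ord0 i))
  ((b * (i == j)%:R) * flat ('X^2 * (p - p^`())) (a + b * x ord0 i)).
Proof.
apply:is_derive_lineP.
pose l (s : R) := (a + b * x ord0 i) + s * (b * (i == j)%:R).
have -> : (fun s=> flat p (a + b * (x + s *: 'e_j) ord0 i)) = flat p \o l.
 by apply/funext=> s;rewrite /l /= !mxE eqxx/= mulrDr addrA mulrCA.
have dl : is_derive (0 : R) (1 : R) l (b * (i == j)%:R).
 have -> : l = cst (a + b * x ord0 i) + (b * (i == j)%:R) *: (id : R -> R).
  by apply/funext=> s;rewrite /l;congr (_ + _);exact:mulrC.
 apply:is_derive_eq.
 by rewrite add0r /GRing.scale/= mulr1.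
have l0 : l 0 = a + b * x ord0 i by rewrite /l mul0r addr0.
rewrite -l0 mulrC;apply:is_derive1_comp;exact:is_derive_flat.
Qed.

Lemma continuous_flat p : continuous (@flat R p).
Proof.
move=> s;apply:differentiable_continuous;apply/derivable1_diffP.
by case:(is_derive_flat p s).
Qed.

Lemma smooth_flat_coord p (a b : R) (i : 'I_n) :
 smooth (fun x : V=> flat p (a + b * x ord0 i)).
Proof.
have cc q : continuous (fun x : V=> flat q (a + b * x ord0 i)).
 move=> x;apply:(@continuous_comp _ _ _ (fun x : V=> a + b * x ord0 i) (@flat R q)).
  apply:(@differentiable_continuous _ _ _ _ (cst a + b *: (fun x : V=> x ord0 i : R))).
  by apply:differentiableD=> //;apply:differentiableZ;exact:differentiable_coord.
 exact:continuous_flat.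
move=> k;elim: k p=> [|k ih] p;first exact/C_k0.
apply/C_kS;split=> [//|x j|j];first by case:(is_derive_flat_coord p a b i j x).
have -> : (fun x=> 'D_('e_j) (fun x : V=> flat p (a + b * x ord0 i)) x) =
  (b * (i == j)%:R) *: (fun x : V=> flat ('X^2 * (p - p^`())) (a + b * x ord0 i)).
 by apply/funext=> x;have [_ ->] := is_derive_flat_coord p a b i j x.
by apply:C_kZ;exact:ih.
Qed.

Lemma norm_ge_coord (x : V) (r : R) : 0 < r -> r <= `|x| -> exists i, r <= `|x ord0 i|.
Proof.
move=> r0;apply:contraPP=> /forallNP h;apply/negP;rewrite -ltNge.
rewrite [ltLHS]/Num.norm/= mx_normrE;apply:bigmax_lt=> // -[i j] _ /=.
by rewrite (ord1 i) ltNge;apply/negP;exact:h.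
Qed.

(** The product over all coordinates of flat functions of r + x_i and r - x_i vanishes as soon as
    one coordinate reaches r in absolute value, which fits the sup norm. *)
Lemma bump0_ex (r : R) : 0 < r -> exists K : V -> R, [/\ smooth K,
 forall x, 0 <= K x, 0 < K 0 & forall x, r <= `|x| -> K x = 0].
Proof.
move=> r0.
pose B (i : 'I_n) : V -> R:= (fun x=> flat 1 (r + 1 * x ord0 i)) * (fun x=> flat 1 (r + -1 * x ord0 i)).
have fg0 (s : R) : 0 <= flat 1 s.
 by rewrite /flat;case:ifP=> // s0;rewrite hornerC mul1r expR_ge0.
have KE x : (\prod_(i < n) B i) x = \prod_(i < n) (flat 1 (r + 1 * x ord0 i) * flat 1 (r + -1 * x ord0 i)).
 by rewrite fct_prodE.
exists (\prod_(i < n) B i);split.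
- by move=> k;apply:C_k_prod=> i _;apply:C_kM;exact:smooth_flat_coord.
- by move=> x;rewrite KE;apply:prodr_ge0=> i _;rewrite mulr_ge0.
- rewrite KE;apply:prodr_gt0=> i _;rewrite mxE !mulr0 addr0 /flat r0.
 by rewrite hornerC mul1r mulr_gt0// expR_gt0.
move=> x /(norm_ge_coord r0)[i xi];rewrite KE (bigD1 i)//= mul1r mulN1r.
have z (s : R) : s <= 0 -> flat 1 s = 0 by rewrite /flat ltNge=> ->.
move: xi;rewrite ler_normr=> /orP[xi|xi].
 by rewrite (z (r - _)) ?mulr0 ?mul0r//;lra.
by rewrite (z (r + _)) ?mul0r//;lra.
Qed.

Lemma csupp_bounded f M : continuous f -> csupp M f ->
 exists2 C, 0 < C & forall x, `|f x| <= C.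
Proof.
move=> cf fM;pose A:= [set x : V | `|x| <= `|M|].
have cA : compact A.
 apply:bounded_closed_compact.
  by exists `|M|;split;[exact:num_real|move=> N MN x /= Ax;rewrite (le_trans Ax)// ltW].
 rewrite (_ : A = (fun x : V=> `|x|) @^-1` [set r | r <= `|M|]);last by [].
 by apply:closed_comp;[move=> x _;exact:norm_continuous|exact:closed_le].
have A0 : A !=set0 by exists 0;rewrite /A/= normr0.
have cf' : {within A, continuous (fun x=> `|f x|)}.
 apply:continuous_subspaceT=> x.
 by apply:(@continuous_comp _ _ _ f (fun r : R=> `|r|));[exact:cf|exact:norm_continuous].
have [c _ hc] := EVT_max_rV A0 cA cf'.
exists (`|f c| + 1)=> [|x];first by rewrite ltr_wpDl.
have [xM|xM] := leP `|x| `|M|.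
 by apply:(le_trans (hc x (mem_set xM)));rewrite lerDl.
by rewrite fM ?normr0 ?addr_ge0// (le_lt_trans _ xM)// ler_norm.
Qed.

Lemma sqi_csupp f M C : measurable_fun setT f -> csupp M f ->
 (forall x, `|f x| <= C) -> sqi f.
Proof.
move=> mf fM fC;have M1 : 0 < `|M| + 1 by rewrite ltr_wpDl.
have sB : sqi (\1_(ball (0 : V) (`|M| + 1))).
 by apply:sqi_indic;[exact:meas_ball|rewrite leb_ball// ltry].
apply:(@sqi_le _ _ _ mu setT measurableT f _ mf (sqiZ measurableT C sB))=> x _.
rewrite fctE /GRing.scale/= indicE;have [xM|xM] := leP `|x| `|M|.
 rewrite mem_set ?mulr1;first by rewrite (le_trans (fC x))// ler_norm.
 by rewrite -ball_normE /= sub0r normrN (le_lt_trans xM)// ltrDl.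
by rewrite fM ?normr0// (le_lt_trans _ xM)// ler_norm.
Qed.

Lemma sqi_continuous_csupp f M : continuous f -> csupp M f -> sqi f.
Proof.
move=> cf fM;have [C _ fC] := csupp_bounded cf fM.
by apply:(sqi_csupp _ fM fC);exact:continuous_meas.
Qed.

Lemma csupp_D f M v : csupp M f -> csupp M (fun x=> 'D_v f x).
Proof.
move=> fM x Mx;have -> : 'D_v f x = 'D_v (cst 0 : V -> R) x.
 apply:near_eq_derive;have : \forall y \near x, M < `|y|.
  apply:open_nbhs_nbhs;split=> //.
  apply:(@open_comp _ _ (fun y : V=> `|y|) [set r | M < r]);last exact:open_gt.
  by move=> y _;exact:norm_continuous.
 by apply:filterS=> y My;rewrite fM.
exact:derive_cst.
Qed.

(** Dominated convergence: the mean value theorem bounds the quotients by the supremum of the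
    derivative, and since the steps t k are bounded by B all the quotients vanish outside the ball
    of radius M'. *)
Lemma dq_cvg f (v : V) M (t : nat -> R) : C_k 1 f -> csupp M f ->
 (forall k, t k != 0) -> t k @[k --> \oo] --> 0 ->
 nrm ((t k)^-1 *: (tr (t k *: v) f - f) - (fun x=> 'D_v f x)) @[k --> \oo] --> 0.
Proof.
move=> Sf fM t0 ct.
have [B B0 tB] : exists2 B, 0 < B & forall k, `|t k| <= B.
 have [B [_ hB]] := cvg_seq_bounded (cvgP _ ct).
 exists (`|B| + 1)=> [|k];first by rewrite ltr_wpDl.
 by apply:(hB (`|B| + 1))=> //;rewrite (le_lt_trans (ler_norm _))// ltrDl.
have cf : continuous f:= C_k_cont Sf.
have cD : continuous (fun x=> 'D_v f x) by apply/C_k0;exact:C_k_Dv.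
have [C C0 hC] := csupp_bounded cD (@csupp_D f M v fM).
pose M' := `|M| + B * `|v| + 1.
have M'0 : 0 < M' by rewrite ltr_wpDl// addr_ge0// mulr_ge0// ltW.
have sB : sqi (\1_(ball (0 : V) M')).
 by apply:sqi_indic;[exact:meas_ball|rewrite leb_ball// ltry].
have mq k : measurable_fun setT ((t k)^-1 *: (tr (t k *: v) f - f)).
 apply:measurable_funM=> //;apply:measurable_funB;last exact:continuous_meas.
 by apply:(measurableT_comp (continuous_meas cf));exact:measurable_addrV.
apply:(dominated_nrm measurableT mq _ (sqiZ measurableT C sB) _ _).2.
- exact:continuous_meas.
- move=> x _;have:= @C1_derivable _ _ f x v Sf.
 move=> /cvgr_dnbhsP=> H.
 have:= H t;rewrite -/('D_v f x)=> /(_ (conj t0 ct));apply:cvg_trans.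
 rewrite (_ : (fun k=> _) = (fun k=> (t k)^-1 *: ((f \o shift x) (t k *: v) - f x)))//.
 by apply/funext=> k;rewrite !fctE /tr /= (addrC x).
move=> k x _;rewrite !fctE /GRing.scale/= /tr indicE;have [xM|xM] := ltP `|x| M'.
 have [c _ ->] := @MVT_line _ _ f x v (t k) (fun y=> @C1_derivable _ _ f y v Sf).
 by rewrite mulKf// mem_set ?mulr1//;rewrite -ball_normE /= sub0r normrN.
have e3 : 0 <= B * `|v| by rewrite mulr_ge0// ltW.
rewrite /M' in xM;have h1 : M < `|x| by have:= ler_norm M;lra.
have h2 : M < `|x + t k *: v|.
 have e1 : `|x| <= `|x + t k *: v| + `|t k *: v|.
  by rewrite -{1}(addrK (t k *: v) x) ler_normB.
 have e2 : `|t k *: v| <= B * `|v| by rewrite normrZ ler_wpM2r.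
 by have:= ler_norm M;lra.
by rewrite !fM// subrr mulr0 normr0 mulr_ge0// ltW.
Qed.

End bump_rV.

Lemma seq_cvg0 (R : realType) (V : normedModType R) (F : V -> R) :
 (forall h : nat -> V, h m @[m --> \oo] --> (0 : V) -> F (h m) @[m --> \oo] --> (0 : R)) ->
 forall e, 0 < e -> exists2 d, 0 < d & forall h : V, `|h| < d -> `|F h| <= e.
Proof.
move=> H e e0;apply:contrapT=> N.
have /choice[h hP] (k : nat) : exists h : V, `|h| < k.+1%:R^-1 /\ e < `|F h|.
 apply:contrapT=> /forallNP hk;apply:N;exists k.+1%:R^-1.
  by rewrite invr_gt0.
 by move=> h hd;rewrite leNgt;apply/negP=> eF;apply:(hk h).
have h0 : h m @[m --> \oo] --> (0 : V).
 apply/cvgrPdist_lt=> d d0.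
 have [k _ hk] := near_infty_natSinv_lt (PosNum d0).
 exists k=> // m /= km;rewrite sub0r normrN;have [h1 _] := hP m.
 exact:(lt_trans h1 (hk _ km)).
have /cvgrPdist_le/(_ _ e0)[k _ /(_ k (leqnn k))] := H h h0.
by rewrite /= sub0r normrN leNgt;have [_ ->] := hP k.
Qed.

Lemma continuous_dist (R : realType) (V : normedModType R) (f : V -> R) :
 (forall x e, 0 < e -> exists2 d, 0 < d & forall h, `|h| < d -> `|f (x + h) - f x| <= e) ->
 continuous f.
Proof.
move=> H x;apply/cvgrPdist_le=> e e0;have [d d0 hd] := H x e e0.
apply/nbhs_ballP;exists d=> // y;rewrite -ball_normE /= distrC=> xy.
have:= hd (y - x) xy;rewrite (_ : x + (y - x) = y);last by rewrite addrC subrK.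
by rewrite distrC.
Qed.

(** * Integration by parts, convolution and mollification *)

Section convol.
Context (R : realType) (n : nat).
Notation V:= 'rV[R]_n.
Notation mu:= (lebesgue_rV R n).
Notation sqi:= (sqi mu setT).
Notation dot:= (dot mu setT).
Notation nrm:= (nrm mu setT).
Implicit Types (f g K : V -> R).

Lemma invS_cvg0 : (k.+1%:R^-1 : R) @[k --> \oo] --> (0 : R).
Proof. exact:cvg_harmonic. Qed.

Lemma sqi_C1 f M : C_k 1 f -> csupp M f -> sqi f.
Proof. by move=> /C_k_cont cf;exact:sqi_continuous_csupp. Qed.

Lemma sqi_Dv f M v : C_k 1 f -> csupp M f -> sqi (fun x=> 'D_v f x).
Proof.
move=> Sf fM;apply:(@sqi_continuous_csupp _ _ _ M);last exact:csupp_D.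
by apply/C_k0;exact:C_k_Dv.
Qed.

Lemma dot_trl h f g : sqi f -> sqi g -> dot (tr h f) g = dot f (tr (- h) g).
Proof.
move=> sf sg;rewrite -(dot_tr h sf (sqi_tr (- h) sg));congr (Lsq.dot _ _ _ _).
by apply/funext=> x;rewrite /tr addrK.
Qed.

(** Translation invariance moves a difference quotient of step t from f to a quotient of step -t on
    g, up to the sign. Both quotients converge in L^2 by [dq_cvg]. *)
Lemma IBP f g M M' v : C_k 1 f -> C_k 1 g -> csupp M f -> csupp M' g ->
 dot (fun x=> 'D_v f x) g = - dot f (fun x=> 'D_v g x).
Proof.
move=> Sf Sg fM gM;have sf:= sqi_C1 Sf fM;have sg:= sqi_C1 Sg gM.
have sDf:= sqi_Dv v Sf fM;have sDg:= sqi_Dv v Sg gM.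
pose t (k : nat) : R:= k.+1%:R^-1.
have t0 k : t k != 0 by rewrite invr_eq0.
have tN0 k : - t k != 0 by rewrite oppr_eq0.
have ctN : - t k @[k --> \oo] --> (0 : R).
 by rewrite -[X in _ --> X]oppr0;apply:cvgN;exact:invS_cvg0.
pose q (s : R) (f : V -> R) := s^-1 *: (tr (s *: v) f - f).
have sq s f' : sqi f' -> sqi (q s f').
 by move=> sf';apply:sqiZ=> //;apply:sqiB=> //;exact:sqi_tr.
have c1:= cvg_dot measurableT (fun k=> sq (t k) f sf) sDf sg (dq_cvg v Sf fM t0 invS_cvg0).
have c2:= cvg_dot measurableT (fun k=> sq (- t k) g sg) sDg sf (dq_cvg v Sg gM tN0 ctN).
have E k : dot (q (t k) f) g = - dot (q (- t k) g) f.
 rewrite /q !dotZl ?dotBl//;[|exact:sqi_tr|exact:sqi_tr|apply:sqiB=> //;exact:sqi_tr|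
  apply:sqiB=> //;exact:sqi_tr].
 by rewrite dot_trl// scaleNr (dotC _ _ (tr _ g)) (dotC _ _ g f) invrN mulNr opprK.
apply:(cvg_unique _ c1)=> //=;rewrite (dotC _ _ f).
by under eq_fun do rewrite E;apply:cvgN.
Qed.

Definition convol K g : V -> R:= fun x=> dot (fun y=> K (x - y)) g.

Lemma conv_dist K g x h : sqi K -> sqi g ->
 `|convol K g (x + h) - convol K g x| <= nrm (tr h K - K) * nrm g.
Proof.
move=> sK sg;have s1:= sqi_refl x (sqi_tr h sK);have s2:= sqi_refl x sK.
have E : convol K g (x + h) = dot (fun y=> tr h K (x - y)) g.
 by congr (Lsq.dot _ _ _ _);apply/funext=> y;rewrite /tr addrAC.
rewrite E -dotBl//;apply:(le_trans (dot_CS measurableT (sqiB measurableT s1 s2) sg)).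
rewrite ler_wpM2r ?nrm_ge0// le_eqVlt;apply/orP;left;apply/eqP.
by rewrite -[RHS](nrm_refl x)//;apply:sqiB=> //;exact:sqi_tr.
Qed.

Lemma conv_continuous K g : sqi K -> sqi g -> continuous (convol K g).
Proof.
move=> sK sg;apply:(@continuous_dist R V)=> x e e0.
have [_ cK] := trcont_sqint sK.
have e1 : 0 < e / (nrm g + 1) by rewrite divr_gt0// ltr_wpDl// nrm_ge0.
have [d d0 hd] := @seq_cvg0 R V (fun h=> nrm (tr h K - K)) cK _ e1.
exists d=> // h /hd;rewrite (ger0_norm (nrm_ge0 _ _ _))=> {}hd.
apply:(le_trans (conv_dist x h sK sg));apply:(le_trans (ler_wpM2r (nrm_ge0 _ _ _) hd)).
rewrite -mulrA;apply:ler_piMr;first exact:ltW.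
by rewrite ler_pdivrMl ?mulr1 ?lerDl// ltr_wpDl// nrm_ge0.
Qed.

Lemma is_derive_conv K g M x v : C_k 1 K -> csupp M K -> sqi g ->
 is_derive x v (convol K g) (convol (fun y=> 'D_v K y) g x).
Proof.
move=> SK KM sg;have sK:= sqi_C1 SK KM;have sDK:= sqi_Dv v SK KM.
have H : h^-1 *: ((convol K g \o shift x) (h *: v) - convol K g x) @[h --> (0 : R)^'] -->
  convol (fun y=> 'D_v K y) g x.
 apply/cvgr_dnbhsP=> t [t0 ct].
 have sq s : sqi (s^-1 *: (tr (s *: v) K - K)).
  by apply:sqiZ=> //;apply:sqiB=> //;exact:sqi_tr.
 have E k : (t k)^-1 *: ((convol K g \o shift x) (t k *: v) - convol K g x) =
   dot (fun y=> ((t k)^-1 *: (tr (t k *: v) K - K)) (x - y)) g.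
  have s1:= sqi_refl x (sqi_tr (t k *: v) sK);have s2:= sqi_refl x sK.
  have -> : (fun y=> ((t k)^-1 *: (tr (t k *: v) K - K)) (x - y)) =
   (t k)^-1 *: ((fun y=> tr (t k *: v) K (x - y)) - (fun y=> K (x - y))) by [].
  rewrite dotZl ?dotBl//;last exact:sqiB.
  congr (_ * (_ - _));rewrite /= /convol;congr (Lsq.dot _ _ _ _);apply/funext=> y.
  by rewrite /tr;congr K;rewrite -addrA addrC.
 pose q k:= (t k)^-1 *: (tr (t k *: v) K - K).
 have c : nrm ((fun y=> q k (x - y)) - (fun y=> 'D_v K (x - y))) @[k --> \oo] --> 0.
  have -> : (fun k=> nrm ((fun y=> q k (x - y)) - (fun y=> 'D_v K (x - y)))) =
    (fun k=> nrm (q k - (fun y=> 'D_v K y))).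
   apply/funext=> k;exact:(nrm_refl x (sqiB measurableT (sq _) sDK)).
  exact:(dq_cvg v SK KM t0 ct).
 rewrite (funext E).
 exact:(cvg_dot measurableT (fun k=> sqi_refl x (sq _)) (sqi_refl x sDK) sg c).
by apply:DeriveDef;[apply/cvg_ex;eexists;exact:H|exact:cvg_lim].
Qed.

Lemma pd_csupp K M s : csupp M K -> csupp M (pderiv s K).
Proof. by move=> KM;elim: s=> //= i s;exact:csupp_D. Qed.

Lemma C_k_pderiv K k s : C_k (k + size s) K -> C_k k (pderiv s K).
Proof.
elim: s k=> [|i s ih] k /=;first by rewrite addn0.
by rewrite addnS -addSn=> /ih;exact:C_k_D.
Qed.

Lemma smooth_pd K s : smooth K -> smooth (pderiv s K).
Proof. by move=> SK k;exact:C_k_pderiv. Qed.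

Lemma pderiv_conv K g M s : smooth K -> csupp M K -> sqi g ->
 pderiv s (convol K g) = convol (pderiv s K) g.
Proof.
move=> SK KM sg;elim: s=> //= i s ->;apply/funext=> x.
by have [_ ->] := is_derive_conv x 'e_i (smooth_pd s SK 1%N) (pd_csupp s KM) sg.
Qed.

Lemma smooth_conv K g M : smooth K -> csupp M K -> sqi g -> smooth (convol K g).
Proof.
move=> SK KM sg k;have sK s : sqi (pderiv s K).
 exact:(sqi_C1 (smooth_pd s SK 1%N) (pd_csupp s KM)).
split=> s _;last by rewrite (pderiv_conv _ SK KM)//;exact:conv_continuous.
move=> x i;rewrite (pderiv_conv _ SK KM)//.
by have [] := is_derive_conv x 'e_i (smooth_pd s SK 1%N) (pd_csupp s KM) sg.
Qed.

Lemma conv_eq0 K g x : (forall y, K (x - y) = 0 \/ g y = 0) -> convol K g x = 0.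
Proof.
move=> h;rewrite /convol /Lsq.dot (_ : (fun y=> _) = cst 0).
 by rewrite Rintegral_cst// mul0r.
by apply/funext=> y;case:(h y)=> /= ->;rewrite ?mul0r ?mulr0.
Qed.

Lemma csupp_conv K g M M' : csupp M K -> csupp M' g -> csupp (M + M') (convol K g).
Proof.
move=> KM gM x Mx;apply:conv_eq0=> y;have [yM|yM] := ltP M' `|y|.
 by right;exact:gM.
left;apply:KM;have:= ler_normD (x - y) y;rewrite subrK;lra.
Qed.

Lemma convE K g x : sqi K -> sqi g -> convol K g x = dot K (fun y=> g (x - y)).
Proof.
move=> sK sg;rewrite /convol -(dot_refl x sK (sqi_refl x sg));congr (Lsq.dot _ _ _ _).
by apply/funext=> y;rewrite subKr.
Qed.

End convol.

Section fubini_real.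
Context (R : realType) (n : nat).
Notation V:= 'rV[R]_n.
Notation mu:= (lebesgue_rV R n).

Lemma fubini_real (f : V * V -> R) :
 (mu \x mu)%E.-integrable setT (EFin \o f) ->
 (forall x, mu.-integrable setT (EFin \o (fun y=> f (x, y)))) ->
 (forall y, mu.-integrable setT (EFin \o (fun x=> f (x, y)))) ->
 \int[mu]_x (\int[mu]_y f (x, y)) = \int[mu]_y (\int[mu]_x f (x, y)) /\
 mu.-integrable setT (EFin \o (fun x=> \int[mu]_y f (x, y))).
Proof.
move=> fi i1 i2.
have E1 x : (\int[mu]_y f (x, y))%:E = (\int[mu]_y (f (x, y))%:E)%E.
 by rewrite /Rintegral fineK//;exact:integrable_fin_num (i1 x).
have E2 y : (\int[mu]_x f (x, y))%:E = (\int[mu]_x (f (x, y))%:E)%E.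
 by rewrite /Rintegral fineK//;exact:integrable_fin_num (i2 y).
split.
 rewrite {1 3}/Rintegral;congr fine.
 rewrite (eq_integral (fun x=> \int[mu]_y (f (x, y))%:E)%E);last by move=> x _;exact:E1.
 rewrite (Fubini fi);apply:eq_integral=> y _;exact/esym/E2.
have:= integrable_fubini_F fi;apply:eq_integrable=> // x _.
by rewrite /= E1.
Qed.

End fubini_real.

Section mollification.
Context (R : realType) (n : nat).
Notation V:= 'rV[R]_n.
Notation mu:= (lebesgue_rV R n).
Notation sqi:= (sqi mu setT).
Notation dot:= (dot mu setT).
Notation nrm:= (nrm mu setT).
Implicit Types (f g K : V -> R).

Definition bumpf (r : R) K:= [/\ smooth K, forall x, 0 <= K x,
 forall x, r <= `|x| -> K x = 0 & \int[mu]_x K x = 1].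

Lemma integrable_csupp f M : sqi f -> csupp M f -> mu.-integrable setT (EFin \o f).
Proof.
move=> sf fM;have M1 : 0 < `|M| + 1 by rewrite ltr_wpDl.
have sB : sqi (\1_(ball (0 : V) (`|M| + 1))).
 by apply:sqi_indic;[exact:meas_ball|rewrite leb_ball// ltry].
have:= sqi_mul measurableT sf sB;apply:eq_integrable=> // x _ /=.
rewrite indicE;have [xM|xM] := leP `|x| `|M|.
 by rewrite mem_set ?mulr1// -ball_normE /= sub0r normrN (le_lt_trans xM)// ltrDl.
by rewrite fM ?mul0r// (le_lt_trans _ xM)// ler_norm.
Qed.

Lemma bump_ex (r : R) : 0 < r -> exists K, bumpf r K.
Proof.
move=> r0;have [K [SK K0 Kpos Kr]] := @bump0_ex R n r r0.
have KM : csupp r K by move=> x rx;rewrite Kr// ltW.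
have sK:= sqi_C1 (SK 1%N) KM;have iK:= integrable_csupp sK KM.
have I0 : 0 < \int[mu]_x K x.
 have cK:= C_k_cont (SK 0%N).
 have : \forall y \near (0 : V), `|K 0 - K y| < K 0 / 2.
  by have:= cK 0;move=> /cvgrPdist_lt;apply;rewrite divr_gt0.
 move=> /nbhs_ballP[d /= d0 hd].
 have sB : sqi (\1_(ball (0 : V) d)).
  by apply:sqi_indic;[exact:meas_ball|rewrite leb_ball// ltry].
 have iB0 : mu.-integrable setT (EFin \o (\1_(ball (0 : V) d) : V -> R)).
  apply:(integrable_csupp (M:= d) sB)=> x dx;rewrite indicE memNset//.
  by rewrite -ball_normE /= sub0r normrN;apply/negP;rewrite -leNgt ltW.
 have iB : mu.-integrable setT (EFin \o (fun x : V=> K 0 / 2 * \1_(ball (0 : V) d) x)).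
  exact:(integrableZl measurableT (K 0 / 2) iB0).
 apply:(@lt_le_trans _ _ (\int[mu]_x (K 0 / 2 * \1_(ball (0 : V) d) x))).
  rewrite RintegralZl//.
  apply:mulr_gt0;first by rewrite divr_gt0.
  have E : (\int[mu]_x (\1_(ball (0 : V) d) x)%:E)%E = ((2 * d) ^+ n)%:E.
   rewrite integral_indic//;last exact:meas_ball.
   by rewrite setIT;exact:leb_ball.
  by rewrite /Rintegral E /= exprn_gt0// mulr_gt0.
 apply:le_Rintegral=> // x _;rewrite indicE;have [xd|xd] := boolP (x \in _).
  have:= hd x (set_mem xd);rewrite mulr1 ltr_norml;lra.
 by rewrite mulr0.
exists ((\int[mu]_x K x)^-1 *: K);split.
- by move=> k;exact:C_kZ.
- by move=> x;rewrite fctE /GRing.scale/= mulr_ge0// invr_ge0 ltW.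
- by move=> x rx;rewrite fctE Kr// scaler0.
have -> : \int[mu]_x ((\int[mu]_x K x)^-1 *: K) x = \int[mu]_x ((\int[mu]_x K x)^-1 * K x) by [].
by rewrite RintegralZl// mulVf// gt_eqF.
Qed.

Section moll_le.
Variables (K g : V -> R) (r M S : R).
Hypotheses (bK : bumpf r K) (sg : sqi g) (gM : csupp M g).
Hypothesis hS : forall h, `|h| < r -> nrm (tr (- h) g - g) <= S.

Let KM : csupp r K. Proof. by case:bK=> _ _ Kr _ x rx;rewrite Kr// ltW. Qed.
Let sK : sqi K. Proof. by case:bK=> SK _ _ _;exact:(sqi_C1 (SK 1%N) KM). Qed.
Let iK : mu.-integrable setT (EFin \o K). Proof. exact:integrable_csupp KM. Qed.

Lemma sqi_conv : sqi (convol K g).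
Proof.
apply:(sqi_continuous_csupp _ (csupp_conv KM gM)).
exact:conv_continuous.
Qed.

Let psi:= convol K g - g.
Let spsi : sqi psi. Proof. by apply:sqiB=> //;exact:sqi_conv. Qed.
Let F (p : V * V) := K p.1 * ((g (p.2 - p.1) - g p.2) * psi p.2).

Let psiE x : psi x = \int[mu]_h (K h * (g (x - h) - g x)).
Proof.
have sgx:= sqi_refl x sg.
rewrite /psi fctE [X in X + _](convE x sK sg).
have -> : (- g) x = - (\int[mu]_h K h * g x) by case:bK=> _ _ _ ->;rewrite mul1r.
rewrite -RintegralZr// -RintegralB//.
- by apply:eq_Rintegral=> h _;rewrite mulrBr.
- exact:sqi_mul.
- exact:(integrableZr measurableT (g x) iK).
Qed.

Let mF : measurable_fun setT F.
Proof.
have mg:= sg.1;have mp:= spsi.1;have mK:= sK.1.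
apply:measurable_funM;first exact:(measurableT_comp mK measurable_fst).
apply:measurable_funM;last exact:(measurableT_comp mp measurable_snd).
apply:measurable_funB;last exact:(measurableT_comp mg measurable_snd).
apply:(measurableT_comp mg);apply:measurable_addrVV;first exact:measurable_snd.
by apply:measurable_opprV;exact:measurable_fst.
Qed.

Let sdiff h : sqi (tr (- h) g - g).
Proof. by apply:sqiB=> //;exact:sqi_tr. Qed.

Let K0 x : 0 <= K x. Proof. by case:bK. Qed.

Let inner h : \int[mu]_x F (h, x) = K h * dot (tr (- h) g - g) psi.
Proof. by rewrite -RintegralZl//;exact:sqi_mul. Qed.

Let iF1 h : mu.-integrable setT (EFin \o (fun x=> F (h, x))).
Proof. exact:(integrableZl measurableT (K h) (sqi_mul measurableT (sdiff h) spsi)). Qed.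

Let iF2 x : mu.-integrable setT (EFin \o (fun h=> F (h, x))).
Proof.
have i1:= sqi_mul measurableT sK (sqi_refl x sg).
have i2 : mu.-integrable setT (EFin \o (fun h=> K h * g x)).
 exact:(integrableZr measurableT (g x) iK).
have i3 : mu.-integrable setT (EFin \o (fun h=> (K h * g (x - h) - K h * g x) * psi x)).
 exact:(integrableZr measurableT (psi x) (integrableB measurableT i1 i2)).
apply:eq_integrable i3=> // h _;rewrite /= /F/=;congr EFin;ring.
Qed.

Let iF : (mu \x mu)%E.-integrable setT (EFin \o F).
Proof.
apply/integrable12ltyP;first exact/measurable_EFinP.
pose C:= (nrm g + nrm g) * nrm psi.
have C0 : 0 <= C by rewrite mulr_ge0 ?addr_ge0 ?nrm_ge0.
apply:(@le_lt_trans _ _ (\int[mu]_h (K h * C)%:E)%E).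
 apply:ge0_le_integral=> //.
 - by move=> h _;exact:integral_ge0.
 - have mE : measurable_fun setT (abse \o (EFin \o F)).
   by apply:measurableT_comp=> //;exact/measurable_EFinP.
  exact:(@measurable_fun_fubini_tonelli_F _ _ _ _ _ mu _ mE (fun x=> abse_ge0 _)).
 - by apply/measurable_EFinP;apply:measurable_funM=> //;exact:sK.1.
 move=> h _.
 rewrite (eq_integral (fun x=> (K h * (`|(tr (- h) g - g) x| * `|psi x|))%:E));last first.
  by move=> x _;rewrite /F/= !normrM (ger0_norm (K0 h)).
 have sa:= sqi_abs measurableT (sdiff h);have sp:= sqi_abs measurableT spsi.
 have i1:= sqi_mul measurableT sa sp.
 have i2 : mu.-integrable setT (EFin \o (fun x=> K h * (`|(tr (- h) g - g) x| * `|psi x|))).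
  exact:(integrableZl measurableT (K h) i1).
 rewrite -(fineK (integrable_fin_num measurableT i2)) lee_fin.
 rewrite [leLHS](RintegralZl (K h) measurableT i1).
 apply:ler_wpM2l=> //;have:= dot_CS measurableT sa sp.
 rewrite !nrm_abs=> h1;apply:(le_trans (ler_norm _));apply:(le_trans h1).
 apply:ler_wpM2r;first exact:nrm_ge0.
 by apply:(le_trans (nrmB measurableT (sqi_tr (- h) sg) sg));rewrite nrm_tr.
have i4:= integrableZr measurableT C iK.
exact:(integrable_lty measurableT i4).
Qed.

(** Minkowski's inequality for integrals, by duality: psi = K * g - g is the K-average of the
    differences [tr (- h) g - g]. Pairing psi with itself and exchanging the integrals gives |psi|^2
    <= S |psi|. *)
Lemma moll_le : nrm (convol K g - g) <= S.
Proof.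
have [E i] := fubini_real iF iF1 iF2.
have Epsi : dot psi psi = \int[mu]_h (K h * dot (tr (- h) g - g) psi).
 under [RHS]eq_Rintegral do rewrite -inner.
 rewrite E;apply:eq_Rintegral=> x _;rewrite {1}psiE -RintegralZr//.
  by apply:eq_Rintegral=> h _;rewrite /F/= mulrA.
 have i1:= sqi_mul measurableT sK (sqi_refl x sg).
 have i2 : mu.-integrable setT (EFin \o (fun h=> K h * g x)).
  exact:(integrableZr measurableT (g x) iK).
 apply:eq_integrable (integrableB measurableT i1 i2)=> // h _.
 by rewrite /= mulrBr.
have le1 : dot psi psi <= S * nrm psi.
 rewrite Epsi -[leRHS]mul1r;case:bK=> _ _ Kr <-;rewrite -RintegralZr//.
 apply:le_Rintegral=> //.
 - by apply:eq_integrable i=> // h _;rewrite /= inner.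
 - exact:(integrableZr measurableT (S * nrm psi) iK).
 move=> h _;have [hr|hr] := ltP `|h| r;last by rewrite Kr// !mul0r.
 rewrite ler_wpM2l//;apply:(le_trans (ler_norm _)).
 apply:(le_trans (dot_CS measurableT (sdiff h) spsi)).
 by rewrite ler_wpM2r ?nrm_ge0// hS.
rewrite -/psi;have:= nrm_ge0 mu setT psi;rewrite le_eqVlt=> /predU1P[<-|p0].
 (* If psi has norm 0, what remains is S >= 0. It comes from h = 0 when r > 0; for r <= 0 the kernel
    would vanish although its integral is 1. *)
 have [r0|r0] := ltP 0 r;last first.
  case:bK=> _ _ Kr I1;exfalso;move: I1;rewrite (_ : (fun x=> K x) = cst 0).
   by rewrite Rintegral_cst// mul0r=> /eqP;rewrite eq_sym oner_eq0.
  by apply/funext=> x;rewrite Kr// (le_trans r0).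
 by apply:le_trans (hS (h:= 0) _);[exact:nrm_ge0|rewrite normr0].
by move: le1;rewrite -sqr_nrm expr2 ler_pM2r.
Qed.

End moll_le.

Lemma bump_cvg g M (K : nat -> V -> R) : sqi g -> csupp M g ->
 (forall m, bumpf m.+1%:R^-1 (K m)) -> nrm (convol (K m) g - g) @[m --> \oo] --> 0.
Proof.
move=> sg gM bK;apply/cvgrPdist_le=> e e0;have [_ cg] := trcont_sqint sg.
have [d d0 hd] := @seq_cvg0 R V (fun h=> nrm (tr h g - g)) cg _ e0.
have [k _ hk] := near_infty_natSinv_lt (PosNum d0).
exists k=> // m /= km;rewrite sub0r normrN (ger0_norm (nrm_ge0 _ _ _)).
apply:(moll_le (bK m) sg gM)=> h hr.
have:= hd (- h);rewrite normrN (ger0_norm (nrm_ge0 _ _ _));apply.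
exact:(lt_trans hr (hk _ km)).
Qed.

End mollification.

(** * Density of test functions, and approximation of weak derivatives *)

Section dense.
Context (R : realType) (n : nat).
Notation V:= 'rV[R]_n.
Notation mu:= (lebesgue_rV R n).
Implicit Types (f g K phi : V -> R) (Om : set V).

Lemma patch_mul f g Om x : (f \_ Om) x * g x = ((fun x=> f x * g x) \_ Om) x.
Proof. by rewrite /patch;case:ifP;rewrite ?mul0r. Qed.

Lemma dot_patchl f g Om : dot mu Om f g = dot mu setT (f \_ Om) g.
Proof.
rewrite {1}/dot Rintegral_mkcond;apply:eq_Rintegral=> x _.
by rewrite patch_mul.
Qed.

Lemma dot_patchr f g Om : dot mu Om f g = dot mu setT f (g \_ Om).
Proof. by rewrite dotC dot_patchl dotC. Qed.

Lemma dot_patch f g Om : dot mu Om f g = dot mu setT (f \_ Om) (g \_ Om).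
Proof.
rewrite dot_patchl;apply:eq_Rintegral=> x _.
by rewrite /patch;case:ifP=> //;rewrite !mul0r.
Qed.

Lemma nrm_patch f Om : nrm mu Om f = nrm mu setT (f \_ Om).
Proof. by rewrite /nrm dot_patch. Qed.

Lemma sqi_patch f Om : measurable Om ->
 sqi mu Om f <-> sqi mu setT (f \_ Om).
Proof.
move=> mO;have E : (\int[mu]_x (((f \_ Om) x) ^+ 2)%:E =
  \int[mu]_(x in Om) ((f x) ^+ 2)%:E)%E.
 rewrite [RHS]integral_mkcond;apply:eq_integral=> x _.
 by rewrite /patch;case:ifP=> //;rewrite expr0n.
split=> -[mf foo];split;rewrite ?E// -?E//.
 exact:(measurable_restrictT f mO).1.
exact:(measurable_restrictT f mO).2.
Qed.

Lemma sqi_sub f A B : measurable A -> measurable B -> A `<=` B ->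
 sqi mu B f -> sqi mu A f.
Proof.
move=> mA mB AB [mf foo];split;first exact:measurable_funS mf.
apply:le_lt_trans foo;apply:ge0_subset_integral=> //.
 by apply/measurable_EFinP;exact:measurable_funX.
by move=> x _;rewrite lee_fin sqr_ge0.
Qed.

Lemma sqiT A f : measurable A -> sqi mu setT f -> sqi mu A f.
Proof. by move=> mA sf;apply:sqi_sub sf=> //. Qed.

Lemma test_functionP Om phi F : smooth phi -> closed F -> bounded_set F ->
 F `<=` Om -> (forall x, ~ F x -> phi x = 0) -> test_function Om phi.
Proof.
move=> Sphi cF bF FO h;split=> //.
have sF : closure [set x | phi x != 0] `<=` F.
 rewrite closureE;apply:smallest_sub=> // x /= /eqP px.
 by apply:contrapT=> nF;apply:px;exact:h.
split;last exact:subset_trans FO.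
apply:(subclosed_compact _ (bounded_closed_compact bF cF) sF).
exact:closed_closure.
Qed.

Lemma test_csupp Om phi : test_function Om phi -> exists M, csupp M phi.
Proof.
move=> [_ [cs _]];have /bounded_setP[M M0 hM] := compact_bounded cs.
exists M=> x Mx;apply/eqP;apply:contraTT (ltW Mx)=> px;rewrite -ltNge.
by apply:hM;exact:subset_closure.
Qed.

Lemma test_eq0 Om phi x : test_function Om phi -> ~ Om x -> phi x = 0.
Proof.
move=> [_ [_ sO]] nO;apply/eqP;apply:contrapT=> /negP px;apply:nO;apply:sO.
exact:subset_closure.
Qed.

Lemma test_sub A B phi : A `<=` B -> test_function A phi -> test_function B phi.
Proof. by move=> AB [Sp [cs sA]];split=> //;split=> //;exact:subset_trans AB. Qed.

Lemma sqi_test Om phi s : test_function Om phi -> sqi mu setT (pderiv s phi).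
Proof.
move=> tp;have [M pM] := test_csupp tp;have [Sp _] := tp.
exact:(sqi_C1 (smooth_pd s Sp 1%N) (pd_csupp s pM)).
Qed.

Lemma test_pderiv Om phi s : test_function Om phi ->
 test_function Om (pderiv s phi).
Proof.
move=> tp;have [Sp [cs sO]] := tp.
apply:(@test_functionP _ _ (closure [set x | phi x != 0]))=> //.
- exact:smooth_pd.
- exact:closed_closure.
- exact:compact_bounded.
elim: s=> [|i s ih] x nx /=.
 by apply/eqP;apply:contrapT=> /negP px;apply:nx;exact:subset_closure.
have -> : 'D_('e_i) (pderiv s phi) x = 'D_('e_i) (cst 0 : V -> R) x.
 apply:near_eq_derive.
 have : \forall y \near x, ~ closure [set x | phi x != 0] y.
  by apply:open_nbhs_nbhs;split=> //;apply:closed_openC;exact:closed_closure.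
 by apply:filterS=> y;exact:ih.
exact:derive_cst.
Qed.

Definition inner_set Om (r : R) : set V :=
 [set x | forall y, ~ Om y -> r <= `|x - y|].

Lemma closed_inner_set Om r : closed (inner_set Om r).
Proof.
rewrite (_ : inner_set Om r = \bigcap_(y in ~` Om) ((fun x=> `|x - y|) @^-1` [set t | r <= t])).
 apply:closed_bigI=> y _;apply:closed_comp;last exact:closed_ge.
 move=> x _;apply:(@lipschitz_dist_continuous R V R _ 1 ler01)=> a b.
 rewrite mul1r;apply:(le_trans (ler_dist_dist _ _)).
 by rewrite opprB addrA subrK.
by apply/seteqP;split=> [x h y Oy|x h y Oy];exact:h.
Qed.

Lemma inner_set_ex Om x : open Om -> Om x -> exists2 r, 0 < r & inner_set Om r x.
Proof.
move=> oO Ox;have /nbhs_ballP[r /= r0 hr] : nbhs x Om by exact:open_nbhs_nbhs.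
exists r=> // y nO;rewrite leNgt;apply/negP=> xy;apply:nO;apply:hr.
by rewrite -ball_normE.
Qed.

Lemma sub_inner_set Om r : 0 < r -> inner_set Om r `<=` Om.
Proof.
move=> r0 x h;apply:contrapT=> nO;have:= h x nO.
by rewrite subrr normr0 leNgt r0.
Qed.

Lemma bounded_normle (M : R) : bounded_set [set x : V | `|x| <= M].
Proof.
apply/bounded_setP;exists (`|M| + 1)=> [|x /= xM];first by rewrite ltr_wpDl.
by rewrite (le_lt_trans xM)// (le_lt_trans (ler_norm _))// ltrDl.
Qed.

Lemma closed_normle (M : R) : closed [set x : V | `|x| <= M].
Proof.
rewrite (_ : [set x | _] = (fun x : V=> `|x|) @^-1` [set r | r <= M]);last by [].
by apply:closed_comp;[move=> x _;exact:norm_continuous|exact:closed_le].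
Qed.

Lemma test_convol Om K g (r r' M : R) : 0 < r' -> bumpf r K -> sqi mu setT g ->
 csupp M g -> (forall x, ~ inner_set Om (r + r') x -> g x = 0) ->
 test_function Om (convol K g).
Proof.
move=> r'0 bK sg gM gO;have [SK _ Kr _] := bK.
have KM : csupp r K by move=> x rx;rewrite Kr// ltW.
apply:(@test_functionP _ _ (inner_set Om r' `&` [set x | `|x| <= r + M])).
- exact:(smooth_conv SK KM sg).
- by apply:closedI;[exact:closed_inner_set|exact:closed_normle].
- have /bounded_setP[N N0 hN] := bounded_normle (r + M).
 by apply/bounded_setP;exists N=> // x [_ /=];exact:hN.
- by move=> x [h _];exact:(sub_inner_set r'0).
move=> x nx;have [h|/negP h] := boolP (`|x| <= r + M);last first.
 by apply:(csupp_conv KM gM);rewrite ltNge;exact/negP.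
have {}nx : ~ inner_set Om r' x by move=> hx;apply:nx.
apply:conv_eq0=> y;have [xy|xy] := leP r `|x - y|;first by left;exact:Kr.
right;apply:gO=> hy;apply:nx=> z nz.
have:= hy z nz;have:= ler_distD y x z;have:= distrC x y.
have:= ler_distD x y z;rewrite (distrC y x);lra.
Qed.

Lemma test_dense Om g (e : R) : open Om -> sqi mu setT g ->
 (forall x, ~ Om x -> g x = 0) -> 0 < e ->
 exists2 phi, test_function Om phi & nrm mu setT (phi - g) <= e.
Proof.
move=> oO sg gO e0;have mg:= sg.1.
pose A k:= inner_set Om k.+1%:R^-1 `&` [set x : V | `|x| <= k%:R].
have mA k : measurable (A k).
 apply:measurableI;apply:closed_meas;first exact:closed_inner_set.
 exact:closed_normle.
pose G k x:= g x * \1_(A k) x.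
have mG k : measurable_fun setT (G k).
 by apply:measurable_funM=> //;exact:measurable_indic.
have Gg k x : `|G k x| <= `|g x|.
 by rewrite /G indicE;case:(_ \in _);rewrite ?mulr1 ?mulr0 ?normr0.
have sG k : sqi mu setT (G k) by apply:(sqi_le measurableT (mG k) sg)=> x _.
have lim x : setT x -> G m x @[m --> \oo] --> g x.
 move=> _;have [Ox|nO] := pselect (Om x);last first.
  rewrite (_ : (fun m=> G m x) = cst (g x));first exact:cvg_cst.
  by apply/funext=> m;rewrite /G gO// mul0r.
 have [r r0 hr] := inner_set_ex oO Ox.
 have [k _ hk] := near_infty_natSinv_lt (PosNum r0).
 apply:cvg_near_cst;exists (maxn k (Num.bound `|x|))=> // m /=.
 rewrite geq_max=> /andP[km xm];rewrite /G indicE mem_set ?mulr1//;split.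
  by move=> y nO;rewrite (le_trans _ (hr y nO))// ltW//;exact:(hk _ km).
 rewrite /= (le_trans (ler_norm _))// ltW//.
 by apply:(lt_le_trans (unstable.ltr_norm_bound `|x|));rewrite ler_nat.
have [_ cG] := dominated_nrm measurableT mG mg (sqi_abs measurableT sg) lim (fun m x _=> Gg m x).
have e2 : 0 < e / 2 by rewrite divr_gt0.
move/cvgrPdist_le : cG=> /(_ _ e2)[k _ /(_ k (leqnn k))].
rewrite /= sub0r normrN (ger0_norm (nrm_ge0 _ _ _))=> hk.
have GM : csupp k%:R (G k).
 by move=> x kx;rewrite /G indicE memNset ?mulr0// => -[_ /=];rewrite leNgt kx.
have /choice[K bK] (m : nat) : exists K : V -> R, bumpf m.+1%:R^-1 K.
 by apply:bump_ex;rewrite invr_gt0.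
have:= bump_cvg (sG k) GM bK;move/cvgrPdist_le=> /(_ _ e2)[m _ hm].
(* With 1/(l+1) + 1/(2(k+1)) <= 1/(k+1), the mollification of [G k] keeps the distance 1/(2(k+1))
   from the complement of Om, and l >= m keeps it close to [G k]. *)
pose l:= maxn m (k.+1 * 2)%N.
have:= hm l (leq_maxl _ _);rewrite /= sub0r normrN (ger0_norm (nrm_ge0 _ _ _))=> {}hm.
have l2 : l.+1%:R^-1 + (k.+1 * 2)%:R^-1 <= k.+1%:R^-1 :> R.
 rewrite natrM invfM;have : l.+1%:R^-1 <= k.+1%:R^-1 * 2^-1 :> R.
  rewrite -invfM -natrM lef_pV2 ?posrE ?ltr0n ?muln_gt0// ler_nat.
  by rewrite (leq_trans (leq_maxr m _))// leqnSn.
 by move=> h;rewrite [leRHS]splitr lerD2r.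
exists (convol (K l) (G k)).
 apply:(test_convol (r' := (k.+1 * 2)%:R^-1) _ (bK l) (sG k) GM).
  by rewrite invr_gt0 ltr0n muln_gt0.
 move=> x nx;rewrite /G indicE memNset ?mulr0// => -[hx _];apply:nx=> y nO.
 exact:le_trans (hx y nO).
have sc : sqi mu setT (convol (K l) (G k)) by exact:(sqi_conv (bK l) (sG k) GM).
rewrite (_ : _ - g = (convol (K l) (G k) - G k) + (G k - g));last by rewrite addrA subrK.
apply:(le_trans (nrmD measurableT _ _));[exact:sqiB|exact:sqiB|].
by rewrite [leRHS]splitr lerD.
Qed.

(** The fundamental lemma of the calculus of variations: the extension of g by 0 is a limit of test
    functions of Om, hence orthogonal to itself. *)
Lemma vanish Om g : open Om -> sqi mu Om g ->
 (forall phi, test_function Om phi -> dot mu Om g phi = 0) ->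
 ae_eq mu Om g (cst 0).
Proof.
move=> oO sg h;have mO:= open_meas oO.
have sG:= (sqi_patch g mO).1 sg;set G:= g \_ Om in sG.
have GO x : ~ Om x -> G x = 0 by move=> nO;rewrite /G /patch memNset.
have GG0 : dot mu setT G G = 0.
 apply/eqP;rewrite -normr_le0;apply/ler_addgt0Pr=> e e0;rewrite add0r.
 have e1 : 0 < e / (nrm mu setT G + 1) by rewrite divr_gt0// ltr_wpDl// nrm_ge0.
 have [phi tp hp] := test_dense oO sG GO e1.
 have sp:= sqi_test [::] tp.
 have -> : dot mu setT G G = - dot mu setT (phi - G) G.
  by rewrite dotBl// (dotC _ _ phi) -[X in X - _](dot_patchl g phi Om) h// sub0r opprK.
 rewrite normrN;apply:(le_trans (dot_CS measurableT (sqiB measurableT sp sG) sG)).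
 apply:(le_trans (ler_wpM2r (nrm_ge0 _ _ _) hp));rewrite -mulrA.
 apply:ler_piMr;first exact:ltW.
 by rewrite ler_pdivrMl ?mulr1 ?lerDl// ltr_wpDl// nrm_ge0.
by apply:nrm0_ae=> //;rewrite nrm_patch /nrm GG0 sqrtr0.
Qed.

Lemma refl_test (K : V -> R) M x : smooth K -> csupp M K ->
 test_function setT (fun y=> K (x - y)).
Proof.
move=> SK KM;apply:(@test_functionP _ _ [set y : V | `|y| <= M + `|x|])=> //.
- move=> k;have:= @C_k_affine R n n k (- 1%:M) x K (SK k).
 rewrite (_ : (fun y=> K (y *m - 1%:M + x)) = (fun y=> K (x - y)))//.
 by apply/funext=> y;rewrite mulmxN mulmx1 addrC.
- exact:closed_normle.
- exact:bounded_normle.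
move=> y /negP;rewrite -ltNge=> h;apply:KM.
have:= ler_normB x (x - y);rewrite subKr;lra.
Qed.

Lemma pderiv_refl (K : V -> R) x s : smooth K ->
 pderiv s (fun y=> K (x - y)) = (fun y=> (-1) ^+ size s * pderiv s K (x - y)).
Proof.
move=> SK;elim: s=> [|i s ih] /=;first by apply/funext=> y;rewrite expr0 mul1r.
apply/funext=> y;rewrite ih.
have dK : derivable (pderiv s K) (x - y) (- 'e_i).
 by apply:C1_derivable;exact:(smooth_pd s SK 1%N).
have E : is_derive y 'e_i (fun y=> pderiv s K (x - y)) ('D_(- 'e_i) (pderiv s K) (x - y)).
 have EE : (fun h : R=> h^-1 *: (((fun y=> pderiv s K (x - y)) \o shift y) (h *: 'e_i) - pderiv s K (x - y))) =
   (fun h : R=> h^-1 *: ((pderiv s K \o shift (x - y)) (h *: - 'e_i) - pderiv s K (x - y))).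
  apply/funext=> h;rewrite /= scalerN;congr (_ *: (pderiv s K _ - _)).
  by rewrite opprD addrCA.
 by apply:DeriveDef;rewrite /derivable /derive EE.
have [d1 d2] := E.
have -> : (fun y=> (-1) ^+ size s * pderiv s K (x - y)) =
  ((-1) ^+ size s) *: (fun y=> pderiv s K (x - y)) by [].
rewrite deriveZ// d2 exprS mulN1r (C1_deriveE _ _ (smooth_pd s SK 1%N)).
rewrite (C1_deriveE (x - y) 'e_i (smooth_pd s SK 1%N)) /GRing.scale/= mulNr -mulrN.
congr (_ * _);rewrite -sumrN;apply:eq_bigr=> j _.
by rewrite [(- 'e_i) _ _]mxE mulNr.
Qed.

(* One sequence of mollifications approximates all the weak derivatives at once. *)
Theorem Moll g M : sqi mu setT g -> csupp M g ->
 exists phi : nat -> V -> R, [/\ forall m, smooth (phi m),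
  forall m x, (forall y, `|x - y| < m.+1%:R^-1 -> g y = 0) -> phi m x = 0 &
  forall s gs, sqi mu setT gs -> is_weak_deriv setT s g gs ->
   nrm mu setT (pderiv s (phi m) - gs) @[m --> \oo] --> 0].
Proof.
move=> sg gM.
have /choice[K bK] (m : nat) : exists K : V -> R, bumpf m.+1%:R^-1 K.
 by apply:bump_ex;rewrite invr_gt0.
have SK m : smooth (K m) by case:(bK m).
have KM m : csupp m.+1%:R^-1 (K m).
 by case:(bK m)=> _ _ Kr _ x rx;rewrite Kr// ltW.
exists (fun m=> convol (K m) g);split.
- by move=> m;exact:(smooth_conv (SK m) (KM m) sg).
- move=> m x h;apply:conv_eq0=> y;have [xy|xy] := leP m.+1%:R^-1 `|x - y|.
  by left;case:(bK m)=> _ _ + _;exact.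
 by right;exact:h.
move=> s gs sgs wgs.
pose U:= [set x : V | M < `|x|].
have oU : open U.
 apply:(@open_comp _ _ (fun y : V=> `|y|) [set r | M < r]);last exact:open_gt.
 by move=> y _;exact:norm_continuous.
have mU:= open_meas oU.
(* The weak derivative vanishes almost everywhere outside the ball that carries g. Cutting it there
   gives g1 with bounded support, to which [bump_cvg] applies. *)
have v : ae_eq mu U gs (cst 0).
 apply:vanish=> //;first exact:sqi_sub sgs.
 move=> phi tp;have tT : test_function setT phi by exact:test_sub tp.
 have:= wgs phi tT;rewrite -/(dot mu setT _ _) -/(dot mu setT _ _).
 rewrite [X in X = _](_ : _ = 0);last first.
  rewrite /dot (_ : (fun x=> _) = cst 0) ?Rintegral_cst ?mul0r//.
  apply/funext=> x /=;have [xM|xM] := ltP M `|x|;first by rewrite gM// mul0r.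
  by rewrite (test_eq0 (test_pderiv s tp)) ?mulr0// /U /= => h;rewrite leNgt h in xM.
 move/esym/eqP;rewrite mulf_eq0 signr_eq0/= => /eqP <-.
 apply/esym;rewrite [RHS]dot_patchr;apply:eq_Rintegral=> x _;congr (_ * _).
 by rewrite /patch;case:ifPn=> // /negP xU;rewrite (test_eq0 tp)// => h;apply:xU;rewrite inE.
pose g1 x:= gs x * \1_(~` U) x.
have mg1 : measurable_fun setT g1.
 by apply:measurable_funM;[exact:sgs.1|apply:measurable_indic;exact:measurableC].
have sg1 : sqi mu setT g1.
 apply:(sqi_le measurableT mg1 sgs)=> x _.
 by rewrite /g1 indicE;case:(_ \in _);rewrite ?mulr1 ?mulr0 ?normr0.
have ae1 : ae_eq mu setT gs g1.
 apply:filterS v=> x h _;rewrite /g1 indicE in_setC.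
 have [xU|xU] := boolP (x \in U);last by rewrite mulr1.
 by rewrite mulr0;apply:h;exact:set_mem.
have g1M : csupp M g1 by move=> x Mx;rewrite /g1 indicE in_setC mem_set ?mulr0.
(* The reflected kernel is a test function. The sign from differentiating the reflection and the
   sign in the definition of a weak derivative cancel, so that the derivative of K * g is K * g1. *)
have E m : nrm mu setT (pderiv s (convol (K m) g) - gs) = nrm mu setT (convol (K m) g1 - g1).
 have -> : pderiv s (convol (K m) g) = convol (K m) g1.
  rewrite (pderiv_conv s (SK m) (KM m) sg);apply/funext=> x.
  have tx:= refl_test x (SK m) (KM m).
  have:= wgs _ tx;rewrite pderiv_refl// -/(dot mu setT _ _) -/(dot mu setT _ _).
  have sr:= sqi_refl x (sqi_C1 (smooth_pd s (SK m) 1%N) (pd_csupp s (KM m))).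
  rewrite (_ : (fun y=> (-1) ^+ size s * pderiv s (K m) (x - y)) =
   (-1) ^+ size s *: (fun y=> pderiv s (K m) (x - y)))// dotZr//.
  move/(mulfI (negbT (signr_eq0 _ _))).
  rewrite (ae_eq_dot measurableT sgs sg1 (sqi_test [::] tx) ae1).
  by move=> H;rewrite /convol (dotC _ _ _ g) (dotC _ _ _ g1).
 apply:ae_eq_nrm=> //.
 - apply:sqiB=> //;exact:(sqi_conv (bK m) sg1 g1M).
 - apply:sqiB=> //;exact:(sqi_conv (bK m) sg1 g1M).
 by apply:filterS ae1=> x h /h e;rewrite !fctE e.
by rewrite (funext E);exact:bump_cvg g1M bK.
Qed.

End dense.

(** * Weak derivatives in one direction at a time, and jets *)

Section wd.
Context (R : realType) (n : nat).
Notation V:= 'rV[R]_n.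
Notation mu:= (lebesgue_rV R n).
Implicit Types (D : set V) (u g : V -> R) (U : seq 'I_n -> V -> R) (a : V -> R).

Lemma pderiv_rcons s i (f : V -> R) :
 pderiv (rcons s i) f = pderiv s (fun x=> 'D_('e_i) f x).
Proof. by rewrite /pderiv foldr_rcons. Qed.

Lemma pderiv_cat s t (f : V -> R) : pderiv (s ++ t) f = pderiv s (pderiv t f).
Proof. by rewrite /pderiv foldr_cat. Qed.

Lemma pderiv_rconsC s i (f : V -> R) : smooth f ->
 pderiv (rcons s i) f = pderiv (i :: s) f.
Proof.
elim: s=> // j s IH Sf;rewrite /= -/(pderiv _ _).
have -> : pderiv (rcons s i) f = pderiv (i :: s) f by exact:IH.
apply/funext=> x;rewrite /= -/(pderiv s f).
exact:(Schwarz x j i (smooth_pd s Sf 2%N)).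
Qed.

Lemma smooth_pderivC s t (f : V -> R) : smooth f ->
 pderiv s (pderiv t f) = pderiv t (pderiv s f).
Proof.
move=> Sf;elim: t s=> [//|i t IH] s;rewrite /= -/(pderiv t f).
have -> : pderiv s (fun x=> 'D_('e_i) (pderiv t f) x) = pderiv (rcons s i) (pderiv t f).
 by rewrite pderiv_rcons.
rewrite pderiv_rconsC;last exact:smooth_pd.
by rewrite /= -/(pderiv s _) IH.
Qed.

Definition wd D i u g:= forall phi, test_function D phi ->
 dot mu D u (fun x=> 'D_('e_i) phi x) = - dot mu D g phi.

(** A function [U [::]] with representatives of its weak derivatives up to order k, each tied to the
    previous one by [wd]. Both the family and the order of differentiation are explicit, so that
    sums, products and compositions of jets can be written down. *)
Definition jet k D U:= (forall s, (size s <= k)%N -> sqi mu D (U s)) /\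
 (forall s i, (size s < k)%N -> wd D i (U s) (U (i :: s))).

Lemma dot_test A D f phi : A `<=` D -> (forall x, ~ A x -> phi x = 0) ->
 dot mu D f phi = dot mu A f phi.
Proof.
move=> AD h;rewrite dot_patchr [RHS]dot_patchr;congr dot.
apply/funext=> x;rewrite /patch;case:ifPn=> xD;case:ifPn=> xA //.
- by apply:h=> /mem_set;rewrite (negPf xA).
- by move: xD;rewrite mem_set//;apply:AD;exact:set_mem.
Qed.

Lemma wd_sub A D i u g : A `<=` D -> wd D i u g -> wd A i u g.
Proof.
move=> AD w phi tp;have z : forall x, ~ A x -> phi x = 0 by move=> x;exact:test_eq0.
have z' : forall x, ~ A x -> 'D_('e_i) phi x = 0.
 by move=> x;exact:(test_eq0 (test_pderiv [:: i] tp)).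
by rewrite -(dot_test u AD z') -(dot_test g AD z);exact:w (test_sub AD tp).
Qed.

Lemma jet_sub k A D U : measurable A -> measurable D -> A `<=` D -> jet k D U -> jet k A U.
Proof.
move=> mA mD AD [sU wU];split=> [s sk|s i sk];last exact:wd_sub (wU s i sk).
by apply:sqi_sub mA mD AD _;exact:sU.
Qed.

Lemma jetW k l D U : (k <= l)%N -> jet l D U -> jet k D U.
Proof.
move=> kl [sU wU];split=> [s sk|s i sk];first exact:sU (leq_trans sk kl).
exact:wU (leq_trans sk kl).
Qed.

Lemma compact_inner D F : open D -> closed F -> bounded_set F -> F `<=` D ->
 exists2 r, 0 < r & F `<=` inner_set D r.
Proof.
move=> oD cF bF FD.
have kF : compact F by apply:bounded_closed_compact.
have : \forall r \near (0 : R)^'+, F `<=` inner_set D r.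
 move/compact_near_coveringP : kF;apply=> x Fx.
 have [r r0 xr] := inner_set_ex oD (FD _ Fx).
 have r20 : 0 < r / 2 by rewrite divr_gt0.
 exists (ball x (r / 2), [set s | 0 < s < r / 2])=> /=.
  split;first exact:nbhsx_ballx.
  exists (r / 2)=> //= s /=;rewrite sub0r normrN=> sr s0.
  by rewrite s0 (le_lt_trans (ler_norm s))//.
 move=> [y s] [/= yx /andP[s0 sr]] z nDz.
 have:= xr _ nDz;move: yx;rewrite -ball_normE /= => yx xz.
 have h : `|x - z| <= `|x - y| + `|y - z|.
  by apply:le_trans (ler_normD _ _);rewrite addrA subrK.
 lra.
move=> H;near (0 : R)^'+ => r;exists r;first by near: r;exact:nbhs_right_gt.
by near: r.
Unshelve. all: by end_near. Qed.

Definition zoff F (phi : V -> R) := forall x, ~ F x -> phi x = 0.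
(** The product of a test function with a coefficient of class C^k, or its composition with a chart,
    is in general not smooth. This wider class is stable under both. *)
Definition ctest D phi:= C_k 1 phi /\
 exists F, [/\ closed F, bounded_set F, F `<=` D & zoff F phi].

Lemma zoff_csupp F phi : bounded_set F -> zoff F phi -> exists M, csupp M phi.
Proof.
move=> /bounded_setP[M M0 FM] z;exists M=> x Mx;apply:z=> /FM.
by rewrite ltNge (ltW Mx).
Qed.

Lemma test_ctest D phi : test_function D phi -> ctest D phi.
Proof.
move=> [Sp [cp pD]];split;first exact:Sp.
exists (closure [set x | phi x != 0]);split=> //;first exact:closed_closure.
 exact:compact_bounded.
move=> x nx;apply:contrapT=> px;apply:nx;apply:subset_closure=> /=;exact/eqP.
Qed.

Lemma derive_zoff F phi v : closed F -> zoff F phi -> zoff F (fun x=> 'D_v phi x).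
Proof.
move=> cF z x nFx.
have [r r0 h] := inner_set_ex (closed_openC cF) nFx.
have E : \near x, phi x = (cst 0 : V -> R) x.
 apply/nbhs_ballP;exists r=> // y;rewrite -ball_normE /= => xy;apply:z=> Fy.
 by have:= h y (fun H=> H Fy);rewrite leNgt xy.
by rewrite (near_eq_derive v E) derive_cst.
Qed.

(** The mollifications of phi and their first derivatives converge in L^2. Let r be a distance that
    the support of phi keeps from the complement of D; once the radius is below r/2 the
    mollifications are test functions of D, and the identity passes to the limit. *)
Lemma wd_C1 D i u g phi : open D -> sqi mu D u -> sqi mu D g -> wd D i u g ->
 ctest D phi -> dot mu D u (fun x=> 'D_('e_i) phi x) = - dot mu D g phi.
Proof.
move=> oD su sg w [C1p [F [cF bF FD z]]].
have [M pM] := zoff_csupp bF z.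
have [M0 M00 FM0] := proj1 (bounded_setP _) bF.
have mD:= open_meas oD.
have sp:= sqi_C1 C1p pM.
have [r r0 Fr] := compact_inner oD cF bF FD.
have [p [Sp Zp cvp]] := Moll sp pM.
have wp : forall t, (size t <= 1)%N -> is_weak_deriv setT t phi (pderiv t phi).
 case=> [|j [|//]] _ psi tpsi;first by rewrite expr0 mul1r.
 have [M' pM'] := test_csupp tpsi;rewrite expr1 mulN1r.
 rewrite -!/(dot mu setT _ _);apply:oppr_inj;rewrite opprK.
 exact:esym (IBP 'e_j C1p (proj1 tpsi 1%N) pM pM').
have c0:= cvp [::] _ sp (wp [::] isT).
have sD:= sqi_Dv 'e_i C1p pM.
have c1:= cvp [:: i] _ sD (wp [:: i] isT).
have r20 : 0 < r / 2 by rewrite divr_gt0.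
have tp : \forall m \near \oo, test_function D (p m).
 near=> m.
 have mr : m.+1%:R^-1 < r / 2.
  by near: m;move/cvgr0_norm_lt : (@invS_cvg0 R)=> /(_ _ r20)[N _ h];
   exists N=> // k /h;exact:le_lt_trans (ler_norm _).
 apply:(@test_functionP _ _ _ _ (inner_set D (r / 2) `&` [set x | `|x| <= M0 + 1]))=> //.
 - by apply:closedI;[exact:closed_inner_set|exact:closed_normle].
 - by apply/bounded_setP;exists (M0 + 2);[lra|move=> x [_ /=] h;lra].
 - by move=> x [] /(sub_inner_set r20).
 - move=> x nF;apply:Zp=> y xy;apply:contrapT=> py.
  have yF : F y by apply:contrapT=> nFy;apply:py;exact:z.
  apply:nF;split=> /=.
   move=> w0 nDw;have:= Fr _ yF _ nDw.
   have h : `|y - w0| <= `|x - y| + `|x - w0|.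
    rewrite (distrC x y);apply:le_trans (ler_normD _ _).
    by rewrite addrA subrK.
   by move: (lt_trans xy mr)=> xyr yw;lra.
  have yM : `|y| <= M0 by rewrite ltW// FM0.
  have h : `|x| <= `|x - y| + `|y| by apply:le_trans (ler_normD _ _);rewrite subrK.
  apply:le_trans h _;rewrite addrC lerD// ltW//;apply:lt_le_trans xy _.
  by rewrite invf_le1// ler1n.
have su' := proj1 (sqi_patch u mD) su.
have sg' := proj1 (sqi_patch g mD) sg.
have cv0:= cvp [::] _ sp (wp [::] isT).
case:tp=> N _ tN.
pose q m:= p (N + m)%N.
have tq m : test_function D (q m) by apply:tN;exact:leq_addr.
have cq (f : nat -> R) : f m @[m --> \oo] --> (0 : R) -> f (N + m)%N @[m --> \oo] --> (0 : R).
 by move=> h;rewrite (_ : (fun m=> f (N + m)%N) = [sequence f (m + N)%N]_m) ?cvg_shiftn//;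
  apply/funext=> m;rewrite addnC.
have d1 : dot mu D u (fun x=> 'D_('e_i) (q m) x) @[m --> \oo] --> dot mu D u (fun x=> 'D_('e_i) phi x).
 rewrite dot_patchl dotC;under eq_fun do rewrite dot_patchl dotC.
 exact:(@cvg_dot _ _ _ mu setT measurableT (fun m x=> 'D_('e_i) (q m) x)
  (fun x=> 'D_('e_i) phi x) _ (fun m=> sqi_test [:: i] (tq m)) sD su' (cq _ c1)).
have d0 : dot mu D g (q m) @[m --> \oo] --> dot mu D g phi.
 rewrite dot_patchl dotC;under eq_fun do rewrite dot_patchl dotC.
 exact:(@cvg_dot _ _ _ mu setT measurableT q phi _ (fun m=> sqi_test [::] (tq m)) sp sg' (cq _ cv0)).
have e : (fun m=> dot mu D u (fun x=> 'D_('e_i) (q m) x)) = (fun m=> - dot mu D g (q m)).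
 by apply/funext=> m;exact:w.
rewrite e in d1;apply:cvg_unique d1 _=> //;exact:cvgN.
Unshelve. all: by end_near. Qed.

Lemma sqi_ctest A D phi : open A -> ctest D phi -> sqi mu A phi.
Proof.
move=> oA [C [F [_ bF _ z]]];have [M pM] := zoff_csupp bF z.
exact:sqi_sub (open_meas oA) measurableT (@subsetT _ _) (sqi_C1 C pM).
Qed.

Lemma wd_uniq D i u u' g g' : open D -> sqi mu D u -> sqi mu D u' ->
 sqi mu D g -> sqi mu D g' -> ae_eq mu D u u' -> wd D i u g ->
 wd D i u' g' -> ae_eq mu D g g'.
Proof.
move=> oD su su' sg sg' eu w w';have mD:= open_meas oD.
have v : ae_eq mu D (g - g') (cst 0).
 apply:vanish=> //;first exact:sqiB.
 move=> phi tp.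
 have s0:= sqiT mD (sqi_test [::] tp).
 have s1:= sqiT mD (sqi_test [:: i] tp).
 rewrite dotBl//;have:= w _ tp;rewrite (ae_eq_dot mD su su' s1 eu) w'//.
 by move/oppr_inj=> ->;rewrite subrr.
by apply:filterS v=> x h /h /eqP;rewrite subr_eq0=> /eqP.
Qed.

Lemma wdZ D i (c : R) u g : open D -> sqi mu D u -> sqi mu D g ->
 wd D i u g -> wd D i (c *: u) (c *: g).
Proof.
move=> oD su sg w phi tp;have mD:= open_meas oD.
have s0:= sqiT mD (sqi_test [::] tp).
have s1:= sqiT mD (sqi_test [:: i] tp).
by rewrite !dotZl// w// mulrN.
Qed.

Lemma wd_sum D i (I : Type) (r : seq I) (P : pred I) (u g : I -> V -> R) : open D ->
 (forall j, P j -> sqi mu D (u j)) -> (forall j, P j -> sqi mu D (g j)) ->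
 (forall j, P j -> wd D i (u j) (g j)) ->
 wd D i (\sum_(j <- r | P j) u j) (\sum_(j <- r | P j) g j).
Proof.
move=> oD su sg w phi tp;have mD:= open_meas oD.
have s0:= sqiT mD (sqi_test [::] tp).
have s1:= sqiT mD (sqi_test [:: i] tp).
rewrite !dot_suml// -sumrN;apply:eq_bigr=> j Pj;exact:w.
Qed.

Lemma wdD D i u g u' g' : open D -> sqi mu D u -> sqi mu D g ->
 sqi mu D u' -> sqi mu D g' ->
 wd D i u g -> wd D i u' g' -> wd D i (u + u') (g + g').
Proof.
move=> oD su sg su' sg' w w' phi tp;have mD:= open_meas oD.
have s0:= sqiT mD (sqi_test [::] tp).
have s1:= sqiT mD (sqi_test [:: i] tp).
by rewrite !dotDl// w// w'// opprD.
Qed.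

Lemma ctestM D a phi : C_k 1 a -> ctest D phi -> ctest D (a * phi).
Proof.
move=> Ca [Cp [F [cF bF FD z]]];split;first exact:C_kM.
by exists F;split=> // x /z h;rewrite /= !fctE h mulr0.
Qed.

Lemma derive_mul1 a phi i x : C_k 1 a -> C_k 1 phi ->
 'D_('e_i) (a * phi) x = 'D_('e_i) a x * phi x + a x * 'D_('e_i) phi x.
Proof.
move=> Ca Cp;have d1 : derivable a x 'e_i by exact:C_k_derivable Ca.
have d2 : derivable phi x 'e_i by exact:C_k_derivable Cp.
by rewrite deriveM//;rewrite addrC [X in X + _]mulrC.
Qed.

Lemma sqiM_ck D a u C : open D -> C_k 0 a -> (forall x, D x -> `|a x| <= C) ->
 sqi mu D u -> sqi mu D (a * u).
Proof.
move=> oD Ca aC su;apply:(@sqiM _ _ _ _ _ (open_meas oD) a u C)=> //.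
apply:measurable_funTS;apply:continuous_meas;exact/C_k0.
Qed.

(** The identity for u is used with [a * phi], which is only a C^1 test function, whence [wd_C1]. *)
Lemma wdM D a i u g C : open D -> C_k 1 a -> (forall x, D x -> `|a x| <= C) ->
 (forall x, D x -> `|'D_('e_i) a x| <= C) -> sqi mu D u -> sqi mu D g ->
 wd D i u g -> wd D i (a * u) ((fun x=> 'D_('e_i) a x) * u + a * g).
Proof.
move=> oD Ca aC DaC su sg w phi tp;have mD:= open_meas oD.
have ct:= test_ctest tp;have cat:= ctestM Ca ct.
have Ca0 : C_k 0 a by exact:C_kW Ca.
have CDa:= C_k_D i Ca.
have s0 : sqi mu D phi:= sqi_ctest oD ct.
have s1 : sqi mu D (fun x=> 'D_('e_i) phi x) := sqiT mD (sqi_test [:: i] tp).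
have H:= wd_C1 oD su sg w cat.
have E : (fun x=> 'D_('e_i) (a * phi) x) =
 (fun x=> 'D_('e_i) a x) * phi + a * (fun x=> 'D_('e_i) phi x).
 apply/funext=> x;exact:(derive_mul1 i x Ca (proj1 ct)).
have sh (f g' h : V -> R) : dot mu D (f * g') h = dot mu D g' (f * h).
 by congr Rintegral;apply/funext=> x;rewrite !fctE mulrCA mulrA.
have sDp : sqi mu D ((fun x=> 'D_('e_i) a x) * phi) by apply:sqiM_ck=> //;exact:DaC.
have sap : sqi mu D (a * (fun x=> 'D_('e_i) phi x)) by apply:sqiM_ck=> //;exact:aC.
move: H;rewrite E dotDr// => H.
rewrite dotDl//.
- rewrite (sh a u) (sh _ u) (sh a g);move: H;set A1:= dot _ _ _ _;set A2:= dot _ _ _ _;set A3:= dot _ _ _ _;lra.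
- by apply:sqiM_ck=> //;exact:DaC.
- by apply:sqiM_ck=> //;exact:aC.
Qed.

End wd.

(** * Norms of jets and operations on jets *)

Section jets.
Context (R : realType) (n : nat).
Notation V:= 'rV[R]_n.
Notation mu:= (lebesgue_rV R n).
Implicit Types (D : set V) (u g : V -> R) (U W : seq 'I_n -> V -> R) (a : V -> R).

(* The sum of the L2 norms of the derivatives of order < k. *)
Definition J k D U : R:= \sum_(j < k) \sum_(t : j.-tuple 'I_n) nrm mu D (U t).

Lemma J_ge0 k D U : 0 <= J k D U.
Proof. by apply:sumr_ge0=> j _;apply:sumr_ge0=> t _;exact:nrm_ge0. Qed.

Lemma le_J k D U s : (size s < k)%N -> nrm mu D (U s) <= J k D U.
Proof.
move=> sk;rewrite /J (bigD1 (Ordinal sk)) //= (bigD1 (in_tuple s)) //= -addrA lerDl.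
by apply:addr_ge0;apply:sumr_ge0=> j _;rewrite ?nrm_ge0//;apply:sumr_ge0=> t _;exact:nrm_ge0.
Qed.

Lemma J_W k l D U : (k <= l)%N -> J k D U <= J l D U.
Proof.
move=> kl;rewrite /J (big_ord_widen l (fun j=> \sum_(t : j.-tuple 'I_n) nrm mu D (U t)) kl).
rewrite [leRHS](bigID (fun j : 'I_l=> (j < k)%N)) /= lerDl.
by apply:sumr_ge0=> j _;apply:sumr_ge0=> t _;exact:nrm_ge0.
Qed.

(** The number of lists of length less than k, that is, of terms in [J k]. *)
Definition cJ k : R:= \sum_(j < k) \sum_(t : j.-tuple 'I_n) 1.

Lemma cJ_ge0 k : 0 <= cJ k.
Proof. by apply:sumr_ge0=> j _;apply:sumr_ge0. Qed.

Lemma J_le k D U M : (forall s, (size s < k)%N -> nrm mu D (U s) <= M) -> J k D U <= cJ k * M.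
Proof.
move=> h;rewrite /J /cJ mulr_suml;apply:ler_sum=> j _;rewrite mulr_suml.
by apply:ler_sum=> t _;rewrite mul1r;apply:h;rewrite size_tuple.
Qed.

Lemma J_ext k D U W : (forall s, (size s < k)%N -> nrm mu D (U s) = nrm mu D (W s)) -> J k D U = J k D W.
Proof.
by move=> h;apply:eq_bigr=> j _;apply:eq_bigr=> t _;apply:h;rewrite size_tuple.
Qed.

Lemma jet_uniq k D U W : open D -> jet k D U -> jet k D W -> ae_eq mu D (U [::]) (W [::]) ->
 forall s, (size s <= k)%N -> ae_eq mu D (U s) (W s).
Proof.
move=> oD [sU wU] [sW wW] e;elim=> // i s IH sk.
apply:(wd_uniq oD (sU s (ltnW sk)) (sW s (ltnW sk)) (sU _ sk) (sW _ sk) (IH (ltnW sk)) (wU _ _ sk) (wW _ _ sk)).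
Qed.

Lemma jet_lim k D (U : nat -> seq 'I_n -> V -> R) W : open D -> (forall m, jet k D (U m)) ->
 (forall s, (size s <= k)%N -> sqi mu D (W s)) ->
 (forall s, (size s <= k)%N -> nrm mu D (U m s - W s) @[m --> \oo] --> 0) -> jet k D W.
Proof.
move=> oD jU sW cW;split=> // s i sk phi tp;have mD:= open_meas oD.
have s0:= sqiT mD (sqi_test [::] tp).
have s1:= sqiT mD (sqi_test [:: i] tp).
have c1:= @cvg_dot _ _ _ mu D mD (fun m=> U m s) (W s) _ (fun m=> proj1 (jU m) s (ltnW sk)) (sW s (ltnW sk)) s1 (cW s (ltnW sk)).
have c0:= @cvg_dot _ _ _ mu D mD (fun m=> U m (i :: s)) (W (i :: s)) _ (fun m=> proj1 (jU m) (i :: s) sk) (sW (i :: s) sk) s0 (cW (i :: s) sk).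
have e : (fun m=> dot mu D (U m s) (pderiv [:: i] phi)) = (fun m=> - dot mu D (U m (i :: s)) phi).
 by apply/funext=> m;exact:(proj2 (jU m)).
rewrite e in c1;exact:cvg_unique c1 (cvgN c0).
Qed.

(** The jet of the derivative [U t]: what is appended at the end of the list is differentiated
    first. *)
Definition shiftj t U : seq 'I_n -> V -> R:= fun s=> U (s ++ t).

Lemma jet_shift k t D U : jet (k + size t) D U -> jet k D (shiftj t U).
Proof.
move=> [sU wU];split=> [s sk|s i sk];first by apply:sU;rewrite size_cat leq_add2r.
by rewrite /shiftj;apply:wU;rewrite size_cat ltn_add2r.
Qed.

Lemma J_shift k t D U : J k D (shiftj t U) <= cJ k * J (k + size t) D U.
Proof. by apply:J_le=> s sk;rewrite /shiftj;apply:le_J;rewrite size_cat ltn_add2r. Qed.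

Definition sumj (I : Type) (r : seq I) (U : I -> seq 'I_n -> V -> R) : seq 'I_n -> V -> R :=
 fun s=> \sum_(i <- r) U i s.

Lemma jet_sum k D (I : Type) (r : seq I) (U : I -> seq 'I_n -> V -> R) : open D ->
 (forall i, jet k D (U i)) -> jet k D (sumj r U).
Proof.
move=> oD jU;split=> [s sk|s i sk].
 by apply:(sqi_sum (open_meas oD))=> j _;case:(jU j)=> h _;exact:h.
apply:wd_sum=> // j _;case:(jU j)=> h h';[exact:h (ltnW sk)|exact:h|exact:h'].
Qed.

Lemma nrm_sum D (I : Type) (r : seq I) (P : pred I) (F : I -> V -> R) : measurable D ->
 (forall i, P i -> sqi mu D (F i)) ->
 nrm mu D (\sum_(i <- r | P i) F i) <= \sum_(i <- r | P i) nrm mu D (F i).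
Proof.
move=> mD sF;elim: r=> [|i r IH];first by rewrite !big_nil nrm0.
rewrite !big_cons;case:ifPn=> // Pi;apply:le_trans (nrmD mD (sF _ Pi) _) _.
 exact:sqi_sum.
by rewrite lerD2l.
Qed.

Lemma J_sum k D (I : Type) (r : seq I) (U : I -> seq 'I_n -> V -> R) : open D ->
 (forall i, jet k D (U i)) -> J k.+1 D (sumj r U) <= \sum_(i <- r) J k.+1 D (U i).
Proof.
move=> oD jU;rewrite /J [leRHS]exchange_big /=;apply:ler_sum=> j _.
rewrite [leRHS]exchange_big /=;apply:ler_sum=> t _;apply:nrm_sum=> [|i _].
 exact:open_meas.
by case:(jU i)=> h _;apply:h;rewrite size_tuple -ltnS.
Qed.

Definition scalej (c : R) U : seq 'I_n -> V -> R:= fun s=> c *: U s.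

Lemma jet_scale k D c U : open D -> jet k D U -> jet k D (scalej c U).
Proof.
move=> oD [sU wU];have mD:= open_meas oD;split=> [s sk|s i sk].
 by apply:sqiZ=> //;exact:sU.
by apply:wdZ=> //;[exact:sU (ltnW sk)|exact:sU|exact:wU].
Qed.

Lemma J_scale k D c U : open D -> jet k D U -> J k.+1 D (scalej c U) = `|c| * J k.+1 D U.
Proof.
move=> oD [sU _];rewrite /J mulr_sumr;apply:eq_bigr=> j _;rewrite mulr_sumr.
by apply:eq_bigr=> t _;rewrite nrmZ//;[exact:open_meas|apply:sU;rewrite size_tuple -ltnS].
Qed.

(** All the ways to distribute the derivatives of s over two factors. Repetitions are kept, so that
    the Leibniz rule needs no binomial coefficients. *)
Fixpoint splits (s : seq 'I_n) : seq (seq 'I_n * seq 'I_n) :=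
 if s is i :: s' then [seq (i :: p.1, p.2) | p <- splits s'] ++
  [seq (p.1, i :: p.2) | p <- splits s'] else [:: ([::], [::])].

Lemma size_splits s p : p \in splits s -> (size p.1 + size p.2 = size s)%N.
Proof.
elim: s p=> [|i s IH] p /=;first by rewrite inE=> /eqP ->.
by rewrite mem_cat=> /orP[] /mapP[q /IH <- ->] /=;rewrite ?addnS.
Qed.

Lemma splits_size s : size (splits s) = (2 ^ size s)%N.
Proof. by elim: s=> //= i s IH;rewrite size_cat !size_map IH addnn expnS mul2n. Qed.

(* Leibniz rule *)
Definition mulj a U : seq 'I_n -> V -> R :=
 fun s=> \sum_(p <- splits s) (pderiv p.1 a * U p.2).

Definition bnd k D a (M : R) := forall s, (size s <= k)%N -> forall x, D x -> `|pderiv s a x| <= M.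

Lemma C_k_bnd k D a : C_k k a -> bounded_set D -> exists2 M, 0 <= M & bnd k D a M.
Proof.
move=> [_ ca] bD.
have B s : exists M, 0 <= M /\ ((size s <= k)%N -> forall x, D x -> `|pderiv s a x| <= M).
 have [sk|_] := boolP (size s <= k)%N;last by exists 0.
 have [r r0 Dr] := proj1 (bounded_setP _) bD.
 have kK : compact [set x : V | `|x| <= r].
  exact:bounded_closed_compact (@bounded_normle _ _ r) (@closed_normle _ _ r).
 have cc : {within [set x : V | `|x| <= r], continuous (pderiv s a)}.
  by apply:continuous_subspaceT;exact:ca.
 have [M M0 h] := @pinfty_ex_gt0 _ _ (compact_bounded (continuous_compact cc kK)).
 exists M;split;first exact:ltW.
 by move=> _ x /Dr xr;apply:h;exists x=> //=;exact:ltW.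
have /choice[M hM] := B.
exists (\sum_(j < k.+1) \sum_(t : j.-tuple 'I_n) M t).
 by apply:sumr_ge0=> j _;apply:sumr_ge0=> t _;case:(hM t).
move=> s sk x Dx;apply:le_trans (proj2 (hM s) sk x Dx) _.
rewrite (bigD1 (Ordinal (sk : (size s < k.+1)%N)))//= (bigD1 (in_tuple s))//= -addrA lerDl.
by apply:addr_ge0;apply:sumr_ge0=> j _;rewrite ?(proj1 (hM _))//;apply:sumr_ge0=> t _;case:(hM t).
Qed.

Lemma sqi_mulj k D a U M s p : open D -> C_k k a -> bnd k D a M -> jet k D U ->
 (size s <= k)%N -> p \in splits s -> sqi mu D (pderiv p.1 a * U p.2).
Proof.
move=> oD Ca b [sU _] sk /size_splits ps.
have p1 : (size p.1 <= k)%N by apply:leq_trans sk;rewrite -ps leq_addr.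
have p2 : (size p.2 <= k)%N by apply:leq_trans sk;rewrite -ps leq_addl.
apply:sqiM_ck (b _ p1) (sU _ p2)=> //.
by apply/C_k0;case:Ca=> _;exact.
Qed.

Lemma jet_mul k D a U M : open D -> C_k k a -> bnd k D a M -> jet k D U -> jet k D (mulj a U).
Proof.
move=> oD Ca b jU;have mD:= open_meas oD;split=> [s sk|s i sk].
 rewrite /mulj big_seq;apply:sqi_sum=> // p;exact:(sqi_mulj oD Ca b jU sk).
rewrite /mulj /= big_cat !big_map /= -big_split /= big_seq [X in wd _ _ _ X]big_seq.
have p1 p : p \in splits s -> (size p.1 < k)%N.
 by move=> /size_splits ps;apply:leq_ltn_trans sk;rewrite -ps leq_addr.
have p2 p : p \in splits s -> (size p.2 < k)%N.
 by move=> /size_splits ps;apply:leq_ltn_trans sk;rewrite -ps leq_addl.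
have sU2 p : p \in splits s -> sqi mu D (U p.2) by move=> /p2/ltnW;exact:(proj1 jU).
have sU3 p : p \in splits s -> sqi mu D (U (i :: p.2)) by move=> /p2 h;exact:(proj1 jU (i :: p.2) h).
have C0 t : (size t <= k)%N -> C_k 0 (pderiv t a).
 by move=> tk;apply/C_k0;case:Ca=> _;exact.
have C1 t : (size t < k)%N -> C_k 1 (pderiv t a).
 by move=> tk;apply:C_k_pderiv;exact:C_kW Ca.
apply:wd_sum=> // p ps.
- exact:(sqi_mulj oD Ca b jU (ltnW sk) ps).
- apply:sqiD=> //;apply:sqiM_ck=> //.
 + by apply:C0 (i :: p.1) _;exact:p1.
 + exact:b (i :: p.1) (p1 _ ps).
 + exact:sU2.
 + by apply:C0;exact:ltnW (p1 _ ps).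
 + exact:b (ltnW (p1 _ ps)).
 + exact:sU3.
- apply:(wdM oD (C1 _ (p1 _ ps)) (b _ (ltnW (p1 _ ps))) (b (i :: p.1) (p1 _ ps)) (sU2 _ ps) (sU3 _ ps)).
 exact:(proj2 jU) (p2 _ ps).
Qed.

Lemma mulj_nrm_le k D a U M s p : open D -> C_k k a -> 0 <= M -> bnd k D a M -> jet k D U ->
 (size s <= k)%N -> p \in splits s -> nrm mu D (pderiv p.1 a * U p.2) <= M * nrm mu D (U p.2).
Proof.
move=> oD Ca M0 b [sU _] sk /size_splits ps.
have p1 : (size p.1 <= k)%N by apply:leq_trans sk;rewrite -ps leq_addr.
have p2 : (size p.2 <= k)%N by apply:leq_trans sk;rewrite -ps leq_addl.
apply:nrmM (M0) (b _ p1) (sU _ p2);first exact:open_meas.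
apply:measurable_funTS;apply:continuous_meas.
by case:Ca=> _;exact.
Qed.

Lemma mulj_le k D a U M s : open D -> C_k k a -> 0 <= M -> bnd k D a M -> jet k D U ->
 (size s <= k)%N -> nrm mu D (mulj a U s) <= 2 ^+ k * M * J (size s).+1 D U.
Proof.
move=> oD Ca M0 b jU sk;have mD:= open_meas oD.
rewrite /mulj big_seq;apply:le_trans (nrm_sum _ mD _) _=> [p ps|].
 exact:(sqi_mulj oD Ca b jU sk ps).
have h p : p \in splits s -> nrm mu D (pderiv p.1 a * U p.2) <= M * J (size s).+1 D U.
 move=> ps;apply:le_trans (mulj_nrm_le oD Ca M0 b jU sk ps) _.
 rewrite ler_wpM2l// le_J// ltnS -(size_splits ps) leq_addl//.
apply:(@le_trans _ _ (\sum_(p <- splits s | p \in splits s) M * J (size s).+1 D U)).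
 exact:ler_sum.
rewrite -big_seq big_const_seq count_predT iter_addr_0 splits_size -[leLHS]mulr_natl -mulrA natrX.
rewrite ler_wpM2r ?mulr_ge0 ?J_ge0//.
by rewrite ler_weXn2l// ler1n.
Qed.

Lemma J_mul k D a U M : open D -> C_k k a -> 0 <= M -> bnd k D a M -> jet k D U ->
 J k.+1 D (mulj a U) <= cJ k.+1 * (2 ^+ k * M * J k.+1 D U).
Proof.
move=> oD Ca M0 b jU;apply:J_le=> s sk.
apply:le_trans (mulj_le oD Ca M0 b jU (sk : (size s <= k)%N)) _.
by rewrite ler_wpM2l ?J_W// mulr_ge0// exprn_ge0.
Qed.

Lemma mulj_rest k D a U M s : open D -> C_k k a -> 0 <= M -> bnd k D a M -> jet k D U ->
 (size s <= k)%N -> sqi mu D (a * U s) /\ nrm mu D (mulj a U s - a * U s) <= 2 ^+ k * M * J (size s) D U.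
Proof.
move=> oD Ca M0 b jU;have mD:= open_meas oD.
(* The last element of [splits s] sends all derivatives to U. In all the others at least one
   derivative falls on a, and the order left for U is smaller. *)
have Es : forall s, exists2 r, splits s = rcons r ([::], s) & forall p, p \in r -> (size p.2 < size s)%N.
 elim=> [|i t [r Er hr]];first by exists [::].
 exists ([seq (i :: p.1, p.2) | p <- splits t] ++ [seq (p.1, i :: p.2) | p <- r]).
  by rewrite /= {2}Er map_rcons /= rcons_cat.
 move=> p;rewrite mem_cat=> /orP[] /mapP[q hq ->] /=.
  by rewrite ltnS -(size_splits hq) leq_addl.
 by rewrite ltnS;exact:hr.
move=> sk;have [r Er hr] := Es s.
have rs p : p \in r -> p \in splits s by rewrite Er mem_rcons inE=> ->;rewrite orbT.
have sr p : p \in r -> sqi mu D (pderiv p.1 a * U p.2).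
 move=> /rs;exact:(sqi_mulj oD Ca b jU sk).
have si : ([::], s) \in splits s by rewrite Er mem_rcons inE eqxx.
split;first exact:(sqi_mulj oD Ca b jU sk si).
rewrite /mulj Er -cats1 big_cat big_seq1 /= addrK.
rewrite big_seq;apply:le_trans (nrm_sum _ mD sr) _.
have h p : p \in r -> nrm mu D (pderiv p.1 a * U p.2) <= M * J (size s) D U.
 move=> ps;apply:le_trans (mulj_nrm_le oD Ca M0 b jU sk (rs _ ps)) _.
 by rewrite ler_wpM2l// le_J// hr.
apply:(@le_trans _ _ (\sum_(p <- r | p \in r) M * J (size s) D U));first exact:ler_sum.
rewrite -big_seq big_const_seq count_predT iter_addr_0 -[leLHS]mulr_natl -mulrA.
rewrite ler_wpM2r ?mulr_ge0 ?J_ge0// -natrX ler_nat.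
apply:(@leq_trans (size (splits s)));first by rewrite Er size_rcons.
by rewrite splits_size leq_exp2l.
Qed.

(* Only the undifferentiated coefficient meets the top order derivatives. *)
Lemma mulj_top k D a U M d s : open D -> C_k k a -> 0 <= M -> bnd k D a M -> jet k D U ->
 0 <= d -> (forall x, D x -> `|a x| <= d) -> (size s <= k)%N ->
 nrm mu D (mulj a U s) <= d * nrm mu D (U s) + 2 ^+ k * M * J (size s) D U.
Proof.
move=> oD Ca M0 b jU d0 da sk;have mD:= open_meas oD.
have [saU h] := mulj_rest oD Ca M0 b jU sk.
have sm:= proj1 (jet_mul oD Ca b jU) s sk.
have -> : mulj a U s = a * U s + (mulj a U s - a * U s) by rewrite addrC subrK.
apply:le_trans (nrmD mD saU (sqiB mD sm saU)) _;apply:lerD h.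
apply:nrmM d0 da (proj1 jU s sk)=> //.
apply:measurable_funTS;apply:continuous_meas.
by case:Ca=> _ /(_ [::]);exact.
Qed.

Definition addj U W : seq 'I_n -> V -> R:= fun s=> U s + W s.

Lemma jet_add k D U W : open D -> jet k D U -> jet k D W -> jet k D (addj U W).
Proof.
move=> oD [sU wU] [sW wW];have mD:= open_meas oD;split=> [s sk|s i sk].
 by apply:sqiD=> //;[exact:sU|exact:sW].
by apply:wdD=> //;[exact:sU (ltnW sk)|exact:sU|exact:sW (ltnW sk)|exact:sW|exact:wU|exact:wW].
Qed.

Lemma J_add k D U W : open D -> jet k D U -> jet k D W -> J k.+1 D (addj U W) <= J k.+1 D U + J k.+1 D W.
Proof.
move=> oD [sU _] [sW _];have mD:= open_meas oD;rewrite /J -big_split /=.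
apply:ler_sum=> j _;rewrite -big_split /=;apply:ler_sum=> t _;apply:nrmD=> //.
 by apply:sU;rewrite size_tuple -ltnS.
by apply:sW;rewrite size_tuple -ltnS.
Qed.

Lemma cJ_le k l : (k <= l)%N -> cJ k <= cJ l.
Proof.
move=> kl;rewrite /cJ (big_ord_widen l (fun j=> \sum_(t : j.-tuple 'I_n) (1 : R)) kl).
rewrite [leRHS](bigID (fun j : 'I_l=> (j < k)%N)) /= lerDl.
by apply:sumr_ge0=> j _;apply:sumr_ge0.
Qed.

Lemma J_uniq k D U W : open D -> jet k D U -> jet k D W -> ae_eq mu D (U [::]) (W [::]) -> J k.+1 D U = J k.+1 D W.
Proof.
move=> oD jU jW e;apply:J_ext=> s sk;apply:ae_eq_nrm.
- exact:open_meas.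
- exact:(proj1 jU).
- exact:(proj1 jW).
- exact:jet_uniq jU jW e s sk.
Qed.

End jets.

Section approx.
Context (R : realType) (n : nat).
Notation V:= 'rV[R]_n.
Notation mu:= (lebesgue_rV R n).
Implicit Types (D : set V) (u g f phi : V -> R) (U W : seq 'I_n -> V -> R).

Lemma jet_csupp k phi M : smooth phi -> csupp M phi -> jet k setT (fun s=> pderiv s phi).
Proof.
move=> Sp pM;split=> [s _|s i _ psi tp].
 exact:sqi_C1 (smooth_pd s Sp 1%N) (pd_csupp s pM).
have [M' pM'] := test_csupp tp;apply:oppr_inj;rewrite opprK.
exact:esym (IBP 'e_i (smooth_pd s Sp 1%N) (proj1 tp 1%N) (pd_csupp s pM) pM').
Qed.

Lemma jet_dot k D U s phi : jet k D U -> (size s <= k)%N -> test_function D phi ->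
 dot mu D (U s) phi = (-1) ^+ size s * dot mu D (U [::]) (pderiv s phi).
Proof.
move=> [sU wU];elim: s phi=> [|i s IH] phi sk tp;first by rewrite mul1r.
have:= wU s i sk phi tp;move/(congr1 -%R);rewrite opprK=> <-.
rewrite (IH _ (ltnW sk) (test_pderiv [:: i] tp)) exprS mulN1r -mulNr;congr (_ * dot _ _ _ _).
by rewrite -pderiv_rcons pderiv_rconsC//;case:tp.
Qed.

Lemma jet_is_weak k D U s : jet k D U -> (size s <= k)%N -> is_weak_deriv D s (U [::]) (U s).
Proof.
move=> jU sk phi tp;rewrite -!/(dot mu D _ _) (jet_dot jU sk tp) mulrA -exprD addnn -mul2n exprM.
by rewrite sqrrN expr1n expr1n mul1r.
Qed.

Lemma wd_tr h i u g : sqi mu setT u -> sqi mu setT g -> wd setT i u g ->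
 wd setT i (tr h u) (tr h g).
Proof.
move=> su sg w phi tp.
have [M pM] := test_csupp tp;case:tp=> Sp _.
have Spt : smooth (tr (- h) phi).
 move=> k;have:= @C_k_affine R n n k 1%:M (- h) phi (Sp k).
 by congr C_k;apply/funext=> x;rewrite mulmx1.
have pMt : csupp (M + `|h|) (tr (- h) phi).
 move=> x Mx;apply:pM;have:= ler_normB x (x - h).
 rewrite opprB addrC subrK=> hx;rewrite -(ltrD2r `|h|);apply:(lt_le_trans Mx).
 by have:= ler_normD (x - h) h;rewrite subrK.
have tpt : test_function setT (tr (- h) phi).
 apply:(@test_functionP _ _ _ _ [set x : V | `|x| <= M + `|h|])=> //.
 - exact:closed_normle.
 - exact:bounded_normle.
 - by move=> x /negP;rewrite -ltNge;exact:pMt.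
have s0:= sqi_C1 (Sp 1%N) pM;have s1:= sqi_Dv 'e_i (Sp 1%N) pM.
have:= w _ tpt.
have -> : (fun x=> 'D_('e_i) (tr (- h) phi) x) = tr (- h) (fun x=> 'D_('e_i) phi x).
 by apply/funext=> x;rewrite /tr derive_trE.
rewrite -!dot_trl ?opprK//.
Qed.

Lemma cvg_nrm D (f_ : nat -> V -> R) f : measurable D -> (forall m, sqi mu D (f_ m)) -> sqi mu D f ->
 nrm mu D (f_ m - f) @[m --> \oo] --> 0 -> nrm mu D (f_ m) @[m --> \oo] --> nrm mu D f.
Proof.
move=> mD sf_ sf c;apply/cvgrPdist_le=> e e0.
move/cvgrPdist_le : c=> /(_ e e0)[N _ h];exists N=> // m /h.
rewrite sub0r normrN ger0_norm ?nrm_ge0// => hm;apply:le_trans hm.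
rewrite ler_norml;apply/andP;split.
 rewrite lerBrDl -lerBrDr opprK;have:= nrmD mD (sqiB mD (sf_ m) sf) sf.
 by rewrite subrK addrC.
have:= nrmD mD (sqiB mD sf (sf_ m)) (sf_ m);rewrite subrK -lerBlDr.
by rewrite -(nrmN _ _ (f - f_ m)) opprB.
Qed.

Lemma approx_sum (I : Type) (r : seq I) (F : I -> nat -> R) :
 (forall i, F i m @[m --> \oo] --> (0 : R)) -> (\sum_(i <- r) F i m) @[m --> \oo] --> (0 : R).
Proof.
move=> h;elim: r=> [|i r IH].
 by under eq_fun do rewrite big_nil;exact:cvg_cst.
under eq_fun do rewrite big_cons;have:= cvgD (h i) IH;rewrite addr0;exact.
Qed.

Lemma jet_moll k W M : jet k setT W -> csupp M (W [::]) ->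
 exists phi : nat -> V -> R, [/\ forall m, smooth (phi m),
  forall m x, (forall y, `|x - y| < m.+1%:R^-1 -> W [::] y = 0) -> phi m x = 0,
  forall m, csupp (M + 1) (phi m) &
  forall s, (size s <= k)%N -> nrm mu setT (pderiv s (phi m) - W s) @[m --> \oo] --> 0].
Proof.
move=> jW WM;have [phi [Sp Zp cp]] := Moll (proj1 jW [::] isT) WM.
exists phi;split=> // [m x Mx|s sk];last first.
 by apply:cp;[exact:(proj1 jW)|exact:jet_is_weak jW sk].
apply:Zp=> y xy;apply:WM.
have h:= ler_normD (x - y) y;move: h;rewrite subrK=> h.
have m1 : m.+1%:R^-1 <= 1 :> R by rewrite invf_le1// ler1n.
by move: xy;move: (m.+1%:R^-1) m1=> t;lra.
Qed.

End approx.

(** * The half space: approximation and integration by parts *)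

Section halfspace.
Context (R : realType) (n : nat).
Notation V:= 'rV[R]_n.+1.
Notation mu:= (lebesgue_rV R n.+1).

Definition hsp : set V:= [set x | 0 < x ord0 ord0].

Lemma continuous_coord (i : 'I_n.+1) : continuous (fun x : V=> x ord0 i).
Proof.
apply:(@lipschitz_dist_continuous R _ _ _ 1)=> // x y;rewrite mul1r.
by have:= coord_le (x - y) i;rewrite !mxE.
Qed.

Lemma open_half : open hsp.
Proof.
apply:(@open_comp _ _ (fun x : V=> x ord0 ord0) [set r | 0 < r]);last exact:open_gt.
by move=> x _;exact:continuous_coord.
Qed.

Lemma closed_coord_ge (r : R) : closed [set x : V | r <= x ord0 ord0].
Proof.
apply:(@closed_comp _ _ (fun x : V=> x ord0 ord0) [set s | r <= s]);last exact:closed_ge.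
by move=> x _;exact:continuous_coord.
Qed.

Lemma test_half (phi : V -> R) (r M : R) : 0 < r -> smooth phi -> csupp M phi ->
 (forall x : V, x ord0 ord0 < r -> phi x = 0) -> test_function hsp phi.
Proof.
move=> r0 Sp pM z.
apply:(@test_functionP _ _ _ _ ([set x : V | `|x| <= M] `&` [set x | r <= x ord0 ord0]))=> //.
- apply:closedI;[exact:closed_normle|exact:closed_coord_ge].
- have /bounded_setP[N N0 h] := @bounded_normle R n.+1 M.
 by apply/bounded_setP;exists N=> // x [/h].
- by move=> x [_ /=];exact:lt_le_trans.
- move=> x;have [Mx|xM] := ltP M `|x|;first by move=> _;exact:pM.
 by have [xr _|rx []//] := ltP (x ord0 ord0) r;exact:z.
Qed.

(** A jet of the whole space that vanishes for x_0 <= 0 is translated by 1/(m+1) into the half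
    space. This leaves room for a mollification that still vanishes near the boundary, and
    translations are continuous in L^2. *)
Lemma half_approx k (W : seq 'I_n.+1 -> V -> R) M : jet k setT W -> csupp M (W [::]) ->
 (forall x : V, x ord0 ord0 <= 0 -> W [::] x = 0) ->
 exists phi : nat -> V -> R, (forall m, test_function hsp (phi m)) /\
  forall s, (size s <= k)%N -> nrm mu setT (pderiv s (phi m) - W s) @[m --> \oo] --> 0.
Proof.
move=> jW WM W0;have [sW wW] := jW.
pose e0 : V:= 'e_ord0.
have ne0 : `|e0| <= 1.
 by apply:norm_le_coord=> // i;rewrite !mxE /=;case:(_ == _);rewrite ?normr1 ?normr0.
pose h (m : nat) : V:= - (m.+1%:R^-1 *: e0).
have h0 : h m @[m --> \oo] --> (0 : V).
 apply/cvgr0Pnorm_le=> e ep;move/cvgrPdist_le : (@invS_cvg0 R)=> /(_ e ep)[N _ hN].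
 exists N=> // m /hN;rewrite sub0r normrN /h normrN normrZ=> H;apply:le_trans H.
 by rewrite ler_piMr.
have A m : exists phi, test_function hsp phi /\ forall s, (size s <= k)%N ->
  nrm mu setT (pderiv s phi - tr (h m) (W s)) <= m.+1%:R^-1.
 have m0 : 0 < m.+1%:R^-1 :> R by rewrite invr_gt0.
 have jt : jet k setT (fun s=> tr (h m) (W s)).
  split=> [s sk|s i sk];first by apply:sqi_tr;exact:sW.
  by apply:wd_tr;[exact:sW (ltnW sk)|exact:sW|exact:wW].
 have hn : `|h m| <= 1.
  by rewrite /h normrN normrZ mulr_ile1// gtr0_norm// invf_le1// ler1n.
 have tM : csupp (M + 1) (tr (h m) (W [::])).
  move=> x Mx;apply:WM;have:= ler_normB (x + h m) (h m);rewrite addrK;lra.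
 have [p [Sp Zp pM cp]] := jet_moll jt tM.
 have ev : \forall j \near \oo, forall s, (size s <= k)%N ->
   nrm mu setT (pderiv s (p j) - tr (h m) (W s)) <= m.+1%:R^-1.
  (* Summing over the finitely many lists of length at most k lets one index j serve all of them. *)
  have : (\sum_(t <- enum {: {j : 'I_k.+1 & j.-tuple 'I_n.+1}}) nrm mu setT (pderiv (tagged t) (p j) - tr (h m) (W (tagged t)))) @[j --> \oo] --> 0.
   apply:approx_sum=> -[j t];apply:cp;have:= ltn_ord j;rewrite ltnS=> jk;by rewrite /= size_tuple.
  move=> /cvgrPdist_le/(_ _ m0)[N _ hN];exists N=> // j /hN;rewrite sub0r normrN ger0_norm;last first.
   by apply:sumr_ge0=> t _;exact:nrm_ge0.
  move=> le s sk;apply:le_trans le.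
  pose t : {j : 'I_k.+1 & j.-tuple 'I_n.+1} := Tagged (fun j : 'I_k.+1=> j.-tuple 'I_n.+1) (in_tuple s : (nat_of_ord (Ordinal (sk : (size s < k.+1)%N))).-tuple 'I_n.+1).
  rewrite big_enum (bigD1 t) //= lerDl;apply:sumr_ge0=> u _;exact:nrm_ge0.
 have ev2 : \forall j \near \oo, (j.+1%:R^-1 : R) < m.+1%:R^-1 / 2.
  have e2 : 0 < m.+1%:R^-1 / 2 :> R by rewrite divr_gt0.
  by move/cvgrPdist_lt : (@invS_cvg0 R)=> /(_ _ e2)[N _ hN];exists N=> // j /hN;
   rewrite sub0r normrN gtr0_norm// invr_gt0.
 have [j [evj jm]] := filter_ex (filterI ev ev2).
 exists (p j);split=> //.
 apply:(@test_half _ (m.+1%:R^-1 / 2) (M + 1 + 1))=> //.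
 move=> x xr;apply:Zp=> y xy;apply:W0;rewrite !mxE eqxx mulr1.
 have:= coord_le (x - y) ord0;rewrite !mxE ler_norml=> /andP[+ _].
 move: xy jm xr;move: (m.+1%:R^-1) (j.+1%:R^-1) (x ord0 ord0) (y ord0 ord0)=> a b c d;lra.
have /choice[phi hphi] := A.
exists phi;split=> [m|s sk];first by case:(hphi m).
have c1 : nrm mu setT (pderiv s (phi m) - tr (h m) (W s)) @[m --> \oo] --> 0.
 apply:mono_cvg0 (@invS_cvg0 R)=> m;rewrite nrm_ge0;exact:(proj2 (hphi m)).
have c2:= proj2 (trcont_sqint (sW s sk)) h h0.
have c3 : nrm mu setT (pderiv s (phi m) - tr (h m) (W s)) + nrm mu setT (tr (h m) (W s) - W s) @[m --> \oo] --> (0 + 0 : R) by exact:cvgD.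
rewrite addr0 in c3;apply:(mono_cvg0 _ c3)=> m;rewrite nrm_ge0 /=.
have st : sqi mu setT (tr (h m) (W s)) by apply:sqi_tr;exact:sW.
have sp:= sqi_test s (proj1 (hphi m)).
have:= nrmD measurableT (sqiB measurableT sp st) (sqiB measurableT st (sW s sk)).
by rewrite addrA subrK.
Qed.

End halfspace.

Section halfIBP.
Context (R : realType) (n : nat).
Notation V:= 'rV[R]_n.+1.
Notation mu:= (lebesgue_rV R n.+1).
Notation hsp:= (@hsp R n).
Implicit Types (u g gi eta : V -> R).

Lemma cvg_bound (u : nat -> R) (l C : R) (N : nat) :
 (forall m, (N <= m)%N -> `|u m - l| <= C * m.+1%:R^-1) -> u m @[m --> \oo] --> l.
Proof.
move=> h;apply/cvgrPdist_le=> e e0.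
have c : C * m.+1%:R^-1 @[m --> \oo] --> (C * 0 : R) by apply:cvgMr;exact:invS_cvg0.
rewrite mulr0 in c;move/cvgrPdist_le : c=> /(_ e e0)[N' _ hN].
exists (maxn N N')=> // m /=;rewrite geq_max=> /andP[Nm N'm].
rewrite distrC;apply:le_trans (h m Nm) _;have:= hN m N'm.
by rewrite sub0r normrN;apply:le_trans;exact:ler_norm.
Qed.

(** [flat 'X^2] is the derivative of [flat 1]. With s + 1 = (m+1) x_0 the weight turns this into a
    decay of the derivative of [theta m] that survives the multiplication by x_0. *)
Lemma flat2_le : exists2 K : R, 0 <= K & forall s, (s + 1) ^+ 2 * `|flat 'X^2 s| <= K.
Proof.
have [C hC] := @flat_le R ((1 + 'X) ^+ 2).
exists (Num.max 4 C);first by rewrite le_max;apply/orP;left.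
move=> s;have [s0|s0] := leP s 0.
 by rewrite /flat ltNge s0 /= normr0 mulr0 le_max;apply/orP;left.
have E : (s + 1) ^+ 2 * `|flat 'X^2 s| = `|flat ((1 + 'X) ^+ 2) s|.
 rewrite /flat s0 !hornerE;rewrite !normrM mulrA;congr (_ * _).
 rewrite -[X in X * _](ger0_norm (sqr_ge0 (s + 1))) -!normrM;congr `|_|.
 by field;rewrite gt_eqF.
rewrite E;have [s1|s1] := leP s 1.
 apply:le_trans (hC s) _;rewrite gtr0_norm//.
 have C0 : 0 <= C.
  by have:= hC 1;rewrite normr1 mulr1;apply:le_trans;exact:normr_ge0.
 by rewrite le_max;apply/orP;right;rewrite ler_piMr.
rewrite le_max;apply/orP;left;rewrite /flat s0 !hornerE.
have si : s^-1 <= 1 by rewrite invf_le1// ltW.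
have si0 : 0 < s^-1 by rewrite invr_gt0.
rewrite ger0_norm ?mulr_ge0 ?sqr_ge0 ?expR_ge0//.
have e1 : expR (- s^-1) <= 1 by have:= ler_expR (- s^-1) 0;rewrite expR0=> ->;lra.
have e0:= expR_ge0 (- s^-1).
idtac;move: e1 e0 si si0;set a:= expR _;set b:= s^-1;nra.
all: lra.
Qed.

Definition theta (m : nat) (x : V) : R:= flat 1 (-1 + m.+1%:R * x ord0 ord0).

Lemma theta_derive m i x : 'D_('e_i) (theta m) x =
 (m.+1%:R * (ord0 == i)%:R) * flat 'X^2 (-1 + m.+1%:R * x ord0 ord0).
Proof.
have -> : ('X^2 : {poly R}) = 'X^2 * (1 - 1^`()) by rewrite derivC subr0 mulr1.
exact:(@derive_val _ _ _ _ _ _ _ (is_derive_flat_coord 1 (-1) m.+1%:R ord0 i x)).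
Qed.

Lemma smooth_theta m : smooth (theta m).
Proof. exact:smooth_flat_coord. Qed.

Lemma theta_ge0 m x : 0 <= theta m x <= 1.
Proof.
rewrite /theta /flat;case:ifP=> [s0|];last by rewrite lexx ler01.
rewrite hornerC mul1r expR_ge0 /=;set s:= _ + _ in s0 *.
by have:= ler_expR (- s^-1) 0;rewrite expR0=> ->;rewrite oppr_le0 invr_ge0 ltW.
Qed.

Lemma theta_cvg x : hsp x -> theta m x @[m --> \oo] --> (1 : R).
Proof.
move=> /= x0;set a:= x ord0 ord0 in x0 *.
have a2 : 0 < a / 2 by rewrite divr_gt0.
move/cvgrPdist_le : (@invS_cvg0 R)=> /(_ _ a2)[N _ hN].
apply:(@cvg_bound _ _ (2 / a) N)=> m /hN;rewrite sub0r normrN gtr0_norm ?invr_gt0// => h.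
have m0 : 0 < m.+1%:R :> R by rewrite ltr0n.
have s0 : m.+1%:R * a >= 2.
 move: h;rewrite -(ler_pM2l m0) mulfV ?gt_eqF// mulrA=> h;lra.
rewrite /theta /flat -/a.
have p : 0 < -1 + m.+1%:R * a by lra.
rewrite p hornerC mul1r.
have e1 : expR (- (-1 + m.+1%:R * a)^-1) <= 1.
 by have:= ler_expR (- (-1 + m.+1%:R * a)^-1) 0;rewrite expR0=> ->;rewrite oppr_le0 invr_ge0 ltW.
rewrite distrC ger0_norm ?subr_ge0//.
have:= expR_ge1Dx (- (-1 + m.+1%:R * a)^-1)=> e2.
apply:(@le_trans _ _ ((-1 + m.+1%:R * a)^-1));first by lra.
rewrite -mulrA -invfM -[X in _ <= X]invrK lef_pV2 ?posrE ?invr_gt0//;last first.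
  by rewrite divr_gt0 ?mulr_gt0.
rewrite invf_div;lra.
Qed.

Lemma sqi_ball_cst (M C : R) : sqi mu hsp (fun x=> C * \1_[set y : V | `|y| <= M] x).
Proof.
have mB : measurable [set y : V | `|y| <= M] by apply:closed_meas;exact:closed_normle.
apply:(sqi_sub (open_meas (@open_half R n)) measurableT (@subsetT _ _)).
apply:(sqiZ measurableT C);apply:sqi_indic=> //.
by apply:lebesgue_bounded=> //;exact:bounded_normle.
Qed.

(** The functions [theta m * eta] are test functions of the half space. If i is the normal
    direction, the term with the derivative of [theta m] is harmless because eta is O(x_0) at the
    boundary: [bD] bounds it by a constant times the minimum of 1 and 1/((m+1) x_0), which is
    dominated and tends to 0 pointwise. *)
Lemma half_IBP i g gi eta M : sqi mu hsp g -> sqi mu hsp gi -> wd hsp i g gi ->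
 smooth eta -> csupp M eta -> (i = ord0 -> forall x : V, x ord0 ord0 = 0 -> eta x = 0) ->
 dot mu hsp g (fun x=> 'D_('e_i) eta x) = - dot mu hsp gi eta.
Proof.
move=> sg sgi w Se eM e0;have oH:= @open_half R n;have mH:= open_meas oH.
have C1e:= Se 1%N.
pose De:= fun x=> 'D_('e_i) eta x.
have SDe : smooth De:= smooth_pd [:: i] Se.
have eDM : csupp M De:= @csupp_D _ _ eta M 'e_i eM.
have [C C0 eC] := csupp_bounded (C_k_cont C1e) eM.
have [L L0 DeL] := csupp_bounded (C_k_cont (SDe 1%N)) eDM.
have [K K0 hK] := flat2_le.
have tt m : test_function hsp (theta m * eta).
 apply:(@test_half _ _ _ (m.+1%:R^-1) M);first by rewrite invr_gt0.
 - by move=> k;apply:C_kM=> //;exact:smooth_theta.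
 - by move=> x /eM h;rewrite !fctE h mulr0.
 move=> x xm;rewrite !fctE /theta /flat ifF ?mul0r//;apply/negP=> h.
 move: xm;rewrite -(ltr_pM2l (_ : 0 < m.+1%:R :> R)) ?mulfV ?gt_eqF ?ltr0n//;lra.
have DE m x : 'D_('e_i) (theta m * eta) x = 'D_('e_i) (theta m) x * eta x + theta m x * De x.
 exact:derive_mul1 (smooth_theta m 1%N) C1e.
have bD m x : hsp x -> `|'D_('e_i) (theta m) x * eta x| <= L * K * Num.min 1 (m.+1%:R^-1 / x ord0 ord0).
 move=> /= x0;rewrite theta_derive.
 have min0 : 0 <= Num.min 1 (m.+1%:R^-1 / x ord0 ord0).
  by rewrite le_min ler01 /= divr_ge0 ?invr_ge0 ?ler0n// ltW.
 case:eqP=> [i0|_];last by rewrite mulr0 !mul0r normr0 mulr_ge0// mulr_ge0// ltW.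
 have ex : `|eta x| <= L * x ord0 ord0.
  have dl y : derivable eta y 'e_i by exact:C_k_derivable C1e.
  have [c _] := MVT_line (x - x ord0 ord0 *: 'e_i) (x ord0 ord0) dl.
  rewrite subrK [eta (x - _)]e0 ?subr0//;last by rewrite -i0 !mxE !eqxx mulr1 subrr.
  by move=> ->;rewrite normrM gtr0_norm// mulrC;apply:ler_wpM2r;[exact:ltW|exact:DeL].
 rewrite mulr1;have [s0|s0] := leP (-1 + m.+1%:R * x ord0 ord0) 0.
  by rewrite /flat ltNge s0 /= mulr0 mul0r normr0 mulr_ge0// mulr_ge0// ltW.
 have:= hK (-1 + m.+1%:R * x ord0 ord0).
 rewrite addrAC addNr add0r;set a:= m.+1%:R * x ord0 ord0 in s0 *.
 have a1 : 1 < a by lra.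
 have m0 : 0 < m.+1%:R :> R by rewrite ltr0n.
 move=> h;have F0:= normr_ge0 (flat 'X^2 (-1 + a)).
 rewrite !normrM (gtr0_norm m0).
 apply:(@le_trans _ _ (m.+1%:R * `|flat 'X^2 (-1 + a)| * (L * x ord0 ord0))).
  by rewrite ler_wpM2l// mulr_ge0// ltW.
 have -> : m.+1%:R * `|flat 'X^2 (-1 + a)| * (L * x ord0 ord0) = L * (a * `|flat 'X^2 (-1 + a)|).
  by rewrite /a;ring.
 rewrite -mulrA ler_wpM2l//;first exact:ltW.
 rewrite -invfM -/a minr_pMr// mulr1 le_min;apply/andP;split.
  apply:le_trans h;rewrite ler_wpM2r// ler_eXnr//;exact:ltW.
 rewrite ler_pdivlMr ?(lt_trans ltr01)//;by rewrite mulrAC -expr2.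
have B1 : `|L| * K + L >= 0 by rewrite addr_ge0// ?mulr_ge0// ltW.
have [_ c1] : sqi mu hsp De /\ nrm mu hsp ((fun x=> 'D_('e_i) (theta m * eta) x) - De) @[m --> \oo] --> 0.
 apply:(@dominated_nrm _ _ _ mu hsp mH (fun m x=> 'D_('e_i) (theta m * eta) x) De _ _ _
  (sqi_ball_cst M (L * K + L))).
 - move=> m;apply:measurable_funTS;apply:continuous_meas.
  exact:(C_k_cont (smooth_pd [:: i] (proj1 (tt m)) 0%N)).
 - apply:measurable_funTS;apply:continuous_meas.
  exact:(C_k_cont (SDe 0%N)).
 - move=> x hx;under eq_fun do rewrite DE.
  have H1 : theta m x * De x @[m --> \oo] --> (1 * De x : R) by apply:cvgMl;exact:theta_cvg.
  suff H2 : 'D_('e_i) (theta m) x * eta x @[m --> \oo] --> (0 : R).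
   by have:= cvgD H2 H1;rewrite add0r mul1r;exact.
  apply:(@cvg_bound _ _ (L * K / x ord0 ord0) 0)=> m _;rewrite subr0.
  apply:le_trans (bD m x hx) _.
  have -> : L * K / x ord0 ord0 * m.+1%:R^-1 = L * K * (m.+1%:R^-1 / x ord0 ord0).
   by rewrite -!mulrA (mulrC (m.+1%:R^-1)).
  have LK : 0 <= L * K by rewrite mulr_ge0// ltW.
  by apply:ler_wpM2l=> //;rewrite ge_min lexx orbT.
 - move=> m x hx;have [xM|Mx] := leP `|x| M;last first.
   rewrite indicE memNset ?mulr0;last by apply/negP;rewrite -ltNge.
   have te : csupp M (theta m * eta) by move=> y My;rewrite !fctE eM ?mulr0.
   by rewrite (@csupp_D _ _ (theta m * eta) M 'e_i te x Mx) normr0.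
  rewrite indicE mem_set// mulr1 DE;apply:le_trans (ler_normD _ _) _.
  apply:lerD.
   apply:le_trans (bD m x hx) _;have LK : 0 <= L * K by rewrite mulr_ge0// ltW.
   by rewrite -[leRHS]mulr1;apply:ler_wpM2l=> //;rewrite ge_min lexx.
  rewrite normrM;have /andP[t0 t1] := theta_ge0 m x;rewrite ger0_norm//.
  by apply:le_trans (DeL x);rewrite ler_piMl.
have [_ c0] : sqi mu hsp eta /\ nrm mu hsp (theta m * eta - eta) @[m --> \oo] --> 0.
 apply:(@dominated_nrm _ _ _ mu hsp mH (fun m=> theta m * eta) eta _ _ _
  (sqi_ball_cst M C)).
 - move=> m;apply:measurable_funTS;apply:continuous_meas.
  exact:(C_k_cont ((proj1 (tt m)) 0%N)).
 - apply:measurable_funTS;apply:continuous_meas;exact:C_k_cont C1e.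
 - move=> x hx;have H1 : theta m x * eta x @[m --> \oo] --> (1 * eta x : R) by apply:cvgMl;exact:theta_cvg.
  by rewrite mul1r in H1.
 - move=> m x hx;have [xM|Mx] := leP `|x| M;last by rewrite !fctE eM// mulr0 normr0 indicE memNset ?mulr0//;apply/negP;rewrite -ltNge.
  rewrite indicE mem_set// mulr1 !fctE normrM;have /andP[t0 t1] := theta_ge0 m x;rewrite ger0_norm//.
  by apply:le_trans (eC x);rewrite ler_piMl.
have sT s m : sqi mu hsp (pderiv s (theta m * eta)).
 exact:sqiT mH (sqi_test s (tt m)).
have se : sqi mu hsp eta:= sqiT mH (sqi_C1 C1e eM).
have sDe : sqi mu hsp De:= sqiT mH (sqi_C1 (SDe 1%N) eDM).
have d1:= @cvg_dot _ _ _ mu hsp mH (fun m x=> 'D_('e_i) (theta m * eta) x) De g (fun m=> sT [:: i] m) sDe sg c1.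
have d0:= @cvg_dot _ _ _ mu hsp mH (fun m=> theta m * eta) eta gi (fun m=> sT [::] m) se sgi c0.
have e : (fun m=> dot mu hsp (fun x=> 'D_('e_i) (theta m * eta) x) g) = (fun m=> - dot mu hsp (theta m * eta) gi).
 by apply/funext=> m;rewrite dotC (w _ (tt m)) dotC.
rewrite e in d1;rewrite dotC (dotC _ _ gi);exact:cvg_unique d1 (cvgN d0).
Qed.

End halfIBP.

(** * Higher order reflection across the boundary of the half space *)

Section reflection.
Context (R : realType) (n : nat).
Notation V:= 'rV[R]_n.+1.
Notation mu:= (lebesgue_rV R n.+1).
Notation hsp:= (@hsp R n).
Implicit Types (u g gi phi : V -> R) (U : seq 'I_n.+1 -> V -> R).

Definition wt (c : R) (i : 'I_n.+1) : R:= if i == ord0 then c else 1.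
Definition sc (c : R) (x : V) : V:= affine_rV (wt c) (cst 0) x.

Lemma scE c x i : sc c x ord0 i = wt c i * x ord0 i.
Proof. by rewrite mxE addr0. Qed.

Lemma scK c c' x : sc c (sc c' x) = sc (c * c') x.
Proof. by apply/rowP=> i;rewrite !scE /wt;case:ifP;rewrite ?mul1r// mulrA. Qed.

Lemma sc1 x : sc 1 x = x.
Proof. by apply/rowP=> i;rewrite scE /wt;case:ifP;rewrite mul1r. Qed.

Lemma dot_sc c u g : c != 0 -> sqi mu setT u -> sqi mu setT g ->
 sqi mu setT (u \o sc c) /\ dot mu setT (u \o sc c) (g \o sc c) = `|c|^-1 * dot mu setT u g.
Proof.
move=> c0 su sg.
have w0 i : wt c i != 0 by rewrite /wt;case:ifP;rewrite ?oner_neq0.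
have pE : \prod_i `|wt c i|^-1 = `|c|^-1.
 rewrite (bigD1 ord0) //= /wt eqxx big1 ?mulr1// => i /negPf ->.
 by rewrite normr1 invr1.
have H A : measurable A -> mu (sc c @^-1` A) = ((`|c|^-1)%:E * mu A)%E.
 by move=> mA;rewrite -pE;exact:(lebesgue_affine_rV (cst 0) w0 mA).
have p0 : 0 <= `|c|^-1 by rewrite invr_ge0.
have ms : measurable_fun setT (sc c) := measurable_affine_rV (wt c) (cst 0).
split;first exact:(sqi_transfer ms p0 H su).
exact:(dot_transfer ms p0 H su sg).
Qed.

Lemma dot_scl c u g : c != 0 -> sqi mu setT u -> sqi mu setT g ->
 dot mu setT (u \o sc c) g = `|c|^-1 * dot mu setT u (g \o sc c^-1).
Proof.
move=> c0 su sg;have ci : c^-1 != 0 by rewrite invr_eq0.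
have [sgc _] := dot_sc ci sg sg.
rewrite -(proj2 (dot_sc c0 su sgc));congr dot;apply/funext=> x /=.
by rewrite scK mulVf// sc1.
Qed.

Lemma nrm_sc c u : c != 0 -> sqi mu setT u -> nrm mu setT (u \o sc c) = Num.sqrt (`|c|^-1) * nrm mu setT u.
Proof. by move=> c0 su;rewrite /nrm (proj2 (dot_sc c0 su su)) sqrtrM ?invr_ge0. Qed.

Lemma smooth_sc c phi : smooth phi -> smooth (phi \o sc c).
Proof.
move=> Sp k;have:= @C_k_affine R _ _ k (diag_mx (\row_i wt c i)) 0 phi (Sp k).
congr C_k;apply/funext=> x /=;congr phi;apply/rowP=> j.
by rewrite mul_mx_diag addr0 !mxE addr0 mulrC.
Qed.

Lemma derive_sc c i phi x : smooth phi ->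
 'D_('e_i) (phi \o sc c) x = wt c i * 'D_('e_i) phi (sc c x).
Proof.
move=> Sp.
have E (h : R) : h^-1 *: (((phi \o sc c) \o shift x) (h *: 'e_i) - (phi \o sc c) x) =
  h^-1 *: ((phi \o shift (sc c x)) (h *: (sc c 'e_i)) - phi (sc c x)).
 congr (_ *: (phi _ - _));apply/rowP=> j.
 by rewrite !(scE, mxE) mulrDr mulrCA.
have -> : 'D_('e_i) (phi \o sc c) x = 'D_(sc c 'e_i) phi (sc c x).
 by rewrite /derive;under eq_fun do rewrite E.
rewrite (C1_deriveE _ _ (Sp 1%N)) (bigD1 i) //= big1 ?addr0.
 by rewrite scE mxE !eqxx mulr1.
by move=> j ji;rewrite scE mxE eqxx (negPf ji) mulr0 mul0r.
Qed.

Lemma csupp_sc c phi M : 1 <= `|c| -> csupp M phi -> csupp M (phi \o sc c).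
Proof.
move=> c1 pM x Mx;apply:pM;apply:(lt_le_trans Mx).
apply:norm_le_coord=> // i;apply:le_trans (coord_le (sc c x) i).
by rewrite scE normrM ler_peMl// /wt;case:ifP;rewrite ?normr1.
Qed.

Lemma csupp_sc_half phi M : 0 <= M -> csupp M phi -> csupp (2 * M) (phi \o sc (- 2^-1)).
Proof.
move=> M0 pM x Mx;apply:pM.
have h : `|x| <= 2 * `|sc (- 2^-1) x|.
 apply:norm_le_coord;first by rewrite mulr_ge0.
 move=> i;have:= coord_le (sc (- 2^-1) x) i.
 rewrite scE normrM /wt;case:ifP=> _;last first.
  by rewrite normr1 mul1r=> h;have:= normr_ge0 (x ord0 i);lra.
 have e2 : `|2^-1 : R| = 2^-1 by rewrite ger0_norm ?invr_ge0.
  by rewrite normrN e2=> h;lra.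
lra.
Qed.

(** For x_0 < 0 the value is al g(-x_0, x') + be g(-x_0/2, x'), and for x_0 > 0 it is g(x). *)
Definition ext (al be : R) g : V -> R :=
 (g \_ hsp) + (al *: ((g \_ hsp) \o sc (-1)) + be *: ((g \_ hsp) \o sc (- 2^-1))).

Let cm1 : (-1 : R) != 0. Proof. by rewrite oppr_eq0 oner_eq0. Qed.
Let cm2 : (- 2^-1 : R) != 0. Proof. by rewrite oppr_eq0 invr_eq0 pnatr_eq0. Qed.
Let mH : measurable hsp. Proof. exact:open_meas (@open_half R n). Qed.

Lemma sqi_ext al be g : sqi mu hsp g -> sqi mu setT (ext al be g).
Proof.
move=> /(sqi_patch _ mH) sg;apply:sqiD=> //.
by apply:sqiD=> //;apply:sqiZ=> //;exact:(proj1 (dot_sc _ sg sg)).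
Qed.

Lemma dot_ext al be g phi : sqi mu hsp g -> sqi mu setT phi ->
 dot mu setT (ext al be g) phi =
 dot mu setT (g \_ hsp) (phi + (al *: (phi \o sc (-1)) + (2 * be) *: (phi \o sc (-2)))).
Proof.
move=> sg sp;have /(sqi_patch _ mH) sgH:= sg.
have [s1 _] := dot_sc cm1 sgH sgH;have [s2 _] := dot_sc cm2 sgH sgH.
have c2 : (-2 : R) != 0 by rewrite oppr_eq0 pnatr_eq0.
have [t1 _] := dot_sc cm1 sp sp;have [t2 _] := dot_sc c2 sp sp.
have i1 : (-1 : R)^-1 = -1 by rewrite invrN invr1.
have i2 : (- 2^-1 : R)^-1 = -2 by rewrite invrN invrK.
have z1:= sqiZ measurableT al t1;have z2:= sqiZ measurableT (2 * be) t2.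
have z3:= sqiZ measurableT al s1;have z4:= sqiZ measurableT be s2.
rewrite /ext !dotDl//;last by apply:sqiD.
rewrite !dotDr//;last by apply:sqiD.
rewrite !dotZl// !dotZr//.
rewrite (dot_scl cm1 sgH sp) (dot_scl cm2 sgH sp) i1 i2.
rewrite !normrN normr1 invr1 mul1r ger0_norm ?invr_ge0// invrK mulrA (mulrC be).
by [].
Qed.

(** The reflections are moved to the test function, which becomes eta. For the normal direction
    [half_IBP] requires eta to vanish at the boundary, where it equals (1 - al - be) phi. *)
Lemma wd_ext_refl i al be g gi : sqi mu hsp g -> sqi mu hsp gi -> wd hsp i g gi ->
 (i = ord0 -> al + be = 1) ->
 wd setT i (ext al be g) (ext (al * wt (-1) i) (be * wt (- 2^-1) i) gi).
Proof.
move=> sg sgi w abE phi tp;have [M pM] := test_csupp tp.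
have Sp : smooth phi by case:tp.
have c2 : (-2 : R) != 0 by rewrite oppr_eq0 pnatr_eq0.
rewrite (dot_ext al be sg (sqi_test [:: i] tp)) (dot_ext _ _ sgi (sqi_test [::] tp)).
set a' := al * _;set b' := be * _.
pose eta : V -> R:= phi + (a' *: (phi \o sc (-1)) + (2 * b') *: (phi \o sc (-2))).
have wm1 : wt (-1) i * wt (-1) i = 1.
 by rewrite /wt;case:ifP;rewrite ?mulr1// mulrNN mulr1.
have wm2 : wt (- 2^-1) i * wt (-2) i = 1.
 by rewrite /wt;case:ifP;rewrite ?mulr1// mulrNN mulVf.
have Seta : smooth eta.
 move=> k;apply:C_kD=> //;apply:C_kD;apply:C_kZ;exact:smooth_sc.
have n1 : 1 <= `|-1 : R| by rewrite normrN normr1.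
have n2 : 1 <= `|-2 : R| by rewrite normrN ger0_norm// ler1n.
have etaM : csupp M eta.
 move=> x Mx;rewrite /eta !fctE (pM _ Mx).
 have -> : phi (sc (-1) x) = 0:= csupp_sc n1 pM Mx.
 have -> : phi (sc (-2) x) = 0:= csupp_sc n2 pM Mx.
 by rewrite !scaler0 !addr0.
have De : (fun x=> 'D_('e_i) eta x) = (fun x=> 'D_('e_i) phi x) +
  (al *: ((fun x=> 'D_('e_i) phi x) \o sc (-1)) + (2 * be) *: ((fun x=> 'D_('e_i) phi x) \o sc (-2))).
 apply/funext=> x.
 have d0 : derivable phi x 'e_i by exact:C_k_derivable (Sp 1%N).
 have d1 : derivable (phi \o sc (-1)) x 'e_i by exact:C_k_derivable (smooth_sc (-1) Sp 1%N).
 have d2 : derivable (phi \o sc (-2)) x 'e_i by exact:C_k_derivable (smooth_sc (-2) Sp 1%N).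
 have d1' : derivable (a' *: (phi \o sc (-1))) x 'e_i by exact:derivableZ.
 have d2' : derivable ((2 * b') *: (phi \o sc (-2))) x 'e_i by exact:derivableZ.
 rewrite /eta (deriveD d0 (derivableD d1' d2')) (deriveD d1' d2') (deriveZ _ d1) (deriveZ _ d2).
 rewrite (derive_sc _ _ _ Sp) (derive_sc _ _ _ Sp) !fctE;congr (_ + (_ + _)).
  by rewrite /a' /= scalerA -mulrA wm1 mulr1.
 by rewrite /b' /= scalerA -!mulrA wm2 mulr1.
have:= half_IBP sg sgi w Seta etaM.
rewrite De=> H;rewrite -!dot_patchl;apply:H=> i0 x x0.
have sx c : sc c x = x.
 by apply/rowP=> j;rewrite scE /wt;case:eqP=> [->|_];rewrite ?x0 ?mulr0// mul1r.
rewrite /eta !fctE /= !sx /a' /b' /wt i0 eqxx /=.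
move: (abE i0)=> e;rewrite -!/(GRing.mul _ _).
have -> : phi x + (al * -1 * phi x + 2 * (be * - 2^-1) * phi x) = (1 - (al + be)) * phi x by field.
by rewrite e subrr mul0r.
Qed.

(** The weights -3 and 4 solve al + be = 1 and - al - be/2 = 1, so that values and first normal
    derivatives match across the boundary. Each normal derivative multiplies the two weights by -1
    and -1/2. *)
Definition extj U : seq 'I_n.+1 -> V -> R :=
 fun s=> ext (-3 * (-1) ^+ count_mem ord0 s) (4 * (- 2^-1) ^+ count_mem ord0 s) (U s).

Lemma jet_ext U : jet 2 hsp U -> jet 2 setT (extj U).
Proof.
move=> [sU wU];split=> [s sk|s i sk];first by apply:sqi_ext;exact:sU.
have:= @wd_ext_refl i (-3 * (-1) ^+ count_mem ord0 s) (4 * (- 2^-1) ^+ count_mem ord0 s) _ _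
 (sU s (ltnW sk)) (sU (i :: s) sk) (wU s i sk).
have E c (a : R) : a * c ^+ count_mem ord0 s * wt c i = a * c ^+ count_mem ord0 (i :: s).
 by rewrite /= exprD /wt -mulrA;congr (_ * _);rewrite mulrC;case:eqP=> _;rewrite ?expr1 ?expr0.
rewrite !E;clear E;apply=> i0.
case:s sk=> [|j [|//]] _ /=;first by rewrite !expr0;lra.
by case:(_ == _);rewrite ?addn0 /= ?expr1 ?expr0;lra.
Qed.

Lemma nrm_subset A B f : measurable A -> measurable B -> A `<=` B -> sqi mu B f -> nrm mu A f <= nrm mu B f.
Proof.
move=> mA mB AB sf;have sfA:= sqi_sub mA mB AB sf.
rewrite nrm_patch [leRHS]nrm_patch;apply:nrm_le=> //;[exact:(proj1 (sqi_patch f mA) sfA)|exact:(proj1 (sqi_patch f mB) sf)|].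
move=> x _;rewrite /patch;case:ifPn=> xA;last by rewrite normr0.
by rewrite mem_set//;apply:AB;exact:set_mem.
Qed.

Lemma extE al be g x : hsp x -> ext al be g x = g x.
Proof.
move=> hx;rewrite /ext !fctE /= /patch mem_set//.
have z c : c <= 0 -> (sc c x \in hsp) = false.
 move=> c0;apply/negP=> /set_mem;rewrite /hsp /= scE /wt eqxx.
 by move=> h;have:= mulr_ge0_le0 (ltW hx) c0;rewrite mulrC leNgt h.
rewrite !z;[by rewrite !scaler0 !addr0|by rewrite oppr_le0 invr_ge0|by rewrite oppr_le0].
Qed.

(** 12 is 1 + 3 * 1 + 4 * 2: the two changes of variable multiply the norm by 1 and by the square
    root of 2, which is at most 2. *)
Lemma nrm_extj U s : sqi mu hsp (U s) ->
 nrm mu hsp (U s) <= nrm mu setT (extj U s) <= 12 * nrm mu hsp (U s).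
Proof.
move=> sU;have /(sqi_patch _ mH) sg:= sU.
apply/andP;split.
 rewrite (_ : nrm mu hsp (U s) = nrm mu hsp (extj U s)).
  by apply:nrm_subset=> //;exact:sqi_ext.
 apply:ae_eq_nrm=> //;first exact:sqi_sub (sqi_ext _ _ sU).
 by apply:aeW=> x hx;rewrite /extj extE.
rewrite /extj;set al:= -3 * _;set be:= 4 * _.
have la : `|al| <= 3 by rewrite /al normrM normrX !normrN normr1 expr1n mulr1 ger0_norm.
have lb : `|be| <= 4.
 rewrite /be normrM normrX normrN ger0_norm// ger0_norm ?invr_ge0// ler_piMr//.
 by rewrite exprn_ile1// ?invr_ge0// invf_le1// ler1n.
have [s1 _] := dot_sc cm1 sg sg;have [s2 _] := dot_sc cm2 sg sg.
have z1:= sqiZ measurableT al s1;have z2:= sqiZ measurableT be s2.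
have N:= nrm_ge0 mu hsp (U s).
apply:le_trans (nrmD measurableT sg (sqiD measurableT z1 z2)) _.
have h1:= nrmD measurableT z1 z2;rewrite !nrmZ// !nrm_sc// -!nrm_patch in h1 *.
have q1 : Num.sqrt (`|-1 : R|^-1) = 1 by rewrite normrN normr1 invr1 sqrtr1.
have q2 : Num.sqrt (`|- 2^-1 : R|^-1) <= 2.
 rewrite normrN ger0_norm ?invr_ge0// invrK.
 have h4 : (2 : R) <= 2 ^+ 2 by rewrite expr2;lra.
 by apply:le_trans (ler_wsqrtr h4) _;rewrite sqrtr_sqr ger0_norm.
rewrite q1 mul1r in h1.
have h2 : `|al| * nrm mu hsp (U s) <= 3 * nrm mu hsp (U s) by rewrite ler_wpM2r.
have h3 : `|be| * (Num.sqrt (`|- 2^-1 : R|^-1) * nrm mu hsp (U s)) <= 4 * (2 * nrm mu hsp (U s)).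
 by apply:ler_pM=> //;rewrite ?mulr_ge0 ?sqrtr_ge0// ler_wpM2r.
lra.
Qed.

Lemma csupp_extj U M : 0 <= M -> csupp M (U [::]) -> csupp (2 * M) (extj U [::]).
Proof.
move=> M0 UM.
have UM' : csupp M ((U [::]) \_ hsp).
 by move=> x /UM e;rewrite /patch;case:ifP.
move=> x Mx;rewrite /extj /ext !fctE /=.
have n1 : 1 <= `|-1 : R| by rewrite normrN normr1.
have Mx1 : M < `|x| by apply:le_lt_trans Mx;rewrite ler_peMl// ler1n.
rewrite (UM' x Mx1).
have -> : ((U [::]) \_ hsp) (sc (-1) x) = 0:= csupp_sc n1 UM' Mx1.
have -> : ((U [::]) \_ hsp) (sc (- 2^-1) x) = 0:= csupp_sc_half M0 UM' Mx.
by rewrite !scaler0 !addr0.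
Qed.

End reflection.

Section perm.
Context (R : realType) (n : nat).
Notation V:= 'rV[R]_n.
Notation mu:= (lebesgue_rV R n).
Implicit Types (D : set V) (phi : V -> R) (U W : seq 'I_n -> V -> R).

Lemma pderiv_perm s t phi : smooth phi -> perm_eq s t -> pderiv s phi = pderiv t phi.
Proof.
move=> Sp;elim: s t=> [|i s IH] t st.
 by move: st;rewrite perm_sym=> /perm_nilP ->.
have it : i \in t by rewrite -(perm_mem st) mem_head.
case/splitPr: it st=> t1 t2 st.
have st' : perm_eq s (t1 ++ t2).
 by rewrite -(perm_cons i);apply:perm_trans st _;rewrite perm_catC /= perm_cons perm_catC.
rewrite -[pderiv (i :: s) phi]/(pderiv [:: i] (pderiv s phi)) (IH _ st').
rewrite -[in RHS]cat1s !pderiv_cat -smooth_pderivC//;exact:smooth_pd.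
Qed.

(** Derivatives of test functions commute, hence both members have the same integrals against test
    functions and agree almost everywhere. *)
Lemma jet_perm k D U s t : open D -> jet k D U -> (size s <= k)%N -> perm_eq s t ->
 nrm mu D (U s) = nrm mu D (U t).
Proof.
move=> oD jU sk st;have tk : (size t <= k)%N by rewrite -(perm_size st).
have mD:= open_meas oD;have [sU _] := jU.
apply:ae_eq_nrm (sU s sk) (sU t tk) _=> //.
have v : ae_eq mu D (U s - U t) (cst 0).
 apply:vanish=> //;first by apply:sqiB;[|exact:sU|exact:sU].
 move=> phi tp;have s0:= sqiT mD (sqi_test [::] tp).
 rewrite (dotBl mD (sU s sk) (sU t tk) s0) (jet_dot jU sk tp) (jet_dot jU tk tp).
 by rewrite (pderiv_perm (proj1 tp) st) (perm_size st) subrr.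
by apply:filterS v=> x h /h /eqP;rewrite subr_eq0=> /eqP.
Qed.

End perm.

(** * Constant coefficient estimates in the whole space *)

Section fullspace.
Context (R : realType) (n : nat).
Notation V:= 'rV[R]_n.
Notation mu:= (lebesgue_rV R n).
Notation nT:= (nrm mu setT).
Notation dT:= (dot mu setT).
Implicit Types (phi : V -> R) (U W : seq 'I_n -> V -> R) (A y : 'M[R]_n).

(** Two integrations by parts move l to the right and p to the left. This exchange of the middle
    indices is all that the estimates below use of phi. *)
Lemma swap_dot phi M (k l p q : 'I_n) : smooth phi -> csupp M phi ->
 dT (pderiv [:: k;l] phi) (pderiv [:: p;q] phi) = dT (pderiv [:: k;p] phi) (pderiv [:: l;q] phi).
Proof.
move=> Sp pM.
have S1 s : C_k 1 (pderiv s phi) := smooth_pd s Sp 1%N.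
have cM s:= pd_csupp s pM.
have pe (a b : 'I_n) : perm_eq [:: a;b] [:: b;a].
 by rewrite -[[:: a;b]]/([:: a] ++ [:: b]) perm_catC.
have -> : pderiv [:: k;l] phi = pderiv [:: l;k] phi.
 exact:pderiv_perm.
have -> : pderiv [:: k;p] phi = pderiv [:: p;k] phi.
 exact:pderiv_perm.
have h1 : dT (pderiv [:: l;k] phi) (pderiv [:: p;q] phi) = - dT (pderiv [:: k] phi) (pderiv [:: l;p;q] phi) := IBP 'e_l (S1 [:: k]) (S1 [:: p;q]) (cM [:: k]) (cM [:: p;q]).
have h2 : dT (pderiv [:: p;k] phi) (pderiv [:: l;q] phi) = - dT (pderiv [:: k] phi) (pderiv [:: p;l;q] phi) := IBP 'e_p (S1 [:: k]) (S1 [:: l;q]) (cM [:: k]) (cM [:: l;q]).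
have e : pderiv [:: l;p;q] phi = pderiv [:: p;l;q] phi.
 apply:pderiv_perm=> //;have:= pe l p;rewrite -(perm_cat2r [:: q]);exact.
exact:(etrans h1 (etrans (congr1 (fun f=> - dT (pderiv [:: k] phi) f) e) (esym h2))).
Qed.

Definition opA A U : seq 'I_n -> V -> R:= fun s=> \sum_k \sum_l A k l *: U (s ++ [:: k;l]).

Lemma jet_opA k D A U : open D -> jet k.+2 D U -> jet k D (opA A U).
Proof.
move=> oD jU.
have H : jet k D (sumj (index_enum _) (fun i=> sumj (index_enum _) (fun l=> scalej (A i l) (shiftj [:: i;l] U)))).
 apply:jet_sum=> // i;apply:jet_sum=> // l;apply:jet_scale=> //.
 by apply:jet_shift;rewrite addn2.
exact:H.
Qed.

Lemma sum3 (I : finType) (T : nmodType) (F : I -> I -> I -> T) :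
 \sum_m \sum_s \sum_x F m s x = \sum_x \sum_m \sum_s F m s x.
Proof. by under eq_bigr do rewrite exchange_big;rewrite exchange_big. Qed.

(** For the fields X_m = sum_k y_mk D_k and the operator A = sum_m X_m^2, this is the algebra behind
    |A phi|^2 = sum_{m,s} |X_m X_s phi|^2. *)
Lemma quad_swap y (q : 'I_n -> 'I_n -> 'I_n -> 'I_n -> R) :
 (forall k l p r, q k l p r = q k p l r) ->
 \sum_k \sum_l \sum_p \sum_r ((y^T *m y) k l * (y^T *m y) p r * q k l p r) =
 \sum_m \sum_s \sum_k \sum_p \sum_l \sum_r (y m k * y s p * (y m l * y s r) * q k p l r).
Proof.
move=> sw;rewrite [RHS]sum3;apply:eq_bigr=> k _.
rewrite [LHS]exchange_big [RHS]sum3;apply:eq_bigr=> p _.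
rewrite [RHS]sum3;apply:eq_bigr=> l _;rewrite [RHS]sum3;apply:eq_bigr=> r _.
rewrite !mxE big_distrlr mulr_suml;apply:eq_bigr=> m _;rewrite mulr_suml.
apply:eq_bigr=> s _;rewrite !mxE sw;congr (_ * _);exact:mulrACA.
Qed.

Section elliptic.
Variables (y : 'M[R]_n) (yu : y \in unitmx).
Let A:= y^T *m y.
Let z:= invmx y.
Let C:= \sum_k \sum_l \sum_m \sum_s `|z k m * z l s|.

Lemma dot_sum2 (c d : 'I_n -> 'I_n -> R) (P : 'I_n -> 'I_n -> V -> R) :
 (forall k l, sqi mu setT (P k l)) ->
 dT (\sum_k \sum_p c k p *: P k p) (\sum_k \sum_p d k p *: P k p) =
 \sum_k \sum_p \sum_l \sum_r (c k p * d l r * dT (P k p) (P l r)).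
Proof.
move=> s2;have mT:= @measurableT _ V.
have sz a k p : sqi mu setT (a *: P k p) by exact:sqiZ.
have sd k : sqi mu setT (\sum_p d k p *: P k p) by apply:sqi_sum.
have sc k : sqi mu setT (\sum_p c k p *: P k p) by apply:sqi_sum.
have sdd : sqi mu setT (\sum_k \sum_p d k p *: P k p) by apply:sqi_sum.
rewrite dot_suml//;apply:eq_bigr=> k _;rewrite dot_suml//.
apply:eq_bigr=> p _;rewrite dotC dot_suml//.
apply:eq_bigr=> l _;rewrite dot_suml//.
by apply:eq_bigr=> r _;rewrite dotZl// dotZr// mulrA (mulrC (d l r)) dotC.
Qed.

Section abstract.
Variable P : 'I_n -> 'I_n -> V -> R.
Hypothesis sP : forall k l, sqi mu setT (P k l).
Hypothesis swP : forall k l p r, dT (P k l) (P p r) = dT (P k p) (P l r).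
Let X m s : V -> R:= \sum_k \sum_p (y m k * y s p) *: P k p.
Let N:= nT (\sum_k \sum_l A k l *: P k l).

Let XA : N ^+ 2 = \sum_m \sum_s nT (X m s) ^+ 2.
Proof.
rewrite sqr_nrm (dot_sum2 _ _ sP) (quad_swap y (q:= fun k l p r=> dT (P k l) (P p r)))//.
apply:eq_bigr=> m _;apply:eq_bigr=> s _.
by rewrite sqr_nrm (dot_sum2 _ _ sP).
Qed.

(** By [XA] each |X_m X_s phi| is at most N. Inverting y recovers D_k D_l phi from the X_m X_s phi,
    with coefficients whose absolute values are summed up in C. *)
Lemma abstract_elliptic k l : nT (P k l) <= C * N.
Proof.
have N0 : 0 <= N by exact:nrm_ge0.
have mT:= @measurableT _ V.
have sX m s : sqi mu setT (X m s).
 by apply:sqi_sum=> // i _;apply:sqi_sum=> // p _;exact:sqiZ.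
have XN m s : nT (X m s) <= N.
 rewrite -(ler_pXn2r (n:= 2)) ?nnegrE ?nrm_ge0// XA.
 rewrite (bigD1 m) //= (bigD1 s) //= -addrA lerDl;apply:addr_ge0.
  by apply:sumr_ge0=> j _;exact:sqr_ge0.
 by do 2 (apply:sumr_ge0=> ? _);exact:sqr_ge0.
have zy i j : \sum_m z i m * y m j = (i == j)%:R.
 by have:= congr1 (fun B : 'M[R]_n=> B i j) (mulVmx yu);rewrite !mxE.
have E : P k l = \sum_m \sum_s (z k m * z l s) *: X m s.
 apply/esym;rewrite /X.
 transitivity (\sum_i \sum_p ((\sum_m z k m * y m i) * (\sum_s z l s * y s p)) *: P i p).
  under eq_bigr do under eq_bigr do rewrite scaler_sumr.
  rewrite sum3;apply:eq_bigr=> i _.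
  under eq_bigr do under eq_bigr do rewrite scaler_sumr.
  rewrite sum3;apply:eq_bigr=> p _;rewrite big_distrlr scaler_suml.
  apply:eq_bigr=> m _;rewrite scaler_suml;apply:eq_bigr=> s _.
  by rewrite scalerA mulrACA.
 rewrite (bigD1 k) //= (bigD1 l) //= !zy !eqxx mulr1 scale1r.
 rewrite big1=> [|p pl];last by rewrite !zy eq_sym (negPf pl) mulr0 scale0r.
 rewrite addr0 big1 ?addr0// => i ik;apply:big1=> p _.
 by rewrite !zy eq_sym (negPf ik) mul0r scale0r.
rewrite E;apply:le_trans (nrm_sum _ mT _) _=> [m _|].
 by apply:sqi_sum=> // s _;exact:sqiZ.
apply:(@le_trans _ _ (\sum_m \sum_s `|z k m * z l s| * N)).
 apply:ler_sum=> m _;apply:le_trans (nrm_sum _ mT _) _=> [s _|];first exact:sqiZ.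
 by apply:ler_sum=> s _;rewrite nrmZ// ler_wpM2l.
under eq_bigr do rewrite -mulr_suml.
rewrite -mulr_suml ler_wpM2r//.
pose S i j:= \sum_m \sum_s `|z i m * z j s|.
have S0 i j : 0 <= S i j by do 2 (apply:sumr_ge0=> ? _).
have : S k l <= \sum_i \sum_j S i j.
 rewrite (bigD1 k) //= (bigD1 l) //= -addrA lerDl addr_ge0//;first by apply:sumr_ge0.
 by do 2 (apply:sumr_ge0=> ? _).
by [].
Qed.

End abstract.

Lemma elliptic_const_ge0 : 0 <= C.
Proof. by do 4 (apply:sumr_ge0=> ? _). Qed.

Lemma full_elliptic W M k l : jet 2 setT W -> csupp M (W [::]) ->
 nT (W [:: k;l]) <= C * nT (opA A W [::]).
Proof.
move=> jW WM;have [phi [Sp _ pM cp]] := jet_moll jW WM.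
have [sW _] := jW;have mT:= @measurableT _ V.
pose P m i j:= pderiv [:: i;j] (phi m).
have s2 m i j : sqi mu setT (P m i j) := sqi_C1 (smooth_pd _ (Sp m) 1%N) (pd_csupp _ (pM m)).
have cP i j : nT (P m i j - W [:: i;j]) @[m --> \oo] --> 0:= cp [:: i;j] isT.
have sw m i j p q : dT (P m i j) (P m p q) = dT (P m i p) (P m j q) := swap_dot i j p q (Sp m) (pM m).
clearbody P.
have sA m : sqi mu setT (\sum_i \sum_j A i j *: P m i j).
 by apply:sqi_sum=> // i _;apply:sqi_sum=> // j _;exact:sqiZ.
have sO : sqi mu setT (opA A W [::]).
 by apply:sqi_sum=> // i _;apply:sqi_sum=> // j _;apply:sqiZ=> //;exact:sW.
have c1:= cvg_nrm mT (fun m=> s2 m k l) (sW [:: k;l] isT) (cP k l).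
have c2 : nT (\sum_i \sum_j A i j *: P m i j - opA A W [::]) @[m --> \oo] --> 0.
 have c3 : (\sum_i \sum_j `|A i j| * nT (P m i j - W [:: i;j])) @[m --> \oo] --> (0 : R).
  apply:approx_sum=> i;apply:approx_sum=> j.
  have : `|A i j| * nT (P m i j - W [:: i;j]) @[m --> \oo] --> (`|A i j| * 0 : R).
   by apply:cvgMr;exact:cP.
  by rewrite mulr0.
 apply:(mono_cvg0 _ c3)=> m;rewrite nrm_ge0 /= /opA -sumrB.
 under [X in nT X]eq_bigr do rewrite -sumrB.
 have sd i j : sqi mu setT (A i j *: P m i j - A i j *: W [:: i;j]).
  by apply:sqiB=> //;apply:sqiZ=> //;exact:sW.
 apply:le_trans (nrm_sum _ mT _) _=> [i _|];first by apply:sqi_sum.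
 apply:ler_sum=> i _;apply:le_trans (nrm_sum _ mT _) _=> [j _|];first exact:sd.
 apply:ler_sum=> j _;rewrite -scalerBr nrmZ//.
 by apply:sqiB=> //;exact:sW.
have c4:= cvg_nrm mT sA sO c2.
have c5 : C * nT (\sum_i \sum_j A i j *: P m i j) @[m --> \oo] --> (C * nT (opA A W [::]) : R) by apply:cvgMr;exact:c4.
apply:(ler_cvg_to c1 c5).
by apply:nearW=> m;exact:abstract_elliptic (s2 m) (sw m) k l.
Qed.

End elliptic.

(** By [swap_dot], |D_i D_j phi|^2 is the product of D_i D_i phi and D_j D_j phi in L^2;
    Cauchy-Schwarz and mollification conclude. *)
Lemma full_interp2 W M (i j : 'I_n) : jet 2 setT W -> csupp M (W [::]) ->
 nT (W [:: i;j]) ^+ 2 <= nT (W [:: i;i]) * nT (W [:: j;j]).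
Proof.
move=> jW WM;have [phi [Sp _ pM cp]] := jet_moll jW WM.
have [sW _] := jW;have mT:= @measurableT _ V.
pose P m i j:= pderiv [:: i;j] (phi m).
have s2 m a b : sqi mu setT (P m a b) := sqi_C1 (smooth_pd _ (Sp m) 1%N) (pd_csupp _ (pM m)).
have cP a b : nT (P m a b - W [:: a;b]) @[m --> \oo] --> 0:= cp [:: a;b] isT.
have sw m a b p q : dT (P m a b) (P m p q) = dT (P m a p) (P m b q) := swap_dot a b p q (Sp m) (pM m).
clearbody P.
have c a b:= cvg_nrm mT (fun m=> s2 m a b) (sW [:: a;b] isT) (cP a b).
have c1 : nT (P m i j) * nT (P m i j) @[m --> \oo] --> (nT (W [:: i;j]) * nT (W [:: i;j]) : R) by exact:cvgM.
have c2 : nT (P m i i) * nT (P m j j) @[m --> \oo] --> (nT (W [:: i;i]) * nT (W [:: j;j]) : R) by exact:cvgM.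
rewrite expr2;apply:(ler_cvg_to c1 c2).
apply:nearW=> m;rewrite -expr2 sqr_nrm sw.
by apply:le_trans (ler_norm _) _;exact:dot_CS.
Qed.

Lemma full_interp1 W M i : jet 2 setT W -> csupp M (W [::]) ->
 nT (W [:: i]) ^+ 2 <= nT (W [::]) * nT (W [:: i;i]).
Proof.
move=> jW WM;have [phi [Sp _ pM cp]] := jet_moll jW WM.
have [sW _] := jW;have mT:= @measurableT _ V.
have s2 m t : sqi mu setT (pderiv t (phi m)) := sqi_C1 (smooth_pd t (Sp m) 1%N) (pd_csupp t (pM m)).
have c t tk:= cvg_nrm mT (fun m=> s2 m t) (sW t tk) (cp t tk).
have ci:= c [:: i] isT;have c0:= c [::] isT;have cii:= c [:: i;i] isT.
have c1 : nT (pderiv [:: i] (phi m)) * nT (pderiv [:: i] (phi m)) @[m --> \oo] --> (nT (W [:: i]) * nT (W [:: i]) : R) by exact:cvgM.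
have c2 : nT (pderiv [::] (phi m)) * nT (pderiv [:: i;i] (phi m)) @[m --> \oo] --> (nT (W [::]) * nT (W [:: i;i]) : R) by exact:cvgM.
rewrite expr2;apply:(ler_cvg_to c1 c2).
apply:nearW=> m.
have h : dT (pderiv [:: i] (phi m)) (pderiv [:: i] (phi m)) = - dT (phi m) (pderiv [:: i;i] (phi m)) :=
 IBP 'e_i (Sp m 1%N) (smooth_pd [:: i] (Sp m) 1%N) (pM m) (pd_csupp [:: i] (pM m)).
have h2:= dot_CS mT (s2 m [::]) (s2 m [:: i;i]).
move: h h2;rewrite -[pderiv [::] (phi m)]/(phi m).
move: (pderiv [:: i] (phi m)) (pderiv [:: i;i] (phi m)) (phi m)=> P1 P2 P0 h h2.
rewrite -expr2 sqr_nrm h;apply:le_trans h2;apply:le_trans (ler_norm _) _.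
by rewrite normrN.
Qed.

End fullspace.

(** * The fourth order estimate in the half space, constant coefficients *)

Section flat.
Context (R : realType) (n : nat).
Notation V:= 'rV[R]_n.+1.
Notation mu:= (lebesgue_rV R n.+1).
Notation hsp:= (@hsp R n).
Notation nH:= (nrm mu hsp).
Notation nT:= (nrm mu setT).
Implicit Types (phi : V -> R) (U W : seq 'I_n.+1 -> V -> R) (y : 'M[R]_n.+1).

Let oH : open hsp:= @open_half R n.
Let mH : measurable hsp:= open_meas oH.

(** The inequality of the whole space applied to the reflected jet; 144 is the square of the
    constant of [nrm_extj]. *)
Lemma half_interp2 U M i j : 0 <= M -> jet 2 hsp U -> csupp M (U [::]) ->
 nH (U [:: i;j]) ^+ 2 <= 144 * (nH (U [:: i;i]) * nH (U [:: j;j])).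
Proof.
move=> M0 jU UM;have [sU _] := jU.
have:= full_interp2 i j (jet_ext jU) (csupp_extj M0 UM).
have /andP[a1 _] := nrm_extj (sU [:: i;j] isT).
have /andP[_ a2] := nrm_extj (sU [:: i;i] isT).
have /andP[_ a3] := nrm_extj (sU [:: j;j] isT).
have p1:= nrm_ge0 mu hsp (U [:: i;j]).
have p2:= nrm_ge0 mu setT (extj U [:: i;i]).
have p3:= nrm_ge0 mu setT (extj U [:: j;j]).
move=> h;have h1 : nH (U [:: i;j]) ^+ 2 <= nT (extj U [:: i;j]) ^+ 2 by rewrite ler_pXn2r ?nnegrE ?nrm_ge0.
apply:le_trans h1 (le_trans h _);apply:le_trans (ler_pM p2 p3 a2 a3) _.
by rewrite le_eqVlt;apply/orP;left;apply/eqP;ring.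
Qed.

Lemma half_interp1 U M i : 0 <= M -> jet 2 hsp U -> csupp M (U [::]) ->
 nH (U [:: i]) ^+ 2 <= 144 * (nH (U [::]) * nH (U [:: i;i])).
Proof.
move=> M0 jU UM;have [sU _] := jU.
have:= full_interp1 i (jet_ext jU) (csupp_extj M0 UM).
have /andP[a1 _] := nrm_extj (sU [:: i] isT).
have /andP[_ a2] := nrm_extj (sU [::] isT).
have /andP[_ a3] := nrm_extj (sU [:: i;i] isT).
have p2:= nrm_ge0 mu setT (extj U [::]).
have p3:= nrm_ge0 mu setT (extj U [:: i;i]).
move=> h;have h1 : nH (U [:: i]) ^+ 2 <= nT (extj U [:: i]) ^+ 2 by rewrite ler_pXn2r ?nnegrE ?nrm_ge0.
apply:le_trans h1 (le_trans h _);apply:le_trans (ler_pM p2 p3 a2 a3) _.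
by rewrite le_eqVlt;apply/orP;left;apply/eqP;ring.
Qed.

(* AM-GM *)
Lemma sqr_le_mul (x a b c e : R) : 0 <= a -> 0 <= b -> 0 <= c -> 0 < e -> x ^+ 2 <= c * (a * b) ->
 x <= e * b + c / e * a.
Proof.
move=> a0 b0 c0 e0 h;have ei : 0 < e^-1 by rewrite invr_gt0.
have r0 : 0 <= e * b + c / e * a by rewrite addr_ge0// ?mulr_ge0// ltW.
have [x0|x0] := leP x 0;first exact:le_trans x0 r0.
rewrite -(ler_pXn2r (n:= 2)) ?nnegrE ?(ltW x0)//;apply:le_trans h _.
have -> : c * (a * b) = (e * b) * (c / e * a).
 by rewrite mulrCA;field;rewrite gt_eqF.
have p0 : 0 <= e * b by rewrite mulr_ge0// ltW.
have q0 : 0 <= c / e * a by rewrite !mulr_ge0// ltW.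
move: p0 q0;move: (e * b) (c / e * a)=> p q *;nra.
Qed.

Lemma flat_interp U M s i (e : R) : 0 <= M -> 0 < e -> jet 4 hsp U -> (forall t, csupp M (U t)) -> size s = 2%N ->
 nH (U (i :: s)) <= e * nH (U [:: i, i & s]) + 144 / e * nH (U s).
Proof.
move=> M0 e0 jU UM ss.
have jG : jet 2 hsp (shiftj s U) by apply:jet_shift;rewrite ss.
have:= half_interp1 i M0 jG (UM s);rewrite /shiftj /=.
by apply:sqr_le_mul=> //;exact:nrm_ge0.
Qed.

(** Integration by parts in a tangential direction leaves no boundary term, so that it commutes with
    extension by 0, whatever the trace. *)
Lemma tangential_jet U k i : i != ord0 -> jet k.+1 hsp U ->
 forall s, (size s <= k)%N -> wd setT i ((U s) \_ hsp) ((U (i :: s)) \_ hsp).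
Proof.
move=> i0 [sU wU] s sk phi tp;have [N pN] := test_csupp tp.
rewrite -!dot_patchl;apply:(half_IBP (sU s (leqW sk)) (sU (i :: s) sk) (wU s i sk) (proj1 tp) pN).
by move=> e;rewrite e eqxx in i0.
Qed.

Lemma patchZ (c : R) (f : V -> R) D : (c *: f) \_ D = c *: (f \_ D).
Proof. by apply/funext=> x;rewrite /patch !fctE;case:ifP;rewrite ?scaler0. Qed.

Lemma patch_sum (I : Type) (r : seq I) (F : I -> V -> R) D :
 (\sum_(i <- r) F i) \_ D = \sum_(i <- r) ((F i) \_ D).
Proof.
elim: r=> [|i r IH];first by rewrite !big_nil;apply/funext=> x;rewrite /patch;case:ifP.
rewrite !big_cons -IH;apply/funext=> x;rewrite /patch !fctE;case:ifP=> // _.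
by rewrite addr0.
Qed.

Section estimate.
Variables (y : 'M[R]_n.+1) (yu : y \in unitmx).
Let A:= y^T *m y.
Let Ce:= \sum_k \sum_l \sum_m \sum_s `|(invmx y) k m * (invmx y) l s|.
Let Ce0 : 0 <= Ce:= elliptic_const_ge0 y.
Variables (U : seq 'I_n.+1 -> V -> R) (M : R).
Hypothesis M0 : 0 <= M.
Hypothesis jU : jet 4 hsp U.
Hypothesis UM : forall s, csupp M (U s).
Hypothesis jU0 : jet 2 setT (fun s=> (U s) \_ hsp).
Let K:= nH (opA A (opA A U) [::]).

Let sU s : (size s <= 4)%N -> sqi mu hsp (U s) := proj1 jU s.

Section tangential.
Variables (i j : 'I_n.+1) (i0 : i != ord0) (j0 : j != ord0).
Let W s:= (U [:: i, j & s]) \_ hsp.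

(** Although U has zero trace only to second order, W is a jet of the whole space: tested against
    phi, the tangential derivatives i and j move over to phi, and what remains is the extension of
    U, a jet by [jU0]. *)
Let jW : jet 2 setT W.
Proof.
split=> [s sk|s k sk phi tp];first by apply/(sqi_patch _ mH);exact:sU.
have t2:= test_pderiv [:: j] (test_pderiv [:: i] tp).
have ti:= test_pderiv [:: i] tp.
have [_ w0] := jU0.
have D s' psi : (size s' <= 2)%N -> test_function setT psi ->
  dot mu setT (W s') psi = dot mu setT ((U s') \_ hsp) (pderiv [:: j;i] psi).
 move=> sk' tpsi.
 have h1 : dot mu setT ((U (j :: s')) \_ hsp) (pderiv [:: i] psi) = - dot mu setT (W s') psi :=
  tangential_jet i0 jU (s:= j :: s') sk' tpsi.
 have h2 : dot mu setT ((U s') \_ hsp) (pderiv [:: j;i] psi) =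
   - dot mu setT ((U (j :: s')) \_ hsp) (pderiv [:: i] psi) :=
  tangential_jet j0 jU (s:= s') (leqW sk') (test_pderiv [:: i] tpsi).
 exact:(esym (etrans h2 (etrans (congr1 -%R h1) (opprK _)))).
have D1:= D s _ (ltnW sk) (test_pderiv [:: k] tp).
have D2:= D (k :: s) _ sk tp.
have e:= smooth_pderivC [:: j;i] [:: k] (proj1 tp).
have w1 : dot mu setT ((U s) \_ hsp) (pderiv [:: k] (pderiv [:: j;i] phi)) =
 - dot mu setT ((U (k :: s)) \_ hsp) (pderiv [:: j;i] phi) := w0 s k sk _ t2.
exact:(etrans D1 (etrans (congr1 (dot mu setT _) e) (etrans w1 (congr1 -%R (esym D2))))).
Qed.

Let AW : opA A W [::] = (opA A U [:: i;j]) \_ hsp.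
Proof.
rewrite /opA patch_sum;apply:eq_bigr=> k _;rewrite patch_sum;apply:eq_bigr=> l _.
by rewrite patchZ.
Qed.

Let jA : jet 2 hsp (opA A U) := jet_opA A oH jU.
Let jAA : jet 0 hsp (opA A (opA A U)) := jet_opA A oH jA.

Let sAij : sqi mu hsp (opA A U [:: i;j]) := proj1 jA [:: i;j] isT.

(** Inside the half space both sides are the pairing of A u with A D_i D_j phi. *)
Let dual phi : test_function hsp phi ->
 dot mu hsp (opA A U [:: i;j]) (\sum_k \sum_l A k l *: pderiv [:: k;l] phi) =
 dot mu hsp (opA A (opA A U) [::]) (pderiv [:: i;j] phi).
Proof.
move=> tp;have sp s : sqi mu hsp (pderiv s phi).
 exact:sqiT mH (sqi_test s tp).
have sA s : (size s <= 2)%N -> sqi mu hsp (opA A U s) := proj1 jA s.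
have E k l : dot mu hsp (opA A U [:: i;j]) (pderiv [:: k;l] phi) =
  dot mu hsp (opA A U [:: k;l]) (pderiv [:: i;j] phi).
 rewrite (jet_dot jA (s:= [:: i;j]) isT (test_pderiv _ tp)).
 rewrite (jet_dot jA (s:= [:: k;l]) isT (test_pderiv _ tp)).
 by rewrite (smooth_pderivC [:: i;j] [:: k;l] (proj1 tp)).
have sz k l : sqi mu hsp (A k l *: pderiv [:: k;l] phi) by apply:sqiZ.
have sz' k l : sqi mu hsp (A k l *: opA A U [:: k;l]) by apply:sqiZ=> //;exact:sA.
have s1 k : sqi mu hsp (\sum_l A k l *: pderiv [:: k;l] phi) by apply:sqi_sum.
have s1' k : sqi mu hsp (\sum_l A k l *: opA A U [:: k;l]) by apply:sqi_sum.
rewrite dotC dot_suml// {2}/opA dot_suml//;apply:eq_bigr=> k _.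
rewrite dot_suml// dot_suml//;apply:eq_bigr=> l _.
rewrite dotZl// dotZl//;last exact:sA.
by rewrite dotC E.
Qed.

(** W is a limit of test functions phi_m of the half space, so that |A W|^2 is the limit of (A D_i
    D_j u, A phi_m) = (A^2 u, D_i D_j phi_m). This is at most K |D_i D_j W| <= K Ce |A W| by the
    elliptic estimate, and one factor |A W| cancels. *)
Let Wle : nT (opA A W [::]) <= Ce * K.
Proof.
have WM : csupp M (W [::]) by move=> x /UM e;rewrite /W /patch e;case:ifP.
have W0 (x : V) : x ord0 ord0 <= 0 -> W [::] x = 0.
 by move=> x0;rewrite /W /patch memNset// /hsp /= => h;move: x0;rewrite leNgt h.
have [phi [tp cp]] := half_approx jW WM W0.
have mT:= @measurableT _ V.
have sp m s : sqi mu setT (pderiv s (phi m)) := sqi_test s (tp m).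
have [sW _] := jW.
have sAW : sqi mu setT (opA A W [::]) by rewrite AW;apply/(sqi_patch _ mH).
pose Ap m:= \sum_k \sum_l A k l *: pderiv [:: k;l] (phi m).
have sz m k l : sqi mu setT (A k l *: pderiv [:: k;l] (phi m)) by apply:sqiZ.
have sAp m : sqi mu setT (Ap m).
 by apply:sqi_sum=> // k _;exact:sqi_sum.
have c2 : nT (Ap m - opA A W [::]) @[m --> \oo] --> 0.
 have c3 : (\sum_k \sum_l `|A k l| * nT (pderiv [:: k;l] (phi m) - W [:: k;l])) @[m --> \oo] --> (0 : R).
  apply:approx_sum=> k;apply:approx_sum=> l.
  have : `|A k l| * nT (pderiv [:: k;l] (phi m) - W [:: k;l]) @[m --> \oo] --> (`|A k l| * 0 : R).
   by apply:cvgMr;exact:(cp [:: k;l] isT).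
  by rewrite mulr0.
 apply:(mono_cvg0 _ c3)=> m;rewrite nrm_ge0 /= /Ap /opA -sumrB.
 under [X in nT X]eq_bigr do rewrite -sumrB.
 have sd k l : sqi mu setT (A k l *: pderiv [:: k;l] (phi m) - A k l *: W [:: k;l]).
  by apply:sqiB=> //;apply:sqiZ=> //;exact:sW.
 apply:le_trans (nrm_sum _ mT _) _=> [k _|];first by apply:sqi_sum.
 apply:ler_sum=> k _;apply:le_trans (nrm_sum _ mT _) _=> [l _|];first exact:sd.
 apply:ler_sum=> l _;rewrite -scalerBr nrmZ//.
 by apply:sqiB=> //;exact:sW.
have d1:= cvg_dot mT sAp sAW sAW c2.
have n1:= cvg_nrm mT (fun m=> sp m [:: i;j]) (sW [:: i;j] isT) (cp [:: i;j] isT).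
have n2 : K * nT (pderiv [:: i;j] (phi m)) @[m --> \oo] --> (K * nT (W [:: i;j]) : R) by apply:cvgMr.
have le m : dot mu setT (Ap m) (opA A W [::]) <= K * nT (pderiv [:: i;j] (phi m)).
 rewrite AW dotC -dot_patchl (dual (tp m));apply:le_trans (ler_norm _) _.
 have spH : sqi mu hsp (pderiv [:: i;j] (phi m)).
  exact:sqiT mH (sp m [:: i;j]).
 apply:le_trans (dot_CS mH (proj1 jAA [::] isT) spH) _.
 by rewrite ler_wpM2l ?nrm_ge0//;apply:nrm_subset=> //;exact:sp.
have h : nT (opA A W [::]) ^+ 2 <= K * nT (W [:: i;j]).
 by rewrite sqr_nrm;exact:(ler_cvg_to d1 n2 (nearW _ le)).
have h2:= full_elliptic yu i j jW WM.
have N0:= nrm_ge0 mu setT (opA A W [::]);have K0 : 0 <= K:= nrm_ge0 _ _ _.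
have h3 : nT (opA A W [::]) * nT (opA A W [::]) <= Ce * K * nT (opA A W [::]).
 rewrite -expr2 (le_trans h)// (mulrC Ce) -mulrA;exact:ler_wpM2l.
have [e|n0] := eqVneq (nT (opA A W [::])) 0;first by rewrite e mulr_ge0.
by move: h3;rewrite ler_pM2r// lt_neqAle eq_sym n0.
Qed.

Lemma tangential_le k l : nH (U [:: i;j;k;l]) <= Ce ^+ 2 * K.
Proof.
have WM : csupp M (W [::]) by move=> x /UM e;rewrite /W /patch e;case:ifP.
have:= full_elliptic yu k l jW WM;rewrite {1}/W -nrm_patch=> h;apply:le_trans h _.
by rewrite expr2 -mulrA;apply:ler_wpM2l=> //;exact:Wle.
Qed.

End tangential.
Let X:= nH (U (nseq 4 ord0)).
Let K0 : 0 <= K:= nrm_ge0 _ _ _.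
Let X0 : 0 <= X:= nrm_ge0 _ _ _.

(** Interpolation for D_0 D_0 u between D_i D_i D_0 D_0 u, which has two tangential directions, and
    D_0^4 u, which gets the small factor e. *)
Let mixed_le i (e : R) : i != ord0 -> 0 < e -> nH (U [:: i;ord0;ord0;ord0]) <= e * X + 144 / e * (Ce ^+ 2 * K).
Proof.
move=> i0 e0.
have jG : jet 2 hsp (shiftj [:: ord0;ord0] U) by exact:jet_shift.
have:= half_interp2 i ord0 M0 jG (UM [:: ord0;ord0]);rewrite /shiftj /= => h.
apply:sqr_le_mul=> //;[by rewrite mulr_ge0// exprn_ge0|].
apply:le_trans h _;rewrite ler_wpM2l// ler_wpM2r//.
exact:tangential_le.
Qed.

(* Up to the order of the derivatives, either at least two of them are tangential, or one, or none. *)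
Let other_le s (e : R) : size s = 4%N -> s != nseq 4 ord0 -> 0 < e ->
 nH (U s) <= e * X + (144 / e + 1) * (Ce ^+ 2 * K).
Proof.
move=> s4 sn e0.
have Q0 : 0 <= Ce ^+ 2 * K by rewrite mulr_ge0// exprn_ge0.
have E0 : 0 <= 144 / e by rewrite divr_ge0// ltW.
pose p : pred 'I_n.+1:= fun i=> i != ord0.
have pe : perm_eq s (seq.filter p s ++ seq.filter (predC p) s) by rewrite perm_sym perm_filterC.
have fE : seq.filter (predC p) s = nseq (size (seq.filter (predC p) s)) ord0.
 apply/all_pred1P;apply/allP=> i;rewrite mem_filter /= /p negbK=> /andP[/eqP -> _].
 by rewrite eqxx.
have sz : (size (seq.filter p s) + size (seq.filter (predC p) s) = 4)%N by rewrite -size_cat -(perm_size pe).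
have fp : all p (seq.filter p s) := filter_all p s.
rewrite (jet_perm oH jU _ pe) ?s4//.
have hs : seq.filter p s = [::] -> s = nseq 4 ord0.
 move=> f0;rewrite -s4;apply/all_pred1P;apply/allP=> i si;apply/negPn/negP=> ni.
 have : i \in seq.filter p s by rewrite mem_filter si andbT.
 by rewrite f0.
move: hs fE sz fp.
move: (seq.filter p s) (seq.filter (predC p) s)=> [|i [|j r]] t hs fE sz fp.
- by rewrite hs ?eqxx in sn.
- have tz : size t = 3%N by case:sz.
 have -> : [:: i] ++ t = [:: i;ord0;ord0;ord0] by rewrite fE tz.
 move: fp;rewrite /= andbT=> i0;apply:le_trans (mixed_le i0 e0) _.
 by rewrite lerD2l ler_wpM2r// lerDl.
- case:sz=> sz;have : size (r ++ t) = 2%N by rewrite size_cat.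
 rewrite /= -/(cat r t);move: (r ++ t)=> [|k [|l [|//]]] // _.
 move: fp=> /and3P[i0 j0 _];apply:le_trans (tangential_le i0 j0 k l) _.
 have eX : 0 <= e * X by rewrite mulr_ge0// ltW.
 have Qe : 0 <= 144 / e * (Ce ^+ 2 * K) by rewrite mulr_ge0.
 by rewrite (mulrDl (144 / e)) mul1r;lra.
Qed.

Let a:= A ord0 ord0.

Let a0 : 0 < a.
Proof.
rewrite /a /A mxE lt_neqAle;apply/andP;split;last by apply:sumr_ge0=> j _;rewrite mxE -expr2 sqr_ge0.
apply/eqP=> /esym/eqP;rewrite psumr_eq0=> [|j _];last by rewrite mxE -expr2 sqr_ge0.
move=> /allP h;have y0 j : y j ord0 = 0.
 by have:= h j (mem_index_enum j);rewrite mxE /= mulf_eq0 orbb=> /eqP.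
have:= congr1 (fun B : 'M[R]_n.+1=> B ord0 ord0) (mulVmx yu);rewrite !mxE.
by rewrite big1=> [/eqP|j _];rewrite ?y0 ?mulr0// eqxx eq_sym oner_eq0.
Qed.

Let S:= \sum_k \sum_l \sum_p \sum_q `|A k l * A p q|.
Let S0 : 0 <= S. Proof. by do 4 (apply:sumr_ge0=> ? _). Qed.

(** Solves the equation for the pure normal derivative: a^2 D_0^4 u is A^2 u minus all the other
    fourth order terms. *)
Let normal_le (B : R) : 0 <= B -> (forall s, size s = 4%N -> s != nseq 4 ord0 -> nH (U s) <= B) ->
 a ^+ 2 * X <= K + S * B.
Proof.
move=> B0 hB.
pose T:= (('I_n.+1 * 'I_n.+1) * ('I_n.+1 * 'I_n.+1))%type.
pose c (t : T) := A t.1.1 t.1.2 * A t.2.1 t.2.2.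
pose F (t : T) : V -> R:= c t *: U [:: t.1.1;t.1.2;t.2.1;t.2.2].
have sF t : sqi mu hsp (F t) by apply:sqiZ=> //;exact:sU.
have E : opA A (opA A U) [::] = \sum_t F t.
 rewrite /opA pair_bigA /=.
 under eq_bigr do rewrite pair_bigA scaler_sumr /=.
 rewrite pair_bigA /=;apply:eq_bigr=> -[[k l] [p q]] _.
 by rewrite /F /c /= scalerA.
have ES : S = \sum_t `|c t|.
 rewrite /S pair_bigA /=;under eq_bigr do rewrite pair_bigA /=.
 by rewrite pair_bigA.
pose t0 : T:= ((ord0, ord0), (ord0, ord0)).
have sr : sqi mu hsp (\sum_(t | t != t0) F t) by exact:sqi_sum.
have EF : F t0 = opA A (opA A U) [::] - \sum_(t | t != t0) F t by rewrite E (bigD1 t0) //= addrK.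
have sO : sqi mu hsp (opA A (opA A U) [::]) by rewrite E;exact:sqi_sum.
have N0 : nH (F t0) = a ^+ 2 * X.
 have c0 : c t0 = a ^+ 2 by [].
 transitivity (`|c t0| * X);first by apply:nrmZ=> //;exact:sU.
 by rewrite c0 ger0_norm ?sqr_ge0.
rewrite -N0 EF;apply:le_trans (nrmB mH sO sr) _;rewrite lerD2l.
apply:le_trans (nrm_sum _ mH _) _=> //.
rewrite ES mulr_suml [leRHS](bigD1 t0) //=.
apply:(@le_trans _ _ (\sum_(t | t != t0) `|c t| * B));last by rewrite lerDr mulr_ge0.
apply:ler_sum=> t tn;have -> : nH (F t) = `|c t| * nH (U [:: t.1.1;t.1.2;t.2.1;t.2.2]).
 by apply:nrmZ=> //;exact:sU.
apply:ler_wpM2l=> //;apply:hB=> //;apply:contra tn.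
by case:t=> [[k l] [p q]] /= /eqP [-> -> -> ->].
Qed.

(** Chosen so that S e1 <= a^2 / 2: half of the left-hand side of [normal_le] absorbs the normal
    derivative brought back by the interpolation. *)
Let e1 : R:= a ^+ 2 / (2 * S + 1).
Definition flat_const : R:= (2 / a ^+ 2 * (1 + S * ((144 / e1 + 1) * Ce ^+ 2))) + e1 * (2 / a ^+ 2 * (1 + S * ((144 / e1 + 1) * Ce ^+ 2))) + (144 / e1 + 1) * Ce ^+ 2.

Let e10 : 0 < e1.
Proof. by rewrite divr_gt0 ?exprn_gt0// ltr_wpDl// mulr_ge0. Qed.

Lemma flat_const_ge0 : 0 <= flat_const.
Proof.
have q : 0 <= (144 / e1 + 1) * Ce ^+ 2 by rewrite mulr_ge0 ?exprn_ge0// addr_ge0// divr_ge0// ltW.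
have r : 0 <= 2 / a ^+ 2 * (1 + S * ((144 / e1 + 1) * Ce ^+ 2)).
 by rewrite mulr_ge0 ?divr_ge0 ?exprn_ge0 ?(ltW a0)// addr_ge0// mulr_ge0.
by rewrite /flat_const !addr_ge0// mulr_ge0// ltW.
Qed.

Lemma flat_estimate s : size s = 4%N -> nH (U s) <= flat_const * nH (opA A (opA A U) [::]).
Proof.
move=> s4;rewrite -/K;have ei : 0 < e1:= e10.
set q:= (144 / e1 + 1) * Ce ^+ 2.
have q0 : 0 <= q by rewrite mulr_ge0 ?exprn_ge0// addr_ge0// divr_ge0// ltW.
have B0 : 0 <= e1 * X + q * K by rewrite addr_ge0// mulr_ge0// ltW.
have hB s' : size s' = 4%N -> s' != nseq 4 ord0 -> nH (U s') <= e1 * X + q * K.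
 by move=> h h';have:= other_le h h' ei;rewrite mulrA.
have a20 : 0 < a ^+ 2 by rewrite exprn_gt0.
have hX : X <= 2 / a ^+ 2 * (1 + S * q) * K.
 have:= normal_le B0 hB.
 have hS : S * (e1 * X) <= a ^+ 2 / 2 * X.
  rewrite mulrA ler_wpM2r// /e1 mulrCA ler_pM2l//.
  rewrite ler_pdivrMr;last by rewrite ltr_wpDl// mulr_ge0.
  lra.
 rewrite mulrDr=> h.
 have h2 : a ^+ 2 * X <= 2 * ((1 + S * q) * K) by lra.
 rewrite -(ler_pM2l a20);apply:le_trans h2 _.
 by rewrite le_eqVlt;apply/orP;left;apply/eqP;field;rewrite gt_eqF.
set w:= 2 / a ^+ 2 * (1 + S * q) in hX *.
have w0 : 0 <= w by rewrite mulr_ge0 ?divr_ge0 ?exprn_ge0 ?(ltW a0)// addr_ge0// mulr_ge0.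
have -> : flat_const = w + e1 * w + q by [].
have hc : e1 * X <= e1 * (w * K) by rewrite ler_pM2l.
have wK : 0 <= w * K by rewrite mulr_ge0.
have qK : 0 <= q * K by rewrite mulr_ge0.
have ewK : 0 <= e1 * (w * K) by rewrite mulr_ge0// ltW.
rewrite !mulrDl -(mulrA e1).
have [->|sn] := eqVneq s (nseq 4 ord0);first by rewrite -/X;lra.
by have:= hB s s4 sn;lra.
Qed.

End estimate.
End flat.

Lemma derive_affine (R : realType) (m n : nat) (A : 'M[R]_(m, n)) (b : 'rV[R]_n)
  (f : 'rV[R]_n -> R) (x v : 'rV[R]_m) :
 'D_v (fun y : 'rV[R]_m=> f (y *m A + b)) x = 'D_(v *m A) f (x *m A + b).
Proof.
have E (h : R) : h^-1 *: (((fun x=> f (x *m A + b)) \o shift x) (h *: v) - f (x *m A + b)) =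
  h^-1 *: ((f \o shift (x *m A + b)) (h *: (v *m A)) - f (x *m A + b)).
 by rewrite /= mulmxDl scalemxAl addrA.
by rewrite /derive;under eq_fun do rewrite E.
Qed.

(** * Charts that flatten the boundary, and the chain rule in them *)

Section shear_calculus.
Context (R : realType) (n : nat).
Notation V:= 'rV[R]_n.+1.
Notation e0:= ('e_ord0 : V).
Implicit Types (gm : 'rV[R]_n -> R) (phi : V -> R) (z : V).

Definition colmx : 'M[R]_(n.+1, n) := col' ord0 1%:M.

Lemma mul_colmx z : z *m colmx = col' ord0 z.
Proof.
apply/rowP=> j;rewrite !mxE (bigD1 (lift ord0 j)) //= !mxE eqxx mulr1 big1 ?addr0// => k kj.
by rewrite !mxE (negPf kj) mulr0.
Qed.

Definition base gm z : R:= gm (col' ord0 z).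

Lemma baseE gm : base gm = (fun z=> gm (z *m colmx + 0)).
Proof. by apply/funext=> z;rewrite addr0 mul_colmx. Qed.

Lemma C_k_base k gm : C_k k gm -> C_k k (base gm).
Proof. by rewrite baseE;exact:C_k_affine. Qed.

Lemma base_shift gm z (t : R) : base gm (z + t *: e0) = base gm z.
Proof.
by congr gm;apply/rowP=> j;rewrite !mxE /= mulr0 addr0.
Qed.

Lemma derive0_base gm z : 'D_e0 (base gm) z = 0.
Proof.
have c0 : e0 *m colmx = 0 by rewrite mul_colmx;apply/rowP=> j;rewrite !mxE.
rewrite baseE derive_affine c0.
have E (h : R) : h^-1 *: ((gm \o shift (z *m colmx + 0)) (h *: 0) - gm (z *m colmx + 0)) = 0.
 by rewrite /= scaler0 add0r subrr scaler0.
by rewrite /derive;under eq_fun do rewrite E;rewrite lim_cst.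
Qed.

Lemma shearE gm z : shear gm z = z + base gm z *: e0.
Proof. by []. Qed.

Lemma shearK gm : cancel (shear gm) (shear (fun y=> - gm y)).
Proof.
by move=> z;rewrite [LHS]shearE /base col'_shear shearE /base scaleNr addrK.
Qed.

Lemma shearNK gm : cancel (shear (fun y=> - gm y)) (shear gm).
Proof.
by move=> z;rewrite [LHS]shearE /base col'_shear shearE /base scaleNr subrK.
Qed.

Lemma shear_differentiable gm z : C_k 1 gm ->
 differentiable (shear gm) z /\
 forall v, 'd (shear gm) z v = v + 'D_v (base gm) z *: e0.
Proof.
move=> Cg;have Cb:= C_k_base Cg.
have [db dbE] := C1_differentiable z Cb.
have dk : differentiable (fun z : V=> base gm z *: e0) z by exact:differentiableZl.
have di : differentiable (@id V) z by [].
have E : shear gm = id + (fun z : V=> base gm z *: e0) by [].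
split;first by rewrite E;exact:differentiableD.
move=> v.
have h1 : 'd (shear gm) z v = 'd (@id V) z v + 'd (fun z : V=> base gm z *: e0) z v :=
 congr1 (fun f=> f v) (diffD di dk).
have h2 : 'd (@id V) z v = v:= etrans (esym (deriveE v di)) (derive_id z v).
have h3 : 'd (fun z : V=> base gm z *: e0) z v = 'd (base gm) z v *: e0 :=
 congr1 (fun f=> f v) (diffZl e0 db).
have h4 : 'd (base gm) z v = 'D_v (base gm) z:= etrans (dbE v) (esym (C1_deriveE _ _ Cb)).
exact:(etrans h1 (congr2 +%R h2 (etrans h3 (congr1 (fun a=> a *: e0) h4)))).
Qed.

Lemma derive_shear gm phi z v : C_k 1 gm -> C_k 1 phi ->
 derivable (phi \o shear gm) z v /\
 'D_v (phi \o shear gm) z = 'D_v phi (shear gm z) + 'D_v (base gm) z * 'D_e0 phi (shear gm z).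
Proof.
move=> Cg Cp;have [ds dsE] := shear_differentiable z Cg.
have [dp dpE] := C1_differentiable (shear gm z) Cp.
have dc : differentiable (phi \o shear gm) z by exact:differentiable_comp.
split;first exact:diff_derivable.
have h1 : 'D_v (phi \o shear gm) z = 'd (phi \o shear gm) z v:= deriveE v dc.
have h2 : 'd (phi \o shear gm) z v = 'd phi (shear gm z) ('d (shear gm) z v) :=
 congr1 (fun f=> f v) (diff_comp ds dp).
have h3 : 'd phi (shear gm z) (v + 'D_v (base gm) z *: e0) =
  'd phi (shear gm z) v + 'D_v (base gm) z * 'd phi (shear gm z) e0.
 by rewrite linearD linearZ.
have h4 : 'D_v phi (shear gm z) = 'd phi (shear gm z) v:= deriveE v dp.
have h5 : 'D_e0 phi (shear gm z) = 'd phi (shear gm z) e0:= deriveE e0 dp.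
apply:(etrans h1 (etrans h2 (etrans (congr1 ('d phi (shear gm z)) (dsE v)) (etrans h3 _)))).
exact:(congr2 +%R (esym h4) (congr1 _ (esym h5))).
Qed.

Lemma continuous_shear gm : C_k 1 gm -> continuous (shear gm).
Proof. by move=> Cg z;apply:differentiable_continuous;have [] := shear_differentiable z Cg. Qed.

Lemma C1_shear gm phi : C_k 1 gm -> C_k 1 phi -> C_k 1 (phi \o shear gm).
Proof.
move=> Cg Cp;have cs:= continuous_shear Cg.
apply/C_kS;split.
- have cp : continuous phi:= C_k_cont Cp.
 by move=> z;apply:continuous_comp;[exact:cs|exact:cp].
- by move=> z i;have [] := derive_shear z 'e_i Cg Cp.
- move=> i;apply/C_k0.
 have -> : (fun x=> 'D_('e_i) (phi \o shear gm) x) = (fun x=> 'D_('e_i) phi (shear gm x) +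
  'D_('e_i) (base gm) x * 'D_e0 phi (shear gm x)).
  by apply/funext=> z;have [_] := derive_shear z 'e_i Cg Cp.
 have c1 : continuous (fun x=> 'D_('e_i) phi x) := C_k_cont (C_k_D i Cp).
 have c0 : continuous (fun x=> 'D_e0 phi x) := C_k_cont (C_k_D ord0 Cp).
 have cb : continuous (fun x=> 'D_('e_i) (base gm) x) := C_k_cont (C_k_D i (C_k_base Cg)).
 have H (f : V -> R) : continuous f -> continuous (f \o shear gm).
  by move=> cf z;apply:continuous_comp;[exact:cs|exact:cf].
 move=> z;have d1:= H _ c1 z;have d0:= H _ c0 z;have db:= cb z.
 exact:(cvgD d1 (cvgM db d0)).
Qed.

End shear_calculus.

Section chart.
Context (R : realType) (n : nat).
Notation V:= 'rV[R]_n.+1.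
Notation mu:= (lebesgue_rV R n.+1).
Notation e0:= ('e_ord0 : V).
Variables (P : 'M[R]_n.+1) (gm : 'rV[R]_n -> R) (x0 : V).
Hypothesis PP : P *m P^T = 1%:M.
Hypothesis Cg : C_k 4 gm.
Notation I:= 'I_n.+1.

Let PP' : P^T *m P = 1%:M. Proof. exact:mulmx1C. Qed.
Let Cg1 : C_k 1 gm. Proof. exact:C_kW Cg. Qed.

(** In the orthonormal coordinates (x - x0) P^T the boundary is the graph of gm over all coordinates
    but the one of index 0. The chart preserves Lebesgue measure, so that no Jacobian determinant
    enters the integrals. *)
Definition chart (z : V) : V:= shear gm z *m P + x0.
Definition uchart (x : V) : V:= shear (fun y=> - gm y) ((x - x0) *m P^T).

Lemma chartK : cancel chart uchart.
Proof. by move=> z;rewrite /chart /uchart addrK -mulmxA PP mulmx1 shearK. Qed.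

Lemma uchartK : cancel uchart chart.
Proof. by move=> x;rewrite /chart /uchart shearNK -mulmxA PP' mulmx1 subrK. Qed.

Lemma continuous_affine_rV (m k : nat) (A : 'M[R]_(m, k)) (b : 'rV[R]_k) :
 continuous (fun x : 'rV[R]_m=> x *m A + b).
Proof.
pose C:= \sum_i \sum_j `|A i j|.
have C0 : 0 <= C by do 2 (apply:sumr_ge0=> ? _).
have lip (x y : 'rV[R]_m) : `|x *m A - y *m A| <= C * `|x - y|.
 rewrite -mulmxBl;apply:(@norm_le_coord R k)=> [|j];first by rewrite mulr_ge0.
 rewrite mxE (le_trans (ler_norm_sum _ _ _))// /C mulr_suml;apply:ler_sum=> i _.
 rewrite normrM mulrC ler_pM// ?coord_le//.
 by rewrite (bigD1 j)//= lerDl sumr_ge0.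
apply:(@lipschitz_dist_continuous R 'rV[R]_m 'rV[R]_k _ C C0)=> x y.
by rewrite opprD addrACA subrr addr0 lip.
Qed.

Lemma continuous_chart : continuous chart.
Proof.
move=> z;apply:(@continuous_comp _ _ _ (shear gm) (fun y : V=> y *m P + x0)).
 exact:continuous_shear.
exact:continuous_affine_rV.
Qed.

Lemma continuous_uchart : continuous uchart.
Proof.
have E : uchart = shear (fun y=> - gm y) \o (fun x : V=> x *m P^T + (- x0 *m P^T)).
 by apply/funext=> x;rewrite /uchart /= mulmxBl mulNmx.
rewrite E=> x;apply:continuous_comp;first exact:continuous_affine_rV.
by apply:continuous_shear;exact:(C_kN Cg1).
Qed.

Let mchart : measurable_fun setT chart.
Proof.
apply:measurable_fun_rVP=> i;apply:continuous_meas=> z.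
apply:(@continuous_comp _ _ _ chart (fun x : V=> x ord0 i));first exact:continuous_chart.
exact:continuous_coord.
Qed.

Lemma lebesgue_chart A : measurable A -> mu (chart @^-1` A) = (1%:E * mu A)%E.
Proof.
move=> mA.
have mg : measurable_fun setT gm by apply:continuous_meas;exact:C_k_cont Cg.
have mA1 : measurable ((fun x : V=> x + x0) @^-1` A).
 by rewrite -[X in measurable X]setTI;exact:measurable_addrV.
have mA2 : measurable ((fun x : V=> x *m P) @^-1` ((fun x : V=> x + x0) @^-1` A)).
 by rewrite -[X in measurable X]setTI;exact:measurable_mulrV.
have -> : chart @^-1` A = shear gm @^-1` ((fun x : V=> x *m P) @^-1` ((fun x : V=> x + x0) @^-1` A)) by [].
rewrite (lebesgue_shear mg mA2) mul1e (lebesgue_orth PP mA1) mul1e.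
exact:lebesgue_addrV.
Qed.

Lemma sqi_chart (f : V -> R) : sqi mu setT f -> sqi mu setT (f \o chart).
Proof. exact:(sqi_transfer mchart ler01 lebesgue_chart). Qed.

Lemma dot_chart (f h : V -> R) : sqi mu setT f -> sqi mu setT h ->
 dot mu setT (f \o chart) (h \o chart) = dot mu setT f h.
Proof. by move=> sf sh;rewrite (dot_transfer mchart ler01 lebesgue_chart sf sh) mul1r. Qed.

Section domains.
Variables (D Om : set V).
Hypothesis oD : open D.
Hypothesis oO : open Om.
Hypothesis DO : forall z, D z -> Om (chart z).
Let mD : measurable D:= open_meas oD.
Let mO : measurable Om:= open_meas oO.

Lemma sqi_comp (u : V -> R) : sqi mu Om u -> sqi mu D (u \o chart).
Proof.
move=> /(sqi_patch _ mO)/sqi_chart su.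
apply:(@sqi_le _ _ _ mu D mD _ ((u \_ Om) \o chart)).
- have : measurable_fun D ((u \_ Om) \o chart) by apply:measurable_funS (proj1 su).
 by apply:eq_measurable_fun=> z /set_mem Dz;rewrite /= /patch mem_set//;exact:DO.
- exact:sqi_sub su.
- by move=> z Dz;rewrite /= /patch mem_set//;exact:DO.
Qed.

Lemma nrm_comp (u : V -> R) : sqi mu Om u -> nrm mu D (u \o chart) <= nrm mu Om u.
Proof.
move=> su;have /(sqi_patch _ mO) su' := su;have suc:= sqi_comp su.
have -> : nrm mu D (u \o chart) = nrm mu D ((u \_ Om) \o chart).
 apply:ae_eq_nrm=> //;first exact:sqi_sub (sqi_chart su').
 by apply:aeW=> z Dz;rewrite /= /patch mem_set//;exact:DO.
apply:le_trans (nrm_subset mD measurableT (@subsetT _ _) (sqi_chart su')) _.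
by rewrite [leRHS]nrm_patch /nrm dot_chart.
Qed.

Lemma dot_comp (u psi : V -> R) : sqi mu Om u -> sqi mu setT psi ->
 (forall x, Om x -> ~ D (uchart x) -> psi x = 0) ->
 dot mu D (u \o chart) (psi \o chart) = dot mu Om u psi.
Proof.
move=> su sp z;have /(sqi_patch _ mO) su' := su.
rewrite [RHS]dot_patchl -(dot_chart su' sp) dot_patchl;congr Rintegral;apply/funext=> y.
rewrite /= /patch;case:ifPn=> [/set_mem/DO h|nD];first by rewrite mem_set.
case:ifPn=> [/set_mem h|_];last by [].
rewrite mul0r (z _ h) ?mulr0// chartK=> Dy;move: nD;by rewrite mem_set.
Qed.

Definition Gam (k : I) (z : V) : R:= 'D_('e_k) (base gm) z.

Lemma C_k_Gam k : C_k 3 (Gam k).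
Proof. by apply:C_k_D;exact:C_k_base Cg. Qed.

Lemma Gam0 z : Gam ord0 z = 0. Proof. exact:derive0_base. Qed.

Lemma derive0_Gam k z : 'D_e0 (Gam k) z = 0.
Proof.
have C2 : C_k 2 (base gm) by apply:C_kW (C_k_base Cg).
rewrite /Gam (Schwarz z ord0 k C2).
have -> : (fun y=> 'D_e0 (base gm) y) = (cst 0 : V -> R) by apply/funext=> y;exact:derive0_base.
exact:derive_cst.
Qed.

(** In the chart the k-th rotated derivative reads D_k - Gam_k D_0. *)
Lemma chart_derive (psi : V -> R) k z : C_k 1 psi ->
 'D_('e_k) (psi \o chart) z - Gam k z * 'D_e0 (psi \o chart) z = \sum_l P k l * 'D_('e_l) psi (chart z).
Proof.
move=> Cp;pose psia (y : V) := psi (y *m P + x0).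
have Ca : C_k 1 psia by exact:C_k_affine.
have [_ E1] := derive_shear z 'e_k Cg1 Ca.
have [_ E2] := derive_shear z e0 Cg1 Ca.
have F : psi \o chart = psia \o shear gm by [].
rewrite F E1 E2 derive0_base mul0r addr0 addrK /psia derive_affine.
rewrite (C1_deriveE _ _ Cp);apply:eq_bigr=> l _;congr (_ * _).
rewrite mxE (bigD1 k) //= big1 ?addr0=> [|j jk];first by rewrite mxE !eqxx mul1r.
by rewrite mxE eqxx (negPf jk) mul0r.
Qed.

Lemma ctest_uchart (phi : V -> R) : ctest D phi -> ctest Om (phi \o uchart) /\
 forall x, ~ D (uchart x) -> phi (uchart x) = 0.
Proof.
move=> [Cp [F [cF bF FD z]]];split;last by move=> x nD;apply:z=> /FD.
split.
 have E : phi \o uchart = (fun x : V=> (phi \o shear (fun y=> - gm y)) (x *m P^T + (- x0 *m P^T))).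
  by apply/funext=> x;rewrite /uchart /= mulmxBl mulNmx.
 by rewrite E;apply:C_k_affine;apply:C1_shear=> //;exact:(C_kN Cg1).
have kF : compact F by exact:bounded_closed_compact.
have kcF : compact (chart @` F).
 by apply:continuous_compact=> //;apply:continuous_subspaceT;exact:continuous_chart.
exists (chart @` F);split.
- apply:compact_closed=> //;exact:norm_hausdorff.
- exact:compact_bounded.
- by move=> _ [y Fy <-];apply:DO;exact:FD.
- by move=> x nx /=;apply:z=> Fx;apply:nx;exists (uchart x)=> //;exact:uchartK.
Qed.

(** The derivative in the direction k of the l-th coordinate of [chart]. *)
Definition Jac k l (z : V) : R:= P k l + Gam k z * P ord0 l.

Lemma C_k_Jac k l : C_k 3 (Jac k l).
Proof.
have -> : Jac k l = (fun _ : V=> P k l) + P ord0 l *: Gam k.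
 by apply/funext=> z;rewrite /Jac !fctE mulrC.
by apply:C_kD;[exact:C_k_cst|apply:C_kZ;exact:C_k_Gam].
Qed.

End domains.
End chart.

Section chain.
Context (R : realType) (n : nat).
Notation V:= 'rV[R]_n.+1.
Notation mu:= (lebesgue_rV R n.+1).
Notation e0:= ('e_ord0 : V).
Variables (P : 'M[R]_n.+1) (gm : 'rV[R]_n -> R) (x0 : V).
Hypothesis PP : P *m P^T = 1%:M.
Hypothesis Cg : C_k 4 gm.
Notation I:= 'I_n.+1.
Notation chart:= (chart P gm x0).
Notation uchart:= (uchart P gm x0).
Notation Jac:= (Jac P gm).
Notation Gam:= (Gam gm).
Implicit Types (U : seq I -> V -> R).

Let PP' : P^T *m P = 1%:M. Proof. exact:mulmx1C. Qed.

Variable MG : R.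
Hypothesis MG0 : 0 <= MG.
Hypothesis bG : forall k, bnd 3 setT (Gam k) MG.

Section chain_rule.
Variables (D Om : set V).
Hypothesis oD : open D.
Hypothesis oO : open Om.
Hypothesis DO : forall z, D z -> Om (chart z).
Let mD : measurable D:= open_meas oD.
Let mO : measurable Om:= open_meas oO.

(** Since Gam_k does not depend on x_0, D_k phi = (D_k - Gam_k D_0) phi + D_0 (Gam_k phi). Both
    summands are pull-backs of constant combinations of first derivatives, of psi and of psi2, which
    are C^1 test functions of Om; the weak derivatives of u can thus be tested against them. *)
Lemma chain_rule (u : V -> R) (ul : I -> V -> R) k :
 sqi mu Om u -> (forall l, sqi mu Om (ul l)) -> (forall l, wd Om l u (ul l)) ->
 wd D k (u \o chart) (\sum_l Jac k l * (ul l \o chart)).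
Proof.
move=> su sul w phi tp.
have ct:= test_ctest tp;have [C1p _] := ct.
have CG : C_k 1 (Gam k) by apply:C_kW (C_k_Gam Cg k).
have ct2 : ctest D (Gam k * phi) := ctestM CG ct.
pose O' := uchart @^-1` D.
have oO' : open O'.
 by apply:open_comp=> // x _;exact:continuous_uchart.
have DO' z : D z -> O' (chart z) by move=> Dz;rewrite /O' /= chartK.
have O'O x : O' x -> Om x by move=> /DO;rewrite uchartK.
have [cpsi zpsi] := ctest_uchart PP Cg DO' ct.
have [cpsi2 zpsi2] := ctest_uchart PP Cg DO' ct2.
set psi:= phi \o uchart in cpsi zpsi;set psi2:= (Gam k * phi) \o uchart in cpsi2 zpsi2.
have K1 : psi \o chart = phi by apply/funext=> z;rewrite /psi /= chartK.
have K2 : psi2 \o chart = Gam k * phi by apply/funext=> z;rewrite /psi2 /= chartK.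
have [C1 [F [cF bF FO zF]]] := cpsi;have [C2 [F2 [cF2 bF2 FO2 zF2]]] := cpsi2.
have ctO : ctest Om psi by split=> //;exists F;split=> // x /FO /O'O.
have ctO2 : ctest Om psi2 by split=> //;exists F2;split=> // x /FO2 /O'O.
have [M pM] := zoff_csupp bF zF;have [M2 pM2] := zoff_csupp bF2 zF2.
pose d1 l x:= 'D_('e_l) psi x;pose d2 l x:= 'D_('e_l) psi2 x.
have s1 l : sqi mu setT (d1 l) := sqi_Dv 'e_l C1 pM.
have s2 l : sqi mu setT (d2 l) := sqi_Dv 'e_l C2 pM2.
have s0:= sqi_C1 C1 pM;have s02:= sqi_C1 C2 pM2.
have z1 l x : Om x -> ~ D (uchart x) -> d1 l x = 0.
 by move=> _ nD;apply:(@derive_zoff _ _ F psi 'e_l cF zF x)=> /FO.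
have z2 l x : Om x -> ~ D (uchart x) -> d2 l x = 0.
 by move=> _ nD;apply:(@derive_zoff _ _ F2 psi2 'e_l cF2 zF2 x)=> /FO2.
have E : (fun x=> 'D_('e_k) phi x) = \sum_l P k l *: (d1 l \o chart) + \sum_l P ord0 l *: (d2 l \o chart).
 apply/funext=> z;rewrite !fctE !fct_sumE.
 have e1:= chart_derive P x0 Cg k z C1;have e2:= chart_derive P x0 Cg ord0 z C2.
 rewrite K1 in e1;rewrite K2 Gam0 mul0r subr0 (derive_mul1 ord0 z CG C1p) derive0_Gam// mul0r add0r in e2.
 by rewrite -[X in X + _]e1 -[X in _ + X]e2 subrK.
have sc l : sqi mu D (d1 l \o chart) := sqiT mD (sqi_chart x0 PP Cg (s1 l)).
have sc2 l : sqi mu D (d2 l \o chart) := sqiT mD (sqi_chart x0 PP Cg (s2 l)).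
have su' := sqi_comp PP Cg oD oO DO su.
have sul' l:= sqi_comp PP Cg oD oO DO (sul l).
have t1:= wd_C1 oO su (sul _) (w _) ctO;have t2:= wd_C1 oO su (sul _) (w _) ctO2.
have LHS : dot mu D (u \o chart) (fun x=> 'D_('e_k) phi x) =
  \sum_l (- (P k l * dot mu Om (ul l) psi + P ord0 l * dot mu Om (ul l) psi2)).
 have sz l : sqi mu D (P k l *: (d1 l \o chart)) by exact:sqiZ.
 have sz2 l : sqi mu D (P ord0 l *: (d2 l \o chart)) by exact:sqiZ.
 rewrite E dotDr//;try by exact:sqi_sum.
 rewrite dotC dot_suml// [X in _ + X]dotC dot_suml// -big_split;apply:eq_bigr=> l _ /=.
 rewrite !dotZl// (dotC _ _ _ (u \o chart)) (dotC _ _ (d2 l \o chart)).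
 rewrite (dot_comp PP Cg oO DO su (s1 l) (z1 l)) (dot_comp PP Cg oO DO su (s2 l) (z2 l)).
 by rewrite (t1 l) (t2 l) opprD !mulrN.
have sphi : sqi mu D phi:= sqi_ctest oD ct.
have sphi2 : sqi mu D (Gam k * phi) := sqi_ctest oD ct2.
have sG l : sqi mu D (Gam k * (ul l \o chart)).
 apply:(sqiM_ck oD (C_kW _ CG) _ (sul' l))=> // x Dx;exact:(bG k (s:= [::]) isT Logic.I).
have JE l : Jac k l * (ul l \o chart) = P k l *: (ul l \o chart) + P ord0 l *: (Gam k * (ul l \o chart)).
 by apply/funext=> z;rewrite /Jac !fctE mulrDl (mulrC (Gam k z)) -mulrA.
have sJ l : sqi mu D (Jac k l * (ul l \o chart)) by rewrite JE;apply:sqiD=> //;exact:sqiZ.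
have zz1 x : Om x -> ~ D (uchart x) -> psi x = 0 by move=> _;exact:zpsi.
have zz2 x : Om x -> ~ D (uchart x) -> psi2 x = 0 by move=> _;exact:zpsi2.
apply:etrans LHS _;rewrite dot_suml// -sumrN;apply:eq_bigr=> l _;congr (- _).
rewrite JE dotDl//;try by exact:sqiZ.
rewrite !dotZl//;congr (_ * _ + _ * _).
 by rewrite -(dot_comp PP Cg oO DO (sul l) s0 zz1) K1.
rewrite -(dot_comp PP Cg oO DO (sul l) s02 zz2) K2.
by congr Rintegral;apply/funext=> x;rewrite !fctE mulrCA mulrA.
Qed.

End chain_rule.

(** The jet of the composition with the chart. The innermost derivative, the last of the list, is
    expanded by the chain rule and the remaining ones by the Leibniz rule. The number k only bounds
    the recursion: by [compj_fuel] any k that reaches the length of s gives the same function. *)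
Fixpoint compj (k : nat) U (s : seq I) : V -> R :=
 match k, s with
 | k'.+1, x :: s' => \sum_l mulj (Jac (last x s') l) (compj k' (shiftj [:: l] U)) (belast x s')
 | _, _=> U [::] \o chart
 end.

Lemma compj0 k U : compj k U [::] = U [::] \o chart.
Proof. by case:k. Qed.

Lemma mulj0 a U : mulj a U [::] = a * U [::].
Proof. by rewrite /mulj big_seq1. Qed.

Definition MJ : R:= \sum_k \sum_l (`|P k l| + MG * `|P ord0 l|).

Lemma MJ_ge0 : 0 <= MJ.
Proof. by apply:sumr_ge0=> k _;apply:sumr_ge0=> l _;rewrite addr_ge0// mulr_ge0. Qed.

Lemma pderivD k s (f g : V -> R) : (size s <= k)%N -> C_k k f -> C_k k g ->
 pderiv s (f + g) = pderiv s f + pderiv s g.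
Proof.
elim: s k=> // i s IH k sk Cf Cg';rewrite /= -!/(pderiv s _).
have:= IH k (ltnW sk) Cf Cg';rewrite -!/(pderiv s _)=> ->.
apply/funext=> x;rewrite deriveD//.
- by case:Cf=> h _;exact:h.
- by case:Cg' => h _;exact:h.
Qed.

Lemma pderivZ k s (c : R) (f : V -> R) : (size s <= k)%N -> C_k k f ->
 pderiv s (c *: f) = c *: pderiv s f.
Proof.
elim: s k=> // i s IH k sk Cf;rewrite /= -!/(pderiv s _).
have:= IH k (ltnW sk) Cf;rewrite -!/(pderiv s _)=> ->.
by apply/funext=> x;rewrite deriveZ//;case:Cf=> h _;exact:h.
Qed.

Lemma pderiv_cst s (c : R) : pderiv s (fun _ : V=> c) = (fun _=> if s is [::] then c else 0).
Proof.
elim: s=> // i s IH;rewrite /= -/(pderiv s _);apply/funext=> x.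
by rewrite IH;exact:derive_cst.
Qed.

Lemma bnd_Jac k l : bnd 3 setT (Jac k l) MJ.
Proof.
move=> s s3 x _.
have -> : Jac k l = (fun _ : V=> P k l) + P ord0 l *: Gam k.
 by apply/funext=> z;rewrite /Jac !fctE mulrC.
rewrite (pderivD s3 (@C_k_cst R n.+1 3 (P k l)) (C_kZ _ (C_k_Gam Cg k))) (pderivZ _ s3 (C_k_Gam Cg k)) pderiv_cst !fctE.
apply:le_trans (ler_normD _ _) _;apply:(@le_trans _ _ (`|P k l| + MG * `|P ord0 l|)).
 apply:lerD;first by case:s s3=> //= *;rewrite normr0.
 by rewrite normrM mulrC ler_wpM2r//;exact:bG.
rewrite /MJ (bigD1 k) //= (bigD1 l) //= -addrA lerDl addr_ge0//.
 by apply:sumr_ge0=> j _;rewrite addr_ge0// mulr_ge0.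
by apply:sumr_ge0=> i _;apply:sumr_ge0=> j _;rewrite addr_ge0// mulr_ge0.
Qed.

Lemma jet_comp k D Om U : open D -> open Om -> (forall z, D z -> Om (chart z)) ->
 (k <= 4)%N -> jet k Om U -> jet k D (compj k U).
Proof.
move=> oD oO DO;elim: k U=> [|k IH] U k4 jU.
 by split=> // s _;case:s=> *;apply:(sqi_comp PP Cg oD oO DO);exact:(proj1 jU [::] isT).
have jV l : jet k D (compj k (shiftj [:: l] U)).
 by apply:IH;[exact:ltnW|apply:jet_shift;rewrite addn1].
have CJ i l : C_k k (Jac i l) by apply:C_kW (C_k_Jac P Cg i l).
have bJ i l : bnd k D (Jac i l) MJ.
 move=> s sk x Dx;apply:bnd_Jac=> //;exact:leq_trans sk k4.
have jM i l : jet k D (mulj (Jac i l) (compj k (shiftj [:: l] U))) by exact:jet_mul (bJ i l) (jV l).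
split=> [[|x s] sk|[|x s] i sk].
- exact:(sqi_comp PP Cg oD oO DO (proj1 jU [::] isT)).
- apply:(sqi_sum (open_meas oD))=> l _;apply:(proj1 (jM _ l)).
 by rewrite size_belast.
- rewrite /=;have:= @chain_rule D Om oD oO DO (U [::]) (fun l=> U [:: l]) i (proj1 jU [::] isT) (fun l=> proj1 jU [:: l] isT) (fun l=> proj2 jU [::] l isT).
 congr (wd _ _ _ _);apply:eq_bigr=> l _;by rewrite mulj0 compj0.
- apply:wd_sum=> // l _.
 + by apply:(proj1 (jM _ l));rewrite size_belast;exact:ltnW.
 + by apply:(proj1 (jM _ l));rewrite /= size_belast.
 + by apply:(proj2 (jM _ l));rewrite size_belast.
Qed.

Lemma mulj_ext a U W s : (forall t, (size t <= size s)%N -> U t = W t) -> mulj a U s = mulj a W s.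
Proof.
move=> h;rewrite /mulj big_seq [RHS]big_seq;apply:eq_bigr=> p /size_splits ps.
by rewrite h// -ps leq_addl.
Qed.

Lemma mulj_local a U W s z : (forall t, U t z = W t z) -> mulj a U s z = mulj a W s z.
Proof. by move=> h;rewrite /mulj !fct_sumE;apply:eq_bigr=> p _;rewrite !fctE h. Qed.

Lemma mulj_local0 a U s z : (forall t, U t z = 0) -> mulj a U s z = 0.
Proof. by move=> h;rewrite /mulj !fct_sumE;apply:big1=> p _;rewrite !fctE h mulr0. Qed.

Lemma compj_fuel k k' U s : (size s <= k)%N -> (size s <= k')%N -> compj k U s = compj k' U s.
Proof.
elim: k k' U s=> [|k IH] [|k'] U [|x s] //= sk sk'.
apply:eq_bigr=> l _;apply:mulj_ext=> t;rewrite size_belast=> ts.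
by apply:IH;exact:leq_trans ts _.
Qed.

Lemma compj_local k U W s z : (forall t, U t (chart z) = W t (chart z)) -> compj k U s z = compj k W s z.
Proof.
elim: k U W s=> [|k IH] U W [|x s] h;try exact:h.
rewrite /= !fct_sumE;apply:eq_bigr=> l _;apply:mulj_local=> t;apply:IH=> t';exact:h.
Qed.

Lemma compj_local0 k U s z : (forall t, U t (chart z) = 0) -> compj k U s z = 0.
Proof.
elim: k U s=> [|k IH] U [|x s] h;try exact:h.
rewrite /= !fct_sumE;apply:big1=> l _;apply:mulj_local0=> t;apply:IH=> t';exact:h.
Qed.

Lemma J_comp_le k : (k <= 4)%N -> exists2 C, 0 <= C & forall D Om U, open D -> open Om ->
 (forall z, D z -> Om (chart z)) -> jet k Om U -> J k.+1 D (compj k U) <= C * J k.+1 Om U.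
Proof.
elim: k=> [_|k IH k4].
 exists (cJ R n.+1 1);first exact:cJ_ge0.
 move=> D Om U oD oO DO jU;apply:J_le=> -[|//] _;rewrite compj0.
 apply:le_trans (nrm_comp PP Cg oD oO DO (proj1 jU [::] isT)) _;exact:le_J.
have [C C0 hC] := IH (ltnW k4).
pose c1:= cJ R n.+1 k.+1 * (2 ^+ k * MJ).
have c10 : 0 <= c1 by rewrite !mulr_ge0 ?cJ_ge0 ?MJ_ge0// exprn_ge0.
have c20 : 0 <= c1 * (C * cJ R n.+1 k.+1) by apply:mulr_ge0=> //;apply:mulr_ge0=> //;exact:cJ_ge0.
exists (cJ R n.+1 k.+2 * (1 + \sum_(l : I) c1 * (C * cJ R n.+1 k.+1))).
 by rewrite mulr_ge0 ?cJ_ge0// addr_ge0// sumr_ge0.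
move=> D Om U oD oO DO jU;rewrite -mulrA;apply:J_le=> -[|x s] sk.
 rewrite compj0;apply:le_trans (nrm_comp PP Cg oD oO DO (proj1 jU [::] isT)) _.
 apply:(@le_trans _ _ (J k.+2 Om U));first exact:le_J.
 by rewrite ler_peMl ?J_ge0// lerDl sumr_ge0.
have jS l : jet k Om (shiftj [:: l] U) by apply:jet_shift;rewrite addn1.
have jV l : jet k D (compj k (shiftj [:: l] U)) := jet_comp oD oO DO (ltnW k4) (jS l).
have CJ i l : C_k k (Jac i l) by apply:C_kW (C_k_Jac P Cg i l).
have bJ i l : bnd k D (Jac i l) MJ.
 move=> t tk y Dy;apply:bnd_Jac=> //;exact:leq_trans tk k4.
have jM i l : jet k D (mulj (Jac i l) (compj k (shiftj [:: l] U))) by exact:jet_mul (bJ i l) (jV l).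
have sb : (size (belast x s) <= k)%N by rewrite size_belast.
rewrite /=;apply:le_trans (nrm_sum _ (open_meas oD) _) _=> [l _|].
 exact:(proj1 (jM _ l)).
apply:(@le_trans _ _ (\sum_(l : I) c1 * (C * cJ R n.+1 k.+1) * J k.+2 Om U)).
 apply:ler_sum=> l _;apply:le_trans (le_J (k:= k.+1) _ _ _) _;first exact:sb.
 apply:le_trans (J_mul oD (CJ _ l) MJ_ge0 (bJ _ l) (jV l)) _.
 set Y:= J k.+1 D _;have -> : cJ R n.+1 k.+1 * (2 ^+ k * MJ * Y) = c1 * Y by rewrite /c1 -!mulrA.
 rewrite -(mulrA c1) -(mulrA C);apply:ler_wpM2l=> //.
 apply:le_trans (hC D Om _ oD oO DO (jS l)) _.
 rewrite ler_wpM2l//;have:= J_shift k.+1 [:: l] Om U;by rewrite addn1.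
by rewrite -mulr_suml mulrDl mul1r lerDr J_ge0.
Qed.

End chain.

(** * Comparison of the flattened bilaplacian with the one with frozen coefficients *)

Section perturbation.
Context (R : realType) (n : nat).
Notation V:= 'rV[R]_n.+1.
Notation mu:= (lebesgue_rV R n.+1).
Notation I:= 'I_n.+1.
Variables (P : 'M[R]_n.+1) (gm : 'rV[R]_n -> R) (x0 : V).
Hypothesis PP : P *m P^T = 1%:M.
Hypothesis Cg : C_k 4 gm.
Variable MG : R.
Hypothesis MG0 : 0 <= MG.
Hypothesis bG : forall k, bnd 3 setT (Gam gm k) MG.
Notation chart:= (chart P gm x0).
Notation Gam:= (Gam gm).
Implicit Types (U W X : seq I -> V -> R) (D : set V).

Let PP' : P^T *m P = 1%:M. Proof. exact:mulmx1C. Qed.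
Let CGk k m : (k <= 3)%N -> C_k k (Gam m).
Proof. by move=> k3;apply:C_kW (C_k_Gam Cg m). Qed.
Let bGk k D m : (k <= 3)%N -> bnd k D (Gam m) MG.
Proof. by move=> k3 s sk x Dx;apply:bG=> //;exact:leq_trans sk k3. Qed.

(** The jet of D_m w - Gam_m D_0 w, that is, of the m-th rotated derivative read in the chart
    ([chart_Y]). *)
Definition Yj m W:= addj (shiftj [:: m] W) (scalej (-1) (mulj (Gam m) (shiftj [:: ord0] W))).

Lemma jet_Y k D m W : open D -> (k <= 3)%N -> jet k.+1 D W -> jet k D (Yj m W).
Proof.
move=> oD k3 jW;have jS l : jet k D (shiftj [:: l] W) by apply:jet_shift;rewrite addn1.
apply:jet_add=> //;apply:jet_scale=> //;exact:(jet_mul oD (CGk m k3) (bGk m k3) (jS _)).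
Qed.

(** One bound for the operators [Yj], [Y0j] and [Dj]. In 32 MG, 2^4 bounds the number of Leibniz
    terms and 2 MG bounds Gam minus its frozen value; 40 MG leaves room for one more MG. One factor
    ka comes from shifting a jet and the other from counting lists. *)
Definition Qc : R:= (1 + cJ R n.+1 5) ^+ 2 * (1 + 40 * MG).
Let ka:= 1 + cJ R n.+1 5.
Let ka1 : 1 <= ka. Proof. by rewrite lerDl cJ_ge0. Qed.
Let kale k : (k <= 5)%N -> cJ R n.+1 k <= ka.
Proof. by move=> k5;apply:le_trans (cJ_le _ _ k5) _;rewrite lerDr. Qed.

Lemma Qc_ge1 : 1 <= Qc.
Proof.
rewrite /Qc -/ka.
have h2 : 1 <= ka ^+ 2 by rewrite expr_ge1// (le_trans _ ka1).
have : 1 * 1 <= ka ^+ 2 * (1 + 40 * MG) by apply:ler_pM=> //;rewrite lerDl mulr_ge0.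
by rewrite mulr1.
Qed.

Lemma mulj_le_Q k D (a : V -> R) d W m s : open D -> (k <= 3)%N -> C_k k a -> bnd k D a (2 * MG) ->
 jet k.+1 D W -> 0 <= d -> (forall x, D x -> `|a x| <= d) -> (size s <= k)%N ->
 nrm mu D (mulj a (shiftj [:: m] W) s) <= d * J k.+2 D W + ka * ((32 * MG)) * J k.+1 D W.
Proof.
move=> oD k3 Ca ba jW d0 da sk;have M20 : 0 <= 2 * MG by rewrite mulr_ge0.
have jS : jet k D (shiftj [:: m] W) by apply:jet_shift;rewrite addn1.
apply:le_trans (mulj_top oD Ca M20 ba jS d0 da sk) _;apply:lerD.
 by rewrite ler_wpM2l// /shiftj le_J// size_cat addn1 ltnS.
apply:(@le_trans _ _ ((32 * MG) * (ka * J k.+1 D W))).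
 apply:ler_pM;rewrite ?mulr_ge0 ?J_ge0 ?exprn_ge0//.
  have h : (2 : R) ^+ k <= 2 ^+ 4 by rewrite ler_weXn2l ?ler1n// (leq_trans k3).
  have -> : (32 : R) * MG = 2 ^+ 4 * (2 * MG) by ring.
  by rewrite ler_wpM2r.
 apply:le_trans (J_W _ _ sk) _;have:= J_shift k [:: m] D W;rewrite addn1=> h.
 apply:le_trans h _;rewrite ler_wpM2r ?J_ge0//;apply:kale;exact:leq_trans k3 _.
by rewrite le_eqVlt;apply/orP;left;apply/eqP;ring.
Qed.

Let kaM : MG <= ka * MG. Proof. by rewrite ler_peMl. Qed.
Let Kle1 : 1 + MG + ka * (32 * MG) <= ka * (1 + 40 * MG).
Proof.
rewrite mulrDr mulr1 -addrA;apply:lerD=> //.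
have -> : ka * (40 * MG) = 8 * (ka * MG) + ka * (32 * MG) by ring.
rewrite lerD2r;apply:le_trans kaM _;rewrite ler_peMl ?ler1n// mulr_ge0//.
exact:le_trans ler01 ka1.
Qed.
Let Kle2 : 1 + MG <= ka * (1 + 40 * MG).
Proof.
apply:le_trans Kle1;rewrite lerDl !mulr_ge0//;exact:le_trans ler01 ka1.
Qed.

Let Ple k (c d : R) : 0 <= c -> 0 <= d -> (k <= 3)%N -> c <= ka * (1 + 40 * MG) ->
 cJ R n.+1 k.+1 * (c * d) <= Qc * d.
Proof.
move=> c0 d0 k3 h;rewrite mulrA ler_wpM2r//;apply:(@le_trans _ _ (ka * (ka * (1 + 40 * MG)))).
 by apply:ler_pM=> //;rewrite ?cJ_ge0//;apply:kale;exact:leq_ltn_trans k3 _.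
by rewrite /Qc -/ka mulrA -expr2.
Qed.

Lemma J_Y k D m W : open D -> (k <= 3)%N -> jet k.+1 D W -> J k.+1 D (Yj m W) <= Qc * J k.+2 D W.
Proof.
move=> oD k3 jW;have jS l : jet k D (shiftj [:: l] W) by apply:jet_shift;rewrite addn1.
have mD:= open_meas oD;have J0:= J_ge0 k.+2 D W.
have MGG : 0 <= (32 * MG) by rewrite !mulr_ge0.
have hh : forall s, (size s < k.+1)%N -> nrm mu D (Yj m W s) <= (1 + MG + 0) * J k.+2 D W + ka * ((32 * MG)) * J k.+1 D W.
 move=> s sk;have sM:= proj1 (jet_mul oD (CGk ord0 k3) (bGk ord0 k3) (jS ord0)) s sk.
 have sM' := proj1 (jet_mul oD (CGk m k3) (bGk m k3) (jS ord0)) s sk.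
 apply:le_trans (nrmD mD (proj1 (jS m) s sk) (sqiZ mD _ sM')) _.
 rewrite nrmZ// normrN normr1 mul1r addr0 mulrDl mul1r -addrA;apply:lerD.
  by rewrite /shiftj le_J// size_cat addn1 ltnS.
 apply:(mulj_le_Q _ oD k3 (CGk m k3) _ jW MG0)=> //.
  by move=> t tk x Dx;apply:le_trans (bGk m k3 tk Dx) _;rewrite ler_peMl// ler1n.
 by move=> x Dx;exact:(bGk m k3 (s:= [::]) isT Dx).
apply:le_trans (J_le hh) _.
have J1 : J k.+1 D W <= J k.+2 D W by apply:J_W.
have J10:= J_ge0 k.+1 D W.
apply:(@le_trans _ _ (cJ R n.+1 k.+1 * ((1 + MG + ka * ((32 * MG))) * J k.+2 D W))).
 rewrite ler_wpM2l ?cJ_ge0// addr0 [leRHS]mulrDl lerD2l ler_wpM2l// mulr_ge0//.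
 exact:le_trans ler01 ka1.
have h0 : 0 <= 1 + MG + ka * (32 * MG).
 by rewrite !addr_ge0// mulr_ge0//;exact:le_trans ler01 ka1.
exact:(Ple h0 J0 k3 Kle1).
Qed.

Section frozen_coefficients.
Variables (c : I -> R) (c0 : c ord0 = 0) (cM : forall m, `|c m| <= MG).
Variables (D : set V) (oD : open D) (d : R) (d0 : 0 <= d).
Hypothesis close : forall m z, D z -> `|Gam m z - c m| <= d.
Let mD : measurable D:= open_meas oD.

Definition Y0j m W:= addj (shiftj [:: m] W) (scalej (- c m) (shiftj [:: ord0] W)).
Definition Dj m W:= addj (Yj m W) (scalej (-1) (Y0j m W)).

Lemma jet_Y0 k m W : jet k.+1 D W -> jet k D (Y0j m W).
Proof.
move=> jW;have jS l : jet k D (shiftj [:: l] W) by apply:jet_shift;rewrite addn1.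
by apply:jet_add=> //;exact:jet_scale.
Qed.

Lemma J_Y0 k m W : (k <= 3)%N -> jet k.+1 D W -> J k.+1 D (Y0j m W) <= Qc * J k.+2 D W.
Proof.
move=> k3 jW;have jS l : jet k D (shiftj [:: l] W) by apply:jet_shift;rewrite addn1.
have J0:= J_ge0 k.+2 D W;have cm:= cM m.
have kM : MG <= ka * MG by rewrite ler_peMl.
apply:(@le_trans _ _ (cJ R n.+1 k.+1 * ((1 + MG) * J k.+2 D W)));last first.
 exact:(Ple (addr_ge0 ler01 MG0) J0 k3 Kle2).
apply:J_le=> s sk;apply:le_trans (nrmD mD (proj1 (jS m) s sk) (sqiZ mD _ (proj1 (jS ord0) s sk))) _.
rewrite nrmZ//;last exact:(proj1 (jS ord0) s sk).
rewrite normrN mulrDl mul1r;apply:lerD;first by rewrite /shiftj le_J// size_cat addn1 ltnS.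
by apply:ler_pM;rewrite ?nrm_ge0// /shiftj le_J// size_cat addn1 ltnS.
Qed.

Let em m : V -> R:= Gam m + (fun _=> - c m).

Let Cem k m : (k <= 3)%N -> C_k k (em m).
Proof. by move=> k3;apply:C_kD;[exact:CGk|exact:C_k_cst]. Qed.

Let bem k m : (k <= 3)%N -> bnd k D (em m) (2 * MG).
Proof.
move=> k3 s sk x Dx;rewrite /em (pderivD sk (CGk m k3) (@C_k_cst R n.+1 k (- c m))) pderiv_cst !fctE.
apply:le_trans (ler_normD _ _) _;have:= bGk m k3 sk Dx.
have : `|if s is [::] then - c m else 0| <= MG by case:s {sk} => *;rewrite ?normrN// normr0.
lra.
Qed.

Lemma jet_D k m W : (k <= 3)%N -> jet k.+1 D W -> jet k D (Dj m W).
Proof. by move=> k3 jW;apply:jet_add=> //;[exact:jet_Y|apply:jet_scale=> //;exact:jet_Y0]. Qed.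

Lemma J_D k m W : (k <= 3)%N -> jet k.+1 D W ->
 J k.+1 D (Dj m W) <= Qc * (d * J k.+2 D W + J k.+1 D W).
Proof.
move=> k3 jW;have jS l : jet k D (shiftj [:: l] W) by apply:jet_shift;rewrite addn1.
pose Z:= scalej (-1) (mulj (em m) (shiftj [:: ord0] W)).
have jM : jet k D (mulj (em m) (shiftj [:: ord0] W)) := jet_mul oD (Cem m k3) (bem m k3) (jS ord0).
have jZ : jet k D Z by exact:jet_scale.
(* Two jets of the same function have the same norms. In Z the difference of the operators shows as
   a single product with the coefficient em, at most d on D. *)
have e : ae_eq mu D (Dj m W [::]) (Z [::]).
 apply:aeW=> z _;rewrite /Dj /Yj /Y0j /Z /addj /scalej !mulj0 /em !fctE.
 by rewrite ?scaleN1r /GRing.scale /=;lra.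
rewrite (J_uniq oD (jet_D m k3 jW) jZ e).
have J2:= J_ge0 k.+2 D W;have J1:= J_ge0 k.+1 D W.
have ka0 : 0 <= ka:= le_trans ler01 ka1.
have dd m' x : D x -> `|em m' x| <= d by move=> Dx;exact:close.
apply:(@le_trans _ _ (cJ R n.+1 k.+1 * ((ka * (1 + 40 * MG)) * (d * J k.+2 D W + J k.+1 D W))));last first.
 have q1 : 0 <= ka * (1 + 40 * MG) by apply:mulr_ge0=> //;rewrite addr_ge0// mulr_ge0.
 have q2 : 0 <= d * J k.+2 D W + J k.+1 D W by rewrite addr_ge0// mulr_ge0.
 exact:Ple.
apply:J_le=> s sk;rewrite /Z /scalej nrmZ ?normrN ?normr1 ?mul1r//;last exact:(proj1 jM s sk).
apply:le_trans (mulj_le_Q ord0 oD k3 (Cem m k3) (bem m k3) jW d0 (dd m) sk) _.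
rewrite mulrDr;apply:lerD.
 rewrite ler_peMl ?mulr_ge0//;apply:le_trans ka1 _.
 by rewrite -[leLHS]mulr1 ler_wpM2l// lerDl mulr_ge0.
rewrite ler_wpM2r// ler_wpM2l//;apply:(@le_trans _ _ (40 * MG));last by rewrite lerDr.
by rewrite ler_wpM2r// ler_nat.
Qed.

Definition LapY W:= sumj (index_enum I) (fun m=> Yj m (Yj m W)).
Definition Lap0 W:= sumj (index_enum I) (fun m=> Y0j m (Y0j m W)).
Definition LapD W:= addj (LapY W) (scalej (-1) (Lap0 W)).

Lemma jet_LapY k W : (k <= 2)%N -> jet k.+2 D W -> jet k D (LapY W).
Proof.
move=> k2 jW;apply:jet_sum=> // m;apply:jet_Y=> //;first exact:leqW.
by apply:jet_Y=> //.
Qed.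

Lemma jet_Lap0 k W : (k <= 2)%N -> jet k.+2 D W -> jet k D (Lap0 W).
Proof. by move=> k2 jW;apply:jet_sum=> // m;apply:jet_Y0;apply:jet_Y0. Qed.

Let N : R:= \sum_(m : I) 1.
Let N0 : 0 <= N. Proof. exact:sumr_ge0. Qed.
Let Q0 : 0 <= Qc. Proof. exact:le_trans ler01 Qc_ge1. Qed.

Let sumN (x : R) : \sum_(m : I) x = N * x.
Proof. by rewrite /N mulr_suml;apply:eq_bigr=> m _;rewrite mul1r. Qed.

Lemma J_LapY k W : (k <= 2)%N -> jet k.+2 D W -> J k.+1 D (LapY W) <= N * (Qc * Qc) * J k.+3 D W.
Proof.
move=> k2 jW;have k3 : (k <= 3)%N by exact:leqW.
have jY m : jet k.+1 D (Yj m W) by apply:jet_Y.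
apply:le_trans (J_sum _ oD (fun m=> jet_Y m oD k3 (jY m))) _.
rewrite -mulrA -sumN;apply:ler_sum=> m _;apply:le_trans (J_Y m oD k3 (jY m)) _.
by rewrite -mulrA ler_wpM2l//;apply:J_Y.
Qed.

Lemma J_Lap0 k W : (k <= 2)%N -> jet k.+2 D W -> J k.+1 D (Lap0 W) <= N * (Qc * Qc) * J k.+3 D W.
Proof.
move=> k2 jW;have k3 : (k <= 3)%N by exact:leqW.
have jY m : jet k.+1 D (Y0j m W) by exact:jet_Y0.
apply:le_trans (J_sum _ oD (fun m=> jet_Y0 m (jY m))) _.
rewrite -mulrA -sumN;apply:ler_sum=> m _;apply:le_trans (J_Y0 m k3 (jY m)) _.
by rewrite -mulrA ler_wpM2l//;apply:J_Y0.
Qed.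

Lemma Y0jD m U W s : Y0j m (addj U (scalej (-1) W)) s = Y0j m U s - Y0j m W s.
Proof. by apply/funext=> z;rewrite /Y0j /addj /scalej /shiftj !fctE /GRing.scale /=;ring. Qed.

Lemma J_LapD k W : (k <= 2)%N -> jet k.+2 D W ->
 J k.+1 D (LapD W) <= N * (2 * (Qc * Qc)) * (d * J k.+3 D W + J k.+2 D W).
Proof.
move=> k2 jW;have k3 : (k <= 3)%N by exact:leqW.
have jY m : jet k.+1 D (Yj m W) by apply:jet_Y.
have jDW m : jet k.+1 D (Dj m W) by exact:jet_D.
(* Y^2 - Y0^2 = (Y - Y0) Y + Y0 (Y - Y0): each summand contains the small difference once. *)
pose T m:= addj (Dj m (Yj m W)) (Y0j m (Dj m W)).
have jT m : jet k D (T m) by apply:jet_add=> //;[exact:jet_D|exact:jet_Y0].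
have -> : J k.+1 D (LapD W) = J k.+1 D (sumj (index_enum I) T).
 apply:J_ext=> s _;congr nrm;rewrite /LapD /addj /scalej /LapY /Lap0 /sumj.
 rewrite scaleN1r -sumrB;apply:eq_bigr=> m _.
 rewrite /T {1}/addj [Y0j m (Dj m W) s]Y0jD /Dj {1}/addj {1}/scalej scaleN1r.
 by rewrite addrA subrK.
apply:le_trans (J_sum _ oD jT) _;rewrite -mulrA -sumN;apply:ler_sum=> m _.
apply:le_trans (J_add oD _ _) _;[exact:jet_D|exact:jet_Y0|].
have h1:= J_D m k3 (jY m);have h2:= J_Y0 m k3 (jDW m).
have h3:= J_D m (k2 : (k.+1 <= 3)%N) jW.
have h4:= J_Y m oD (k2 : (k.+1 <= 3)%N) jW;have h5:= J_Y m oD k3 (jetW (leqnSn _) jW).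
set a:= J k.+3 D W in h3 h4 *;set b:= J k.+2 D W in h3 h5 *.
have b1 : Qc * (d * J k.+2 D (Yj m W) + J k.+1 D (Yj m W)) <= Qc * (d * (Qc * a) + Qc * b).
 by rewrite ler_wpM2l// lerD// ler_wpM2l.
have b2 : Qc * J k.+2 D (Dj m W) <= Qc * (Qc * (d * a + b)) by rewrite ler_wpM2l.
have e1 : 2 * (Qc * Qc) * (d * a + b) = Qc * (d * (Qc * a) + Qc * b) + Qc * (Qc * (d * a + b)) by ring.
rewrite e1;apply:lerD;[exact:le_trans h1 b1|exact:le_trans h2 b2].
Qed.

Definition pert_const : R:= 4 * (N * N * (Qc * Qc * (Qc * Qc))).

Lemma perturbation W : jet 4 D W ->
 nrm mu D (LapY (LapY W) [::] - Lap0 (Lap0 W) [::]) <= pert_const * (d * J 5 D W + J 4 D W).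
Proof.
move=> jW;have jL : jet 2 D (LapY W) by exact:jet_LapY.
have j0 : jet 2 D (Lap0 W) by exact:jet_Lap0.
have jLD : jet 2 D (LapD W) by apply:jet_add=> //;exact:jet_scale.
(* The same splitting one level higher, for the squares of the two Laplacians. *)
pose T:= addj (LapD (LapY W)) (Lap0 (LapD W)).
have jA : jet 0 D (LapD (LapY W)).
 by apply:jet_add=> //;[exact:jet_LapY|apply:jet_scale=> //;exact:jet_Lap0].
have jB : jet 0 D (Lap0 (LapD W)) by exact:jet_Lap0.
have LL A B : Lap0 (addj A (scalej (-1) B)) [::] = Lap0 A [::] - Lap0 B [::].
 rewrite /Lap0 /sumj -sumrB;apply:eq_bigr=> m _;apply/funext=> z.
 by rewrite /Y0j /addj /scalej /shiftj !fctE /GRing.scale /=;ring.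
have e : LapY (LapY W) [::] - Lap0 (Lap0 W) [::] = T [::].
 rewrite /T {1}/addj {1}/LapD {1}/addj {1}/scalej scaleN1r.
 rewrite [Lap0 (LapD W) [::]]LL.
 by rewrite addrA subrK.
rewrite e;apply:(@le_trans _ _ (J 1 D T));first exact:le_J.
apply:le_trans (J_add oD jA jB) _.
have h1:= J_LapD (k:= 0) isT jL;have h2:= J_Lap0 (k:= 0) isT jLD.
have h3:= J_LapD (k:= 2) isT jW.
have h4:= J_LapY (k:= 2) isT jW;have h5:= J_LapY (k:= 1) isT (jetW (leqnSn _) jW).
have q0 : 0 <= N * (Qc * Qc) by apply:mulr_ge0=> //;exact:mulr_ge0.
set q:= N * (Qc * Qc) in q0 h2 h4 h5.
have eq2 : N * (2 * (Qc * Qc)) = 2 * q by rewrite /q;ring.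
rewrite eq2 in h1 h3.
have b1 : 2 * q * (d * J 3 D (LapY W) + J 2 D (LapY W)) <= 2 * q * (d * (q * J 5 D W) + q * J 4 D W).
 by apply:ler_wpM2l;[rewrite mulr_ge0|apply:lerD=> //;rewrite ler_wpM2l].
have b2 : q * J 3 D (LapD W) <= q * (2 * q * (d * J 5 D W + J 4 D W)) by rewrite ler_wpM2l.
have -> : pert_const * (d * J 5 D W + J 4 D W) = 2 * q * (d * (q * J 5 D W) + q * J 4 D W) + q * (2 * q * (d * J 5 D W + J 4 D W)).
 by rewrite /pert_const /q;ring.
by apply:lerD;[exact:le_trans h1 b1|exact:le_trans h2 b2].
Qed.

Definition ymx : 'M[R]_n.+1:= \matrix_(m, k) ((k == m)%:R - c m * (k == ord0)%:R).

Lemma ymx_unit : ymx \in unitmx.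
Proof.
(* Changing the sign of c inverts the matrix, because c vanishes at the index 0. *)
pose y' : 'M[R]_n.+1:= \matrix_(m, k) ((k == m)%:R + c m * (k == ord0)%:R).
apply:(proj1 (@mulmx1_unit _ _ ymx y' _));apply/matrixP=> m k;rewrite !mxE.
have E j : ymx m j * y' j k = (j == m)%:R * ((k == j)%:R + c j * (k == ord0)%:R) - (j == ord0)%:R * (c m * ((k == j)%:R + c j * (k == ord0)%:R)).
 by rewrite !mxE;ring.
rewrite (eq_bigr _ (fun j _=> E j)) sumrB (bigD1 m) //= (bigD1 (P:= predT) ord0) //= !eqxx !mul1r.
rewrite !big1 ?addr0;first by rewrite c0 eq_sym;ring.
- by move=> j /negPf ->;rewrite mul0r.
- by move=> j /negPf ->;rewrite mul0r.
Qed.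

Lemma Lap0E W : Lap0 W = opA (ymx^T *m ymx) W.
Proof.
have Y0E m X s : Y0j m X s = \sum_k ymx m k *: X (s ++ [:: k]).
 have E k : ymx m k *: X (s ++ [:: k]) = (k == m)%:R *: X (s ++ [:: k]) + (k == ord0)%:R *: (- c m *: X (s ++ [:: k])).
  by rewrite mxE scalerBl [in RHS]scalerA mulrN scaleNr [c m * _]mulrC.
 rewrite (eq_bigr _ (fun k _=> E k)) big_split /= (bigD1 m) //= eqxx scale1r big1 ?addr0;last first.
  by move=> k /negPf ->;rewrite scale0r.
 rewrite (bigD1 ord0) //= scale1r big1 ?addr0//.
 by move=> k /negPf ->;rewrite scale0r.
apply/funext=> s;rewrite /Lap0 /sumj /opA.
rewrite (eq_bigr (fun m=> \sum_k \sum_l (ymx m k * ymx m l) *: W (s ++ [:: k;l])));last first.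
 move=> m _;rewrite Y0E;apply:eq_bigr=> k _;rewrite Y0E scaler_sumr;apply:eq_bigr=> l _.
 by rewrite scalerA -catA.
rewrite exchange_big;apply:eq_bigr=> k _;rewrite exchange_big;apply:eq_bigr=> l _.
rewrite -scaler_suml;congr (_ *: _);rewrite [RHS]mxE;apply:eq_bigr=> m _;congr (_ * _).
by rewrite [RHS]mxE.
Qed.

End frozen_coefficients.

End perturbation.

(** * Products with a cut-off, carried from one domain to another *)

Section mul_ext.
Context (R : realType) (n : nat).
Notation V:= 'rV[R]_n.
Notation mu:= (lebesgue_rV R n).
Notation I:= 'I_n.
Implicit Types (U W X : seq I -> V -> R) (D F G Om : set V) (a u g : V -> R).

(** The situation of this section: a is supported in F, and within F the set G is contained in Om.
    The product of a with a function on Om is then a function on G, whatever values the factor takes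
    outside Om. *)
Lemma dot_ext_zoff G Om F a u h : F `&` G `<=` Om -> zoff F a ->
 (forall x, ~ G x -> h x = 0) -> dot mu G (a * u) h = dot mu Om u (a * h).
Proof.
move=> FGO za zh;rewrite dot_patchl [RHS]dot_patchl;congr Rintegral;apply/funext=> x.
rewrite /patch;case:ifPn=> xG;case:ifPn=> xO.
- by rewrite !fctE mulrCA mulrA.
- have ax : a x = 0 by apply:za=> Fx;move: xO;rewrite mem_set//;apply:FGO;split=> //;exact:set_mem.
 by rewrite !fctE ax !mul0r.
- have hx : h x = 0 by apply:zh=> /mem_set;rewrite (negPf xG).
 by rewrite !fctE hx ?mulr0 ?mul0r.
- by rewrite !mul0r.
Qed.

Lemma ctest_ext G Om F a phi : F `&` G `<=` Om -> closed F -> zoff F a -> C_k 1 a ->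
 ctest G phi -> ctest Om (a * phi).
Proof.
move=> FGO cF za Ca [Cp [F' [cF' bF' FG' z']]];split;first exact:C_kM.
exists (F `&` F');split.
- exact:closedI.
- have /bounded_setP[N N0 h] := bF';apply/bounded_setP;exists N=> // x [_ /h]//.
- by move=> x [Fx /FG' Gx];exact:FGO.
- move=> x nF;rewrite !fctE;have [Fx|nFx] := pselect (F x);last by rewrite (za x nFx) mul0r.
 by rewrite (z' x) ?mulr0// => F'x;exact:nF.
Qed.

Lemma sqi_ext_zoff G Om F u : measurable G -> measurable Om -> F `&` G `<=` Om -> zoff F u ->
 sqi mu Om u -> sqi mu G u.
Proof.
move=> mG mO FGO zu su;have mGO : measurable (G `&` Om) by exact:measurableI.
have sGO : sqi mu (G `&` Om) u by apply:sqi_sub mGO mO _ su=> x [].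
apply:(proj2 (sqi_patch u mG));have:= proj1 (sqi_patch u mGO) sGO.
congr (sqi mu _ _);apply/funext=> x;rewrite /patch in_setI.
case:ifPn=> [/andP[-> _]//|];case:ifPn=> // xG;rewrite ?xG /= => xO.
by apply/esym/zu=> Fx;move: xO;rewrite mem_set//;apply:FGO;split=> //;exact:set_mem.
Qed.

Lemma wdM_ext G Om F a i u g C : open G -> open Om -> F `&` G `<=` Om -> closed F -> zoff F a ->
 C_k 1 a -> (forall x, `|a x| <= C) -> (forall x, `|'D_('e_i) a x| <= C) ->
 sqi mu Om u -> sqi mu Om g -> wd Om i u g ->
 wd G i (a * u) ((fun x=> 'D_('e_i) a x) * u + a * g).
Proof.
move=> oG oO FGO cF za Ca aC DaC su sg w phi tp.
have mG:= open_meas oG;have mO:= open_meas oO.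
have ct:= test_ctest tp;have [Cp _] := ct.
have zp x : ~ G x -> phi x = 0 by exact:test_eq0 tp.
have zDp x : ~ G x -> 'D_('e_i) phi x = 0 by exact:(test_eq0 (test_pderiv [:: i] tp)).
pose Da x:= 'D_('e_i) a x;pose Dp x:= 'D_('e_i) phi x.
have zDa : zoff F Da by exact:derive_zoff.
have C0a : C_k 0 a by exact:C_kW Ca.
have C0Da : C_k 0 Da:= C_k_D i Ca.
have sp : sqi mu Om phi:= sqiT mO (sqi_test [::] tp).
have sDp : sqi mu Om Dp:= sqiT mO (sqi_test [:: i] tp).
have sDap : sqi mu Om (Da * phi) by apply:sqiM_ck=> // x _;exact:DaC.
have saDp : sqi mu Om (a * Dp) by apply:sqiM_ck=> // x _;exact:aC.
have sDau : sqi mu G (Da * u).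
 apply:(sqi_ext_zoff mG mO FGO)=> [x /zDa h|];first by rewrite fctE h mul0r.
 by apply:sqiM_ck=> // x _;exact:DaC.
have sag : sqi mu G (a * g).
 apply:(sqi_ext_zoff mG mO FGO)=> [x /za h|];first by rewrite fctE h mul0r.
 by apply:sqiM_ck=> // x _;exact:aC.
have spG : sqi mu G phi:= sqiT mG (sqi_test [::] tp).
have H:= wd_C1 oO su sg w (ctest_ext FGO cF za Ca ct).
have E : (fun x=> 'D_('e_i) (a * phi) x) = Da * phi + a * Dp.
 by apply/funext=> x;exact:(derive_mul1 i x Ca Cp).
move: H;rewrite E dotDr// => H.
rewrite -/Dp -/Da (dot_ext_zoff u FGO za zDp) dotDl//.
rewrite (dot_ext_zoff u FGO zDa zp) (dot_ext_zoff g FGO za zp).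
by move: H;set A1:= dot _ _ _ _;set A2:= dot _ _ _ _;set A3:= dot _ _ _ _;lra.
Qed.

Lemma mulj_zoff F a U s : closed F -> zoff F a -> zoff F (mulj a U s).
Proof.
move=> cF za;have zs t : zoff F (pderiv t a).
 by elim: t=> //= i t IH;exact:derive_zoff.
by move=> x nF;rewrite /mulj fct_sumE big1// => p _;rewrite fctE (zs _ x nF) mul0r.
Qed.

Lemma jet_mul_ext k G Om F a U M : open G -> open Om -> F `&` G `<=` Om -> closed F ->
 zoff F a -> C_k k a -> bnd k setT a M -> jet k Om U -> jet k G (mulj a U).
Proof.
move=> oG oO FGO cF za Ca b jU;have mG:= open_meas oG;have mO:= open_meas oO.
have zs t : zoff F (pderiv t a) by elim: t=> //= i t IH;exact:derive_zoff.
have b' : bnd k Om a M by move=> s sk x _;exact:b.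
split=> [s sk|s i sk].
 apply:(sqi_ext_zoff mG mO FGO);first exact:mulj_zoff.
 by apply:(proj1 (jet_mul oO Ca b' jU)).
rewrite /mulj /= big_cat !big_map /= -big_split /= big_seq [X in wd _ _ _ X]big_seq.
have p1 p : p \in splits s -> (size p.1 < k)%N.
 by move=> /size_splits ps;apply:leq_ltn_trans sk;rewrite -ps leq_addr.
have p2 p : p \in splits s -> (size p.2 < k)%N.
 by move=> /size_splits ps;apply:leq_ltn_trans sk;rewrite -ps leq_addl.
have sU2 p : p \in splits s -> sqi mu Om (U p.2) by move=> /p2/ltnW;exact:(proj1 jU).
have sU3 p : p \in splits s -> sqi mu Om (U (i :: p.2)) by move=> /p2 h;exact:(proj1 jU (i :: p.2) h).
have C0 t : (size t <= k)%N -> C_k 0 (pderiv t a).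
 by move=> tk;apply/C_k0;case:Ca=> _;exact.
have C1 t : (size t < k)%N -> C_k 1 (pderiv t a).
 by move=> tk;apply:C_k_pderiv;exact:C_kW Ca.
have sM t (u : V -> R) : (size t <= k)%N -> sqi mu Om u -> sqi mu G (pderiv t a * u).
 move=> tk su;apply:(sqi_ext_zoff mG mO FGO)=> [x /zs h|];first by rewrite fctE h mul0r.
 by apply:sqiM_ck=> //;[exact:C0|move=> x _;exact:b].
apply:wd_sum=> // p ps.
- by apply:sM;[exact:ltnW (p1 _ ps)|exact:sU2].
- apply:sqiD=> //;first by apply:(sM (i :: p.1));[exact:p1|exact:sU2].
 by apply:sM;[exact:ltnW (p1 _ ps)|exact:sU3].
- apply:(wdM_ext oG oO FGO cF (zs _) (C1 _ (p1 _ ps)) (C:= M)).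
 + by move=> x;exact:b (ltnW (p1 _ ps)) x Logic.I.
 + by move=> x;exact:(b (i :: p.1) (p1 _ ps) x Logic.I).
 + exact:sU2.
 + exact:sU3.
 + exact:(proj2 jU) (p2 _ ps).
Qed.

Definition lap2 U : V -> R:= opA 1%:M (opA 1%:M U) [::].

Lemma lap2E U z : lap2 U z = \sum_k \sum_l \sum_p \sum_q
 ((1%:M : 'M[R]_n) k l * (1%:M : 'M[R]_n) p q * U [:: k;l;p;q] z).
Proof.
rewrite /lap2 /opA fct_sumE;apply:eq_bigr=> k _;rewrite fct_sumE;apply:eq_bigr=> l _.
rewrite fctE fct_sumE scaler_sumr;apply:eq_bigr=> p _;rewrite fct_sumE scaler_sumr.
by apply:eq_bigr=> q _;rewrite fctE /GRing.scale /= mulrA.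
Qed.

Lemma lap2_mul_le Om a U M : open Om -> C_k 4 a -> 0 <= M -> bnd 4 Om a M -> jet 4 Om U ->
 nrm mu Om (lap2 (mulj a U)) <= M * nrm mu Om (lap2 U) +
  (\sum_(k : I) \sum_(l : I) \sum_(p : I) \sum_(q : I) 2 ^+ 4) * M * J 4 Om U.
Proof.
move=> oO Ca M0 b jU;have mO:= open_meas oO.
pose r s : V -> R:= mulj a U s - a * U s.
have sr s : (size s <= 4)%N -> sqi mu Om (r s).
 move=> s4;have [saU _] := mulj_rest oO Ca M0 b jU s4.
 by apply:sqiB=> //;exact:(proj1 (jet_mul oO Ca b jU)).
have nr s : (size s <= 4)%N -> nrm mu Om (r s) <= 2 ^+ 4 * M * J 4 Om U.
 move=> s4;have [_ h] := mulj_rest oO Ca M0 b jU s4;apply:le_trans h _.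
 by rewrite ler_wpM2l ?mulr_ge0 ?exprn_ge0// J_W.
have sl : sqi mu Om (lap2 U) := proj1 (jet_opA 1%:M oO (jet_opA 1%:M oO jU)) [::] isT.
have sal : sqi mu Om (a * lap2 U).
 by apply:sqiM_ck (b [::] isT) sl=> //;exact:C_kW Ca.
pose c k l p q : R:= (1%:M : 'M[R]_n) k l * (1%:M : 'M[R]_n) p q.
have c1 k l p q : `|c k l p q| <= 1.
 by rewrite /c !mxE -natrM ger0_norm// -[leRHS]/(1%:R) ler_nat;case:eqP;case:eqP.
pose T:= \sum_k \sum_l \sum_p \sum_q c k l p q *: r [:: k;l;p;q].
have sT1 k l p q : sqi mu Om (c k l p q *: r [:: k;l;p;q]) by apply:sqiZ=> //;exact:sr.
have sT2 k l p : sqi mu Om (\sum_q c k l p q *: r [:: k;l;p;q]) by apply:sqi_sum.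
have sT3 k l : sqi mu Om (\sum_p \sum_q c k l p q *: r [:: k;l;p;q]) by apply:sqi_sum.
have sT4 k : sqi mu Om (\sum_l \sum_p \sum_q c k l p q *: r [:: k;l;p;q]) by apply:sqi_sum.
have sT : sqi mu Om T by apply:sqi_sum.
have E : lap2 (mulj a U) = a * lap2 U + T.
 apply/funext=> z;rewrite -[RHS]/(a z * lap2 U z + T z) !lap2E /T fct_sumE mulr_sumr -big_split;apply:eq_bigr=> k _ /=.
 rewrite fct_sumE mulr_sumr -big_split;apply:eq_bigr=> l _ /=.
 rewrite fct_sumE mulr_sumr -big_split;apply:eq_bigr=> p _ /=.
 rewrite fct_sumE mulr_sumr -big_split;apply:eq_bigr=> q _ /=.
 by rewrite /r /c !fctE /GRing.scale /=;ring.
rewrite E;apply:le_trans (nrmD mO sal sT) _;apply:lerD.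
 apply:nrmM M0 (b [::] isT) sl=> //.
 by apply:measurable_funTS;apply:continuous_meas;exact:C_k_cont Ca.
rewrite -mulrA mulr_suml;apply:le_trans (nrm_sum _ mO _) _=> //;apply:ler_sum=> k _.
rewrite mulr_suml;apply:le_trans (nrm_sum _ mO _) _=> //;apply:ler_sum=> l _.
rewrite mulr_suml;apply:le_trans (nrm_sum _ mO _) _=> //;apply:ler_sum=> p _.
rewrite mulr_suml;apply:le_trans (nrm_sum _ mO _) _=> //;apply:ler_sum=> q _.
have h:= nr [:: k;l;p;q] isT;rewrite -mulrA in h;apply:le_trans _ h.
rewrite nrmZ;[exact:ler_piMl (nrm_ge0 _ _ _) (c1 _ _ _ _)|exact:mO|exact:sr].
Qed.

End mul_ext.

(** * Derivatives and Laplacian of a function read in a chart *)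

Section chart_relation.
Context (R : realType) (n : nat).
Notation V:= 'rV[R]_n.+1.
Notation mu:= (lebesgue_rV R n.+1).
Notation I:= 'I_n.+1.
Variables (P : 'M[R]_n.+1) (gm : 'rV[R]_n -> R) (x0 : V).
Hypothesis PP : P *m P^T = 1%:M.
Hypothesis Cg : C_k 4 gm.
Variable MG : R.
Hypothesis MG0 : 0 <= MG.
Hypothesis bG : forall k, bnd 3 setT (Gam gm k) MG.
Notation chart:= (chart P gm x0).
Notation uchart:= (uchart P gm x0).
Notation Gam:= (Gam gm).
Notation Jac:= (Jac P gm).
Notation Yj:= (Yj gm).
Notation LapY:= (LapY gm).
Implicit Types (U W X : seq I -> V -> R).

Let PP' : P^T *m P = 1%:M. Proof. exact:mulmx1C. Qed.

Definition rotj m U:= sumj (index_enum I) (fun l=> scalej (P m l) (shiftj [:: l] U)).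

Lemma jet_rot k Om m U : open Om -> jet k.+1 Om U -> jet k Om (rotj m U).
Proof.
move=> oO jU;apply:jet_sum=> // l;apply:jet_scale=> //.
by apply:jet_shift;rewrite addn1.
Qed.

Section domains.
Variables (D Om : set V) (oD : open D) (oO : open Om).
Hypothesis DO : forall z, D z -> Om (chart z).
Let mD : measurable D:= open_meas oD.
Let mO : measurable Om:= open_meas oO.

Lemma nrm_chart_le A (u : V -> R) : measurable A -> A `<=` Om -> sqi mu Om u ->
 (forall x, A x -> D (uchart x)) -> nrm mu A u <= nrm mu D (u \o chart).
Proof.
move=> mA AO su AD;have suA:= sqi_sub mA mO AO su.
have sp:= proj1 (sqi_patch u mA) suA.
have suc:= sqi_comp PP Cg oD oO DO su.
have -> : nrm mu A u = nrm mu setT ((u \_ A) \o chart).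
 by rewrite nrm_patch /nrm (dot_chart x0 PP Cg sp sp).
rewrite [leRHS]nrm_patch;apply:nrm_le=> //;first exact:sqi_chart.
 exact:(proj1 (sqi_patch _ mD) suc).
move=> z _;rewrite /= /patch;case:ifPn=> [/set_mem/AD|_];last by rewrite normr0.
by rewrite chartK// => Dz;rewrite mem_set.
Qed.

Lemma chart_Y k U W m : (k <= 3)%N -> jet k.+1 Om U -> jet k.+1 D W ->
 ae_eq mu D (W [::]) (U [::] \o chart) -> ae_eq mu D (Yj m W [::]) (rotj m U [::] \o chart).
Proof.
move=> k3 jU jW e;have [sU wU] := jU;have [sW wW] := jW.
have su:= sU [::] isT;have sul l:= sU [:: l] isT;have sul' l:= sqi_comp PP Cg oD oO DO (sul l).
have ae1 i : ae_eq mu D (W [:: i]) (\sum_l Jac i l * (U [:: l] \o chart)).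
 apply:(wd_uniq oD (sW [::] isT) (sqi_comp PP Cg oD oO DO su) (sW [:: i] isT) _ e (wW [::] i isT)).
  apply:sqi_sum=> // l _;apply:sqiM_ck (sul' l)=> //;first exact:C_kW (C_k_Jac P Cg i l).
  by move=> x _;exact:(bnd_Jac P Cg MG0 bG i l (s:= [::]) isT Logic.I).
 exact:(chain_rule PP Cg bG oD oO DO i su sul (fun l=> wU [::] l isT)).
apply:filterS2 (ae1 m) (ae1 ord0)=> z hm h0 Dz.
have J0 l : Jac ord0 l z = P ord0 l by rewrite /Jac Gam0 mul0r addr0.
rewrite /Yj /addj /scalej mulj0 /shiftj /= !fctE (hm Dz) (h0 Dz) !fct_sumE /rotj /sumj /= fct_sumE.
rewrite scaleN1r mulr_sumr -sumrB;apply:eq_bigr=> l _.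
by rewrite /scalej /shiftj !fctE J0 /Jac /GRing.scale /=;ring.
Qed.

(** By [chart_Y] the operators [Yj] become the rotated derivatives, and P^T P = 1 turns the sum of
    their squares into the Laplacian. *)
Lemma chart_Lap k U W : (k <= 2)%N -> jet k.+2 Om U -> jet k.+2 D W ->
 ae_eq mu D (W [::]) (U [::] \o chart) -> ae_eq mu D (LapY W [::]) (opA 1%:M U [::] \o chart).
Proof.
move=> k2 jU jW e;have k3 : (k <= 3)%N by exact:leqW.
have h m : ae_eq mu D (Yj m (Yj m W) [::]) (rotj m (rotj m U) [::] \o chart).
 apply:(@chart_Y k (rotj m U) (Yj m W) m k3)=> //;[exact:jet_rot|exact:(jet_Y Cg bG m oD (k2 : (k.+1 <= 3)%N) jW)|].
 exact:(chart_Y (k:= k.+1)).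
have H : {ae mu, forall z, forall m, D z -> Yj m (Yj m W) [::] z = (rotj m (rotj m U) [::] \o chart) z}.
 by apply:filter_forall=> m;exact:h.
apply:filterS H=> z hz Dz.
rewrite /LapY /sumj fct_sumE (eq_bigr _ (fun m _=> hz m Dz)) /=.
rewrite /rotj /sumj /opA.
transitivity (\sum_m \sum_l \sum_p (P m l * P m p) * U [:: l;p] (chart z)).
 apply:eq_bigr=> m _;rewrite fct_sumE;apply:eq_bigr=> l _.
 rewrite /scalej {1}/shiftj !fctE fct_sumE scaler_sumr;apply:eq_bigr=> p _.
 by rewrite /shiftj !fctE /GRing.scale /= mulrA.
rewrite fct_sumE exchange_big;apply:eq_bigr=> l _.
rewrite fct_sumE exchange_big;apply:eq_bigr=> p _.
rewrite -mulr_suml fctE /GRing.scale /=;congr (_ * _);rewrite -PP' [RHS]mxE.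
by apply:eq_bigr=> m _;rewrite [in RHS]mxE.
Qed.

End domains.

(** The converse of [J_comp_le], by induction on the innermost derivative: orthogonality of P gives
    D_l U o chart = sum_m P_ml Y_m W, so that the jet X replaces W for the shifted jet of U. The
    constant depends on the chart alone. *)
Lemma chart_rev k : (k <= 4)%N -> exists2 C, 0 <= C & forall D Om U W, open D -> open Om ->
 (forall z, D z -> Om (chart z)) -> jet k Om U -> jet k D W ->
 ae_eq mu D (W [::]) (U [::] \o chart) ->
 forall s, (size s <= k)%N -> nrm mu D (U s \o chart) <= C * J k.+1 D W.
Proof.
elim: k=> [_|k IH k4].
 exists 1=> // D Om U W oD oO DO jU jW e [|//] _;rewrite mul1r.
 rewrite -(ae_eq_nrm (open_meas oD) (proj1 jW [::] isT) (sqi_comp PP Cg oD oO DO (proj1 jU [::] isT)) e).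
 exact:le_J.
have [C C0 hC] := IH (ltnW k4).
pose c:= C * \sum_(m : I) \sum_(l : I) `|P m l| * Qc n MG.
have Q0 : 0 <= Qc n MG:= le_trans ler01 (Qc_ge1 n MG0).
have c0 : 0 <= c by rewrite mulr_ge0// sumr_ge0// => m _;rewrite sumr_ge0// => l _;rewrite mulr_ge0.
exists (1 + c);first by rewrite addr_ge0.
move=> D Om U W oD oO DO jU jW e s;have J0:= J_ge0 k.+2 D W.
case/lastP: s=> [_|s l].
 rewrite -(ae_eq_nrm (open_meas oD) (proj1 jW [::] isT) (sqi_comp PP Cg oD oO DO (proj1 jU [::] isT)) e).
 apply:(@le_trans _ _ (J k.+2 D W));first exact:le_J.
 by rewrite ler_peMl// lerDl.
rewrite size_rcons=> sk;pose X:= sumj (index_enum I) (fun m=> scalej (P m l) (Yj m W)).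
have jY m : jet k D (Yj m W) := jet_Y Cg bG m oD (k4 : (k <= 3)%N) jW.
have jX : jet k D X by apply:jet_sum=> // m;exact:jet_scale.
have jS : jet k Om (shiftj [:: l] U) by apply:jet_shift;rewrite addn1.
have eX : ae_eq mu D (X [::]) (shiftj [:: l] U [::] \o chart).
 have H : {ae mu, forall z, forall m, D z -> Yj m W [::] z = (rotj m U [::] \o chart) z}.
  by apply:filter_forall=> m;exact:(chart_Y oD oO DO m (k4 : (k <= 3)%N)).
 apply:filterS H=> z hz Dz;rewrite /X /sumj fct_sumE /= /shiftj /=.
 transitivity (\sum_m \sum_p P m l * P m p * U [:: p] (chart z)).
  apply:eq_bigr=> m _;rewrite /scalej fctE (hz m Dz) /= /rotj /sumj fct_sumE scaler_sumr.
  by apply:eq_bigr=> p _;rewrite /scalej /shiftj !fctE /GRing.scale /= mulrA.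
 have PE p : \sum_m P m l * P m p = (l == p)%:R.
  have:= congr1 (fun B : 'M[R]_n.+1=> B l p) PP';rewrite !mxE=> <-.
  by apply:eq_bigr=> m _;rewrite mxE.
 rewrite exchange_big (bigD1 l) //= -mulr_suml PE eqxx mul1r big1 ?addr0// => p pl.
 by rewrite -mulr_suml PE eq_sym (negPf pl) mul0r.
have:= hC D Om _ X oD oO DO jS jX eX s sk;rewrite /shiftj cats1=> h;apply:le_trans h _.
have hX : J k.+1 D X <= (\sum_(m : I) `|P m l| * Qc n MG) * J k.+2 D W.
 apply:le_trans (J_sum _ oD (fun m=> jet_scale (P m l) oD (jY m))) _.
 rewrite mulr_suml;apply:ler_sum=> m _;rewrite (J_scale _ oD (jY m)) -mulrA ler_wpM2l//.
 exact:(J_Y Cg MG0 bG m oD (k4 : (k <= 3)%N) jW).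
apply:(@le_trans _ _ (C * ((\sum_(m : I) `|P m l| * Qc n MG) * J k.+2 D W)));first by rewrite ler_wpM2l.
rewrite mulrA ler_wpM2r//;apply:(@le_trans _ _ c);last by rewrite lerDr.
rewrite /c ler_wpM2l//;apply:ler_sum=> m _;rewrite (bigD1 l) //= lerDl.
by rewrite sumr_ge0// => p _;rewrite mulr_ge0.
Qed.

End chart_relation.

(** The indicator of the ball of radius r + e, mollified at scale e. *)
Lemma cutoff_ex (R : realType) (n : nat) (r e : R) : 0 < r -> 0 < e ->
 exists chi : 'rV[R]_n -> R, [/\ smooth chi, csupp (r + 2 * e) chi & forall x, `|x| <= r -> chi x = 1].
Proof.
move=> r0 e0;have [K bK] := bump_ex n e0;have [SK K0 Kr K1] := bK.
have KM : csupp e K by move=> x ex;rewrite Kr// ltW.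
pose B:= [set y : 'rV[R]_n | `|y| <= r + e].
have mB : measurable B by apply:closed_meas;exact:closed_normle.
have sB : sqi (lebesgue_rV R n) setT (\1_B).
 by apply:sqi_indic=> //;apply:lebesgue_bounded=> //;exact:bounded_normle.
have BM : csupp (r + e) (\1_B : 'rV[R]_n -> R).
 by move=> x ex;rewrite indicE memNset// /B /=;apply/negP;rewrite -ltNge.
exists (convol K (\1_B));split.
- exact:smooth_conv SK KM sB.
- have:= csupp_conv KM BM;rewrite (_ : e + (r + e) = r + 2 * e)//;ring.
move=> x xr;rewrite /convol /dot.
have -> : \int[lebesgue_rV R n]_y (K (x - y) * \1_B y) = \int[lebesgue_rV R n]_y K (x - y).
 congr Rintegral;apply/funext=> y;have [h|h] := leP e `|x - y|.
  by rewrite Kr// mul0r.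
 rewrite indicE mem_set ?mulr1// /B /=.
 have:= ler_normD (y - x) x;rewrite subrK (distrC y)=> h2.
 by apply:le_trans h2 _;rewrite addrC;apply:lerD=> //;exact:ltW.
have iK : (lebesgue_rV R n).-integrable setT (EFin \o K).
 have sK:= sqi_C1 (SK 1%N) KM;exact:integrable_csupp sK KM.
rewrite (integral_transfer (measurable_subrV x) ler01 (lebesgue_subrV x) iK).
by rewrite mul1r.
Qed.

(** * Existence of charts at every point of the closure *)

Section chart_existence.
Context (R : realType) (n : nat).
Notation V:= 'rV[R]_n.+1.
Notation e0:= ('e_ord0 : V).

Lemma pderiv_base_shift (gm : 'rV[R]_n -> R) s z (t : R) :
 pderiv s (base gm) (z + t *: e0) = pderiv s (base gm) z.
Proof.
elim: s z=> [|i s IH] z;first exact:base_shift.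
rewrite /= -!/(pderiv s _).
have E : (fun z : V=> pderiv s (base gm) (z + t *: e0)) = pderiv s (base gm).
 by apply/funext=> y;exact:IH.
by rewrite -derive_trE E.
Qed.

(** [base gm] does not have bounded support, but it is constant along e_0. Its derivatives at z are
    those at the projection w of z on x_0 = 0, and they vanish if |w| > M. *)
Lemma bnd_base (k : nat) (gm : 'rV[R]_n -> R) M : C_k k gm -> csupp M gm ->
 exists2 C, 0 <= C & bnd k setT (base gm) C.
Proof.
move=> Cg gM;have [C C0 hC] := C_k_bnd (C_k_base Cg) (@bounded_normle R n.+1 M).
exists C=> // s sk z _.
pose w:= z + (- z ord0 ord0) *: e0.
rewrite -(pderiv_base_shift gm s z (- z ord0 ord0)) -/w.
have [wM|Mw] := leP `|w| M;first exact:hC.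
pose F:= [set y : V | `|y *m colmx R n + 0| <= M].
have cF : closed F.
 apply:(@closed_comp _ _ (fun y : V=> `|y *m colmx R n + 0|) [set r | r <= M]).
  move=> y _;apply:(@continuous_comp _ _ _ (fun y : V=> y *m colmx R n + 0) (fun y=> `|y|)).
   exact:continuous_affine_rV.
  exact:norm_continuous.
 exact:closed_le.
have zF : zoff F (base gm).
 move=> y nF;rewrite baseE;apply:gM;rewrite ltNge;exact/negP.
have zs : zoff F (pderiv s (base gm)) by elim: s {sk} => //= i s IH;exact:derive_zoff.
rewrite zs ?normr0// /F /= addr0 mul_colmx=> h.
move: Mw;rewrite ltNge=> /negP;apply;apply:norm_le_coord=> [|i].
 exact:le_trans (normr_ge0 _) h.
have [->|i0] := eqVneq i ord0.
 rewrite !mxE eqxx mulr1 addrN normr0;exact:le_trans (normr_ge0 _) h.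
have [j ->] : exists j, i = lift ord0 j.
 by case:(unliftP ord0 i)=> [j ->|e];[exists j|rewrite e eqxx in i0].
by apply:le_trans h;have:= coord_le (col' ord0 w) j;rewrite mxE.
Qed.

Definition adapted (P : 'M[R]_n.+1) gm MG (x0 : V) (Om : set V) r :=
 [/\ P *m P^T = 1%:M, C_k 4 gm, 0 <= MG & forall k, bnd 3 setT (Gam gm k) MG] /\
 forall x, `|x - x0| < r -> (Om x <-> hsp (uchart P gm x0 x)).

Lemma adapted_ex (P : 'M[R]_n.+1) gm (x0 : V) Om r : 0 < r -> P *m P^T = 1%:M -> C_k 4 gm ->
 (forall x, `|x - x0| < r -> let y:= (x - x0) *m P^T in Om x <-> gm (col' ord0 y) < y ord0 ord0) ->
 exists gamma' MG, adapted P gamma' MG x0 Om r.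
Proof.
move=> r0 PP Cg H.
pose C:= \sum_i \sum_j `|P^T i j|.
have C0 : 0 <= C by do 2 (apply:sumr_ge0=> ? _).
have lip (x : V) : `|x *m P^T| <= C * `|x|.
 apply:norm_le_coord=> [|j];first by rewrite mulr_ge0.
 rewrite mxE (le_trans (ler_norm_sum _ _ _))// /C mulr_suml;apply:ler_sum=> i _.
 rewrite normrM mulrC ler_pM// ?coord_le//.
 by rewrite (bigD1 j)//= lerDl sumr_ge0.
have q0 : 0 < C * r + 1 by rewrite ltr_wpDl// mulr_ge0// ltW.
have [chi [Schi chiM chi1]] := @cutoff_ex R n _ _ q0 ltr01.
pose gamma' : 'rV[R]_n -> R:= chi * gm.
have Cg' : C_k 4 gamma' by apply:C_kM.
have gM : csupp (C * r + 1 + 2 * 1) gamma' by move=> y /chiM e;rewrite /gamma' fctE e mul0r.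
have [MG MG0 bG] := bnd_base Cg' gM.
exists gamma', MG;split;first split=> //.
 move=> k s s3 x _;have:= bG (rcons s k);rewrite size_rcons pderiv_rcons;apply=> //.
move=> x xr;apply:iff_trans (H x xr) _;rewrite /= /uchart shearE.
set y:= (x - x0) *m P^T.
have yn : `|col' ord0 y| <= C * r + 1.
 apply:norm_le_coord=> [|j];first exact:ltW.
 rewrite mxE;apply:le_trans (coord_le y _) _;apply:le_trans (lip _) _.
 by rewrite ler_wpDr// ler_wpM2l// ltW.
rewrite /hsp /= !mxE /base eqxx mulr1 subr_gt0 /gamma' fctE (chi1 _ yn) mul1r.
by [].
Qed.

(** An interior point is treated as a boundary point: for the constant gm = -1 and r <= 1 the whole
    ball lies above the graph. *)
Lemma interior_chart (x0 : V) Om : open Om -> Om x0 ->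
 exists P gm MG r, 0 < r /\ adapted P gm MG x0 Om r.
Proof.
move=> oO Ox;have [r r0 h] := inner_set_ex oO Ox.
have m0 : 0 < Num.min r 1 by rewrite lt_min r0 ltr01.
have PP : (1%:M : 'M[R]_n.+1) *m 1%:M^T = 1%:M by rewrite trmx1 mulmx1.
have [|g [MG A]] := @adapted_ex 1%:M (fun _=> -1) x0 Om _ m0 PP (@C_k_cst R n 4 (-1)).
 move=> x;rewrite lt_min=> /andP[xr x1] /=;rewrite trmx1 mulmx1;split=> _.
  have:= coord_le (x - x0) ord0;rewrite ler_norml=> /andP[+ _].
  lra.
 by apply:contrapT=> nO;have:= h x nO;rewrite distrC leNgt xr.
by exists 1%:M, g, MG, (Num.min r 1).
Qed.

Lemma boundary_chart alpha (x0 : V) Om : open Om -> class_C_kalpha 4 alpha Om ->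
 closure Om x0 -> ~ Om x0 -> exists P gm MG r, 0 < r /\ adapted P gm MG x0 Om r.
Proof.
move=> oO cl cx nO.
have [|Q [gm [QQ [Cg _] H]]] := cl x0.
 by split=> // /interior_subset.
(* In [class_C_kalpha] the graph is over the last coordinate, in the charts over the coordinate 0.
   The permutation matrix S of sg exchanges the two conventions. *)
pose sg (j : 'I_n.+1) := if unlift ord0 j is Some j' then lift ord_max j' else ord_max.
have sg_inj j k : (sg j == sg k) = (j == k).
 rewrite /sg;case:(unliftP ord0 j)=> [j' ->|->];case:(unliftP ord0 k)=> [k' ->|->].
 - by rewrite !(inj_eq (@lift_inj _ _)).
 - by rewrite eq_sym (negPf (neq_lift _ _)) eq_sym (negPf (neq_lift _ _)).
 - by rewrite !(negPf (neq_lift _ _)).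
 - by rewrite !eqxx.
pose S : 'M[R]_n.+1:= \matrix_(i, j) (i == sg j)%:R.
have SS : S^T *m S = 1%:M.
 apply/matrixP=> j k;rewrite !mxE (bigD1 (sg j)) //= !mxE eqxx mul1r big1 ?addr0 ?sg_inj//.
 by move=> i ij;rewrite !mxE (negPf ij) mul0r.
have wS (w : V) j : (w *m S) ord0 j = w ord0 (sg j).
 rewrite mxE (bigD1 (sg j)) //= mxE eqxx mulr1 big1 ?addr0// => i ij.
 by rewrite mxE (negPf ij) mulr0.
pose P:= (Q *m S)^T.
have PP : P *m P^T = 1%:M.
 by rewrite /P trmxK trmx_mul -mulmxA (mulmxA Q^T) (mulmx1C QQ) mul1mx.
have /nbhs_ballP[r /= r0 hr] := H.
have [|g [MG A]] := @adapted_ex P gm x0 Om r r0 PP Cg.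
 move=> x xr;have:= hr x;rewrite -ball_normE /= distrC=> /(_ xr) {}H.
 rewrite /P trmxK mulmxA;set y:= (x - x0) *m Q in H *.
 rewrite wS /sg unlift_none.
 rewrite (_ : col' ord0 (y *m S) = col' ord_max y)//.
 by apply/rowP=> j;rewrite [LHS]mxE [RHS]mxE wS /sg liftK.
by exists P, g, MG, r.
Qed.

Lemma chart_ex alpha (x0 : V) Om : open Om -> class_C_kalpha 4 alpha Om ->
 closure Om x0 -> exists P gm MG r, 0 < r /\ adapted P gm MG x0 Om r.
Proof.
move=> oO cl cx;have [Ox|nOx] := pselect (Om x0);first exact:interior_chart.
exact:boundary_chart cl cx nOx.
Qed.

End chart_existence.

Section misc.
Context (R : realType) (n : nat).
Notation V:= 'rV[R]_n.
Notation mu:= (lebesgue_rV R n).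
Implicit Types (U W X : seq 'I_n -> V -> R) (D F G Om : set V) (a u g : V -> R).

Lemma nrm_ext_zoff G Om F u : measurable G -> measurable Om -> F `&` G `<=` Om -> zoff F u ->
 sqi mu Om u -> nrm mu G u <= nrm mu Om u.
Proof.
move=> mG mO FGO zu su;have suG:= sqi_ext_zoff mG mO FGO zu su.
rewrite nrm_patch [leRHS]nrm_patch;apply:nrm_le=> //.
- exact:(proj1 (sqi_patch _ mG)).
- exact:(proj1 (sqi_patch _ mO)).
move=> x _;rewrite /patch;case:ifPn=> xG;last by rewrite normr0.
case:ifPn=> // xO;rewrite zu ?normr0// => Fx;move: xO;rewrite mem_set//.
by apply:FGO;split=> //;exact:set_mem.
Qed.

Lemma J_mono k D D' U W : (forall s, (size s < k)%N -> nrm mu D (U s) <= nrm mu D' (W s)) -> J k D U <= J k D' W.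
Proof.
by move=> h;apply:ler_sum=> j _;apply:ler_sum=> t _;apply:h;rewrite size_tuple.
Qed.

Lemma J_succ_le k D U B : 0 <= B -> (forall t, size t = k -> nrm mu D (U t) <= B) ->
 J k.+1 D U <= J k D U + cJ R n k.+1 * B.
Proof.
move=> B0 h;rewrite /J big_ord_recr /= lerD2l /cJ big_ord_recr /= mulrDl.
apply:ler_wpDl;first by rewrite mulr_ge0//;apply:sumr_ge0=> j _;apply:sumr_ge0.
rewrite mulr_suml;apply:ler_sum=> t _;rewrite mul1r;apply:h;exact:size_tuple.
Qed.

Lemma jet_eq k D U W : jet k D U -> (forall s, (size s <= k)%N -> U s = W s) -> jet k D W.
Proof.
move=> [sU wU] e;split=> [s sk|s i sk];first by rewrite -e//;exact:sU.
by rewrite -(e s (ltnW sk)) -(e (i :: s) sk);exact:wU.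
Qed.

Lemma bnd_csupp k a M : C_k k a -> csupp M a -> exists2 C, 0 <= C & bnd k setT a C.
Proof.
move=> Ca aM;have [C C0 hC] := C_k_bnd Ca (@bounded_normle R n M).
exists C=> // s sk x _;have [xM|Mx] := leP `|x| M;first exact:hC.
pose F:= [set y : V | `|y| <= M].
have zF : zoff F a by move=> y nF;apply:aM;rewrite ltNge;exact/negP.
have cF : closed F:= @closed_normle R n M.
have zs : zoff F (pderiv s a) by elim: s {sk} => //= i s IH;exact:derive_zoff.
by rewrite zs ?normr0// /F /=;apply/negP;rewrite -ltNge.
Qed.

Lemma uniform_const (Q : nat -> R -> Prop) N : (forall k C C', C <= C' -> Q k C -> Q k C') ->
 (forall k, (k <= N)%N -> exists2 C, 0 <= C & Q k C) ->
 exists2 C, 0 <= C & forall k, (k <= N)%N -> Q k C.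
Proof.
move=> mono h;elim: N h=> [|N IH] h.
 by have [C C0 hC] := h 0%N isT;exists C=> // k;rewrite leqn0=> /eqP ->.
have [C C0 hC] := IH (fun k kN=> h k (leqW kN));have [C' C0' hC'] := h N.+1 (leqnn _).
exists (C + C');first exact:addr_ge0.
move=> k;rewrite leq_eqVlt=> /orP[/eqP ->|kN].
 by apply:mono hC';rewrite lerDr.
by apply:mono (hC k kN);rewrite lerDl.
Qed.

End misc.

(** * The estimate near one point of the closure of the domain *)

Section local_package.
Context (R : realType) (n : nat).
Notation V:= 'rV[R]_n.+1.
Notation mu:= (lebesgue_rV R n.+1).
Notation I:= 'I_n.+1.
Notation H:= (@hsp R n).
Implicit Types (U W X : seq I -> V -> R).
Variables (P : 'M[R]_n.+1) (gm : 'rV[R]_n -> R) (MG : R) (x0 : V) (Om : set V) (r : R).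
Hypothesis oO : open Om.
Hypothesis r0 : 0 < r.
Hypothesis ad : adapted P gm MG x0 Om r.

Let PP : P *m P^T = 1%:M. Proof. by case:ad=> -[]. Qed.
Let Cg : C_k 4 gm. Proof. by case:ad=> -[]. Qed.
Let MG0 : 0 <= MG. Proof. by case:ad=> -[]. Qed.
Let bG k : bnd 3 setT (Gam gm k) MG. Proof. by case:ad=> -[]. Qed.
Let chO x : `|x - x0| < r -> (Om x <-> H (uchart P gm x0 x)). Proof. by case:ad=> _;apply. Qed.
Notation chart:= (chart P gm x0).
Notation uchart:= (uchart P gm x0).
Notation compj:= (compj P gm x0).

Let z0 : V:= uchart x0.
Let c m:= Gam gm m z0.
Let c0 : c ord0 = 0. Proof. exact:Gam0. Qed.
Let cM m : `|c m| <= MG. Proof. exact:(bG m (s:= [::]) isT Logic.I). Qed.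

Let kf : R:= cJ R n.+1 5 * flat_const (ymx c).
Let kf0 : 0 <= kf. Proof. by apply:mulr_ge0;[exact:cJ_ge0|apply:flat_const_ge0;exact:ymx_unit]. Qed.
Let pc : R:= pert_const n MG.
Let pc0 : 0 <= pc.
Proof.
have Q0 : 0 <= Qc n MG:= le_trans ler01 (Qc_ge1 n MG0).
have N0 : 0 <= \sum_(m < n.+1) (1 : R) by exact:sumr_ge0.
by rewrite /pc /pert_const;apply:mulr_ge0=> //;apply:mulr_ge0;apply:mulr_ge0=> //;exact:mulr_ge0.
Qed.
(** The oscillation allowed to the coefficients: with it kf pc d <= 1/2, so that the top order norm
    in [perturbation] can be absorbed. *)
Let d : R:= (2 * (kf * pc + 1))^-1.
Let kp0 : 0 <= kf * pc. Proof. exact:mulr_ge0. Qed.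
Let d0 : 0 < d. Proof. by rewrite invr_gt0 mulr_gt0// ltr_wpDl. Qed.
Let kd : kf * pc * d <= 2^-1.
Proof.
rewrite /d ler_pdivrMr;last by rewrite mulr_gt0// ltr_wpDl.
by rewrite [leRHS]mulrA mulVf ?pnatr_eq0// mul1r lerDl.
Qed.

Let near_close : exists2 rho, 0 < rho & forall m z, `|z - z0| < rho -> `|Gam gm m z - c m| <= d.
Proof.
have : \forall z \near z0, forall m, `|Gam gm m z - c m| <= d.
 suff h m : \forall z \near z0, `|Gam gm m z - c m| <= d by
  exact:(@filter_forall _ _ (fun m (z : V)=> `|Gam gm m z - c m| <= d) (nbhs (z0 : V)) _ h).
 have cG : continuous (Gam gm m) := C_k_cont (C_k_Gam Cg m).
 have /cvgrPdist_le/(_ d d0) h : Gam gm m z @[z --> z0] --> Gam gm m z0 by exact:cG.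
 by apply:filterS h=> z;rewrite distrC.
move=> /nbhs_ballP[rho /= rho0 h];exists rho=> // m z zr;apply:h.
by rewrite -ball_normE /= distrC.
Qed.

(** W is the jet of (zeta u) o chart for a cut-off zeta. It carries norms back and forth between Om
    near x0 and the half space, where interpolation and the flat estimate are available. All
    constants are fixed before U. *)
Lemma local_package : exists rho C, [/\ 0 < rho, 0 <= C & forall U, jet 4 Om U ->
 jet 2 setT (fun s=> (U s) \_ Om) -> exists W M,
 [/\ 0 <= M, jet 4 H W, forall s, csupp M (W s), jet 2 setT (fun s=> (W s) \_ H) &
 [/\ forall k, (k <= 4)%N -> forall s, (size s <= k)%N ->
    nrm mu (Om `&` ball x0 rho) (U s) <= C * J k.+1 H W,
   forall k, (k <= 4)%N -> J k.+1 H W <= C * J k.+1 Om U &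
   J 5 H W <= C * (nrm mu Om (lap2 U) + J 4 Om U)]]].
Proof.
have [rho0 rho00 close] := near_close.
have [r1 r10 hr1] : exists2 r1, 0 < r1 & forall x, `|x - x0| < r1 -> `|uchart x - z0| < rho0.
 have cu : continuous uchart by exact:continuous_uchart.
 have /cvgrPdist_lt/(_ _ rho00) h : uchart x @[x --> x0] --> uchart x0 by exact:cu.
 move: h=> /nbhs_ballP[r1 /= r10 h];exists r1=> // x xr.
 by rewrite distrC;apply:h;rewrite -ball_normE /= distrC.
pose r2:= Num.min r r1.
have r20 : 0 < r2 by rewrite lt_min r0.
have r2r : r2 <= r by rewrite ge_min lexx.
have r2r1 : r2 <= r1 by rewrite ge_min lexx orbT.
pose F:= [set x : V | `|x - x0| <= r2 / 2].
have Fr x : F x -> `|x - x0| < r by rewrite /F /=;lra.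
have Fr1 x : F x -> `|x - x0| < r1 by rewrite /F /=;lra.
have cF : closed F.
 apply:(@closed_comp _ _ (fun x : V=> x - x0) [set y : V | `|y| <= r2 / 2]);last exact:closed_normle.
 by move=> x _;apply:(@lipschitz_dist_continuous R V V _ 1)=> // y z;rewrite mul1r opprB addrA subrK.
have q0 : 0 < r2 / 4 by rewrite divr_gt0.
have q1 : 0 < r2 / 8 by rewrite divr_gt0.
(* The cut-off is 1 up to the radius r2/4 and vanishes beyond r2/4 + 2 (r2/8) = r2/2. *)
have [chi [Schi chiM chi1]] := @cutoff_ex R n.+1 _ _ q0 q1.
pose zeta (x : V) := chi (x *m 1%:M + (- x0)).
have zetaE x : zeta x = chi (x - x0) by rewrite /zeta mulmx1.
have Cz k : C_k k zeta by apply:C_k_affine.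
have zF : zoff F zeta.
 move=> x nF;rewrite zetaE;apply:chiM.
 have : r2 / 2 < `|x - x0| by rewrite ltNge;exact/negP.
 lra.
have bF : bounded_set F.
 apply/bounded_setP;exists (`|x0| + r2);first by have:= normr_ge0 x0;lra.
 move=> x Fx;have h:= ler_normD (x - x0) x0;rewrite subrK in h.
 by move: Fx;rewrite /F /=;lra.
have [Mz zM] := zoff_csupp bF zF.
have [Mb Mb0 bz] := bnd_csupp (Cz 4%N) zM.
have bzk k D : (k <= 4)%N -> bnd k D zeta Mb.
 by move=> k4 s sk x _;apply:bz=> //;exact:leq_trans sk k4.
have oH : open H:= @open_half R n.
have mH:= open_meas oH;have mO:= open_meas oO.
(* The image of the whole half space under the chart. It needs to agree with Om only on F, the
   support of the cut-off, for zeta U to be a jet on both. *)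
pose G : set V:= [set x | H (uchart x)].
have oG : open G.
 by apply:(@open_comp _ _ uchart H)=> // x _;exact:continuous_uchart.
have mG:= open_meas oG.
have HG z : H z -> G (chart z) by rewrite /G /= chartK.
have FGO : F `&` G `<=` Om by move=> x [/Fr xr Gx];apply/(chO xr).
have FOG : F `&` Om `<=` G by move=> x [/Fr xr Ox];apply/(chO xr).
pose B : set V:= [set z | `|z - z0| < rho0].
have oB : open B.
 have -> : B = ball z0 rho0 by apply/seteqP;split=> z;rewrite -ball_normE /B /= distrC.
 exact:ball_open.
(* On D the coefficients are within d of their frozen values. Since W vanishes outside B, nothing is
   lost by restricting from the half space to D. *)
pose D : set V:= H `&` B.
have oD : open D by exact:openI.
have mD:= open_meas oD.
have DH : D `<=` H by move=> z [].
have oT:= @openT V.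
have [Crev Crev0 hrev] : exists2 C, 0 <= C & forall k, (k <= 4)%N -> forall D Om U W, open D -> open Om ->
 (forall z, D z -> Om (chart z)) -> jet k Om U -> jet k D W ->
 ae_eq mu D (W [::]) (U [::] \o chart) ->
 forall s, (size s <= k)%N -> nrm mu D (U s \o chart) <= C * J k.+1 D W.
 apply:(uniform_const (Q:= fun k C=> forall D Om U W, open D -> open Om ->
 (forall z, D z -> Om (chart z)) -> jet k Om U -> jet k D W ->
 ae_eq mu D (W [::]) (U [::] \o chart) ->
 forall s, (size s <= k)%N -> nrm mu D (U s \o chart) <= C * J k.+1 D W)).
  move=> k C C' CC h D' O' U W a1 a2 a3 a4 a5 a6 s sk;apply:le_trans (h _ _ _ _ a1 a2 a3 a4 a5 a6 s sk) _.
  by rewrite ler_wpM2r// J_ge0.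
 by move=> k k4;exact:(chart_rev x0 PP Cg MG0 bG k4).
have [Cc Cc0 hc] : exists2 C, 0 <= C & forall k, (k <= 4)%N -> forall D Om U, open D -> open Om ->
 (forall z, D z -> Om (chart z)) -> jet k Om U -> J k.+1 D (compj k U) <= C * J k.+1 Om U.
 apply:(uniform_const (Q:= fun k C=> forall D Om U, open D -> open Om ->
 (forall z, D z -> Om (chart z)) -> jet k Om U -> J k.+1 D (compj k U) <= C * J k.+1 Om U)).
  move=> k C C' CC h D' O' U a1 a2 a3 a4;apply:le_trans (h _ _ _ a1 a2 a3 a4) _.
  by rewrite ler_wpM2r// J_ge0.
 by move=> k k4;exact:(J_comp_le x0 PP Cg MG0 bG k4).
pose cm:= Cc * (cJ R n.+1 5 * (2 ^+ 4 * Mb)).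
have cm0 : 0 <= cm.
 by rewrite /cm !mulr_ge0// ?cJ_ge0// exprn_ge0.
pose cl : R:= (\sum_(k : I) \sum_(l : I) \sum_(p : I) \sum_(q : I) 2 ^+ 4) * Mb.
have cl0 : 0 <= cl.
 rewrite /cl mulr_ge0//;do 4 (apply:sumr_ge0=> ? _);exact:exprn_ge0.
pose c3:= 2 * (cm + kf * (Mb + cl) + kf * pc * cm).
have c30 : 0 <= c3 by rewrite /c3 mulr_ge0// !addr_ge0// mulr_ge0// addr_ge0.
exists (r2 / 4), (Crev + cm + c3);split=> //;first by rewrite !addr_ge0.
move=> U jU jU0.
pose U' := mulj zeta U.
have jU'G : jet 4 G U' := jet_mul_ext oG oO FGO cF zF (Cz 4%N) bz jU.
have jU'O : jet 4 Om U' := jet_mul oO (Cz 4%N) (bzk 4 Om (leqnn _)) jU.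
pose W:= compj 4 U'.
have jW : jet 4 H W:= jet_comp PP Cg MG0 bG oH oG HG (leqnn _) jU'G.
have W0 s z : ~ F (chart z) -> W s z = 0.
 by move=> nF;apply:compj_local0=> t;exact:(mulj_zoff U t cF zF nF).
have FB z : F (chart z) -> B z.
 by move=> Fz;rewrite /B /= -[z in `|z - _|](chartK gm x0 PP);apply:hr1;exact:Fr1.
have WM s : csupp (`|z0| + rho0) (W s).
 move=> z zM';apply:W0=> /FB;rewrite /B /= => h.
 have:= ler_normD (z - z0) z0;rewrite subrK;lra.
have M0 : 0 <= `|z0| + rho0 by rewrite addr_ge0// ltW.
pose UO s:= (U s) \_ Om.
(* The extension of W by 0 is the composition computed from the extension of U by 0, with the whole
   space in place of both domains. *)
have jW0 : jet 2 setT (fun s=> (W s) \_ H).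
 have jX : jet 2 setT (mulj zeta UO) := jet_mul oT (Cz 2%N) (bzk 2%N setT isT) jU0.
 have TT : forall z : V, [set: V] z -> [set: V] (chart z) by [].
 have jY:= jet_comp (x0:= x0) PP Cg MG0 bG oT oT TT (isT : (2 <= 4)%N) jX.
 apply:jet_eq jY _=> s s2;apply/funext=> z;rewrite /patch.
 case:ifPn=> [/set_mem Hz|nH].
  rewrite /W (compj_fuel _ _ _ U' (k:= 4) (k' := 2))//;last exact:leq_trans s2 _.
  apply:compj_local=> t;have [Fz|nFz] := pselect (F (chart z)).
   apply:mulj_local=> t';rewrite /UO /patch mem_set//;apply:FGO;split=> //;exact:HG.
  by rewrite (mulj_zoff UO t cF zF nFz) /U' (mulj_zoff U t cF zF nFz).
 apply:compj_local0=> t;have [Fz|nFz] := pselect (F (chart z));last exact:(mulj_zoff UO t cF zF nFz).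
 apply:mulj_local0=> t';rewrite /UO /patch memNset//= => Oz.
 have /(chO (Fr _ Fz)) := Oz;rewrite chartK// => Hz.
 by move: nH;rewrite mem_set.
have eW : ae_eq mu H (W [::]) (U' [::] \o chart) by apply:aeW=> z _;rewrite /W compj0.
have U'GO s : (size s <= 4)%N -> nrm mu G (U' s) <= nrm mu Om (U' s).
 move=> s4;apply:nrm_ext_zoff FGO _ _=> //;first exact:mulj_zoff.
 exact:(proj1 jU'O).
have JW k : (k <= 4)%N -> J k.+1 H W <= cm * J k.+1 Om U.
 move=> k4.
 have -> : J k.+1 H W = J k.+1 H (compj k U').
  apply:J_ext=> s sk;congr nrm;apply:compj_fuel=> //;exact:leq_trans (sk : (size s <= k)%N) k4.
 apply:le_trans (hc k k4 _ _ _ oH oG HG (jetW k4 jU'G)) _.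
 rewrite /cm -mulrA ler_wpM2l//;apply:(@le_trans _ _ (J k.+1 Om U')).
  by apply:J_mono=> s sk;apply:U'GO;exact:leq_trans (sk : (size s <= k)%N) k4.
 apply:le_trans (J_mul oO (Cz k) Mb0 (bzk k Om k4) (jetW k4 jU)) _.
 rewrite -[leRHS]mulrA;apply:ler_pM;rewrite ?cJ_ge0 ?mulr_ge0 ?J_ge0 ?exprn_ge0//.
  by apply:cJ_le.
 by rewrite !ler_wpM2r ?J_ge0// ler_weXn2l// ler1n.
exists W, (`|z0| + rho0);split=> //;split.
- move=> k k4 s sk;pose A:= Om `&` ball x0 (r2 / 4).
 have oA : open A by apply:openI=> //;exact:ball_open.
 have mA:= open_meas oA.
 have AF x : A x -> `|x - x0| < r2 / 4 by rewrite /A -ball_normE /= distrC=> -[].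
 have AO : A `<=` Om by move=> x [].
 have AG : A `<=` G.
  by move=> x Ax;apply:FOG;split;[rewrite /F /=;have:= AF x Ax;lra|exact:AO].
 have s4:= leq_trans sk k4.
 have -> : nrm mu A (U s) = nrm mu A (U' s).
  have jA:= jet_sub mA mO AO jU;have jA' := jet_sub mA mO AO jU'O.
  apply:ae_eq_nrm=> //;[exact:(proj1 jA)|exact:(proj1 jA')|].
  apply:(jet_uniq oA jA jA' _ s4);apply:aeW=> x Ax.
  by rewrite /U' mulj0 fctE zetaE chi1 ?mul1r// ltW// AF.
 apply:le_trans (nrm_chart_le PP Cg oH oG HG mA AG (proj1 jU'G s s4) AG) _.
 apply:le_trans (hrev k k4 _ _ _ _ oH oG HG (jetW k4 jU'G) (jetW k4 jW) eW s sk) _.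
 by rewrite ler_wpM2r ?J_ge0//;lra.
- by move=> k k4;apply:le_trans (JW k k4) _;rewrite ler_wpM2r ?J_ge0//;lra.
have jWD : jet 4 D W:= jet_sub mD mH DH jW.
have BD : B `&` H `<=` D by move=> z [].
have WB s : zoff B (W s) by move=> z nB;apply:W0=> /FB.
have JDH k : (k <= 5)%N -> J k D W <= J k H W.
 move=> k5;apply:J_mono=> s sk;apply:nrm_subset=> //;apply:(proj1 jW).
 by rewrite -ltnS;exact:leq_trans sk k5.
pose A:= (ymx c)^T *m ymx c.
have AE : opA A (opA A W) = Lap0 c (Lap0 c W) by rewrite !Lap0E.
pose N:= nrm mu H (opA A (opA A W) [::]).
have N0 : 0 <= N by exact:nrm_ge0.
have j0 : jet 0 H (Lap0 c (Lap0 c W)) := jet_Lap0 c oH (k:= 0) isT (jet_Lap0 c oH (k:= 2) isT jW).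
have j0D : jet 0 D (Lap0 c (Lap0 c W)) := jet_sub mD mH DH j0.
have jYD : jet 0 D (LapY gm (LapY gm W)) := jet_LapY Cg bG oD (k:= 0) isT (jet_LapY Cg bG oD (k:= 2) isT jWD).
have h1 : J 5 H W <= J 4 H W + kf * N.
 have fN : 0 <= flat_const (ymx c) * N by apply:mulr_ge0=> //;apply:flat_const_ge0;exact:ymx_unit.
 rewrite /kf -mulrA;apply:J_succ_le=> // t t4.
 exact:(flat_estimate (ymx_unit c0) M0 jW WM jW0 t4).
have ND : N <= nrm mu D (Lap0 c (Lap0 c W) [::]).
 rewrite /N AE;apply:nrm_ext_zoff BD _ _=> //;last exact:(proj1 j0D).
 move=> z nB;rewrite -AE /opA fct_sumE big1// => k _;rewrite fct_sumE big1// => l _.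
 rewrite fctE fct_sumE big1 ?scaler0// => p _;rewrite fct_sumE big1// => q _.
 by rewrite fctE WB ?scaler0.
have cl2 m z : D z -> `|Gam gm m z - c m| <= d by move=> [_ Bz];exact:close.
have h2:= perturbation Cg MG0 bG cM oD (ltW d0) cl2 jWD.
have sl : sqi mu Om (lap2 U') := proj1 (jet_opA 1%:M oO (jet_opA 1%:M oO jU'O)) [::] isT.
have slG : sqi mu G (lap2 U') := proj1 (jet_opA 1%:M oG (jet_opA 1%:M oG jU'G)) [::] isT.
have DG z : D z -> G (chart z) by move=> /DH/HG.
(* Two applications of [chart_Lap]: the flattened operators give exactly the bilaplacian of zeta u,
   read in the chart. *)
have h3 : nrm mu D (LapY gm (LapY gm W) [::]) <= nrm mu Om (lap2 U').
 have eD : ae_eq mu D (W [::]) (U' [::] \o chart) by apply:aeW=> z _;rewrite /W compj0.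
 have e1:= chart_Lap PP Cg MG0 bG oD oG DG (k:= 2) isT jU'G jWD eD.
 have e2:= chart_Lap PP Cg MG0 bG oD oG DG (k:= 0) isT (jet_opA 1%:M oG jU'G) (jet_LapY Cg bG oD (k:= 2) isT jWD) e1.
 have -> : nrm mu D (LapY gm (LapY gm W) [::]) = nrm mu D (lap2 U' \o chart).
  apply:ae_eq_nrm e2=> //;first exact:(proj1 jYD).
  exact:(sqi_comp PP Cg oD oG DG slG).
 apply:le_trans (nrm_comp PP Cg oD oG DG slG) _.
 apply:nrm_ext_zoff FGO _ _=> //.
 move=> z nF;rewrite lap2E big1// => k _;rewrite big1// => l _;rewrite big1// => p _;rewrite big1// => q _.
 by rewrite /U' (mulj_zoff U _ cF zF nF) mulr0.
have h4:= lap2_mul_le oO (Cz 4%N) Mb0 (bzk 4%N Om (leqnn _)) jU.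
have h5:= JW 3%N isT.
set Nf:= nrm mu Om (lap2 U) in h4 *;set J4:= J 4 Om U in h4 h5 *.
have h6 : N <= Mb * Nf + cl * J4 + pc * (d * J 5 H W + cm * J4).
 apply:le_trans ND _.
 have -> : Lap0 c (Lap0 c W) [::] = LapY gm (LapY gm W) [::] - (LapY gm (LapY gm W) [::] - Lap0 c (Lap0 c W) [::]).
  by rewrite opprB addrC subrK.
 have s1:= proj1 jYD [::] isT;have s2:= proj1 j0D [::] isT.
 apply:le_trans (nrmB mD s1 (sqiB mD s1 s2)) _;apply:lerD.
  exact:le_trans h3 h4.
 apply:le_trans h2 _;apply:ler_wpM2l=> //;apply:lerD.
  by apply:ler_wpM2l;[exact:ltW|exact:JDH].
 by apply:le_trans h5;exact:JDH.
have Nf0 : 0 <= Nf by exact:nrm_ge0.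
have J40 : 0 <= J4 by exact:J_ge0.
have J50:= J_ge0 5 H W.
have h7 : kf * N <= kf * (Mb * Nf + cl * J4 + pc * (d * J 5 H W + cm * J4)) by exact:ler_wpM2l.
(* The contribution of the perturbation at top order is at most half of the left-hand side. *)
have h8 : kf * pc * d * J 5 H W <= 2^-1 * J 5 H W by exact:ler_wpM2r.
have e1 : kf * (Mb * Nf + cl * J4 + pc * (d * J 5 H W + cm * J4)) =
 kf * Mb * Nf + kf * cl * J4 + kf * pc * d * J 5 H W + kf * pc * cm * J4 by ring.
rewrite e1 in h7.
have h9 : J 5 H W <= 2 * (cm * J4 + kf * Mb * Nf + kf * cl * J4 + kf * pc * cm * J4) by lra.
apply:le_trans h9 _.
have e2 : 2 * (cm * J4 + kf * Mb * Nf + kf * cl * J4 + kf * pc * cm * J4) =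
 c3 * (Nf + J4) - 2 * ((cm + kf * cl + kf * pc * cm) * Nf + kf * Mb * J4) by rewrite /c3;ring.
rewrite e2.
have p1 : 0 <= (cm + kf * cl + kf * pc * cm) * Nf by rewrite mulr_ge0// !addr_ge0// mulr_ge0.
have p2 : 0 <= kf * Mb * J4 by apply:mulr_ge0=> //;exact:mulr_ge0.
have p3 : c3 * (Nf + J4) <= (Crev + cm + c3) * (Nf + J4) by rewrite ler_wpM2r ?addr_ge0//;lra.
lra.
Qed.

End local_package.

(** * Zero traces, the energy identity and Poincare's inequality *)

Section zero_trace.
Context (R : realType) (n : nat).
Notation V:= 'rV[R]_n.
Notation mu:= (lebesgue_rV R n).
Implicit Types (U W : seq 'I_n -> V -> R) (Om : set V) (phi : V -> R).

(* Jets of functions in H^4 and in the closure of the test functions in H^2. *)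
Definition zjet Om U:= jet 4 Om U /\ exists phi : nat -> V -> R,
 (forall m, test_function Om (phi m)) /\
 forall s, (size s <= 2)%N -> nrm mu Om (pderiv s (phi m) - U s) @[m --> \oo] --> 0.

Lemma zjet_approx Om U : open Om -> zjet Om U -> exists phi : nat -> V -> R,
 (forall m, test_function Om (phi m)) /\
 forall s, (size s <= 2)%N -> nrm mu setT (pderiv s (phi m) - (U s) \_ Om) @[m --> \oo] --> 0.
Proof.
move=> oO [jU [phi [tp cp]]];exists phi;split=> // s s2.
have E : (fun m=> nrm mu setT (pderiv s (phi m) - (U s) \_ Om)) = (fun m=> nrm mu Om (pderiv s (phi m) - U s)).
 apply/funext=> m;rewrite [RHS]nrm_patch;congr nrm;apply/funext=> x.
 rewrite [RHS]/patch;case:ifPn=> xO;first by rewrite !fctE /= /patch xO.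
 rewrite !fctE /= /patch (negbTE xO) subr0.
 by apply:(test_eq0 (test_pderiv s (tp m)))=> Ox;move: xO;rewrite mem_set.
by rewrite E;exact:cp.
Qed.

Lemma zjet_ext Om U : open Om -> zjet Om U -> jet 2 setT (fun s=> (U s) \_ Om).
Proof.
move=> oO zU;have mO:= open_meas oO;have [phi [tp cp]] := zjet_approx oO zU.
have [jU _] := zU;apply:(@jet_lim _ _ 2 setT (fun m s=> pderiv s (phi m)) _ openT _ _ cp).
 move=> m;have [M pM] := test_csupp (tp m);exact:jet_csupp (proj1 (tp m)) pM.
by move=> s s2;apply:(proj1 (sqi_patch _ mO));apply:(proj1 jU);exact:leq_trans s2 _.
Qed.

(** Green's formula without boundary terms. It holds with a test function phi_m as second factor by
    definition of the weak derivatives, and phi_m tends to u in H^2 by the zero trace. *)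
Lemma energy Om U : open Om -> zjet Om U ->
 nrm mu Om (opA 1%:M U [::]) ^+ 2 = dot mu Om (lap2 U) (U [::]).
Proof.
move=> oO [jU [phi [tp cp]]];have mO:= open_meas oO.
have [sU _] := jU;pose A : 'M[R]_n:= 1%:M.
have jA : jet 2 Om (opA A U) := jet_opA A oO jU.
have jAA : jet 0 Om (opA A (opA A U)) := jet_opA A oO jA.
have sA s : (size s <= 2)%N -> sqi mu Om (opA A U s) := proj1 jA s.
have sp m s : sqi mu Om (pderiv s (phi m)).
 exact:sqiT mO (sqi_test s (tp m)).
pose Pm m k l:= pderiv [:: k;l] (phi m).
have sP m k l : sqi mu Om (Pm m k l) := sp m [:: k;l].
have cP k l : nrm mu Om (Pm m k l - U [:: k;l]) @[m --> \oo] --> 0:= cp [:: k;l] isT.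
have dP m k l : dot mu Om (opA A U [::]) (Pm m k l) = dot mu Om (opA A U [:: k;l]) (phi m).
 by rewrite (jet_dot jA (s:= [:: k;l]) isT (tp m)) /= sqrrN expr1n mul1r.
clearbody Pm.
have sz m k l : sqi mu Om (A k l *: Pm m k l) by exact:sqiZ.
have s1 m k : sqi mu Om (\sum_l A k l *: Pm m k l) by exact:sqi_sum.
have sQ m : sqi mu Om (\sum_k \sum_l A k l *: Pm m k l) by exact:sqi_sum.
have sO : sqi mu Om (opA A U [::]) := sA [::] isT.
have c2 : nrm mu Om (\sum_k \sum_l A k l *: Pm m k l - opA A U [::]) @[m --> \oo] --> 0.
 have c3 : (\sum_k \sum_l `|A k l| * nrm mu Om (Pm m k l - U [:: k;l])) @[m --> \oo] --> (0 : R).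
  apply:approx_sum=> k;apply:approx_sum=> l.
  have : `|A k l| * nrm mu Om (Pm m k l - U [:: k;l]) @[m --> \oo] --> (`|A k l| * 0 : R).
   by apply:cvgMr;exact:cP.
  by rewrite mulr0.
 apply:(mono_cvg0 _ c3)=> m;rewrite nrm_ge0 /= /opA -sumrB.
 under [X in nrm _ _ X]eq_bigr do rewrite -sumrB.
 have sd k l : sqi mu Om (A k l *: Pm m k l - A k l *: U [:: k;l]).
  by apply:sqiB=> //;apply:sqiZ=> //;exact:sU.
 apply:le_trans (nrm_sum _ mO _) _=> [k _|];first by apply:sqi_sum.
 apply:ler_sum=> k _;apply:le_trans (nrm_sum _ mO _) _=> [l _|];first exact:sd.
 apply:ler_sum=> l _;rewrite -scalerBr nrmZ//.
 by apply:sqiB=> //;exact:sU.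
have d1:= cvg_dot mO sQ sO sO c2.
have d2:= cvg_dot mO (fun m=> sp m [::]) (sU [::] isT) (proj1 jAA [::] isT) (cp [::] isT).
have e : (fun m=> dot mu Om (\sum_k \sum_l A k l *: Pm m k l) (opA A U [::])) =
 (fun m=> dot mu Om (phi m) (opA A (opA A U) [::])).
 have sp0 m : sqi mu Om (phi m) := sp m [::].
 have sz' k l : sqi mu Om (A k l *: opA A U [:: k;l]) by apply:sqiZ=> //;exact:sA.
 have s1' k : sqi mu Om (\sum_l A k l *: opA A U [:: k;l]) by exact:sqi_sum.
 apply/funext=> m;rewrite dot_suml// [RHS]dotC -[opA A (opA A U) [::]]/(\sum_k \sum_l A k l *: opA A U [:: k;l]).
 rewrite dot_suml//;apply:eq_bigr=> k _;rewrite dot_suml// dot_suml//.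
 apply:eq_bigr=> l _;rewrite dotZl// (dotZl mO _ (sA [:: k;l] isT) (sp0 m)).
 by rewrite dotC dP.
rewrite e in d1;rewrite sqr_nrm (dotC _ _ (lap2 U));exact:cvg_unique d1 d2.
Qed.

End zero_trace.

Section poincare.
Context (R : realType) (n : nat).
Notation V:= 'rV[R]_n.+1.
Notation mu:= (lebesgue_rV R n.+1).
Notation nT:= (nrm mu setT).
Implicit Types (U W : seq 'I_n.+1 -> V -> R) (phi : V -> R).

Lemma is_derive_coord (i j : 'I_n.+1) (x : V) :
 is_derive x 'e_j (fun x : V=> x ord0 i) (i == j)%:R.
Proof.
apply:is_derive_lineP.
have -> : (fun s : R=> (x + s *: 'e_j) ord0 i) = (fun s : R=> x ord0 i + (i == j)%:R * s).
 by apply/funext=> s;rewrite !mxE eq_sym mulrC eq_sym.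
have h : is_derive (0 : R) (1 : R) (fun s : R=> (i == j)%:R * s) ((i == j)%:R *: 1).
 exact:(is_deriveZ _ (is_derive_id (0 : R) (1 : R))).
have c : is_derive (0 : R) (1 : R) (fun _ : R=> x ord0 i) 0 by exact:is_derive_cst.
have:= is_deriveD c h;rewrite add0r [_ *: 1]mulr1;exact.
Qed.

Lemma C_k_coord k (i : 'I_n.+1) : C_k k (fun x : V=> x ord0 i).
Proof.
elim: k=> [|k IH];first by apply/C_k0;exact:continuous_coord.
apply/C_kS;split;first exact:continuous_coord.
 by move=> x j;have [] := is_derive_coord i j x.
move=> j;rewrite (_ : (fun x=> _) = (fun _=> (i == j)%:R));first exact:C_k_cst.
by apply/funext=> x;have [_] := is_derive_coord i j x.
Qed.

(** Integration by parts of D_0 (x_0 phi) = phi + x_0 D_0 phi against phi gives |phi|^2 = - 2 (x_0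
    phi, D_0 phi), and |x_0| <= M on the support of phi. *)
Lemma poincare_test phi M : 0 <= M -> smooth phi -> csupp M phi ->
 nT phi <= 2 * M * nT (pderiv [:: ord0] phi).
Proof.
move=> M0 Sp pM;have C1:= Sp 1%N;have mT:= @measurableT _ V.
pose X (x : V) := x ord0 ord0.
have CX k : C_k k X by exact:C_k_coord.
pose D (x : V) := 'D_('e_ord0) phi x.
have CXp : C_k 1 (X * phi) by apply:C_kM.
have XpM : csupp M (X * phi) by move=> x /pM h;rewrite fctE h mulr0.
have CD : C_k 1 D:= smooth_pd [:: ord0] Sp 1%N.
have DM : csupp M D:= @csupp_D _ _ phi M 'e_ord0 pM.
have sp:= sqi_C1 C1 pM;have sD : sqi mu setT D:= sqi_C1 CD DM.
have sXp:= sqi_C1 CXp XpM.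
have sXD : sqi mu setT (X * D).
 by apply:(@sqi_C1 _ _ _ M);[exact:C_kM|move=> x /DM h;rewrite fctE h mulr0].
have H : dot mu setT (fun x=> 'D_('e_ord0) (X * phi) x) phi = - dot mu setT (X * phi) D :=
 IBP 'e_ord0 CXp C1 XpM pM.
have DX (x : V) : 'D_('e_ord0) X x = 1.
 by have [_] := is_derive_coord ord0 ord0 x;rewrite eqxx.
have E : (fun x=> 'D_('e_ord0) (X * phi) x) = phi + X * D.
 by apply/funext=> x;rewrite (derive_mul1 ord0 x (CX 1%N) C1) DX mul1r.
rewrite E dotDl// in H.
have e : dot mu setT (X * D) phi = dot mu setT (X * phi) D.
 by congr Rintegral;apply/funext=> x;rewrite !fctE mulrAC.
have nX : nT (X * phi) <= M * nT phi.
 have s2 : sqi mu setT (M *: phi) by exact:sqiZ.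
 rewrite -[X in X * nT phi](ger0_norm M0) -nrmZ//;apply:nrm_le=> // x _;rewrite !fctE.
 have [xM|Mx] := leP `|x| M;last by rewrite (pM x Mx) scaler0 mulr0.
 rewrite /GRing.scale /= !normrM ler_wpM2r// (ger0_norm M0).
 by apply:le_trans xM;exact:coord_le.
have CS:= dot_CS mT sXp sD.
have N0:= nrm_ge0 mu setT phi;have D0:= nrm_ge0 mu setT D.
have q : nT phi ^+ 2 <= 2 * M * nT D * nT phi.
 rewrite sqr_nrm;have -> : dot mu setT phi phi = - (2 * dot mu setT (X * phi) D).
  by move: H;rewrite e;set a:= dot _ _ _ _;set b:= dot _ _ _ _=> H;lra.
 apply:le_trans (ler_norm _) _;rewrite normrN normrM ger0_norm//.
 apply:(@le_trans _ _ (2 * (nT (X * phi) * nT D)));first by rewrite ler_wpM2l.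
 have -> : 2 * M * nT D * nT phi = 2 * ((M * nT phi) * nT D) by ring.
 by rewrite ler_wpM2l// ler_wpM2r.
have [->|n0] := eqVneq (nT phi) 0;first by rewrite !mulr_ge0// nrm_ge0.
by move: q;rewrite expr2 ler_pM2r// lt_neqAle eq_sym n0.
Qed.

(** M + 1 replaces M because mollifying enlarges the support. *)
Lemma poincare W M : 0 <= M -> jet 2 setT W -> csupp M (W [::]) ->
 nT (W [::]) <= 2 * (M + 1) * nT (W [:: ord0]).
Proof.
move=> M0 jW WM;have [phi [Sp _ pM cp]] := jet_moll jW WM.
have [sW _] := jW;have mT:= @measurableT _ V.
have s2 t m : sqi mu setT (pderiv t (phi m)) := sqi_C1 (smooth_pd t (Sp m) 1%N) (pd_csupp t (pM m)).
have c0:= cvg_nrm mT (s2 [::]) (sW [::] isT) (cp [::] isT).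
have c1:= cvg_nrm mT (s2 [:: ord0]) (sW [:: ord0] isT) (cp [:: ord0] isT).
have c2 : 2 * (M + 1) * nT (pderiv [:: ord0] (phi m)) @[m --> \oo] --> (2 * (M + 1) * nT (W [:: ord0]) : R).
 by apply:cvgMr;exact:c1.
apply:(ler_cvg_to c0 c2);apply:nearW=> m.
exact:(poincare_test (addr_ge0 M0 ler01) (Sp m) (pM m)).
Qed.

(* Second order norms are controlled by the Laplacian. *)
Lemma laplace_J3 M : 0 <= M -> exists2 C, 0 <= C & forall W, jet 2 setT W -> csupp M (W [::]) ->
 J 3 setT W <= C * nT (opA 1%:M W [::]).
Proof.
move=> M0;pose y : 'M[R]_n.+1:= 1%:M.
have yu : y \in unitmx by exact:unitmx1.
pose Ce:= \sum_k \sum_l \sum_m \sum_s `|(invmx y) k m * (invmx y) l s|.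
have Ce0 : 0 <= Ce:= elliptic_const_ge0 y.
pose p:= 2 * (M + 1);have p0 : 0 <= p by rewrite mulr_ge0// addr_ge0.
pose q:= Ce + p * Ce + p * (p * Ce).
have pC : 0 <= p * Ce by exact:mulr_ge0.
have ppC : 0 <= p * (p * Ce) by exact:mulr_ge0.
have q0 : 0 <= q by rewrite /q !addr_ge0.
exists (cJ R n.+1 3 * q);first by rewrite mulr_ge0 ?cJ_ge0.
move=> W jW WM;rewrite -mulrA;apply:J_le.
set N:= nT (opA 1%:M W [::]);have N0 : 0 <= N by exact:nrm_ge0.
have h2 k l : nT (W [:: k;l]) <= Ce * N.
 by have:= full_elliptic yu k l jW WM;rewrite trmx1 mul1mx.
have hP:= poincare M0 jW WM;rewrite -/p in hP.
have h0 : nT (W [::]) <= p * (p * Ce * N).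
 have hi:= full_interp1 ord0 jW WM.
 have a0:= nrm_ge0 mu setT (W [::]);have b0:= nrm_ge0 mu setT (W [:: ord0]).
 have h00:= h2 ord0 ord0;have c0:= nrm_ge0 mu setT (W [:: ord0;ord0]).
 have hP' := hP;apply:le_trans hP' _;rewrite ler_wpM2l//.
 have h : nT (W [:: ord0]) ^+ 2 <= p * nT (W [:: ord0]) * (Ce * N).
  by apply:le_trans hi _;apply:ler_pM.
 have [->|n0] := eqVneq (nT (W [:: ord0])) 0;first by apply:mulr_ge0.
 have bp : 0 < nT (W [:: ord0]) by rewrite lt_neqAle eq_sym n0.
 by move: h;rewrite expr2 mulrAC ler_pM2r// mulrA.
have h1 i : nT (W [:: i]) <= (Ce + p * (p * Ce)) * N.
 have hi:= full_interp1 i jW WM.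
 have:= sqr_le_mul (nrm_ge0 mu setT (W [::])) (nrm_ge0 mu setT (W [:: i;i])) ler01 ltr01.
 move=> /(_ (nT (W [:: i])));rewrite mul1r=> /(_ hi);rewrite divr1 !mul1r=> h.
 apply:le_trans h _;rewrite mulrDl;apply:lerD;first exact:h2.
 by rewrite -!mulrA in h0 *.
have t1 : 0 <= Ce * N by rewrite mulr_ge0.
have t2 : 0 <= p * Ce * N by exact:mulr_ge0.
have t3 : 0 <= p * (p * Ce) * N by exact:mulr_ge0.
rewrite /q=> -[|i [|j [|//]]] _;rewrite !mulrDl.
- by rewrite !mulrA in h0 t3 *;lra.
- by have:= h1 i;rewrite mulrDl;lra.
- by have:= h2 i j;lra.
Qed.

End poincare.

(** * The a priori estimate on the domain *)

Section global.
Context (R : realType) (n : nat).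
Notation V:= 'rV[R]_n.+1.
Notation mu:= (lebesgue_rV R n.+1).
Notation I:= 'I_n.+1.
Notation H:= (@hsp R n).
Implicit Types (U W X : seq I -> V -> R).
Variables (alpha : R) (Om : set V).
Hypothesis oO : open Om.
Hypothesis bO : bounded_set Om.
Hypothesis clO : class_C_kalpha 4 alpha Om.

Let mO : measurable Om:= open_meas oO.

Lemma compact_closure : compact (closure Om).
Proof.
apply:bounded_closed_compact;last exact:closed_closure.
have [M M0 OM] := proj1 (bounded_setP _) bO.
apply/bounded_setP;exists (M + 1);first lra.
move=> x xO;have : closure [set y : V | `|y| <= M] x.
 by apply:closure_subset xO=> y /OM/ltW.
by rewrite -(proj1 (closure_id _) (@closed_normle R n.+1 M)) /= => h;lra.
Qed.

Lemma finite_cover (rho : V -> R) : (forall x, closure Om x -> 0 < rho x) ->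
 exists l : seq V, (forall x, x \in l -> closure Om x) /\
  forall y, Om y -> exists2 x, x \in l & ball x (rho x) y.
Proof.
move=> rho0;have:= compact_closure;rewrite compact_cover=> /(_ V (closure Om) (fun x=> ball x (rho x))).
case.
- by move=> x _;exact:ball_open.
- by move=> x cx;exists x=> //;apply:ballxx;exact:rho0.
move=> l lO cov;exists (finmap.enum_fset l);split.
 by move=> x xl;apply:set_mem;apply:lO.
by move=> y /subset_closure/cov[x /= xl yx];exists x.
Qed.

Lemma nrm_cover (rho : V -> R) (l : seq V) f : (forall y, Om y -> exists2 x, x \in l & ball x (rho x) y) ->
 (forall x, x \in l -> 0 < rho x) -> sqi mu Om f ->
 nrm mu Om f <= \sum_(x <- l) nrm mu (Om `&` ball x (rho x)) f.
Proof.
move=> cov rho0 sf;pose B x:= Om `&` ball x (rho x).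
have mB x : x \in l -> measurable (B x).
 by move=> xl;apply:open_meas;apply:openI=> //;exact:ball_open.
have sB x : x \in l -> sqi mu setT (fun y=> `|(f \_ (B x)) y|).
 move=> xl;apply:sqi_abs=> //;apply:(proj1 (sqi_patch f (mB x xl))).
 by apply:sqi_sub (mB x xl) mO _ sf=> y [].
have nB x : nrm mu (B x) f = nrm mu setT (fun y=> `|(f \_ (B x)) y|) by rewrite nrm_abs nrm_patch.
under eq_bigr do rewrite -/(B _) nB.
rewrite big_seq nrm_patch;apply:(@le_trans _ _ (nrm mu setT (\sum_(x <- l | x \in l) (fun y=> `|(f \_ (B x)) y|))));last first.
 by apply:nrm_sum=> //.
apply:nrm_le=> //;first exact:(proj1 (sqi_patch f mO)).
 exact:sqi_sum.
move=> y _;rewrite fct_sumE [leRHS]ger0_norm ?sumr_ge0//.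
rewrite /patch;case:ifPn=> [/set_mem Oy|_];last by rewrite normr0 sumr_ge0.
have [x xl yx] := cov y Oy.
rewrite (big_rem x xl) /= xl mem_set;last by split.
by rewrite lerDl sumr_ge0.
Qed.

Lemma global_package : exists (l : seq V) C, 0 <= C /\ forall U, jet 4 Om U ->
 jet 2 setT (fun s=> (U s) \_ Om) -> exists (W : V -> seq I -> V -> R) (M : V -> R),
 [/\ forall x, x \in l -> [/\ 0 <= M x, jet 4 H (W x) & forall s, csupp (M x) (W x s)],
   forall k, (k <= 4)%N -> forall s, (size s <= k)%N ->
    nrm mu Om (U s) <= \sum_(x <- l) C * J k.+1 H (W x),
   forall k x, (k <= 4)%N -> x \in l -> J k.+1 H (W x) <= C * J k.+1 Om U &
   forall x, x \in l -> J 5 H (W x) <= C * (nrm mu Om (lap2 U) + J 4 Om U)].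
Proof.
pose Q x rho C:= 0 < rho /\ 0 <= C /\ (closure Om x -> forall U, jet 4 Om U ->
 jet 2 setT (fun s=> (U s) \_ Om) -> exists W M,
 [/\ 0 <= M, jet 4 H W, forall s, csupp M (W s) &
 [/\ forall k, (k <= 4)%N -> forall s, (size s <= k)%N ->
    nrm mu (Om `&` ball x rho) (U s) <= C * J k.+1 H W,
   forall k, (k <= 4)%N -> J k.+1 H W <= C * J k.+1 Om U &
   J 5 H W <= C * (nrm mu Om (lap2 U) + J 4 Om U)]]).
have ex x : exists p : R * R, Q x p.1 p.2.
 (* Off the closure of Om nothing is claimed; the default radius 1 and constant 0 make the choice
    total. *)
 have [cx|ncx] := pselect (closure Om x);last by exists (1, 0);split=> //=;split.
 have [P [gm [MG [r [r0 ad]]]]] := chart_ex oO clO cx.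
 have [rho [C [rho0 C0 h]]] := local_package oO r0 ad.
 exists (rho, C);split=> //=;split=> // _ U jU jU0.
 have [W [M [M0 jW WM _ h']]] := h U jU jU0;by exists W, M.
have /choice[p hp] := ex.
have [l [lO cov]] := @finite_cover (fun x=> (p x).1) (fun x _=> proj1 (hp x)).
pose C:= \sum_(x <- l) (p x).2.
have pC x : x \in l -> (p x).2 <= C.
 move=> xl;rewrite /C (big_rem x xl) /= lerDl sumr_ge0// => y _.
 by case:(hp y)=> _ [].
have C0 : 0 <= C by apply:sumr_ge0=> x _;case:(hp x)=> _ [].
exists l, C;split=> // U jU jU0.
have exW x : exists q : (seq I -> V -> R) * R, x \in l ->
 [/\ 0 <= q.2, jet 4 H q.1, forall s, csupp q.2 (q.1 s) &
 [/\ forall k, (k <= 4)%N -> forall s, (size s <= k)%N ->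
    nrm mu (Om `&` ball x (p x).1) (U s) <= (p x).2 * J k.+1 H q.1,
   forall k, (k <= 4)%N -> J k.+1 H q.1 <= (p x).2 * J k.+1 Om U &
   J 5 H q.1 <= (p x).2 * (nrm mu Om (lap2 U) + J 4 Om U)]].
 have [xl|xl] := boolP (x \in l);last by exists (U, 0).
 have [_ [_ h]] := hp x;have [W [M hW]] := h (lO x xl) U jU jU0.
 by exists (W, M).
have /choice[q hq] := exW.
exists (fun x=> (q x).1), (fun x=> (q x).2);split.
- by move=> x /hq[].
- move=> k k4 s sk.
 have sU : sqi mu Om (U s) by apply:(proj1 jU);exact:leq_trans sk k4.
 apply:le_trans (nrm_cover cov (fun x _=> proj1 (hp x)) sU) _.
 rewrite big_seq [leRHS]big_seq;apply:ler_sum=> x xl;have [_ _ _ [h _ _]] := hq x xl.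
 by apply:le_trans (h k k4 s sk) _;rewrite ler_wpM2r ?J_ge0// pC.
- move=> k x k4 xl;have [_ _ _ [_ h _]] := hq x xl;apply:le_trans (h k k4) _.
 by rewrite ler_wpM2r ?J_ge0// pC.
- move=> x xl;have [_ _ _ [_ _ h]] := hq x xl;apply:le_trans h _.
 by rewrite ler_wpM2r ?addr_ge0 ?nrm_ge0 ?J_ge0// pC.
Qed.

(** Let L be the norm of the Laplacian and f that of the bilaplacian. The extension by 0 gives J 3
    <= C L, in particular |u| <= C L. The energy identity gives L^2 <= f |u| <= C f L, hence L <= C
    f. *)
Lemma laplace_bounds : exists2 C, 0 <= C & forall U, zjet Om U ->
 J 3 Om U <= C * nrm mu Om (lap2 U) /\
 nrm mu Om (opA 1%:M U [::]) ^+ 2 <= nrm mu Om (lap2 U) * nrm mu Om (U [::]).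
Proof.
have [M M0 OM] := proj1 (bounded_setP _) bO.
have [C C0 hC] := @laplace_J3 R n M (ltW M0).
exists (C * C);first exact:mulr_ge0.
move=> U zU;have [jU _] := zU;have [sU _] := jU.
have sl : sqi mu Om (lap2 U) := proj1 (jet_opA 1%:M oO (jet_opA 1%:M oO jU)) [::] isT.
have jZ:= zjet_ext oO zU.
have ZM : csupp M ((U [::]) \_ Om).
 by move=> x Mx;rewrite /patch memNset// => /OM;rewrite ltNge (ltW Mx).
have h:= hC _ jZ ZM.
have e3 : J 3 setT (fun s=> (U s) \_ Om) = J 3 Om U.
 by apply/esym/eq_bigr=> j _;apply:eq_bigr=> t _;rewrite nrm_patch.
have eA : opA 1%:M (fun s=> (U s) \_ Om) [::] = (opA 1%:M U [::]) \_ Om.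
 rewrite /opA patch_sum;apply:eq_bigr=> k _;rewrite patch_sum;apply:eq_bigr=> l _.
 by rewrite patchZ.
rewrite e3 eA -nrm_patch in h.
have en:= energy oO zU.
set L:= nrm mu Om (opA 1%:M U [::]) in h en *;set f:= nrm mu Om (lap2 U).
have f0 : 0 <= f by exact:nrm_ge0.
have L0 : 0 <= L by exact:nrm_ge0.
have CS : L ^+ 2 <= f * nrm mu Om (U [::]).
 rewrite en;apply:le_trans (ler_norm _) _;exact:(dot_CS mO sl (sU [::] isT)).
split=> //.
have hu : nrm mu Om (U [::]) <= C * L by apply:le_trans h;exact:le_J.
have LL : L * L <= (C * f) * L.
 by rewrite -expr2;apply:le_trans CS _;rewrite -mulrA mulrCA;exact:ler_wpM2l.
have Lf : L <= C * f.
 have [->|n0] := eqVneq L 0;first exact:mulr_ge0.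
 by move: LL;rewrite ler_pM2r// lt_neqAle eq_sym n0.
by apply:le_trans h _;rewrite -mulrA ler_wpM2l.
Qed.

(** Three inequalities close the estimate: [i5] bounds J 5 by f and J 4, [i4] bounds J 4 by J 3 and
    a small multiple of J 5, and [i3] bounds J 3 by f. *)
Theorem apriori : exists2 C, 0 <= C & forall U, zjet Om U -> J 5 Om U <= C * nrm mu Om (lap2 U).
Proof.
have [l [C [C0 hC]]] := global_package.
have [C3 C30 h3] := laplace_bounds.
pose N : R:= \sum_(x <- l) 1.
have N0 : 0 <= N by exact:sumr_ge0.
pose c5:= cJ R n.+1 5;have c50 : 0 <= c5 by exact:cJ_ge0.
pose K:= c5 * (N * (C * C)).
have K0 : 0 <= K by apply:mulr_ge0=> //;apply:mulr_ge0=> //;exact:mulr_ge0.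
(* Inserting [i4] in [i5] multiplies J 5 by K K c5 e, which has to be at most 1/2. *)
pose e:= (2 * (K * (K * c5) + 1))^-1.
have q0 : 0 <= K * (K * c5) by apply:mulr_ge0=> //;exact:mulr_ge0.
have e0 : 0 < e by rewrite invr_gt0 mulr_gt0// ltr_wpDl.
have Ke : K * (K * c5) * e <= 2^-1.
 rewrite /e ler_pdivrMr;last by rewrite mulr_gt0// ltr_wpDl.
 by rewrite [leRHS]mulrA mulVf ?pnatr_eq0// mul1r lerDl.
pose D:= K * (1 + c5 * (144 / e)).
have D0 : 0 <= D.
 by apply:mulr_ge0=> //;apply:addr_ge0=> //;apply:mulr_ge0=> //;apply:divr_ge0=> //;exact:ltW.
exists (2 * (K * (1 + D * C3)));first by apply:mulr_ge0=> //;apply:mulr_ge0=> //;apply:addr_ge0=> //;exact:mulr_ge0.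
move=> U zU;have [jU _] := zU;have jU0:= zjet_ext oO zU.
have [W [M [hW hU hJ hL]]] := hC U jU jU0.
set f:= nrm mu Om (lap2 U);have f0 : 0 <= f by exact:nrm_ge0.
have sumN (a : R) : \sum_(x <- l) a = N * a by rewrite /N mulr_suml;apply:eq_bigr=> x _;rewrite mul1r.
have step k a : (k <= 4)%N -> 0 <= a -> (forall x, x \in l -> J k.+1 H (W x) <= C * a) -> J k.+1 Om U <= K * a.
 move=> k4 a0 h;apply:(@le_trans _ _ (cJ R n.+1 k.+1 * (N * (C * C) * a))).
  apply:J_le=> s sk;apply:le_trans (hU k k4 s sk) _.
  rewrite -mulrA -sumN big_seq [leRHS]big_seq;apply:ler_sum=> x xl.
  by rewrite -mulrA ler_wpM2l// h.
 rewrite /K -(mulrA c5);apply:ler_wpM2r;last exact:cJ_le.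
 by apply:mulr_ge0=> //;apply:mulr_ge0=> //;exact:mulr_ge0.
have J50:= J_ge0 5 Om U;have J40:= J_ge0 4 Om U;have J30:= J_ge0 3 Om U.
have i5 : J 5 Om U <= K * (f + J 4 Om U) by apply:step=> //;exact:addr_ge0.
(* Third order derivatives are interpolated on the half space, where the reflection is available,
   and the result is brought back to Om through both directions of the charts. *)
have i4 : J 4 Om U <= K * ((1 + c5 * (144 / e)) * J 3 Om U + c5 * e * J 5 Om U).
 have b0 : 0 <= 1 + c5 * (144 / e).
  by apply:addr_ge0=> //;apply:mulr_ge0=> //;apply:divr_ge0=> //;exact:ltW.
 have ce0 : 0 <= c5 * e by apply:mulr_ge0=> //;exact:ltW.
 apply:step=> //;first by apply:addr_ge0;exact:mulr_ge0.
 move=> x xl;have [M0 jW WM] := hW x xl.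
 have j5:= hJ 4%N x isT xl;have j3:= hJ 2%N x isT xl.
 have J3W:= J_ge0 3 H (W x);have J5W:= J_ge0 5 H (W x).
 have g1 t : size t = 3%N -> nrm mu H (W x t) <= e * J 5 H (W x) + 144 / e * J 3 H (W x).
  case:t=> // i t [t2];apply:le_trans (flat_interp i M0 e0 jW WM t2) _.
  have ee : 0 <= 144 / e by apply:divr_ge0=> //;exact:ltW.
  apply:lerD;first by apply:ler_wpM2l;[exact:ltW|apply:le_J;rewrite /= t2].
  by apply:ler_wpM2l=> //;apply:le_J;rewrite t2.
 have g0 : 0 <= e * J 5 H (W x) + 144 / e * J 3 H (W x).
  by apply:addr_ge0;apply:mulr_ge0=> //;[exact:ltW|apply:divr_ge0=> //;exact:ltW].
 apply:le_trans (J_succ_le g0 g1) _.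
 apply:(@le_trans _ _ (J 3 H (W x) + c5 * (e * J 5 H (W x) + 144 / e * J 3 H (W x)))).
  by rewrite lerD2l ler_wpM2r//;exact:cJ_le.
 have -> : J 3 H (W x) + c5 * (e * J 5 H (W x) + 144 / e * J 3 H (W x)) =
  (1 + c5 * (144 / e)) * J 3 H (W x) + c5 * e * J 5 H (W x) by ring.
 rewrite mulrDr !(mulrCA C);apply:lerD;exact:ler_wpM2l.
have [i3 _] := h3 U zU;rewrite -/f in i3.
have k4 : K * J 4 Om U <= K * (K * ((1 + c5 * (144 / e)) * J 3 Om U + c5 * e * J 5 Om U)) by exact:ler_wpM2l.
have k5 : K * (K * c5) * e * J 5 Om U <= 2^-1 * J 5 Om U by exact:ler_wpM2r.
have k3 : K * (D * J 3 Om U) <= K * (D * (C3 * f)) by apply:ler_wpM2l=> //;exact:ler_wpM2l.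
have E1 : K * (K * ((1 + c5 * (144 / e)) * J 3 Om U + c5 * e * J 5 Om U)) =
 K * (D * J 3 Om U) + K * (K * c5) * e * J 5 Om U by rewrite /D;ring.
have E2 : 2 * (K * (1 + D * C3)) * f = 2 * (K * f + K * (D * (C3 * f))) by ring.
rewrite mulrDr in i5;rewrite E1 in k4;rewrite E2.
lra.
Qed.

End global.

(** * From jets to the Sobolev spaces and Laplacians of the statement *)

Section lincomb.
Context (R : realType) (n : nat).
Notation V:= 'rV[R]_n.+1.
Notation mu:= (lebesgue_rV R n.+1).
Variable Om : set V.

Lemma test_lin (c : R) (phi psi : V -> R) : test_function Om phi -> test_function Om psi ->
 test_function Om (c *: phi + psi).
Proof.
move=> [Sp [cp sp]] [Sq [cq sq]].
pose F:= closure [set x | phi x != 0] `|` closure [set x | psi x != 0].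
apply:(@test_functionP _ _ _ _ F).
- by move=> k;apply:C_kD=> //;exact:C_kZ.
- by apply:closedU;exact:closed_closure.
- by apply:compact_bounded;exact:compactU.
- by move=> x [/sp|/sq].
- move=> x nF;have h (f : V -> R) : ~ closure [set x | f x != 0] x -> f x = 0.
  by move=> nf;apply/eqP;apply:contrapT=> /negP fx;apply:nf;exact:subset_closure.
 by rewrite !fctE /= !h ?scaler0 ?addr0//;[move=> /= h1;apply:nF;right|move=> h1;apply:nF;left].
Qed.

Lemma pderiv_lin (c : R) (phi psi : V -> R) s : smooth phi -> smooth psi ->
 pderiv s (c *: phi + psi) = c *: pderiv s phi + pderiv s psi.
Proof.
move=> Sp Sq;have e1:= pderivD (leqnn (size s)) (C_kZ c (Sp (size s))) (Sq (size s)).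
have e2:= pderivZ c (leqnn (size s)) (Sp (size s)).
exact:(etrans e1 (congr1 (fun f=> f + pderiv s psi) e2)).
Qed.

Lemma zjet_lin (c : R) U W : open Om -> zjet Om U -> zjet Om W -> zjet Om (addj (scalej c U) W).
Proof.
move=> oO [jU [phi [tp cp]]] [jW [psi [tq cq]]];have mO:= open_meas oO.
split;first by apply:jet_add=> //;exact:jet_scale.
exists (fun m=> c *: phi m + psi m);split=> [m|s s2];first exact:test_lin.
have sP (f : nat -> V -> R) m : test_function Om (f m) -> sqi mu Om (pderiv s (f m)).
 by move=> tf;exact:sqiT mO (sqi_test s tf).
have s4 : (size s <= 4)%N:= leq_trans s2 (isT : (2 <= 4)%N).
have sU:= proj1 jU s s4;have sW:= proj1 jW s s4.
have h1 : `|c| * nrm mu Om (pderiv s (phi m) - U s) + nrm mu Om (pderiv s (psi m) - W s) @[m --> \oo] --> (`|c| * 0 + 0 : R).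
 by apply:cvgD;[apply:cvgMr;exact:cp|exact:cq].
rewrite mulr0 addr0 in h1;apply:(squeeze_cvgr _ (@cvg_cst _ (0 : R) _ _ _) h1);apply:nearW=> m.
have sp:= sP _ m (tp m);have sq:= sP _ m (tq m).
rewrite nrm_ge0 /=.
have -> : pderiv s (c *: phi m + psi m) - addj (scalej c U) W s = c *: (pderiv s (phi m) - U s) + (pderiv s (psi m) - W s).
 apply:etrans (congr1 (fun f=> f - _) (pderiv_lin c s (tp m).1 (tq m).1)) _.
 by pose P:= pderiv s (phi m);pose Q:= pderiv s (psi m);rewrite -/P -/Q /addj /scalej scalerBr opprD addrACA.
have d1:= sqiB mO sp sU;have d2:= sqiB mO sq sW.
by apply:le_trans (nrmD mO (sqiZ mO c d1) d2) _;rewrite nrmZ.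
Qed.

Lemma opA_lin (A : 'M[R]_n.+1) (c : R) (U W : seq 'I_n.+1 -> V -> R) s : opA A (addj (scalej c U) W) s = c *: opA A U s + opA A W s.
Proof.
rewrite /opA scaler_sumr -big_split/=;apply:eq_bigr=> k _.
rewrite scaler_sumr -big_split/=;apply:eq_bigr=> l _.
by rewrite /addj /scalej scalerDr !scalerA mulrC.
Qed.

Lemma lap2_lin (c : R) (U W : seq 'I_n.+1 -> V -> R) : lap2 (addj (scalej c U) W) = c *: lap2 U + lap2 W.
Proof.
rewrite /lap2 -opA_lin;congr opA;apply/funext=> s;exact:opA_lin.
Qed.

End lincomb.

Section weak.
Context (R : realType) (n : nat).
Notation V:= 'rV[R]_n.+1.
Notation mu:= (lebesgue_rV R n.+1).
Variable Om : set V.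
Hypothesis oO : open Om.
Let mO : measurable Om:= open_meas oO.
Notation sq:= (sqi mu Om).
Notation aeq:= (ae_eq mu Om).

Let sqt s phi : test_function Om phi -> sq (pderiv s phi).
Proof. by move=> tp;exact:sqiT mO (sqi_test s tp). Qed.

Lemma weak_dot s u g phi : is_weak_deriv Om s u g -> test_function Om phi ->
 dot mu Om u (pderiv s phi) = (-1) ^+ size s * dot mu Om g phi.
Proof. by move=> h;exact:h. Qed.

Lemma weak_ext s u u' g g' : sq u -> sq u' -> sq g -> sq g' -> aeq u u' -> aeq g g' ->
 is_weak_deriv Om s u g -> is_weak_deriv Om s u' g'.
Proof.
move=> su su' sg sg' eu eg h phi tp.
change (dot mu Om u' (pderiv s phi) = (-1) ^+ size s * dot mu Om g' phi).
rewrite -(ae_eq_dot mO su su' (sqt s tp) eu) -(ae_eq_dot mO sg sg' (sqt [::] tp) eg).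
exact:h.
Qed.

Lemma weak_uniq s u g g' : sq g -> sq g' -> is_weak_deriv Om s u g -> is_weak_deriv Om s u g' -> aeq g g'.
Proof.
move=> sg sg' h h';have:= @vanish _ _ Om (g - g') oO (sqiB mO sg sg') _.
have z phi : test_function Om phi -> dot mu Om (g - g') phi = 0.
 move=> tp;rewrite (dotBl mO sg sg' (sqt [::] tp));apply/eqP;rewrite subr_eq0;apply/eqP.
 have:= weak_dot h tp;rewrite (weak_dot h' tp)=> /(mulfI _) -> //.
 by rewrite signr_eq0.
move=> /(_ z);apply:filterS=> x hx Ox;apply/eqP;rewrite -subr_eq0;apply/eqP;exact:hx.
Qed.

Lemma weak_derivP s u : (exists2 g, L2 Om g & is_weak_deriv Om s u g) ->
 sq (weak_deriv Om s u) /\ is_weak_deriv Om s u (weak_deriv Om s u).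
Proof.
by move=> [g L g0];rewrite /weak_deriv;case:xgetP=> [h -> []//|/(_ g)] [];split.
Qed.

(** At the empty list the function itself is kept, since the chosen weak derivative of order 0
    equals it only almost everywhere. *)
Definition Jt (u : V -> R) (s : seq 'I_n.+1) := if s is [::] then u else weak_deriv Om s u.

Lemma Hk_jet k u : Hk k Om u -> jet k Om (Jt u).
Proof.
move=> [Lu hu].
have P s : (size s <= k)%N -> sq (Jt u s) /\ is_weak_deriv Om s u (Jt u s).
 case:s=> [|i s] sk;last by apply:weak_derivP;exact:hu.
 by split=> // phi tp /=;rewrite expr0 mul1r.
split=> [s /P[]//|s i sk phi tp].
have [_ h1] := P s (ltnW sk);have [_ h2] := P (i :: s) sk.
have td : test_function Om (pderiv [:: i] phi) := test_pderiv [:: i] tp.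
have e1:= weak_dot h1 td;have e2:= weak_dot h2 tp.
have e3 : pderiv s (pderiv [:: i] phi) = pderiv (i :: s) phi.
 apply:etrans (pderiv_rconsC s i tp.1);rewrite -cats1;exact:esym (pderiv_cat _ _ _).
have e4:= etrans (esym e1) (etrans (congr1 (dot mu Om u) e3) e2).
rewrite /= exprS mulN1r mulNr -mulrN in e4.
by apply:(mulfI _ e4);rewrite signr_eq0.
Qed.

Lemma jet_Hk k U : jet k Om U -> Hk k Om (U [::]).
Proof.
move=> jU;split=> [|s sk];first exact:(proj1 jU [::]).
by exists (U s);[exact:(proj1 jU s sk)|exact:jet_is_weak jU sk].
Qed.

Lemma jet_weak_deriv k U s : jet k Om U -> (size s <= k)%N ->
 sq (weak_deriv Om s (U [::])) /\ aeq (weak_deriv Om s (U [::])) (U s).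
Proof.
move=> jU sk;have wU:= jet_is_weak jU sk;have sU:= proj1 jU s sk.
have [sw ww] : sq (weak_deriv Om s (U [::])) /\ is_weak_deriv Om s (U [::]) (weak_deriv Om s (U [::])).
 by apply:weak_derivP;exists (U s).
by split=> //;exact:weak_uniq ww wU.
Qed.

(** Functions that agree almost everywhere have the same set of weak derivatives, and [xget] chooses
    the same element of equal sets. The equality thus holds at every point, which allows Laplacians
    to be rewritten and iterated. *)
Lemma weak_deriv_ext s u v : sq u -> sq v -> aeq u v -> weak_deriv Om s u = weak_deriv Om s v.
Proof.
move=> su sv e;rewrite /weak_deriv;congr xget;apply/seteqP;split=> g [Lg wg];split=> //.
 exact (weak_ext su sv Lg Lg e (ae_eq_refl _ _ _) wg).
exact (weak_ext sv su Lg Lg (ae_eq_sym e) (ae_eq_refl _ _ _) wg).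
Qed.

Lemma lap_ext u v : sq u -> sq v -> aeq u v -> lap Om u = lap Om v.
Proof.
by move=> su sv e;apply/funext=> x;apply:eq_bigr=> i _;rewrite (weak_deriv_ext _ su sv e).
Qed.

Lemma lap_jet k U : (2 <= k)%N -> jet k Om U ->
 sq (lap Om (U [::])) /\ aeq (lap Om (U [::])) (opA 1%:M U [::]).
Proof.
move=> k2 jU;have P i:= jet_weak_deriv (s:= [:: i;i]) jU k2.
have lE : lap Om (U [::]) = \sum_(i < n.+1) weak_deriv Om [:: i;i] (U [::]).
 by apply/funext=> x;rewrite fct_sumE.
split;first by rewrite lE;apply:(sqi_sum mO)=> i _;exact:(P i).1.
have h : \forall x \ae mu, forall i, Om x -> weak_deriv Om [:: i;i] (U [::]) x = U [:: i;i] x.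
 by apply:filter_forall=> i;exact:(P i).2.
apply:filterS h=> x hx Ox;rewrite /lap /opA /= fct_sumE;apply:eq_bigr=> k' _.
rewrite hx// fct_sumE (bigD1 k')//= big1 ?addr0=> [|l lk].
 by rewrite mxE eqxx scale1r.
by rewrite mxE eq_sym (negbTE lk) scale0r.
Qed.

Lemma lap2_jet U : jet 4 Om U ->
 sq (lap Om (lap Om (U [::]))) /\ aeq (lap Om (lap Om (U [::]))) (lap2 U).
Proof.
move=> jU;have [s1 e1] := lap_jet (k:= 4) isT jU;have jA:= jet_opA 1%:M oO jU.
by rewrite (lap_ext s1 (proj1 jA [::] isT) e1);exact:(lap_jet (k:= 2) isT jA).
Qed.

Lemma H4_H20_zjet u : H4_H20 Om u -> zjet Om (Jt u).
Proof.
move=> [H4 [_ [phi [tp cp]]]];have jU:= Hk_jet H4;split=> //;exists phi;split=> // s s2.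
have s4 : (size s <= 4)%N:= leq_trans s2 (isT : (2 <= 4)%N).
have [sw ew] := jet_weak_deriv jU s4;have sU:= proj1 jU s s4.
apply:cvg_sqr0=> [m|];first exact:nrm_ge0.
have h:= cp s s2.
have E m : (\int[mu]_(x in Om) ((weak_deriv Om s u x - pderiv s (phi m) x) ^+ 2)%:E)%E = (nrm mu Om (pderiv s (phi m) - Jt u s) ^+ 2)%:E.
 have sp:= sqt s (tp m).
 apply:etrans (integral_sqr_nrm mO (sqiB mO sw sp)) _;congr (_ ^+ 2)%:E.
 rewrite -[LHS](nrmN mu Om) opprB;apply:(ae_eq_nrm mO (sqiB mO sp sw) (sqiB mO sp sU)).
 by apply:filterS ew=> x hx Ox;rewrite !fctE;congr (_ - _);exact:hx.
by move: h;rewrite (funext E)=> /fine_cvgP[].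
Qed.

Lemma zjet_H4_H20 U : zjet Om U -> H4_H20 Om (U [::]).
Proof.
move=> [jU [phi [tp cp]]];split;first exact:(jet_Hk jU).
have j2:= jetW (isT : (2 <= 4)%N) jU;split;first exact:(jet_Hk j2).
exists phi;split=> // s s2;have s4 : (size s <= 4)%N:= leq_trans s2 (isT : (2 <= 4)%N).
have [sw ew] := jet_weak_deriv jU s4;have sU:= proj1 jU s s4.
have E m : (\int[mu]_(x in Om) ((weak_deriv Om s (U [::]) x - pderiv s (phi m) x) ^+ 2)%:E)%E = (nrm mu Om (pderiv s (phi m) - U s) ^+ 2)%:E.
 have sp:= sqt s (tp m).
 apply:etrans (integral_sqr_nrm mO (sqiB mO sw sp)) _;congr (_ ^+ 2)%:E.
 rewrite -[LHS](nrmN mu Om) opprB;apply:(ae_eq_nrm mO (sqiB mO sp sw) (sqiB mO sp sU)).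
 by apply:filterS ew=> x hx Ox;rewrite !fctE;congr (_ - _);exact:hx.
rewrite (funext E);apply:cvg_EFin;first exact:nearW.
have c0:= cp s s2;set X:= (fun m=> nrm mu Om (pderiv s (phi m) - U s)) in c0.
have c2 : X m * X m @[m --> \oo] --> (0 * 0 : R) by exact:cvgM.
rewrite mulr0 in c2;have E2 : (fun m=> X m ^+ 2) = (fun m=> X m * X m) by apply/funext=> m;rewrite expr2.
by rewrite -E2 in c2;exact:c2.
Qed.

Lemma H4_H20_sq u : H4_H20 Om u -> [/\ sq u, sq (lap Om u) & sq (lap Om (lap Om u))].
Proof.
move=> /H4_H20_zjet [jU _];split;first exact:(proj1 jU [::]).
- exact:(lap_jet (k:= 4) isT jU).1.
- exact:(lap2_jet jU).1.
Qed.

Lemma H4_H20_lin (c : R) u v : H4_H20 Om u -> H4_H20 Om v ->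
 [/\ H4_H20 Om (c *: u + v), aeq (lap Om (c *: u + v)) (c *: lap Om u + lap Om v)
 & aeq (lap Om (lap Om (c *: u + v))) (c *: lap Om (lap Om u) + lap Om (lap Om v))].
Proof.
move=> /H4_H20_zjet zu /H4_H20_zjet zv;have zw:= zjet_lin c oO zu zv;split;first exact:(zjet_H4_H20 zw).
- have [_ h1] := lap_jet (k:= 4) isT zw.1;have [_ h2] := lap_jet (k:= 4) isT zu.1.
 have [_ h3] := lap_jet (k:= 4) isT zv.1.
 apply:filterS3 h1 h2 h3=> x h1 h2 h3 Ox.
 by apply:etrans (h1 Ox) _;rewrite opA_lin !fctE -h2// -h3.
- have [_ h1] := lap2_jet zw.1;have [_ h2] := lap2_jet zu.1;have [_ h3] := lap2_jet zv.1.
 apply:filterS3 h1 h2 h3=> x h1 h2 h3 Ox.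
 by apply:etrans (h1 Ox) _;rewrite lap2_lin !fctE -h2// -h3.
Qed.

End weak.

(** * Compactness through translations and finite nets *)

Section rellich.
Context (R : realType) (n : nat).
Notation V:= 'rV[R]_n.+1.
Notation mu:= (lebesgue_rV R n.+1).
Notation nT:= (nrm mu setT).

Let mT : measurable [set: V] := @measurableT _ V.

Lemma translation_muln (f : V -> R) (k : V) m : sqi mu setT f -> nT (tr (k *+ m) f - f) <= m%:R * nT (tr k f - f).
Proof.
move=> sf;have st : sqi mu setT (tr k f - f) by apply:sqiB=> //;exact:sqi_tr.
elim: m=> [|m IH].
 have -> : tr (k *+ 0) f - f = 0 by apply/funext=> x;rewrite !fctE /tr mulr0n addr0 subrr.
 by rewrite (nrm0 mu mT) mulr_ge0 ?nrm_ge0.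
have -> : tr (k *+ m.+1) f - f = tr (k *+ m) (tr k f - f) + (tr (k *+ m) f - f).
 by apply/funext=> x;rewrite !fctE /tr addrA subrK mulrSr addrA.
apply:le_trans (nrmD mT (sqi_tr _ st) (sqiB mT (sqi_tr _ sf) sf)) _.
by rewrite nrm_tr// -natr1 mulrDl mul1r addrC lerD.
Qed.

Lemma nrm_directional (f : V -> R) M h : smooth f -> csupp M f ->
 nT (fun x=> 'D_h f x) <= `|h| * \sum_i nT (pderiv [:: i] f).
Proof.
move=> Sf fM;have C1:= Sf 1%N.
have sD i : sqi mu setT (fun x=> 'D_('e_i) f x) := sqi_C1 (smooth_pd [:: i] Sf 1%N) (pd_csupp [:: i] fM).
have -> : (fun x=> 'D_h f x) = \sum_i h ord0 i *: (fun x=> 'D_('e_i) f x).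
 by apply/funext=> x;rewrite fct_sumE;exact:C1_deriveE.
apply:le_trans (nrm_sum _ mT _) _=> [i _|];first exact:sqiZ.
rewrite mulr_sumr;apply:ler_sum=> i _;rewrite nrmZ// ler_wpM2r ?nrm_ge0//.
exact:coord_le.
Qed.

(** A translation by h is k+1 translations by h/(k+1), so that |tr h f - f| is at most the norm of
    the difference quotient of step 1/(k+1) in the direction h. That norm tends to the one of the
    directional derivative. *)
Lemma translation_test (f : V -> R) M h : smooth f -> csupp M f ->
 nT (tr h f - f) <= `|h| * \sum_i nT (pderiv [:: i] f).
Proof.
move=> Sf fM;apply:le_trans _ (nrm_directional h Sf fM);have C1:= Sf 1%N;have sf:= sqi_C1 C1 fM.
have [t tE] : exists t : nat -> R, forall k, t k = k.+1%:R^-1 by exists (fun k=> k.+1%:R^-1).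
have t0 k : t k != 0 by rewrite tE invr_eq0 pnatr_eq0.
have tt : t k @[k --> \oo] --> 0.
 apply/cvgrPdist_lt=> e e0;have:= near_infty_natSinv_lt (PosNum e0);apply:filterS=> k.
 by rewrite sub0r normrN tE ger0_norm// invr_ge0.
have st k : sqi mu setT (tr (t k *: h) f - f) by apply:sqiB=> //;exact:sqi_tr.
have sDh : sqi mu setT (fun x=> 'D_h f x).
 by apply:(@sqi_C1 _ _ _ M);[exact:C_k_Dv|exact:csupp_D].
have h1 k : nT (tr h f - f) <= nT ((t k)^-1 *: (tr (t k *: h) f - f)).
 have e1 : k.+1%:R * t k = 1 by rewrite tE mulfV.
 have e2 : `|(t k)^-1| = k.+1%:R by rewrite tE invrK ger0_norm.
 by have:= translation_muln (t k *: h) k.+1 sf;rewrite -scaler_nat scalerA e1 scale1r nrmZ// e2.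
have h2:= cvg_nrm mT (fun k=> sqiZ mT (t k)^-1 (st k)) sDh (dq_cvg h C1 fM t0 tt).
by apply:(ler_cvg_to (@cvg_cst _ (nT (tr h f - f)) _ _ _) h2);apply:nearW.
Qed.

Lemma translation_jet W M h : jet 1 setT W -> csupp M (W [::]) ->
 nT (tr h (W [::]) - W [::]) <= `|h| * \sum_i nT (W [:: i]).
Proof.
move=> jW WM;have [phi [Sp _ pM cp]] := jet_moll jW WM.
have [sW _] := jW.
have s2 t m : sqi mu setT (pderiv t (phi m)) := sqi_C1 (smooth_pd t (Sp m) 1%N) (pd_csupp t (pM m)).
have sp m : sqi mu setT (phi m) := s2 [::] m.
have s0:= sW [::] isT.
have c0 : nT (phi m - W [::]) @[m --> \oo] --> 0:= cp [::] isT.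
have d0 : nT (tr h (phi m) - phi m - (tr h (W [::]) - W [::])) @[m --> \oo] --> 0.
 have c2 : nT (phi m - W [::]) + nT (phi m - W [::]) @[m --> \oo] --> (0 + 0 : R) by exact:cvgD.
 rewrite addr0 in c2;apply:(squeeze_cvgr _ (@cvg_cst _ (0 : R) _ _ _) c2);apply:nearW=> m.
 rewrite nrm_ge0 /=.
 have -> : tr h (phi m) - phi m - (tr h (W [::]) - W [::]) = tr h (phi m - W [::]) - (phi m - W [::]).
  by apply/funext=> x;rewrite !fctE /tr;ring.
 have sd:= sqiB mT (sp m) s0.
 by apply:le_trans (nrmB mT (sqi_tr h sd) sd) _;rewrite nrm_tr.
have c1:= cvg_nrm mT (fun m=> sqiB mT (sqi_tr h (sp m)) (sp m)) (sqiB mT (sqi_tr h s0) s0) d0.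
have c2 : `|h| * \sum_i nT (pderiv [:: i] (phi m)) @[m --> \oo] --> (`|h| * \sum_i nT (W [:: i]) : R).
 apply:cvgMr;apply:(cvg_big (@add_continuous _))=> i _;exact:(cvg_nrm mT (s2 [:: i]) (sW [:: i] isT) (cp [:: i] isT)).
apply:(ler_cvg_to c1 c2);apply:nearW=> m;exact:(translation_test h (Sp m) (pM m)).
Qed.

Lemma finite_net (A : set V) d : bounded_set A -> 0 < d ->
 exists (m : nat) (p : 'I_m -> V), forall x, A x -> exists j, `|x - p j| < d.
Proof.
move=> bA d0;have [|l [_ hl]] := @finite_cover R n A bA (fun _=> d);first by [].
exists (size l), (fun j=> nth 0 l j)=> x /hl[p pl].
rewrite -ball_normE /= distrC=> h;have pl' : (index p l < size l)%N by rewrite index_mem.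
by exists (Ordinal pl');rewrite /= nth_index.
Qed.

(** Rellich's theorem in quantitative form. By the translation estimate u is close to K * u in L^2;
    the function K * u is equicontinuous, hence known up to a small error from its values on a
    finite net. *)
Lemma rellich (Om : set V) e : open Om -> bounded_set Om -> 0 < e ->
 exists (m : nat) (p : 'I_m -> V) (K : V -> R) (v : R),
  [/\ sqi mu setT K, 0 <= v & forall U, zjet Om U ->
  nrm mu Om (U [::]) <= e * J 3 Om U + v * \sum_j `|convol K ((U [::]) \_ Om) (p j)|].
Proof.
move=> oO bO e0;have mO:= open_meas oO.
have [M M0 OM] := proj1 (bounded_setP _) bO.
(* Then r (n+1) <= e/2, where n+1 is the number of first derivatives in the translation estimate. *)
pose r:= e / (2 * n.+2%:R);have r0 : 0 < r by rewrite divr_gt0// mulr_gt0.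
have [K bK] := @bump_ex R n.+1 r r0;have [SK _ Kr _] := bK.
have KM : csupp r K by move=> x /ltW;exact:Kr.
have sK:= sqi_C1 (SK 1%N) KM.
have s1 : sqi mu Om (cst 1).
 split;first exact:measurable_cst.
 under eq_integral do rewrite /cst expr1n.
 by rewrite integral_cst// mul1e;exact:lebesgue_bounded.
pose v:= nrm mu Om (cst 1);have v0 : 0 <= v:= nrm_ge0 _ _ _.
pose L:= \sum_i nT (pderiv [:: i] K).
have L0 : 0 <= L by apply:sumr_ge0=> i _;exact:nrm_ge0.
(* The mesh of the net. L is a Lipschitz constant for the translations of K and v is the norm of 1
   on Om, so that d v L <= e/2. *)
pose d:= e / (2 * (v * L + 1)).
have vL0 : 0 <= v * L by exact:mulr_ge0.
have d0 : 0 < d by rewrite divr_gt0// mulr_gt0// ltr_wpDl.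
have [m [p hp]] := finite_net bO d0.
exists m, p, K, v;split=> // U zU;have jZ:= zjet_ext oO zU;have [jU _] := zU;have [sU _] := jU.
pose g:= (U [::]) \_ Om;have sg : sqi mu setT g:= proj1 jZ [::] isT.
have gM : csupp M g by move=> x Mx;rewrite /g /patch memNset// => /OM;rewrite ltNge (ltW Mx).
have ng : nrm mu Om (U [::]) = nT g by rewrite nrm_patch.
have J0 : 0 <= J 3 Om U by exact:J_ge0.
have gJ : nT g <= J 3 Om U by rewrite -ng;exact:le_J.
have D1 : \sum_i nT ((U [:: i]) \_ Om) <= n.+1%:R * J 3 Om U.
 apply:(@le_trans _ _ (\sum_(i < n.+1) J 3 Om U));last by rewrite sumr_const card_ord mulr_natl.
 by apply:ler_sum=> i _;rewrite -nrm_patch;exact:le_J.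
have h1 : nT (convol K g - g) <= r * (n.+1%:R * J 3 Om U).
 apply:(moll_le bK sg gM)=> h hr;apply:le_trans (translation_jet (- h) (jetW (isT : (1 <= 2)%N) jZ) gM) _.
 rewrite normrN;apply:ler_pM;rewrite ?normr_ge0 ?(ltW hr)//.
 by apply:sumr_ge0=> i _;exact:nrm_ge0.
pose S:= \sum_j `|convol K g (p j)|.
have S0 : 0 <= S by apply:sumr_ge0.
have h2 x : Om x -> `|convol K g x| <= d * L * nT g + S.
 move=> /hp[j xj];have:= conv_dist (p j) (x - p j) sK sg;rewrite [p j + _]addrC subrK=> h.
 have h3 : nT (tr (x - p j) K - K) <= d * L.
  by apply:le_trans (translation_test _ SK KM) _;rewrite ler_wpM2r// ltW.
 have h4 : `|convol K g (p j)| <= S.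
  by rewrite /S (bigD1 j)//= lerDl sumr_ge0.
 have -> : convol K g x = (convol K g x - convol K g (p j)) + convol K g (p j) by rewrite subrK.
 apply:le_trans (ler_normD _ _) _;apply:lerD=> //;apply:le_trans h _.
 by rewrite ler_wpM2r ?nrm_ge0.
have scv:= sqi_conv bK sg gM.
have sc : sqi mu Om (convol K g) by exact:sqiT mO scv.
have h5 : nrm mu Om (convol K g) <= (d * L * nT g + S) * v.
 have c0 : 0 <= d * L * nT g + S by rewrite addr_ge0// mulr_ge0 ?nrm_ge0// mulr_ge0// ltW.
 rewrite -[X in X * v](ger0_norm c0) -nrmZ//;apply:nrm_le=> //;first exact:sqiZ.
 by move=> x Ox;rewrite !fctE /cst /GRing.scale/= mulr1 (ger0_norm c0) h2.
have sgO : sqi mu Om g by exact:sqiT mO sg.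
have scT : sqi mu setT (convol K g - g) by exact:sqiB.
have h6 : nrm mu Om (g - convol K g) <= nT (convol K g - g).
 by rewrite -nrmN opprB;exact:nrm_subset.
have eg : nT g = nrm mu Om g.
 rewrite -ng;apply:(ae_eq_nrm mO (sU [::] isT) sgO);apply:aeW=> x Ox.
 by rewrite /g /patch mem_set.
have h7 : nT g <= r * (n.+1%:R * J 3 Om U) + (d * L * nT g + S) * v.
 have:= nrmD mO (sqiB mO sgO sc) sc;rewrite subrK -eg=> h;apply:le_trans h _.
 by apply:lerD=> //;exact:le_trans h6 h1.
rewrite ng;apply:le_trans h7 _;rewrite mulrDl addrA [S * v]mulrC lerD2r.
have -> : e * J 3 Om U = e / 2 * J 3 Om U + e / 2 * J 3 Om U by field.
apply:lerD.
 rewrite mulrA ler_wpM2r//;have -> : r * n.+1%:R = e / 2 * (n.+1%:R / n.+2%:R).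
  by rewrite /r;field.
 by rewrite ler_piMr// ?divr_ge0 ?ltW// ltr_pdivrMr// mul1r ltr_nat.
have -> : d * L * nT g * v = d * (v * L) * nT g by ring.
have dv0 : 0 <= d * (v * L) by apply:mulr_ge0=> //;exact:ltW.
have dve : d * (v * L) <= e / 2.
 have -> : d * (v * L) = e / 2 * (v * L / (v * L + 1)) by rewrite /d;field;rewrite lt0r_neq0// ltr_wpDl.
 by rewrite ler_piMr// ?divr_ge0 ?(ltW e0)// ler_pdivrMr ?ltr_wpDl// mul1r lerDl.
by apply:ler_pM=> //;exact:nrm_ge0.
Qed.
End rellich.

(** * Symmetric forms on a subspace, and the abstract spectral theorem *)

Section form.
Context (R : realType) (E : lmodType R) (V : E -> Prop) (F : E -> E -> R).
Hypothesis V0 : V 0.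
Hypothesis VL : forall c u v, V u -> V v -> V (c *: u + v).
Hypothesis FL : forall c u v w, V u -> V v -> V w -> F (c *: u + v) w = c * F u w + F v w.
Hypothesis FC : forall u v, V u -> V v -> F u v = F v u.
Hypothesis F_ge0 : forall u, V u -> 0 <= F u u.

Lemma formV_Z c u : V u -> V (c *: u). Proof. by move=> Vu;rewrite -[_ *: _]addr0;exact:VL. Qed.
Lemma formV_D u v : V u -> V v -> V (u + v). Proof. by move=> Vu Vv;rewrite -[u]scale1r;exact:VL. Qed.
Lemma formV_N u : V u -> V (- u). Proof. by move=> Vu;rewrite -scaleN1r;exact:formV_Z. Qed.
Lemma formV_B u v : V u -> V v -> V (u - v). Proof. by move=> Vu Vv;apply:formV_D=> //;exact:formV_N. Qed.
Lemma formV_sum (I : Type) (r : seq I) (P : pred I) (f : I -> E) : (forall i, P i -> V (f i)) -> V (\sum_(i <- r | P i) f i).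
Proof. by move=> h;apply:big_ind=> //;exact:formV_D. Qed.

Lemma form0l w : V w -> F 0 w = 0.
Proof.
by move=> Vw;have:= FL 1 V0 V0 Vw;rewrite scale1r addr0 mul1r=> h;apply:(addrI (F 0 w));rewrite addr0.
Qed.
Lemma form_Zl c u w : V u -> V w -> F (c *: u) w = c * F u w.
Proof. by move=> Vu Vw;rewrite -[_ *: _]addr0 FL// form0l// addr0. Qed.
Lemma formDl u v w : V u -> V v -> V w -> F (u + v) w = F u w + F v w.
Proof. by move=> Vu Vv Vw;rewrite -[u in LHS]scale1r FL// mul1r. Qed.
Lemma formNl u w : V u -> V w -> F (- u) w = - F u w.
Proof. by move=> Vu Vw;rewrite -scaleN1r form_Zl// mulN1r. Qed.
Lemma formBl u v w : V u -> V v -> V w -> F (u - v) w = F u w - F v w.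
Proof. by move=> Vu Vv Vw;rewrite formDl ?formNl//;exact:formV_N. Qed.
Lemma formZr c u w : V u -> V w -> F w (c *: u) = c * F w u.
Proof. by move=> Vu Vw;rewrite FC ?form_Zl 1?FC//;exact:formV_Z. Qed.
Lemma formDr u v w : V u -> V v -> V w -> F w (u + v) = F w u + F w v.
Proof. by move=> Vu Vv Vw;rewrite FC ?formDl ?(FC Vw)//;exact:formV_D. Qed.
Lemma formBr u v w : V u -> V v -> V w -> F w (u - v) = F w u - F w v.
Proof. by move=> Vu Vv Vw;rewrite FC ?formBl ?(FC Vw)//;exact:formV_B. Qed.
Lemma form_suml (I : Type) (r : seq I) (f : I -> E) w : (forall i, V (f i)) -> V w ->
 F (\sum_(i <- r) f i) w = \sum_(i <- r) F (f i) w.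
Proof.
move=> Vf Vw;elim: r=> [|i r IH];first by rewrite !big_nil form0l.
by rewrite !big_cons formDl ?IH//;exact:formV_sum.
Qed.

Lemma formD2 u v : V u -> V v -> F (u + v) (u + v) = F u u + 2 * F u v + F v v.
Proof.
move=> Vu Vv;have Vuv:= formV_D Vu Vv.
rewrite formDl// !formDr// (FC Vv Vu);lra.
Qed.
Lemma formB2 u v : V u -> V v -> F (u - v) (u - v) = F u u - 2 * F u v + F v v.
Proof.
move=> Vu Vv;have Vuv:= formV_B Vu Vv.
rewrite formBl// !formBr// (FC Vv Vu);lra.
Qed.
Lemma form_par u v : V u -> V v -> F (u - v) (u - v) <= 2 * F u u + 2 * F v v.
Proof.
move=> Vu Vv;rewrite formB2//;have:= F_ge0 (formV_D Vu Vv);rewrite formD2//;lra.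
Qed.
Lemma form_par' u v : V u -> V v -> F u u <= 2 * F (u - v) (u - v) + 2 * F v v.
Proof.
move=> Vu Vv;have Vuv:= formV_B Vu Vv;have Vn:= formV_N Vv.
have e : F (- v) (- v) = F v v by rewrite formNl// FC// formNl// opprK.
by have:= form_par Vuv Vn;rewrite opprK subrK e.
Qed.

(** F is only semidefinite, as the form Q of [nextvec_ex] requires; a vector with F u u = 0 is
    treated apart. *)
Lemma form_CS u v : V u -> V v -> F u v ^+ 2 <= F u u * F v v.
Proof.
move=> Vu Vv;have H t : 0 <= t ^+ 2 * F u u - 2 * t * F u v + F v v.
 have:= F_ge0 (formV_B (formV_Z t Vu) Vv).
 rewrite formB2 ?form_Zl ?formZr//;try exact:formV_Z.
 by rewrite !mulrA -expr2.
have a0:= F_ge0 Vu;have b0:= F_ge0 Vv.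
have [e|n0] := eqVneq (F u u) 0.
 rewrite e mul0r;have [->|n1] := eqVneq (F u v) 0;first by rewrite expr0n.
 have:= H ((F v v + 1) / F u v);rewrite e mulr0 add0r.
 have -> : 2 * ((F v v + 1) / F u v) * F u v = 2 * (F v v + 1) by field.
 lra.
have ap : 0 < F u u by rewrite lt_neqAle eq_sym n0.
have:= H (F u v / F u u).
have -> : (F u v / F u u) ^+ 2 * F u u - 2 * (F u v / F u u) * F u v + F v v = F v v - F u v ^+ 2 / F u u.
 by field.
by rewrite subr_ge0 ler_pdivrMr// mulrC.
Qed.

Lemma form_null u v : V u -> V v -> F u u = 0 -> F u v = 0.
Proof.
move=> Vu Vv e;have:= form_CS Vu Vv;rewrite e mul0r=> h.
by apply/eqP;rewrite -sqrf_eq0 eq_le h sqr_ge0.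
Qed.

End form.

Section spectral.
Context (R : realType) (E : lmodType R) (V : E -> Prop) (B b : E -> E -> R).
Hypothesis V0 : V 0.
Hypothesis VL : forall c u v, V u -> V v -> V (c *: u + v).
Hypothesis BL : forall c u v w, V u -> V v -> V w -> B (c *: u + v) w = c * B u w + B v w.
Hypothesis BC : forall u v, V u -> V v -> B u v = B v u.
Hypothesis B_ge0 : forall u, V u -> 0 <= B u u.
Hypothesis bL : forall c u v w, V u -> V v -> V w -> b (c *: u + v) w = c * b u w + b v w.
Hypothesis bC : forall u v, V u -> V v -> b u v = b v u.
Hypothesis b_ge0 : forall u, V u -> 0 <= b u u.
Hypothesis b_null : forall u, V u -> b u u = 0 -> B u u = 0.
(** Compactness of b relative to B without weak convergence: up to e B, the form b is controlled by
    finitely many bounded functionals. *)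
Hypothesis compactness : forall e, 0 < e -> exists (m : nat) (l : 'I_m -> E -> R) (C : R),
 [/\ 0 <= C, forall j u v, V u -> V v -> l j (u - v) = l j u - l j v,
  forall j u, V u -> l j u ^+ 2 <= C * B u u &
  forall u, V u -> b u u <= e * B u u + \sum_j l j u ^+ 2].
Hypothesis complete : forall u_ : nat -> E, (forall m, V (u_ m)) ->
 (forall e, 0 < e -> exists N, forall m k, (N <= m)%N -> (N <= k)%N -> B (u_ m - u_ k) (u_ m - u_ k) <= e) ->
 exists2 u, V u & B (u_ m - u) (u_ m - u) @[m --> \oo] --> 0.
Hypothesis infdim : forall es : seq E, (forall v, v \in es -> V v) ->
 exists u, [/\ V u, 0 < B u u & forall v, v \in es -> B u v = 0].

Let VB u v : V u -> V v -> V (u - v). Proof. exact:formV_B. Qed.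
Let VZ c u : V u -> V (c *: u). Proof. exact:formV_Z. Qed.

Lemma b_le_B : exists2 C, 0 <= C & forall u, V u -> b u u <= C * B u u.
Proof.
have [m [l [C [C0 _ lC h]]]] := compactness ltr01.
exists (1 + \sum_(j < m) C);first by rewrite addr_ge0// sumr_ge0.
move=> u Vu;apply:le_trans (h u Vu) _;rewrite mulrDl lerD2l mulr_suml.
by apply:ler_sum=> j _;exact:lC.
Qed.

(* Bounded sequences are b-Cauchy along an ultrafilter. *)
Lemma ultra_cauchy (W : set_system nat) (u_ : nat -> E) K e : UltraFilter W -> 0 < e -> 0 <= K ->
 (forall m, V (u_ m)) -> (forall m, B (u_ m) (u_ m) <= K) ->
 exists2 A, W A & forall m k, A m -> A k -> b (u_ m - u_ k) (u_ m - u_ k) <= e.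
Proof.
move=> UW e0 K0 Vu uK;have PW : ProperFilter W:= ultra_proper.
have e1 : 0 < e / (2 * (4 * K + 1)) by rewrite divr_gt0// mulr_gt0// ltr_wpDl// mulr_ge0.
have [m [l [C [C0 lB lC h]]]] := compactness e1.
have q0 : 0 < e / (2 * (m%:R + 1)) by rewrite divr_gt0// mulr_gt0// ltr_wpDl.
set q:= e / (2 * (m%:R + 1)) in q0.
have CK0 : 0 <= C * K by rewrite mulr_ge0.
have lW j : exists A, W A /\ forall p k, A p -> A k -> (l j (u_ p) - l j (u_ k)) ^+ 2 <= q.
 pose f p:= l j (u_ p).
 have fK p : `[- (C * K + 1), C * K + 1]%classic (f p).
  rewrite /= in_itv /= -ler_norml.
  have h1 : f p ^+ 2 <= C * K by apply:le_trans (lC j _ (Vu p)) _;rewrite ler_wpM2l.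
  rewrite -(ler_pXn2r (n:= 2)) ?nnegrE ?addr_ge0// -normrX ger0_norm ?sqr_ge0//.
  by apply:le_trans h1 _;nra.
 have FW : ProperFilter (f @ W) by exact:fmap_proper_filter.
 have fWK : (f @ W) `[- (C * K + 1), C * K + 1]%classic by exact:(@filterS _ W _ setT _ (fun p _=> fK p) filterT).
 (* Each functional is bounded along the sequence, hence has a cluster point a along W. The preimage
    of a ball around a belongs to the ultrafilter, since otherwise its complement would. *)
 have [a [_ ca]] := @segment_compact R (- (C * K + 1)) (C * K + 1) _ FW fWK.
 (* Then (2 s)^2 <= 4 s <= q. *)
 pose s:= Num.min 1 (q / 4).
 have s0 : 0 < s by rewrite lt_min ltr01 divr_gt0.
 have s1 : s <= 1 by rewrite ge_min lexx.
 have sq : s <= q / 4 by rewrite ge_min lexx orbT.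
 exists (f @^-1` ball a s);split;last first.
  move=> p k;rewrite /= -ball_normE /= => pa ka.
  have h1 : `|f p - f k| <= 2 * s.
   have -> : f p - f k = (a - f k) - (a - f p) by ring.
   by apply:le_trans (ler_normB _ _) _;lra.
  have h2 : `|f p - f k| ^+ 2 <= (2 * s) ^+ 2 by rewrite ler_pXn2r ?nnegrE//;apply:le_trans h1.
  rewrite -normrX ger0_norm ?sqr_ge0// in h2;apply:le_trans h2 _.
  have -> : (2 * s) ^+ 2 = 4 * (s * s) by ring.
  have : s * s <= s * 1 by rewrite ler_pM2l.
  lra.
 have [//|nb] := in_ultra_setVsetC (f @^-1` ball a s) UW.
 have [y [yf yb]] := ca (~` ball a s) (ball a s) nb (nbhsx_ballx a s s0).
 by case:yf.
pose A j:= xget setT [set A | W A /\ forall p k, A p -> A k -> (l j (u_ p) - l j (u_ k)) ^+ 2 <= q].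
have AP j : W (A j) /\ forall p k, A j p -> A j k -> (l j (u_ p) - l j (u_ k)) ^+ 2 <= q.
 by rewrite /A;case:xgetP=> // /(_ _)/= nx;have [Z hZ] := lW j;case:(nx Z).
exists [set p | forall j, A j p].
 exact:(@filter_forall _ _ (fun j p=> A j p) W _ (fun j=> (AP j).1)).
move=> p k Ap Ak;apply:le_trans (h _ (VB (Vu p) (Vu k))) _.
have h1 : B (u_ p - u_ k) (u_ p - u_ k) <= 4 * K.
 by apply:le_trans (form_par V0 VL BL BC B_ge0 (Vu p) (Vu k)) _;have:= uK p;have:= uK k;lra.
have h2 : \sum_(j < m) l j (u_ p - u_ k) ^+ 2 <= \sum_(j < m) q.
 by apply:ler_sum=> j _;rewrite lB//;exact:(AP j).2.
rewrite sumr_const card_ord in h2.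
have h3 : q *+ m <= e / 2.
 rewrite -mulr_natr /q ler_pdivlMr//.
 have -> : e / (2 * (m%:R + 1)) * m%:R * 2 = e * (m%:R / (m%:R + 1)).
  by field;rewrite lt0r_neq0// ltr_wpDl.
 by rewrite ler_piMr ?(ltW e0)// ler_pdivrMr ?ltr_wpDl// mul1r lerDl.
have h4 : e / (2 * (4 * K + 1)) * B (u_ p - u_ k) (u_ p - u_ k) <= e / 2.
 apply:(@le_trans _ _ (e / (2 * (4 * K + 1)) * (4 * K)));first by rewrite ler_pM2l.
 have -> : e / (2 * (4 * K + 1)) * (4 * K) = e / 2 * (4 * K / (4 * K + 1)).
  by field;rewrite lt0r_neq0// ltr_wpDl// mulr_ge0.
 by rewrite ler_piMr ?divr_ge0 ?(ltW e0)// ler_pdivrMr ?ltr_wpDl ?mulr_ge0// mul1r lerDl.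
by move: h2 h3 h4;lra.
Qed.

(** The index p j is taken beyond j in the intersection of the sets that belong to the bounds 1,
    1/2, ..., 1/(j+1). This intersection is finite, hence in W, and so is every tail. *)
Lemma ultra_extract (W : set_system nat) (D : nat -> nat -> R) : UltraFilter W -> eventually `<=` W ->
 (forall e, 0 < e -> exists2 A, W A & forall m k, A m -> A k -> D m k <= e) ->
 exists p : nat -> nat, (forall j, (j <= p j)%N) /\
  forall e, 0 < e -> exists N, forall m k, (N <= m)%N -> (N <= k)%N -> D (p m) (p k) <= e.
Proof.
move=> UW oW h;have PW : ProperFilter W:= ultra_proper.
pose A j:= xget setT [set A | W A /\ forall p k, A p -> A k -> D p k <= j.+1%:R^-1].
have AP j : W (A j) /\ forall p k, A j p -> A j k -> D p k <= j.+1%:R^-1.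
 rewrite /A;case:xgetP=> // nx;have [|Z h1 h2] := h j.+1%:R^-1;first by rewrite invr_gt0.
 by case:(nx Z).
have ex j : exists p, (j <= p)%N /\ forall i, (i <= j)%N -> A i p.
 have h1 : W [set p | (j <= p)%N] by apply:oW;exists j.
 have h2 : W [set p | forall i, (i <= j)%N -> A i p].
  have -> : [set p | forall i, (i <= j)%N -> A i p] = \bigcap_(i in `I_j.+1) A i.
   by apply/seteqP;split=> p /= hp i /=;[rewrite ltnS;exact:hp|move=> ij;apply:hp;rewrite /= ltnS].
  elim: j.+1=> [|k IH];first by rewrite II0 bigcap_set0;exact:filterT.
  by rewrite IIS bigcap_setU bigcap_set1;apply:filterI=> //;exact:(AP k).1.
 by have [p [? ?]] := filter_ex (filterI h1 h2);exists p.
have [p pP] := choice ex;exists p;split=> [j|e e0];first by have [] := pP j.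
have [N _ hN] : \forall N \near \oo, N.+1%:R^-1 < e by exact:near_infty_natSinv_lt (PosNum e0).
exists N=> m k Nm Nk;apply:le_trans (ltW (hN N (leqnn N))).
by apply:(AP N).2;[have [_] := pP m|have [_] := pP k];exact.
Qed.

(** m is the reciprocal of the eigenvalue in the weak formulation. *)
Definition eigvec u m:= forall w, V w -> b u w = m * B u w.
Definition orthfam (es : seq E) := [/\ uniq es, forall v, v \in es -> V v, forall v w, v \in es -> w \in es -> B v w = (v == w)%:R
 & forall v, v \in es -> exists m, eigvec v m].
Definition orthto (es : seq E) u:= V u /\ forall v, v \in es -> B u v = 0.

Lemma orthto_proj es w : orthfam es -> V w -> orthto es (w - \sum_(v <- es) B w v *: v).
Proof.
move=> [ue Ve oe _] Vw.
have Vs : V (\sum_(v <- es) B w v *: v).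
 by rewrite big_seq;apply:(formV_sum V0 VL)=> v ve;exact/VZ/Ve.
split=> [|v ve];first exact:VB.
rewrite (formBl V0 VL BL Vw Vs (Ve _ ve));apply/eqP;rewrite subr_eq0;apply/eqP.
have -> : \sum_(v <- es) B w v *: v = \sum_(v <- es) (if v \in es then B w v *: v else 0).
 by rewrite big_seq [RHS]big_seq;apply:eq_bigr=> i ->.
rewrite (form_suml V0 VL BL _ _ (Ve _ ve));last by move=> i;case:ifP=> // /Ve;exact:VZ.
rewrite (bigD1_seq v)//= ve (form_Zl V0 BL _ (Ve _ ve) (Ve _ ve)) (oe v v ve ve) eqxx mulr1 big_seq_cond big1 ?addr0//.
by move=> i /andP[ie iv];rewrite ie (form_Zl V0 BL _ (Ve _ ie) (Ve _ ve)) (oe i v ie ve) (negbTE iv) mulr0.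
Qed.

Lemma orthtoL es c u v : orthfam es -> orthto es u -> orthto es v -> orthto es (c *: u + v).
Proof.
move=> [_ Ve _ _] [Vu hu] [Vv hv];split=> [|w we];first exact:VL.
by rewrite BL// ?hu ?hv ?mulr0 ?addr0//;exact:Ve.
Qed.

Definition nextvec (es : seq E) u:= [/\ orthto es u, B u u = 1 & exists m,
 [/\ 0 < m, eigvec u m & forall w, orthto es w -> b w w <= m * B w w]].

(** mu is the supremum of b/B on the orthogonal of es. The form Q = mu B - b is semidefinite there,
    and a maximizing sequence has a B-limit u with Q(u,u) = 0. Cauchy-Schwarz for Q then gives
    Q(u,.) = 0, which is the eigenvalue equation, without any derivative of the quotient. *)
Lemma nextvec_ex es : orthfam es -> exists u, nextvec es u.
Proof.
move=> oe;have [_ Ve _ ee] := oe.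
have o0 : orthto es 0 by split=> // v ve;exact:(form0l V0 BL (Ve v ve)).
have oL:= orthtoL _ oe.
have oV u : orthto es u -> V u by case.
pose S:= [set b u u | u in [set u | orthto es u /\ B u u = 1]].
have [C C0 hC] := b_le_B.
have nz u : V u -> 0 < B u u -> B ((Num.sqrt (B u u))^-1 *: u) ((Num.sqrt (B u u))^-1 *: u) = 1.
 move=> Vu u0;rewrite (form_Zl V0 BL)// ?(formZr V0 VL BL BC)//;last exact:VZ.
 by rewrite mulrA -expr2 exprVn sqr_sqrtr ?(ltW u0)// mulVf// gt_eqF.
have oZ c u : orthto es u -> orthto es (c *: u) by move=> ou;rewrite -[_ *: _]addr0;exact:oL.
have [u0 [Vu0 Bu0 hu0]] := infdim Ve.
have ou0 : orthto es u0 by [].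
have S0 : S !=set0.
 exists (b ((Num.sqrt (B u0 u0))^-1 *: u0) ((Num.sqrt (B u0 u0))^-1 *: u0)).
 by exists ((Num.sqrt (B u0 u0))^-1 *: u0)=> //;split;[exact:oZ|exact:nz].
have SC : ubound S C by move=> _ [u [ou u1] <-];apply:le_trans (hC _ (oV _ ou)) _;rewrite u1 mulr1.
have hS : has_sup S by split=> //;exists C.
set mu:= sup S.
have leS u : orthto es u -> b u u <= mu * B u u.
 move=> ou;have Vu:= oV _ ou.
 have [z|n0] := eqVneq (B u u) 0.
  by apply:le_trans (hC _ Vu) _;rewrite z !mulr0.
 have up : 0 < B u u by rewrite lt_neqAle eq_sym n0 B_ge0.
 have : S (b ((Num.sqrt (B u u))^-1 *: u) ((Num.sqrt (B u u))^-1 *: u)).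
  by exists ((Num.sqrt (B u u))^-1 *: u)=> //;split;[exact:oZ|exact:nz].
 move/(ub_le_sup hS.2).
 rewrite (form_Zl V0 bL)// ?(formZr V0 VL bL bC)//;last exact:VZ.
 by rewrite mulrA -expr2 exprVn sqr_sqrtr ?(ltW up)// mulrC ler_pdivrMr.
(* Otherwise b would vanish at u0, hence also B by [b_null]. *)
have mu0 : 0 < mu.
 rewrite ltNge;apply/negP=> h.
 have:= leS _ ou0;have:= b_ge0 Vu0=> h1 h2.
 have h3 : mu * B u0 u0 <= 0 by rewrite pmulr_lle0.
 have:= b_null Vu0 _;rewrite (_ : b u0 u0 = 0);last by apply/eqP;rewrite eq_le h1 (le_trans h2).
 by move=> /(_ erefl) z;rewrite z ltxx in Bu0.
have ex m : exists u, [/\ orthto es u, B u u = 1 & mu - m.+1%:R^-1 < b u u].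
 have m0 : (0 : R) < m.+1%:R^-1 by rewrite invr_gt0.
 by have [_ [u [ou u1] <-] hu] := sup_adherent m0 hS;exists u.
have [u_ uP] := choice ex.
have Vu_ m : V (u_ m) by have [/oV] := uP m.
pose Q u v:= mu * B u v - b u v.
have QL c u v w : orthto es u -> orthto es v -> orthto es w -> Q (c *: u + v) w = c * Q u w + Q v w.
 by move=> /oV Vu /oV Vv /oV Vw;rewrite /Q BL// bL//;ring.
have QC u v : orthto es u -> orthto es v -> Q u v = Q v u.
 by move=> /oV Vu /oV Vv;rewrite /Q BC// bC.
have Q_ge0 u : orthto es u -> 0 <= Q u u by move=> ou;rewrite /Q subr_ge0 leS.
have Qu m : Q (u_ m) (u_ m) <= m.+1%:R^-1.
 by have [_ e1 e2] := uP m;rewrite /Q e1 mulr1 lerBlDr -lerBlDl ltW.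
have [W [UW oW]] := ultraFilterLemma eventually_filter.
have PW : ProperFilter W:= ultra_proper.
have ou m : orthto es (u_ m) by have [] := uP m.
have oB u v : orthto es u -> orthto es v -> orthto es (u - v) by exact:(formV_B o0 oL).
(* The parallelogram inequality for Q gives mu B(u_m - u_k) <= b(u_m - u_k) + 2 Q(u_m) + 2 Q(u_k),
   with Q and b taken on the diagonal; all three terms are small along W. *)
have [e e0|p [pj pc]] := @ultra_extract W (fun m k=> B (u_ m - u_ k) (u_ m - u_ k)) UW oW.
 have e1 : 0 < e * mu / 2 by rewrite divr_gt0// mulr_gt0.
 have [|A WA hA] := @ultra_cauchy W u_ 1 (e * mu / 2) UW e1 ler01 Vu_.
  by move=> m;have [_ -> _] := uP m.
 have e2 : 0 < e * mu / 8 by rewrite divr_gt0// mulr_gt0.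
 have [N _ hN] : \forall N \near \oo, N.+1%:R^-1 < e * mu / 8 by exact:near_infty_natSinv_lt (PosNum e2).
 exists (A `&` [set k | (N <= k)%N]);first by apply:filterI=> //;apply:oW;exists N.
 move=> m k [Am /= Nm] [Ak Nk];rewrite -(ler_pM2l mu0).
 have:= form_par o0 oL QL QC Q_ge0 (ou m) (ou k).
 have eQ : Q (u_ m - u_ k) (u_ m - u_ k) = mu * B (u_ m - u_ k) (u_ m - u_ k) - b (u_ m - u_ k) (u_ m - u_ k) by [].
 have n1 : m.+1%:R^-1 < e * mu / 8:= hN m Nm;have n2 : k.+1%:R^-1 < e * mu / 8:= hN k Nk.
 have:= hA _ _ Am Ak;have:= le_lt_trans (Qu m) n1;have:= le_lt_trans (Qu k) n2.
 by rewrite eQ;lra.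
have [u Vu ul] := complete (fun m=> Vu_ (p m)) pc.
have d0 : forall e, 0 < e -> \forall m \near \oo, B (u_ (p m) - u) (u_ (p m) - u) < e.
 move=> e e0;have /cvgrPdist_lt/(_ e e0) := ul;apply:filterS=> m.
 by rewrite sub0r normrN ger0_norm// B_ge0//;exact:VB.
have ou' : orthto es u.
 split=> // v ve;have Vv:= Ve _ ve.
 apply/eqP;rewrite -sqrf_eq0 eq_le sqr_ge0 andbT;apply/ler_addgt0Pr=> e e0;rewrite add0r.
 have e1 : 0 < e / (B v v + 1) by rewrite divr_gt0// ltr_wpDl// B_ge0.
 have [m hm] := filter_ex (d0 _ e1).
 have Vd:= VB (Vu_ (p m)) Vu.
 have:= form_CS V0 VL BL BC B_ge0 Vd Vv.
 rewrite (formBl V0 VL BL (Vu_ _) Vu Vv) (ou _).2// sub0r sqrrN=> h;apply:le_trans h _.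
 have v0:= B_ge0 Vv;apply:(@le_trans _ _ (e / (B v v + 1) * B v v));first by rewrite ler_wpM2r// ltW.
 by rewrite mulrAC ler_pdivrMr ?ltr_wpDl//;nra.
have Bu : 0 < B u u.
 have [m hm] : exists m, B (u_ (p m) - u) (u_ (p m) - u) < 1 / 4 by apply:filter_ex (d0 _ _);rewrite divr_gt0.
 have:= form_par' V0 VL BL BC B_ge0 (Vu_ (p m)) Vu;have [_ -> _] := uP (p m);lra.
have Qu0 : Q u u = 0.
 apply/eqP;rewrite eq_le Q_ge0// andbT;apply/ler_addgt0Pr=> e e0;rewrite add0r.
 have e1 : 0 < e / 4 by rewrite divr_gt0.
 have e2 : 0 < e / 4 / mu by rewrite divr_gt0.
 have [m [hm1 hm2]] := filter_ex (filterI (d0 _ e2) (near_infty_natSinv_lt (PosNum e1))).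
 have od:= oB _ _ ou' (ou (p m)).
 have:= form_par' o0 oL QL QC Q_ge0 ou' (ou (p m)).
 have eB : B (u - u_ (p m)) (u - u_ (p m)) = B (u_ (p m) - u) (u_ (p m) - u).
  by rewrite (formB2 V0 VL BL BC Vu (Vu_ _)) (formB2 V0 VL BL BC (Vu_ _) Vu) (BC Vu (Vu_ _));ring.
 have q1 : Q (u - u_ (p m)) (u - u_ (p m)) <= e / 4.
  rewrite /Q eB;have:= b_ge0 (oV _ od);move: hm1;rewrite /= ltr_pdivlMr//;lra.
 have q2 : Q (u_ (p m)) (u_ (p m)) <= e / 4.
  apply:le_trans (Qu _) _;apply:le_trans (ltW hm2)=> /=.
  by rewrite lef_pV2 ?posrE// ler_nat ltnS.
 move: q1 q2;lra.
have Qn w : orthto es w -> Q u w = 0 by move=> ow;exact:(form_null o0 oL QL QC Q_ge0 ou' ow).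
(* So far the equation holds on the orthogonal of es only. On the span of es both forms vanish
   against u: B by orthogonality, and b because es consists of eigenvectors. *)
have ei : eigvec u mu.
 move=> w Vw;have ow:= orthto_proj oe Vw;set s:= \sum_(v <- es) B w v *: v in ow.
 have Vs : V s by rewrite /s big_seq;apply:(formV_sum V0 VL)=> v ve;exact/VZ/Ve.
 have z (F : E -> E -> R) : (forall c u v w, V u -> V v -> V w -> F (c *: u + v) w = c * F u w + F v w) ->
   (forall v, v \in es -> F v u = 0) -> F s u = 0.
  move=> FL Fz;rewrite /s;elim: {-2}es (fun v (h : v \in es)=> h)=> [|v r IH] hr.
   by rewrite big_nil (form0l V0 FL).
  have ve : v \in es by apply:hr;rewrite mem_head.
  rewrite big_cons FL//;last first.
  - by rewrite big_seq;apply:(formV_sum V0 VL)=> y yr;apply/VZ/Ve/hr;rewrite inE yr orbT.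
  - exact:Ve.
  - by rewrite Fz// mulr0 add0r IH// => y yr;apply:hr;rewrite inE yr orbT.
 have zB : B s u = 0 by apply:z=> // v ve;rewrite BC ?ou'.2//;exact:Ve.
 have zb : b s u = 0.
  apply:z=> // v ve;have [m hm] := ee v ve;rewrite hm//.
  by rewrite BC ?ou'.2 ?mulr0//;exact:Ve.
 have:= Qn _ ow;rewrite /Q (formBr V0 VL BL BC)// (formBr V0 VL bL bC)// (BC Vu Vs) (bC Vu Vs) zB zb !subr0.
 by move/eqP;rewrite subr_eq0=> /eqP <-.
exists ((Num.sqrt (B u u))^-1 *: u);split;[exact:oZ|exact:nz|exists mu;split=> //].
move=> w Vw;rewrite (form_Zl V0 bL)// (form_Zl V0 BL)// ei//;ring.
Qed.

Definition spec_system (e : nat -> E) (mu : nat -> R) :=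
 [/\ forall k, V (e k), forall j k, B (e j) (e k) = (j == k)%:R, forall k, 0 < mu k, forall k, eigvec (e k) (mu k)
 & forall k w, V w -> (forall i, (i < k)%N -> B w (e i) = 0) -> b w w <= mu k * B w w].

Lemma spec_system_ex : exists e mu, spec_system e mu.
Proof.
(* The default 0 is never met: [omk] shows that every stage is an [orthfam], for which a next vector
   exists. *)
pose st es:= xget 0 [set u | nextvec es u].
have stP es : orthfam es -> nextvec es (st es).
 by move=> oe;rewrite /st;case:xgetP=> // nx;have [u hu] := nextvec_ex oe;case:(nx u).
pose mk k:= iter k (fun es=> rcons es (st es)) [::].
pose e k:= st (mk k).
have mkS k : mk k.+1 = rcons (mk k) (e k) by [].
have mkE k v : v \in mk k <-> exists2 i, (i < k)%N & v = e i.
 elim: k=> [|k IH];first by split=> // -[].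
 rewrite mkS mem_rcons inE;split=> [/orP[/eqP->|/IH[i ik ->]]|[i]].
 - by exists k.
 - by exists i=> //;exact:ltnW.
 - rewrite ltnS leq_eqVlt=> /orP[/eqP->->|ik ve];first by rewrite eqxx.
  by apply/orP;right;apply/IH;exists i.
have omk k : orthfam (mk k).
 elim: k=> [|k IH];first by split.
 have [[Vu hu] uu [m [m0 em _]]] := stP _ IH;have [ue Ve oe ee] := IH.
 rewrite -/(e k) in Vu hu uu em.
 have ni : e k \notin mk k.
  by apply/negP=> h;have:= hu _ h;rewrite uu=> /eqP;rewrite oner_eq0.
 rewrite mkS;split=> [|v|v w|v].
 - by rewrite rcons_uniq ni.
 - by rewrite mem_rcons inE=> /orP[/eqP->//|];exact:Ve.
 - rewrite !mem_rcons !inE=> /orP[/eqP->|vm] /orP[/eqP->|wm].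
  + by rewrite eqxx.
  + by rewrite hu//;case:eqP=> // z;rewrite z wm in ni.
  + by rewrite BC ?hu//;[case:eqP=> // z;rewrite -z vm in ni|exact:Ve].
  + exact:oe.
 - by rewrite mem_rcons inE=> /orP[/eqP->|];[exists m|exact:ee].
have eP k:= stP _ (omk k).
have ex k : exists m, [/\ 0 < m, eigvec (e k) m & forall w, orthto (mk k) w -> b w w <= m * B w w] by have [_ _] := eP k.
have [mu muP] := choice ex.
have Vek k : V (e k) by have [[]] := eP k.
have ort i k : (i < k)%N -> B (e k) (e i) = 0.
 by move=> ik;have [[_ h] _ _] := eP k;apply:h;apply/mkE;exists i.
exists e, mu;split=> [//|j k|k|k|k w Vw hw].
- case:(ltngtP j k)=> [jk|kj|->];[by rewrite BC ?ort|by rewrite ort|by have [] := eP k].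
- by have [] := muP k.
- by have [] := muP k.
- by have [_ _] := muP k;apply;split=> // v /mkE[i ik ->];exact:hw.
Qed.

Lemma spec_noninc e mu : spec_system e mu -> forall j k, (j <= k)%N -> mu k <= mu j.
Proof.
move=> [Ve oe m0 em hm] j k jk;have:= hm j (e k) (Ve k);rewrite em// oe eqxx !mulr1;apply.
by move=> i ij;rewrite oe gtn_eqF//;exact:leq_trans jk.
Qed.

(** Otherwise all mu k are at least d, and b(e_m - e_k) = mu_m + mu_k >= 2 d for different indices.
    This contradicts that the bounded sequence e is b-Cauchy along an ultrafilter finer than the
    tails. *)
Lemma spec_to0 e mu : spec_system e mu -> forall d, 0 < d -> exists N, forall k, (N <= k)%N -> mu k < d.
Proof.
move=> se d d0;have ni:= spec_noninc se;have [Ve oe m0 em hm] := se.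
have [[N hN]|nN] := pselect (exists N, mu N < d).
 by exists N=> k Nk;apply:le_lt_trans hN;exact:ni.
have hd k : d <= mu k by rewrite leNgt;apply/negP=> h;apply:nN;exists k.
have [W [UW oW]] := ultraFilterLemma eventually_filter.
have PW : ProperFilter W:= ultra_proper.
have [|A WA hA] := @ultra_cauchy W e 1 d UW d0 ler01 Ve;first by move=> m;rewrite oe eqxx.
have [m Am] := filter_ex WA.
have [k [Ak mk]] : exists k, A k /\ (m < k)%N.
 by apply:filter_ex (filterI WA _);apply:oW;exists m.+1.
have:= hA _ _ Am Ak;rewrite (formB2 V0 VL bL bC)// !em// !oe !eqxx ltn_eqF//= !mulr1 mulr0.
have:= hd m;have:= hd k;lra.
Qed.

Definition spec_res (e : nat -> E) w m : E:= w - \sum_(k < m) B w (e k) *: e k.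

Lemma spec_sumV (e : nat -> E) (c : nat -> R) m : (forall k, V (e k)) -> V (\sum_(k < m) c k *: e k).
Proof. by move=> Ve;apply:(formV_sum V0 VL)=> i _;exact:VZ. Qed.

Lemma spec_sumB e mu (c : nat -> R) m k : spec_system e mu ->
 B (\sum_(i < m) c i *: e i) (e k) = if (k < m)%N then c k else 0.
Proof.
move=> [Ve oe _ _ _];rewrite (form_suml V0 VL BL)//;last by move=> i;exact:VZ.
have h i : B (c i *: e i) (e k) = if i == k then c k else 0.
 by rewrite (form_Zl V0 BL)// oe;case:eqP=> [->|];rewrite ?mulr1 ?mulr0.
rewrite (eq_bigr (fun i : 'I_m=> if (i : nat) == k then c k else 0))=> [|i _];last exact:h.
rewrite -big_mkcond/=;case:ltnP=> km.
 by rewrite (big_pred1 (Ordinal km)).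
by rewrite big1// => i /eqP ik;move: (ltn_ord i);rewrite ik ltnNge km.
Qed.

Lemma spec_resB e mu w m k : spec_system e mu -> V w -> B (spec_res e w m) (e k) = if (k < m)%N then 0 else B w (e k).
Proof.
move=> se Vw;have [Ve _ _ _ _] := se.
rewrite /spec_res (formBl V0 VL BL)//;last exact:(spec_sumV (fun k=> B w (e k))).
by rewrite (spec_sumB (fun k=> B w (e k)) _ _ se);case:ifP=> _;rewrite ?subrr ?subr0.
Qed.

Lemma spec_resV e mu w m : spec_system e mu -> V w -> V (spec_res e w m).
Proof. by move=> [Ve _ _ _ _] Vw;apply:VB=> //;exact:(spec_sumV (fun k=> B w (e k))). Qed.

(* Orthogonality of [r_k - r_m] to [r_m]. *)
Lemma spec_res_diff e mu w k m : spec_system e mu -> V w -> (k <= m)%N ->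
 B (spec_res e w k - spec_res e w m) (spec_res e w k - spec_res e w m) =
 B (spec_res e w k) (spec_res e w k) - B (spec_res e w m) (spec_res e w m).
Proof.
move=> se Vw km;have [Ve _ _ _ _] := se.
have Vk:= spec_resV k se Vw;have Vm:= spec_resV m se Vw.
pose c i:= if (k <= i)%N then B w (e i) else 0.
have ed : spec_res e w k - spec_res e w m = \sum_(i < m) c i *: e i.
 rewrite /spec_res opprB addrC addrA subrK -(big_mkord xpredT (fun i=> B w (e i) *: e i)) -(big_mkord xpredT (fun i=> B w (e i) *: e i)).
 rewrite -(big_mkord xpredT (fun i=> c i *: e i)) (big_cat_nat (n:= k))//= [RHS](big_cat_nat (n:= k))//=.
 rewrite addrAC subrr add0r [X in _ = X + _]big1_seq ?add0r;last first.
  by move=> i;rewrite mem_index_iota=> /andP[_ /andP[_ ik]];rewrite /c leqNgt ik scale0r.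
 by apply:eq_big_nat=> i /andP[ki _];rewrite /c ki.
have z : B (spec_res e w k - spec_res e w m) (spec_res e w m) = 0.
 rewrite ed (form_suml V0 VL BL)//;last by move=> i;exact:VZ.
 by rewrite big1// => i _;rewrite (form_Zl V0 BL)// BC// (spec_resB _ _ se)// ltn_ord mulr0.
have:= formD2 VL BL BC (VB Vk Vm) Vm;rewrite z subrK mulr0 addr0=> ->.
by rewrite addrK.
Qed.

(** The B-norms of the residues decrease, hence the residues are B-Cauchy by [spec_res_diff]. Their
    b-norms are at most mu_m B(r_0, r_0), which tends to 0. The limit u thus has b(u,u) = 0, and
    B(u,u) = 0 by [b_null]. *)
Lemma spec_complete e mu w : spec_system e mu -> V w ->
 B (spec_res e w m) (spec_res e w m) @[m --> \oo] --> 0.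
Proof.
move=> se Vw;have [Ve oe m0 em hm] := se.
pose r m:= spec_res e w m;pose N m:= B (r m) (r m).
have Vr m : V (r m) by exact:spec_resV se Vw.
have Nle k m : (k <= m)%N -> N m <= N k.
 by move=> km;rewrite -subr_ge0 -(spec_res_diff se Vw km) B_ge0//;exact:VB.
have cN : cvgn N.
 apply:nonincreasing_is_cvgn;first by move=> k m /Nle.
 by exists 0=> _ [m _ <-];exact:B_ge0.
have [|u Vu ul] := complete Vr.
 move=> d d0;have /cvgrPdist_lt/(_ d d0)[M _ hM] := cN.
 have lN m : limn N <= N m by apply:nonincreasing_cvgn_ge=> // i j /Nle.
 have hd m k : (M <= m)%N -> (m <= k)%N -> B (r m - r k) (r m - r k) <= d.
  move=> Mm mk;rewrite (spec_res_diff se Vw mk);have:= hM m Mm=> /=.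
  have:= lN k;have:= lN m;rewrite /N /r=> h1 h2;rewrite distrC ger0_norm ?subr_ge0//;lra.
 exists M=> m k Mm Mk;have [mk|/ltnW km] := leqP m k;first exact:hd.
 have:= hd k m Mk km;rewrite (formB2 V0 VL BL BC (Vr k) (Vr m)) (formB2 V0 VL BL BC (Vr m) (Vr k)) (BC (Vr k) (Vr m)).
 lra.
have bN m : b (r m) (r m) <= mu m * N 0%N.
 have h1 : b (r m) (r m) <= mu m * N m by apply:hm=> // i im;rewrite (spec_resB _ _ se)// im.
 by apply:le_trans h1 _;rewrite ler_pM2l// Nle.
have [C C0 hC] := b_le_B.
have bu : b u u = 0.
 apply/eqP;rewrite eq_le b_ge0// andbT;apply/ler_addgt0Pr=> d d0;rewrite add0r.
 have N0 : 0 <= N 0%N by exact:B_ge0.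
 have d1 : 0 < d / (4 * (C + 1)) by rewrite divr_gt0// mulr_gt0// ltr_wpDl.
 have d2 : 0 < d / (4 * (N 0%N + 1)) by rewrite divr_gt0// mulr_gt0// ltr_wpDl.
 have [M hM] := spec_to0 se d2.
 have /cvgrPdist_lt/(_ _ d1)[M' _ hM'] := ul.
 pose m:= maxn M M';have:= hM m (leq_maxl _ _);have:= hM' m (leq_maxr _ _)=> /=.
 rewrite sub0r normrN ger0_norm ?B_ge0//;last exact:VB.
 have:= form_par' V0 VL bL bC b_ge0 Vu (Vr m).
 have -> : b (u - r m) (u - r m) = b (r m - u) (r m - u).
  by rewrite (formB2 V0 VL bL bC Vu (Vr _)) (formB2 V0 VL bL bC (Vr _) Vu) (bC Vu (Vr _));ring.
 have:= hC _ (VB (Vr m) Vu);have:= bN m;set X:= B _ _;set Y:= b _ _;set Z:= b _ _.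
 move=> h1 h2 h3 h4 h5.
 have X0 : 0 <= X by apply:B_ge0;exact:VB.
 have h6 : C * X <= d / 4.
  apply:(@le_trans _ _ ((C + 1) * (d / (4 * (C + 1)))));first by rewrite ler_pM// ?lerDl// ltW.
  by rewrite le_eqVlt;apply/orP;left;apply/eqP;field;rewrite lt0r_neq0// ltr_wpDl.
 have h7 : mu m * N 0%N <= d / 4.
  apply:(@le_trans _ _ ((d / (4 * (N 0%N + 1))) * (N 0%N + 1)));first by rewrite ler_pM ?lerDl// ltW.
  by rewrite le_eqVlt;apply/orP;left;apply/eqP;field;rewrite lt0r_neq0// ltr_wpDl.
 by move: h1 h2 h3 h6 h7;lra.
have Bu:= b_null Vu bu.
have h0 : 2 * B (r m - u) (r m - u) @[m --> \oo] --> (2 * 0 : R) by apply:cvgMr.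
rewrite mulr0 in h0;apply:(squeeze_cvgr _ (@cvg_cst _ 0 _ _ _) h0);apply:nearW=> m.
rewrite B_ge0//=;have:= form_par' V0 VL BL BC B_ge0 (Vr m) Vu;rewrite Bu mulr0 addr0=> h.
exact:h.
Qed.

(** A further eigenvalue would give an eigenvector orthogonal to every e k. It would equal all its
    residues, and have B-norm 0 by completeness. *)
Lemma spec_eigval e mu u m : spec_system e mu -> V u -> 0 < B u u -> eigvec u m -> exists k, m = mu k.
Proof.
move=> se Vu u0 eu;have [Ve oe m0 em hm] := se.
have [//|nk] := pselect (exists k, m = mu k).
have z k : B u (e k) = 0.
 have h1:= eu _ (Ve k);rewrite bC// em// BC// in h1.
 by apply/eqP;apply:contra_notT nk=> n0;exists k;apply/esym/(mulIf n0).
have h:= spec_complete se Vu.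
have e0 k : spec_res e u k = u by rewrite /spec_res big1 ?subr0// => i _;rewrite z scale0r.
have : B u u @[k --> \oo] --> 0 by rewrite -[X in X @ _ --> _](_ : (fun k=> B (spec_res e u k) (spec_res e u k)) = _)//;apply/funext=> k;rewrite e0.
move=> /cvg_lim;rewrite lim_cst// => h1;move: u0;rewrite h1 ?ltxx//.
Qed.

(** An eigenvector for m is orthogonal to e k as soon as mu k < m, hence for all k >= N. Its
    residues are constant from N on, and they tend to 0. *)
Lemma spec_finite e mu m : spec_system e mu -> 0 < m -> exists N, forall u, V u -> eigvec u m ->
 B (spec_res e u N) (spec_res e u N) = 0.
Proof.
move=> se m0';have [Ve oe m0 em hm] := se.
have [N hN] := spec_to0 se m0';exists N=> u Vu eu.
have z k : (N <= k)%N -> B u (e k) = 0.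
 move=> Nk;have h1:= eu _ (Ve k);rewrite bC// em// BC// in h1.
 apply/eqP;apply/negPn/negP=> n0;have:= hN k Nk;rewrite (mulIf n0 h1) ?ltxx//.
have h:= spec_complete se Vu.
have e0 k : spec_res e u (N + k) = spec_res e u N.
 rewrite /spec_res big_split_ord/= [X in _ - (_ + X)]big1 ?addr0// => i _.
 by rewrite z ?scale0r// leq_addr.
apply/eqP;rewrite eq_le B_ge0 ?andbT;last exact:spec_resV se Vu.
apply/ler_addgt0Pr=> d d0;rewrite add0r;have /cvgrPdist_lt/(_ d d0)[M _ hM] := h.
have:= hM (N + M)%N (leq_addl _ _);rewrite /= e0 sub0r normrN=> h1.
exact:le_trans (ler_norm _) (ltW h1).
Qed.

(** mu is non-increasing with repetitions. [idx] jumps each time to the first index where it drops,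
    so that the reciprocals along [idx] increase strictly and meet every value. *)
Lemma spec_enum e mu : spec_system e mu -> exists lam : nat -> R,
 [/\ forall i j, (i < j)%N -> lam i < lam j, lam k @[k --> \oo] --> +oo
 & range lam = range (fun k=> (mu k)^-1)].
Proof.
move=> se;have ni:= spec_noninc se;have t0:= spec_to0 se;have [Ve oe m0 em hm] := se.
have ex k : exists j, mu j < mu k by have [N hN] := t0 _ (m0 k);exists N;exact:hN.
pose nx k:= ex_minn (ex k).
have nxP k : mu (nx k) < mu k by rewrite /nx;case:ex_minnP.
have nx_min k j : mu j < mu k -> (nx k <= j)%N by rewrite /nx;case:ex_minnP=> p _;exact.
have nx_gt k : (k < nx k)%N by rewrite ltnNge;apply/negP=> /ni;rewrite leNgt nxP.
pose idx i:= iter i nx 0%N.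
have idx_ge i : (i <= idx i)%N by elim: i=> // i IH;apply:leq_ltn_trans IH (nx_gt _).
have lamS i : (mu (idx i))^-1 < (mu (idx i.+1))^-1 by rewrite ltf_pV2 ?posrE//;exact:nxP.
exists (fun i=> (mu (idx i))^-1);split.
- move=> i;elim=> // j IH;rewrite ltnS leq_eqVlt=> /orP[/eqP->|/IH h];first exact:lamS.
 exact:lt_trans h (lamS _).
- apply/cvgryPge=> A;have [N hN] := t0 (`|A| + 1)^-1 ltac:(rewrite invr_gt0 ltr_wpDl//).
 exists N=> // i /= Ni;have h:= hN _ (leq_trans Ni (idx_ge i)).
 apply:(@le_trans _ _ (`|A| + 1));first by apply:(le_trans (ler_norm A));rewrite lerDl.
 by rewrite -[_ + 1]invrK lef_pV2 ?posrE ?invr_gt0 ?ltr_wpDl//;exact:ltW.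
- apply/seteqP;split=> [_ [i _ <-]|_ [k _ <-]];first by exists (idx i).
 elim: k=> [|k [i _ hi]];first by exists 0%N.
 have [h|h] := eqVneq (mu k.+1) (mu k);first by exists i=> //;rewrite h.
 exists i.+1=> //;have mk : mu k = mu (idx i) by apply:invr_inj;rewrite hi.
 suff -> : idx i.+1 = k.+1 by [].
 apply/eqP;rewrite eqn_leq;apply/andP;split.
  by apply:nx_min;rewrite -mk lt_neqAle h ni.
 rewrite ltnNge;apply/negP=> /ni;rewrite mk leNgt;by rewrite nxP.
Qed.

Theorem spectral_theorem : exists (e : nat -> E) (mu lam : nat -> R),
 [/\ forall k, [/\ V (e k), 0 < mu k & eigvec (e k) (mu k)],
   forall j k, B (e j) (e k) = (j == k)%:R,
   forall w, V w -> B (spec_res e w m) (spec_res e w m) @[m --> \oo] --> 0,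
   forall u m, V u -> eigvec u m -> [/\ 0 < B u u -> exists k, m = mu k,
    forall k, m != mu k -> B u (e k) = 0 &
    0 < m -> exists N, forall w, V w -> eigvec w m -> B (spec_res e w N) (spec_res e w N) = 0] &
   [/\ forall i j, (i < j)%N -> lam i < lam j, lam k @[k --> \oo] --> +oo
    & range lam = range (fun k=> (mu k)^-1)]].
Proof.
have [e [mu se]] := spec_system_ex;have [lam hl] := spec_enum se;have [Ve oe m0 em hm] := se.
exists e, mu, lam;split=> // [w Vw|u m Vu eu].
 exact:spec_complete se Vw.
split=> [u0|k mk|mp];[exact:spec_eigval se Vu u0 eu| |exact:spec_finite se mp].
have h1:= eu _ (Ve k);rewrite bC// em// BC// in h1.
by apply/eqP;apply:contraNT mk=> n0;apply/eqP/esym/(mulIf n0).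
Qed.
End spectral.

(** * The forms of the problem satisfy the hypotheses of the spectral theorem *)

Section instance.
Context (R : realType) (n : nat) (alpha : R).
Notation V:= 'rV[R]_n.+1.
Notation mu:= (lebesgue_rV R n.+1).
Variable Om : set V.
Hypothesis oO : open Om.
Hypothesis bO : bounded_set Om.
Hypothesis clO : class_C_kalpha 4 alpha Om.
Let mO : measurable Om:= open_meas oO.
Let mT : measurable [set: V] := @measurableT _ V.
Notation sq:= (sqi mu Om).
Notation aeq:= (ae_eq mu Om).
Notation H:= (H4_H20 Om).

(** [lform1] and [lform2] play the roles of b and B. *)
Definition lform1 (u w : V -> R) : R:= dot mu Om (lap Om u) (lap Om w).
Definition lform2 (u w : V -> R) : R:= dot mu Om (lap Om (lap Om u)) (lap Om (lap Om w)).

Lemma lform1C u v : lform1 u v = lform1 v u. Proof. exact:dotC. Qed.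
Lemma lform2C u v : lform2 u v = lform2 v u. Proof. exact:dotC. Qed.

Lemma lform1L c u v w : H u -> H v -> H w -> lform1 (c *: u + v) w = c * lform1 u w + lform1 v w.
Proof.
move=> Hu Hv Hw;have [Hs e _] := H4_H20_lin oO c Hu Hv.
have [_ s1 _] := H4_H20_sq oO Hu;have [_ s2 _] := H4_H20_sq oO Hv;have [_ s3 _] := H4_H20_sq oO Hw.
have [_ s4 _] := H4_H20_sq oO Hs;have sc:= sqiZ mO c s1.
exact:(etrans (ae_eq_dot mO s4 (sqiD mO sc s2) s3 e) (etrans (dotDl mO sc s2 s3) (congr1 (fun t=> t + _) (dotZl mO c s1 s3)))).
Qed.

Lemma lform2L c u v w : H u -> H v -> H w -> lform2 (c *: u + v) w = c * lform2 u w + lform2 v w.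
Proof.
move=> Hu Hv Hw;have [Hs _ e] := H4_H20_lin oO c Hu Hv.
have [_ _ s1] := H4_H20_sq oO Hu;have [_ _ s2] := H4_H20_sq oO Hv;have [_ _ s3] := H4_H20_sq oO Hw.
have [_ _ s4] := H4_H20_sq oO Hs;have sc:= sqiZ mO c s1.
exact:(etrans (ae_eq_dot mO s4 (sqiD mO sc s2) s3 e) (etrans (dotDl mO sc s2 s3) (congr1 (fun t=> t + _) (dotZl mO c s1 s3)))).
Qed.

Lemma zjet0 : zjet Om (fun _=> 0).
Proof.
have t0 : test_function Om (cst (0 : R)).
 have S0 : smooth (cst 0 : V -> R) by move=> k;exact:C_k_cst.
 apply:(@test_functionP R n.+1 Om (cst 0) set0 S0).
 - exact:closed0.
 - by apply/bounded_setP;exists 1;[exact:ltr01|].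
 - by [].
 - by [].
have p0 (s : seq 'I_n.+1) : pderiv s (cst (0 : R) : V -> R) = cst 0.
 by elim: s=> // i s IH;apply/funext=> x;rewrite /= -/(pderiv s _) IH derive_cst.
split;first split=> [s _|s i _ phi tp];first exact:(sqi0 mu Om).
 by rewrite !dot0l ?oppr0.
exists (fun _=> cst 0);split=> // s _.
have -> : pderiv s (cst (0 : R) : V -> R) - 0 = 0 by rewrite p0 subr0.
rewrite (nrm0 mu mO);exact:cvg_cst.
Qed.

Lemma H0 : H 0. Proof. exact:(zjet_H4_H20 oO zjet0). Qed.

Lemma lap_null u : sq u -> aeq u (cst 0) -> aeq (lap Om u) (cst 0).
Proof.
move=> su e;have s0:= sqi0 mu Om.
have -> : lap Om u = lap Om 0 by exact:lap_ext oO _ _ su s0 e.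
have [_ h] := lap_jet oO (k:= 4) isT zjet0.1;apply:(ae_eq_trans h).
by apply:aeW=> x _;rewrite /opA /= fct_sumE big1// => k _;rewrite fct_sumE big1// => l _;rewrite scaler0.
Qed.

Let nrm_null f : sq f -> aeq f (cst 0) -> nrm mu Om f = 0.
Proof. by move=> sf e;rewrite (ae_eq_nrm mO sf (sqi0 mu Om) e) (nrm0 mu mO). Qed.

Lemma lform1_null u : H u -> lform1 u u = 0 -> lform2 u u = 0.
Proof.
move=> Hu e;have [_ s1 s2] := H4_H20_sq oO Hu.
have z : nrm mu Om (lap Om u) = 0 by apply/eqP;rewrite -sqrf_eq0 sqr_nrm;apply/eqP.
have:= nrm_null s2 (lap_null s1 (nrm0_ae mO s1 z));rewrite /lform2 -sqr_nrm=> ->.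
by rewrite expr0n.
Qed.

Lemma lform2_jet U : zjet Om U -> lform2 (U [::]) (U [::]) = nrm mu Om (lap2 U) ^+ 2.
Proof.
move=> zU;have [s1 e1] := lap2_jet oO zU.1.
have sl : sq (lap2 U) := proj1 (jet_opA 1%:M oO (jet_opA 1%:M oO zU.1)) [::] isT.
by rewrite /lform2 -sqr_nrm (ae_eq_nrm mO s1 sl e1).
Qed.

Lemma lform2_bound : exists2 C, 0 <= C & forall U, zjet Om U -> forall s, (size s <= 4)%N ->
 nrm mu Om (U s) ^+ 2 <= C * lform2 (U [::]) (U [::]).
Proof.
have [C C0 hC] := apriori oO bO clO;exists (C ^+ 2);first exact:sqr_ge0.
move=> U zU s s4;rewrite lform2_jet// -exprMn ler_pXn2r ?nnegrE ?nrm_ge0 ?mulr_ge0 ?nrm_ge0//.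
by apply:le_trans (hC _ zU);exact:le_J.
Qed.

Lemma lform2_eq0 u : H u -> lform2 u u = 0 <-> aeq u (cst 0).
Proof.
move=> Hu;have [s0 s1 s2] := H4_H20_sq oO Hu;split=> e;last first.
 have:= nrm_null s2 (lap_null s1 (lap_null s0 e));rewrite /lform2 -sqr_nrm=> ->.
 by rewrite expr0n.
have [C C0 hC] := lform2_bound;have:= hC _ (H4_H20_zjet oO Hu) [::] isT;rewrite /= e mulr0=> h.
apply:(nrm0_ae mO s0);apply/eqP;rewrite -sqrf_eq0 eq_le h;exact:sqr_ge0.
Qed.

Definition subj (U W : seq 'I_n.+1 -> V -> R) := addj (scalej (-1) W) U.
Let subjE U W s : subj U W s = U s - W s.
Proof. by rewrite /subj /addj /scalej scaleN1r addrC. Qed.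
Let zsub U W : zjet Om U -> zjet Om W -> zjet Om (subj U W).
Proof. by move=> zU zW;exact:zjet_lin. Qed.

Lemma cvg0_opA (D : nat -> seq 'I_n.+1 -> V -> R) (A : 'M[R]_n.+1) s :
 (forall m k l, sq (D m (s ++ [:: k;l]))) ->
 (forall k l, nrm mu Om (D m (s ++ [:: k;l])) @[m --> \oo] --> 0) ->
 nrm mu Om (opA A (D m) s) @[m --> \oo] --> 0.
Proof.
move=> sD cD.
have c : (\sum_k \sum_l `|A k l| * nrm mu Om (D m (s ++ [:: k;l]))) @[m --> \oo] --> (0 : R).
 apply:approx_sum=> k;apply:approx_sum=> l.
 have h : `|A k l| * nrm mu Om (D m (s ++ [:: k;l])) @[m --> \oo] --> (`|A k l| * 0 : R) by apply:cvgMr;exact:cD.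
 by rewrite mulr0 in h.
apply:(squeeze_cvgr _ (@cvg_cst _ (0 : R) _ _ _) c);apply:nearW=> m;rewrite nrm_ge0 /=.
have sZ k l : sq (A k l *: D m (s ++ [:: k;l])) by exact:sqiZ.
have sS k : sq (\sum_l A k l *: D m (s ++ [:: k;l])) by apply:(sqi_sum mO).
apply:le_trans (nrm_sum _ mO _) _=> //;apply:ler_sum=> k _.
by apply:le_trans (nrm_sum _ mO _) _=> //;apply:ler_sum=> l _;rewrite nrmZ.
Qed.

(** By the a priori estimate all derivatives of order at most four are Cauchy in L^2, and their
    limits form a jet W. A diagonal sequence of test functions gives W the zero trace. *)
Lemma lform2_complete (u_ : nat -> V -> R) : (forall m, H (u_ m)) ->
 (forall e, 0 < e -> exists N, forall m k, (N <= m)%N -> (N <= k)%N -> lform2 (u_ m - u_ k) (u_ m - u_ k) <= e) ->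
 exists2 u, H u & lform2 (u_ m - u) (u_ m - u) @[m --> \oo] --> 0.
Proof.
move=> Hu cu;have zU m:= H4_H20_zjet oO (Hu m).
pose U m:= Jt Om (u_ m);have [C C0 hC] := lform2_bound.
have cs s : (size s <= 4)%N -> exists2 w, sq w & nrm mu Om (U m s - w) @[m --> \oo] --> 0.
 move=> s4;apply:(sqi_complete mO)=> [m|e e0];first exact:(proj1 (zU m).1 s s4).
 have e1 : 0 < e ^+ 2 / (C + 1) by rewrite divr_gt0 ?exprn_gt0// ltr_wpDl.
 have [N hN] := cu _ e1;exists N=> m k Nm Nk.
 have zd:= zsub (zU m) (zU k);have h:= hC _ zd s s4;rewrite !subjE in h.
 rewrite -(ler_pXn2r (n:= 2)) ?nnegrE ?nrm_ge0 ?(ltW e0)//;apply:le_trans h _.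
 apply:(@le_trans _ _ ((C + 1) * (e ^+ 2 / (C + 1))));last by rewrite mulrC divfK// gt_eqF// ltr_wpDl.
 by apply:ler_pM=> //;[exact:dot_ge0|rewrite lerDl|exact:hN].
have [W hW] : exists W : seq 'I_n.+1 -> V -> R, forall s, (size s <= 4)%N -> sq (W s) /\ nrm mu Om (U m s - W s) @[m --> \oo] --> 0.
 have ex s : exists w, (size s <= 4)%N -> sq w /\ nrm mu Om (U m s - w) @[m --> \oo] --> 0.
  have [s4|s4] := boolP (size s <= 4)%N;last by exists 0.
  by have [w w1 w2] := cs s s4;exists w.
 by have [W hW] := choice ex;exists W.
have jW : jet 4 Om W.
 by apply:(jet_lim oO (U:= U))=> [m|s /hW[]|s /hW[]]//;exact:(zU m).1.
(* A test function within 1/(m+1) of u_m in every derivative of order at most two; their sequence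
   converges to W. *)
have ex m : exists phi, test_function Om phi /\ forall s, (size s <= 2)%N -> nrm mu Om (pderiv s phi - U m s) <= m.+1%:R^-1.
 have [_ [phi [tp cp]]] := zU m.
 have m0 : (0 : R) < m.+1%:R^-1 by rewrite invr_gt0.
 have : (\sum_(t <- enum {: {j : 'I_3 & j.-tuple 'I_n.+1}}) nrm mu Om (pderiv (tagged t) (phi j) - U m (tagged t))) @[j --> \oo] --> 0.
  by apply:approx_sum=> -[j t];apply:cp;rewrite /= size_tuple -ltnS.
 move=> /cvgrPdist_le/(_ _ m0)[N _ hN];exists (phi N);split=> // s s2.
 have:= hN N (leqnn N);rewrite /= sub0r normrN ger0_norm;last by apply:sumr_ge0=> t _;exact:nrm_ge0.
 apply:le_trans;have s3 : (size s < 3)%N by [].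
 pose t : {j : 'I_3 & j.-tuple 'I_n.+1} := Tagged (fun j : 'I_3=> j.-tuple 'I_n.+1) (in_tuple s : (Ordinal s3).-tuple _).
 rewrite (bigD1_seq t) ?mem_enum ?enum_uniq//= lerDl;apply:sumr_ge0=> i _;exact:nrm_ge0.
have [phi hphi] := choice ex.
have zW : zjet Om W.
 split=> //;exists phi;split=> [m|s s2];first exact:(hphi m).1.
 have s4 : (size s <= 4)%N:= leq_trans s2 (isT : (2 <= 4)%N).
 have [sW cW] := hW s s4.
 have t0 : (m.+1%:R^-1 : R) @[m --> \oo] --> (0 : R).
  apply/cvgrPdist_lt=> e e0;have:= near_infty_natSinv_lt (PosNum e0);apply:filterS=> k.
  by rewrite sub0r normrN ger0_norm// invr_ge0.
 have c : m.+1%:R^-1 + nrm mu Om (U m s - W s) @[m --> \oo] --> (0 + 0 : R) by exact:cvgD.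
 rewrite addr0 in c;apply:(squeeze_cvgr _ (@cvg_cst _ (0 : R) _ _ _) c);apply:nearW=> m.
 have sp : sq (pderiv s (phi m)) by exact:sqiT mO (sqi_test s (hphi m).1).
 have sU : sq (U m s) := proj1 (zU m).1 s s4.
 have hp:= (hphi m).2 s s2;rewrite nrm_ge0/=.
 have -> : pderiv s (phi m) - W s = (pderiv s (phi m) - U m s) + (U m s - W s).
  by pose P:= pderiv s (phi m);rewrite -/P addrA subrK.
 by apply:le_trans (nrmD mO (sqiB mO sp sU) (sqiB mO sU sW)) _;rewrite lerD2r.
exists (W [::]);first exact:(zjet_H4_H20 oO zW).
have zd m:= zsub (zU m) zW.
have cD s : (size s <= 4)%N -> nrm mu Om (subj (U m) W s) @[m --> \oo] --> 0.
 by move=> s4;have [_] := hW s s4;under eq_fun do rewrite -subjE.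
have c4 : nrm mu Om (lap2 (subj (U m) W)) @[m --> \oo] --> 0.
 apply:(@cvg0_opA (fun m=> opA 1%:M (subj (U m) W)) 1%:M [::])=> [m k l|k l].
  exact:(proj1 (jet_opA 1%:M oO (zd m).1) [:: k;l] isT).
 apply:cvg0_opA=> [m p q|p q];last exact:cD.
 exact:(proj1 (zd m).1 [:: k;l;p;q] isT).
have c5 : nrm mu Om (lap2 (subj (U m) W)) * nrm mu Om (lap2 (subj (U m) W)) @[m --> \oo] --> (0 * 0 : R) by exact:cvgM.
rewrite mulr0 in c5.
have E : (fun m=> lform2 (u_ m - W [::]) (u_ m - W [::])) = (fun m=> nrm mu Om (lap2 (subj (U m) W)) * nrm mu Om (lap2 (subj (U m) W))).
 by apply/funext=> m;have h:= lform2_jet (zd m);rewrite subjE in h;exact:etrans h (expr2 _).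
by rewrite E.
Qed.

(** With f the norm of the bilaplacian, b(u,u) <= f |u|, and [rellich] together with J 3 <= C' f
    gives |u| <= (e/2) f + v sum_j |c_j u|. The product of f with this sum is split by the
    inequality of the means. The constant a makes that split exact when each functional gets the
    share e/(2k) of f^2, and k = m + 1 is positive even if m = 0. *)
Lemma lform_compact e : 0 < e -> exists (m : nat) (l : 'I_m -> (V -> R) -> R) (C : R),
 [/\ 0 <= C, forall j u v, H u -> H v -> l j (u - v) = l j u - l j v,
  forall j u, H u -> l j u ^+ 2 <= C * lform2 u u &
  forall u, H u -> lform1 u u <= e * lform2 u u + \sum_j l j u ^+ 2].
Proof.
move=> e0;have [C C0 hC] := lform2_bound;have [C' C'0 hC'] := laplace_bounds oO bO.
have e1 : 0 < e / (2 * (C' + 1)) by rewrite divr_gt0// mulr_gt0// ltr_wpDl.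
have [m [p [K [v [sK v0 hv]]]]] := rellich oO bO e1.
pose k : R:= m.+1%:R;have k0 : 0 < k by [].
pose a:= v ^+ 2 * k / (2 * e);have a0 : 0 <= a by rewrite divr_ge0 ?mulr_ge0 ?sqr_ge0 ?(ltW e0)// ltW.
pose c j (u : V -> R) := convol K (u \_ Om) (p j).
have sg u : sq u -> sqi mu setT (u \_ Om) by move=> su;apply:(proj1 (sqi_patch _ mO)).
have sKj j : sqi mu setT (fun y=> K (p j - y)) by exact:sqi_refl.
exists m, (fun j u=> Num.sqrt a * c j u), (a * (nrm mu setT K ^+ 2 * C));split.
- by apply:mulr_ge0=> //;apply:mulr_ge0=> //;exact:sqr_ge0.
- move=> j u w Hu Hw;rewrite -mulrBr;congr (_ * _).
 have [su _ _] := H4_H20_sq oO Hu;have [sw _ _] := H4_H20_sq oO Hw.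
 rewrite /c /convol;have -> : (u - w) \_ Om = u \_ Om - w \_ Om.
  by apply/funext=> x;rewrite !fctE /patch;case:ifP=> // _;rewrite subrr.
 exact:(dotBr mT (sg _ su) (sg _ sw) (sKj j)).
- move=> j u Hu;have [su _ _] := H4_H20_sq oO Hu.
 have h1 : `|c j u| <= nrm mu setT K * nrm mu Om u.
  apply:le_trans (dot_CS mT (sKj j) (sg _ su)) _.
  by rewrite (nrm_refl (p j) sK) [nrm mu Om u]nrm_patch.
 have h2 : c j u ^+ 2 <= (nrm mu setT K * nrm mu Om u) ^+ 2.
  by rewrite -(sqr_normr (c j u)) ler_pXn2r ?nnegrE ?mulr_ge0 ?nrm_ge0.
 have h3 : nrm mu Om u ^+ 2 <= C * lform2 u u:= hC _ (H4_H20_zjet oO Hu) [::] isT.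
 rewrite exprMn sqr_sqrtr//;have -> : a * (nrm mu setT K ^+ 2 * C) * lform2 u u = a * (nrm mu setT K ^+ 2 * (C * lform2 u u)) by ring.
 rewrite exprMn in h2;apply:(ler_wpM2l a0);apply:(le_trans h2);apply:ler_wpM2l h3;exact:sqr_ge0.
move=> u Hu;have zu:= H4_H20_zjet oO Hu;have [su _ _] := H4_H20_sq oO Hu.
set f:= nrm mu Om (lap2 (Jt Om u)).
have f0 : 0 <= f:= nrm_ge0 _ _ _.
have eB : lform2 u u = f ^+ 2:= lform2_jet zu.
have [h1 h2] := hC' _ zu;have h3:= hv _ zu;rewrite /= in h3.
have [s1 e2] := lap_jet oO (k:= 4) isT zu.1.
have sA : sq (opA 1%:M (Jt Om u) [::]) := proj1 (jet_opA 1%:M oO zu.1) [::] isT.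
have eb : lform1 u u = nrm mu Om (opA 1%:M (Jt Om u) [::]) ^+ 2.
 by rewrite /lform1 -sqr_nrm (ae_eq_nrm mO s1 sA e2).
have N : nrm mu Om u <= e / 2 * f + v * \sum_j `|c j u|.
 apply:le_trans h3 _;rewrite lerD2r.
 apply:(@le_trans _ _ (e / (2 * (C' + 1)) * (C' * f)));first by rewrite ler_pM2l.
 have -> : e / (2 * (C' + 1)) * (C' * f) = e / 2 * f * (C' / (C' + 1)).
  by field;rewrite lt0r_neq0// ltr_wpDl.
 by rewrite ler_piMr ?mulr_ge0 ?divr_ge0 ?(ltW e0)// ler_pdivrMr ?ltr_wpDl// mul1r lerDl.
rewrite eb eB;apply:le_trans h2 _;apply:(@le_trans _ _ (f * (e / 2 * f + v * \sum_j `|c j u|))).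
 by rewrite ler_wpM2l.
have Y j : f * v * `|c j u| <= e / (2 * k) * f ^+ 2 + (Num.sqrt a * c j u) ^+ 2.
 have -> : (Num.sqrt a * c j u) ^+ 2 = a * `|c j u| ^+ 2 by rewrite exprMn sqr_sqrtr// sqr_normr.
 set x:= `|c j u|.
 have -> : e / (2 * k) * f ^+ 2 + a * x ^+ 2 = f * v * x + ((e / k * f - v * x) ^+ 2) * (k / (2 * e)).
  by rewrite /a;field;rewrite !gt_eqF.
 by rewrite lerDl mulr_ge0 ?sqr_ge0// divr_ge0 ?mulr_ge0 ?(ltW e0) ?(ltW k0).
have Ys : f * (v * \sum_j `|c j u|) <= e / 2 * f ^+ 2 + \sum_j (Num.sqrt a * c j u) ^+ 2.
 rewrite mulrA mulr_sumr;apply:le_trans (ler_sum _ (fun j _=> Y j)) _.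
 rewrite big_split/= lerD2r sumr_const card_ord -[X in X <= _]mulr_natr.
 have -> : e / (2 * k) * f ^+ 2 * m%:R = e / 2 * f ^+ 2 * (m%:R / k) by field;rewrite gt_eqF.
 by rewrite ler_piMr ?mulr_ge0 ?divr_ge0 ?sqr_ge0 ?(ltW e0)// ler_pdivrMr// mul1r ler_nat.
rewrite mulrDr;apply:le_trans (lerD (lexx _) Ys) _.
by rewrite addrA lerD2r le_eqVlt;apply/orP;left;apply/eqP;field.
Qed.

Lemma lform1_ge0 u : 0 <= lform1 u u. Proof. exact:dot_ge0. Qed.
Lemma lform2_ge0 u : 0 <= lform2 u u. Proof. exact:dot_ge0. Qed.

Lemma test_H phi : test_function Om phi -> H phi.
Proof.
move=> tp;have [M pM] := test_csupp tp;apply:(@zjet_H4_H20 _ _ _ oO (fun s=> pderiv s phi));split.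
 exact:jet_sub mO mT (@subsetT _ _) (jet_csupp 4 (proj1 tp) pM).
by exists (fun _=> phi);split=> // s _;rewrite subrr (nrm0 mu mO);exact:cvg_cst.
Qed.

Lemma lform2_disj (A A' : set V) phi psi : A `&` A' = set0 -> A `<=` Om -> A' `<=` Om ->
 test_function A phi -> test_function A' psi -> lform2 phi psi = 0.
Proof.
move=> AA AO A'O tp tq.
have P (B : set V) f : B `<=` Om -> test_function B f -> [/\ sq (lap2 (fun s=> pderiv s f)), sq (lap Om (lap Om f)), aeq (lap Om (lap Om f)) (lap2 (fun s=> pderiv s f)) &
  forall x, ~ B x -> lap2 (fun s=> pderiv s f) x = 0].
 move=> BO tf;have tO:= test_sub BO tf;have [M fM] := test_csupp tf.
 have j4 : jet 4 Om (fun s=> pderiv s f) := jet_sub mO mT (@subsetT _ _) (jet_csupp 4 (proj1 tf) fM).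
 have [s1 e1] := lap2_jet oO j4.
 split=> // [|x nB];first exact:(proj1 (jet_opA 1%:M oO (jet_opA 1%:M oO j4)) [::] isT).
 rewrite lap2E big1// => k _;rewrite big1// => l _;rewrite big1// => p _;rewrite big1// => q _.
 by apply:etrans (congr1 (fun t=> _ * t) (test_eq0 (test_pderiv [:: k;l;p;q] tf) nB)) _;rewrite mulr0.
have [s1 s2 e1 z1] := P A phi AO tp;have [s3 s4 e2 z2] := P A' psi A'O tq.
rewrite /lform2 (ae_eq_dot mO s2 s1 s4 e1) dotC (ae_eq_dot mO s4 s3 s1 e2).
rewrite /dot /Rintegral;have -> : (\int[mu]_(x in Om) (lap2 (fun s=> pderiv s psi) x * lap2 (fun s=> pderiv s phi) x)%:E = \int[mu]_(x in Om) (cst 0%E x))%E.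
 apply:eq_integral=> x _;have [Ax|nA] := pselect (A x);last by rewrite z1// mulr0.
 rewrite z2 ?mul0r// => A'x;have : (A `&` A') x by [].
 by rewrite AA.
by rewrite integral_cst// mul0e.
Qed.

(** Bumps with disjoint supports are B-orthogonal. Orthogonality to the k vectors of es is a system
    of k linear equations for the k + 1 coefficients of a combination of bumps, which has a non-zero
    solution. *)
Lemma lform_infdim (O0 : Om !=set0) (es : seq (V -> R)) : (forall v, v \in es -> H v) ->
 exists u, [/\ H u, 0 < lform2 u u & forall v, v \in es -> lform2 u v = 0].
Proof.
move=> He;set k:= size es;have [x0 Ox0] := O0.
have [r /= r0 hr] : exists2 r : R, 0 < r & ball x0 r `<=` Om.
 by have:= open_nbhs_nbhs (conj oO Ox0);rewrite -nbhs_ballE=> -[r /= r0 hr];exists r.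
(* The k + 1 centres are 4 d apart and the balls have radius 2 d: they are disjoint, and 4 k d + 2 d
   <= r keeps them in Om. *)
pose d:= r / (8 * k.+1%:R);have d0 : 0 < d by rewrite divr_gt0// mulr_gt0.
have [K bK] := @bump_ex R n.+1 d d0;have [SK K0 Kd K1] := bK.
have KM : csupp d K by move=> x /ltW;exact:Kd.
have sK:= sqi_C1 (SK 1%N) KM.
pose y (j : 'I_k.+1) : V:= x0 + (j%:R * (4 * d)) *: 'e_ord0.
pose f j : V -> R:= fun x=> K (x - y j).
pose B j:= ball (y j) (2 * d).
have dk : 8 * k.+1%:R * d = r by rewrite mulrC divfK// mulf_neq0.
have BO j : B j `<=` Om.
 move=> x;rewrite /B -ball_normE /= => h;apply:hr;rewrite -ball_normE /=.
 have -> : x0 - x = (x0 - y j) + (y j - x) by rewrite addrA subrK.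
 apply:le_lt_trans (ler_normD _ _) _.
 have h1 : `|x0 - y j| <= j%:R * (4 * d).
  have e1 : `|'e_ord0 : V| <= 1 by apply:norm_le_coord=> // i;rewrite !mxE /=;case:(_ == _);rewrite ?normr1 ?normr0.
  have y0 : 0 <= (j%:R : R) * (4 * d) by rewrite mulr_ge0// mulr_ge0// ltW.
  by rewrite /y opprD addrA subrr add0r normrN normrZ (ger0_norm y0);exact:ler_piMr.
 have h2 : (j%:R : R) * d <= k%:R * d by rewrite ler_pM2r// ler_nat -ltnS.
 have h3 : k.+1%:R * d = k%:R * d + d by rewrite -natr1 mulrDl mul1r.
 by have k0 : 0 <= (k%:R : R) * d by [rewrite mulr_ge0// ltW];rewrite -dk -mulrA h3;move: h1 h h2 k0 d0;rewrite mulrCA;lra.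
have tf j : test_function (B j) (f j).
 apply:(@test_functionP _ _ _ _ (closed_ball (y j) d)).
 - move=> m;have:= C_k_affine 1%:M (- y j) (SK m);congr C_k;apply/funext=> x;by rewrite mulmx1.
 - exact:closed_ball_closed.
 - apply/bounded_setP;exists (`|y j| + 2 * d);first by rewrite ltr_wpDl// mulr_gt0.
  move=> x;rewrite closed_ballE//= /closed_ball_ /= => h.
  have -> : x = y j - (y j - x) by rewrite opprB addrC subrK.
  by apply:le_lt_trans (ler_normB _ _) _;rewrite ltrD2l;move: h d0;lra.
 - by move=> x;rewrite closed_ballE//= /closed_ball_ /B -ball_normE /= => h;move: h d0;lra.
 - move=> x;rewrite closed_ballE//= /closed_ball_ /= => /negP;rewrite -ltNge=> h.
  by apply:Kd;rewrite distrC ltW.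
have tO j:= test_sub (@BO j) (tf j).
have Hf j : H (f j) := test_H (tO j).
have fij i j : i != j -> lform2 (f i) (f j) = 0.
 move=> ij;apply:(@lform2_disj (B i) (B j))=> //.
 apply/seteqP;split=> // x [];rewrite /B -!ball_normE /= => h1 h2.
 have h3 : `|y i - y j| < 4 * d.
  have -> : y i - y j = (y i - x) - (y j - x) by rewrite opprB addrA subrK.
  by apply:le_lt_trans (ler_normB _ _) _;move: h1 h2;lra.
 have:= le_lt_trans (coord_le (y i - y j) ord0) h3.
 have -> : (y i - y j) ord0 ord0 = (i%:R - j%:R) * (4 * d) by rewrite /y !mxE !eqxx !mulr1;ring.
 rewrite normrM [`|4 * d|]ger0_norm;last by rewrite mulr_ge0// ltW.
 move=> h4;have d4 : 0 <= 4 * d by rewrite mulr_ge0// ltW.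
 suff h5 : 1 <= `|(i%:R : R) - j%:R| by have:= ler_peMl d4 h5;rewrite leNgt h4.
 have [lt|lt] : ((i : nat) < j)%N \/ ((j : nat) < i)%N by apply/orP;rewrite -neq_ltn.
  by rewrite distrC -natrB 1?ltnW// normr_nat ler1n subn_gt0 lt.
 by rewrite -natrB 1?ltnW// normr_nat ler1n subn_gt0 lt.
(* Otherwise the bump would vanish almost everywhere, although K has integral 1. *)
have fp j : 0 < lform2 (f j) (f j).
 rewrite lt_neqAle lform2_ge0 andbT eq_sym;apply/eqP=> /(lform2_eq0 (Hf j)) z.
 have [sf _ _] := H4_H20_sq oO (Hf j).
 have n1 : nrm mu setT (f j) = 0.
  have fz t : ~ Om t -> f j t = 0:= test_eq0 (tO j).
  have e : (f j) \_ Om = f j.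
   apply/funext=> t;rewrite /patch;have [//|tO'] := boolP (t \in Om);rewrite (fz t)=> [//|Ot].
   by move/negP: tO';apply;exact:mem_set.
  by rewrite -[RHS](nrm_null sf z) [RHS]nrm_patch e.
 have n2 : nrm mu setT K = 0.
  rewrite -(nrm_tr (- y j) sK);exact:n1.
 have z2:= nrm0_ae mT sK n2.
 have : \int[mu]_x K x = 0.
  rewrite /Rintegral (ae_eq_integral (fun x=> (cst 0 x)%:E))//=.
  - by rewrite integral_cst// mul0e.
  - by apply/measurable_EFinP;exact:sK.1.
  - by apply:filterS z2=> x hx _;rewrite hx.
 by rewrite K1=> /eqP;rewrite oner_eq0.
pose A : 'M[R]_(k.+1, k) := \matrix_(i, j) lform2 (f i) (nth 0 es j).
have [c c0 cA] : exists2 c : 'rV[R]_k.+1, c != 0 & c *m A = 0.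
 have : kermx A != 0 by rewrite -mxrank_eq0 mxrank_ker subn_eq0 -ltnNge ltnS rank_leq_col.
 by move=> /rowV0Pn[c /sub_kermxP cA c0];exists c.
pose u:= \sum_j c ord0 j *: f j.
have Vs (r' : seq 'I_k.+1) (P : pred 'I_k.+1) : H (\sum_(j <- r' | P j) c ord0 j *: f j).
 have HL a b w : H b -> H w -> H (a *: b + w) by move=> Hb Hw;have [] := H4_H20_lin oO a Hb Hw.
 by apply:(formV_sum H0 HL)=> j _;exact:(formV_Z H0 HL).
have HL a b w : H b -> H w -> H (a *: b + w) by move=> Hb Hw;have [] := H4_H20_lin oO a Hb Hw.
have HZ j : H (c ord0 j *: f j) by exact:(formV_Z H0 HL).
have uE w : H w -> lform2 u w = \sum_j c ord0 j * lform2 (f j) w.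
 move=> Hw;rewrite /u (form_suml H0 HL lform2L _ HZ Hw);apply:eq_bigr=> j _.
 have h:= form_Zl H0 lform2L (c ord0 j) (Hf j) Hw;exact h.
exists u;split=> [||v ve];first exact:Vs.
- rewrite uE;last exact:Vs.
 have E j : lform2 (f j) u = c ord0 j * lform2 (f j) (f j).
  rewrite lform2C uE// (bigD1 j)//= big1 ?addr0// => i ij.
  by rewrite fij// mulr0.
 have [j cj] : exists j, c ord0 j != 0.
  by have /rV0Pn[j] := c0;exists j.
 have p1 : 0 < c ord0 j ^+ 2 * lform2 (f j) (f j) by apply:mulr_gt0=> //;rewrite lt_neqAle sqr_ge0 eq_sym sqrf_eq0 cj.
 rewrite (bigD1 j)//= E mulrA -expr2;apply:ltr_pwDl p1 _.
 by apply:sumr_ge0=> i _;rewrite E mulrA -expr2;apply:mulr_ge0;[exact:sqr_ge0|exact:lform2_ge0].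
- have vi : (index v es < k)%N by rewrite index_mem.
 have:= congr1 (fun M : 'rV_k=> M ord0 (Ordinal vi)) cA;rewrite !mxE=> <-.
 rewrite uE;last exact:He.
 by apply:eq_bigr=> j _;rewrite mxE /= nth_index.
Qed.

End instance.

(** * Infinitely many independent harmonic functions *)

Section harmonic.
Context (R : realType) (n : nat).
Notation V:= 'rV[R]_n.+2.
Notation mu:= (lebesgue_rV R n.+2).
Notation i0:= (ord0 : 'I_n.+2).
Notation i1:= (lift ord0 ord0 : 'I_n.+2).

(* Real and imaginary parts of the powers of [x_0 + i x_1]. *)
Fixpoint cpow (k : nat) : (V -> R) * (V -> R) :=
 if k is k'.+1 then let pq:= cpow k' in
  ((fun x : V=> x ord0 i0) * pq.1 - (fun x : V=> x ord0 i1) * pq.2,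
   (fun x : V=> x ord0 i0) * pq.2 + (fun x : V=> x ord0 i1) * pq.1)
 else (cst 1, cst 0).
Definition rpow k:= (cpow k).1.
Definition ipow k:= (cpow k).2.

Lemma smooth_cpow k : smooth (rpow k) /\ smooth (ipow k).
Proof.
rewrite /rpow /ipow;elim: k=> [|k [Sp Sq]];first by split=> m;exact:C_k_cst.
by split=> m;[apply:C_kD;[|apply:C_kN]|apply:C_kD];apply:C_kM=> //;exact:C_k_coord.
Qed.

Lemma derive_cpow k x j :
 is_derive x 'e_j (rpow k) (k%:R * ((j == i0)%:R * rpow k.-1 x - (j == i1)%:R * ipow k.-1 x)) /\
 is_derive x 'e_j (ipow k) (k%:R * ((j == i0)%:R * ipow k.-1 x + (j == i1)%:R * rpow k.-1 x)).
Proof.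
elim: k=> [|k [hp hq]].
 by rewrite !mul0r;split;exact:is_derive_cst.
have h0 : is_derive x 'e_j (fun x : V=> x ord0 i0) (j == i0)%:R by rewrite eq_sym;exact:is_derive_coord.
have h1 : is_derive x 'e_j (fun x : V=> x ord0 i1) (j == i1)%:R by rewrite eq_sym;exact:is_derive_coord.
have E : rpow k.+1 = (fun x : V=> x ord0 i0) * rpow k - (fun x : V=> x ord0 i1) * ipow k by [].
have E' : ipow k.+1 = (fun x : V=> x ord0 i0) * ipow k + (fun x : V=> x ord0 i1) * rpow k by [].
have Ek : k%:R * rpow k x = k%:R * (x ord0 i0 * rpow k.-1 x - x ord0 i1 * ipow k.-1 x) by case:k {hp hq E E'} => [|k];rewrite ?mul0r.
have Ek' : k%:R * ipow k x = k%:R * (x ord0 i0 * ipow k.-1 x + x ord0 i1 * rpow k.-1 x) by case:k {hp hq E E' Ek} => [|k];rewrite ?mul0r.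
have n1 : (k.+1%:R : R) = k%:R + 1 by rewrite natr1.
split.
- rewrite E /=;apply:is_derive_eq.
 rewrite /GRing.scale /= n1 mulrDl mul1r.
 have -> : k%:R * ((j == i0)%:R * rpow k x - (j == i1)%:R * ipow k x) = (j == i0)%:R * (k%:R * rpow k x) - (j == i1)%:R * (k%:R * ipow k x) by ring.
 by rewrite Ek Ek';ring.
- rewrite E' /=;apply:is_derive_eq.
 rewrite /GRing.scale /= n1 mulrDl mul1r.
 have -> : k%:R * ((j == i0)%:R * ipow k x + (j == i1)%:R * rpow k x) = (j == i0)%:R * (k%:R * ipow k x) + (j == i1)%:R * (k%:R * rpow k x) by ring.
 by rewrite Ek Ek';ring.
Qed.

(** With z = x_0 + i x_1, D_0 z^k = k z^(k-1) and D_1 z^k = i k z^(k-1), so that the two second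
    derivatives cancel and the others vanish. *)
Lemma laplacian_rpow k x : \sum_j 'D_('e_j) (fun y=> 'D_('e_j) (rpow k) y) x = 0.
Proof.
have D j : (fun y=> 'D_('e_j) (rpow k) y) = (k%:R * (j == i0)%:R) *: rpow k.-1 - (k%:R * (j == i1)%:R) *: ipow k.-1.
 apply/funext=> y;have [_ ->] := (derive_cpow k y j).1.
 by rewrite !fctE /GRing.scale /=;ring.
have DD j : 'D_('e_j) (fun y=> 'D_('e_j) (rpow k) y) x =
  k%:R * k.-1%:R * ((j == i0)%:R - (j == i1)%:R) * rpow k.-1.-1 x.
 rewrite D;have [hp hq] := derive_cpow k.-1 x j.
 have h : is_derive x 'e_j ((k%:R * (j == i0)%:R) *: rpow k.-1 - (k%:R * (j == i1)%:R) *: ipow k.-1)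
  (k%:R * k.-1%:R * ((j == i0)%:R - (j == i1)%:R) * rpow k.-1.-1 x).
  apply:is_derive_eq;rewrite /GRing.scale /=.
  have [->|n0] := eqVneq j i0;first by rewrite /=;ring.
  by case:(j == i1);rewrite /=;ring.
 by have [_ ->] := h.
rewrite (eq_bigr _ (fun j _=> DD j)) -mulr_suml -mulr_sumr.
have z : \sum_(j < n.+2) ((j == i0)%:R - (j == i1)%:R : R) = 0.
 rewrite big_ord_recl big_ord_recl big1=> [|j _] /=;last by rewrite subrr.
 by rewrite addr0 subr0 sub0r subrr.
by rewrite z mulr0 mul0r.
Qed.

(** D_0 maps the power of degree j+1 to j+1 times the power of degree j. A linear relation is thus
    turned into a shorter one, and the constant coefficient is determined last. *)
Lemma rpow_free (Om : set V) m (d : nat -> R) : open Om -> Om !=set0 ->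
 (forall x, Om x -> \sum_(j < m) d j * rpow j x = 0) -> forall j, (j < m)%N -> d j = 0.
Proof.
move=> oO [x0 Ox0];elim: m d=> // m IH d hd.
have z x : Om x -> \sum_(j < m) (d j.+1 * j.+1%:R) * rpow j x = 0.
 move=> Ox;have e1 : 'D_('e_i0) (fun y=> \sum_(j < m.+1) d j * rpow j y) x = 0.
  have -> : 'D_('e_i0) (fun y=> \sum_(j < m.+1) d j * rpow j y) x = 'D_('e_i0) (cst 0 : V -> R) x.
   by apply:near_eq_derive;have:= open_nbhs_nbhs (conj oO Ox);apply:filterS=> y;exact:hd.
  exact:derive_cst.
 have D j : is_derive x 'e_i0 (d j *: rpow j) (d j * (j%:R * rpow j.-1 x)).
  have [hp _] := derive_cpow j x i0;apply:is_derive_eq.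
  by rewrite /GRing.scale /= ?eqxx /= mul1r mul0r subr0.
 have E : (fun y=> \sum_(j < m.+1) d j * rpow j y) = \sum_(j < m.+1) d j *: rpow j.
  by apply/funext=> y;rewrite fct_sumE.
 have h : is_derive x 'e_i0 (\sum_(j < m.+1) d j *: rpow j) (\sum_(j < m.+1) d j * (j%:R * rpow j.-1 x)).
  by apply:is_derive_sum=> j;exact:D.
 have [_ h2] := h;rewrite E h2 big_ord_recl /= mul0r mulr0 add0r in e1.
 by rewrite -[RHS]e1;apply:eq_bigr=> j _;rewrite mulrA.
have hS j : (j < m)%N -> d j.+1 = 0.
 move=> jm;have:= IH (fun j=> d j.+1 * j.+1%:R) z j jm=> /eqP.
 by rewrite mulf_eq0 pnatr_eq0 orbF=> /eqP.
have d0 : d 0%N = 0.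
 have:= hd _ Ox0;rewrite big_ord_recl big1=> [|j _];last by rewrite hS// mul0r.
 by rewrite addr0 /= mulr1.
by case=> // j;rewrite ltnS;exact:hS.
Qed.

Lemma ae0_continuous (Om : set V) (f : V -> R) : open Om -> (forall x, {for x, continuous f}) ->
 ae_eq mu Om f (cst 0) -> forall x, Om x -> f x = 0.
Proof.
move=> oO cf [N [mN N0 hN]] x Ox;apply/eqP;apply:contrapT=> /negP fx.
have oA : open (Om `&` f @^-1` [set t | t != 0]).
 apply:openI=> //;apply:open_comp=> // y _;exact:cf.
have:= lebesgue_open_gt0 oA (ex_intro _ x (conj Ox fx)).
rewrite lt_neqAle=> /andP[/eqP h _];apply:h;apply/esym/eqP.
rewrite eq_le measure_ge0 andbT -N0;apply:le_measure;rewrite ?inE//;first exact:open_meas.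
move=> y [Oy /eqP fy];apply:hN=> h;apply:fy;exact:h.
Qed.

Variable Om : set V.
Hypothesis oO : open Om.
Hypothesis bO : bounded_set Om.
Hypothesis O0 : Om !=set0.

(** A cut-off equal to 1 on the bounded set Om makes the power square-integrable with all its
    derivatives, without changing it on Om. *)
Lemma rpow_H2h k : exists2 h, H2h Om h & forall x, Om x -> h x = rpow k x.
Proof.
have mO:= open_meas oO.
have [M M0 OM] := proj1 (bounded_setP _) bO.
have [chi [Sc cM c1]] := @cutoff_ex R n.+2 M 1 M0 ltr01.
pose h:= chi * rpow k.
have Sh : smooth h by move=> m;apply:C_kM=> //;exact:(smooth_cpow k).1.
have hM : csupp (M + 2 * 1) h by move=> x /cM e;rewrite /h fctE e mul0r.
have hE x : Om x -> h x = rpow k x by move=> Ox;rewrite /h fctE c1 ?mul1r// ltW// OM.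
have jh : jet 2 Om (fun s=> pderiv s h) := jet_sub mO measurableT (@subsetT _ _) (jet_csupp 2 Sh hM).
exists h=> //;split;first exact:(jet_Hk jh).
have [_ e] := lap_jet oO (k:= 2) isT jh;apply:(ae_eq_trans e);apply:aeW=> x Ox.
have d1 j y : Om y -> 'D_('e_j) h y = 'D_('e_j) (rpow k) y.
 by move=> Oy;apply:near_eq_derive;have:= open_nbhs_nbhs (conj oO Oy);apply:filterS=> z;exact:hE.
have d2 j : 'D_('e_j) (fun y=> 'D_('e_j) h y) x = 'D_('e_j) (fun y=> 'D_('e_j) (rpow k) y) x.
 by apply:near_eq_derive;have:= open_nbhs_nbhs (conj oO Ox);apply:filterS=> z;exact:d1.
apply:etrans (laplacian_rpow k x);rewrite /opA fct_sumE;apply:eq_bigr=> j _.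
apply:etrans _ (d2 j);rewrite fct_sumE (bigD1 j)//= big1 ?addr0=> [|l lj].
 by rewrite mxE eqxx;exact:scale1r.
by rewrite mxE eq_sym (negbTE lj);exact:scale0r.
Qed.

Lemma kernel_infinite : ~ finite_dim Om (pb_eigenspace Om 0).
Proof.
move=> [m [v [_ hv]]].
have [h hP] := choice (fun k=> let: ex_intro2 h h1 h2:= rpow_H2h k in ex_intro (fun h=> H2h Om h /\ forall x, Om x -> h x = rpow k x) h (conj h1 h2)).
have Eh k : pb_eigenspace Om 0 (h k).
 rewrite /pb_eigenspace /= /pb_eigenfunction eqxx.
 have [H _] := hP k;have [z|nz] := pselect (ae_eq_on Om (h k) (cst 0));last by left.
 by right;split=> //;exact:H.1.1.
have [c hc] := choice (fun k=> hv _ (Eh k)).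
pose A : 'M[R]_(m.+1, m) := \matrix_(k, i) c k i.
(* m + 1 powers expressed by m functions satisfy a linear relation, with coefficients in the left
   kernel of A. It holds almost everywhere, hence everywhere on Om by continuity. *)
have [d d0 dA] : exists2 d : 'rV[R]_m.+1, d != 0 & d *m A = 0.
 have : kermx A != 0 by rewrite -mxrank_eq0 mxrank_ker subn_eq0 -ltnNge ltnS rank_leq_col.
 by move=> /rowV0Pn[d /sub_kermxP dA d0];exists d.
pose f:= fun x=> \sum_(k < m.+1) d ord0 k * rpow k x.
have cf x : {for x, continuous f}.
 have -> : f = \sum_(k < m.+1) d ord0 k *: rpow k by apply/funext=> y;rewrite fct_sumE.
 have : C_k 0 (\sum_(k < m.+1) d ord0 k *: rpow k).
  by apply:C_k_sum=> k _;apply:C_kZ;exact:(smooth_cpow k).1.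
 by move=> /C_k0;exact.
have zf : ae_eq mu Om f (cst 0).
 have : \forall x \ae mu, forall k : 'I_m.+1, Om x -> h k x = \sum_(i < m) c k i * v i x.
  by apply:filter_forall=> k;exact:hc.
 apply:filterS=> x hx Ox;rewrite /f /=.
 have -> : \sum_(k < m.+1) d ord0 k * rpow k x = \sum_(k < m.+1) \sum_(i < m) d ord0 k * c k i * v i x.
  apply:eq_bigr=> k _;rewrite -(hP k).2// hx// mulr_sumr;apply:eq_bigr=> i _;exact:mulrA.
 rewrite exchange_big big1// => i _;rewrite -mulr_suml.
 have:= congr1 (fun M : 'rV_m=> M ord0 i) dA;rewrite !mxE=> e.
 by rewrite (eq_bigr (fun k=> d ord0 k * A k i)) ?e ?mul0r// => k _;rewrite mxE.
have zx:= ae0_continuous oO cf zf.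
have z:= @rpow_free Om m.+1 (fun k=> d ord0 (inord k)) oO O0 _.
move/eqP: d0;apply;apply/rowP=> k;rewrite mxE.
have:= z _ k (ltn_ord k);rewrite inord_val;apply=> x Ox;rewrite -[RHS](zx x Ox).
by apply:eq_bigr=> j _;rewrite inord_val.
Qed.
End harmonic.

(** * The theorem *)

Section assembly.
Context (R : realType) (n : nat).
Notation V:= 'rV[R]_n.+1.
Notation mu:= (lebesgue_rV R n.+1).
Variable Om : set V.
Hypothesis oO : open Om.
Let mO : measurable Om:= open_meas oO.
Notation sq:= (sqi mu Om).
Notation aeq:= (ae_eq mu Om).
Notation H:= (H4_H20 Om).

Lemma H4_H20_comb (I : Type) (r : seq I) (c : I -> R) (e : I -> V -> R) : (forall i, H (e i)) ->
 H (\sum_(i <- r) c i *: e i) /\ aeq (lap Om (\sum_(i <- r) c i *: e i)) (\sum_(i <- r) c i *: lap Om (e i)).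
Proof.
move=> He;elim: r=> [|i r [IH1 IH2]].
 rewrite !big_nil;split;first exact:(H0 oO).
 by apply:(lap_null oO (sqi0 mu Om));exact:ae_eq_refl.
rewrite !big_cons;have [h1 h2 _] := H4_H20_lin oO (c i) (He i) IH1;split=> //.
apply:(ae_eq_trans h2);apply:filterS IH2=> x hx Ox;rewrite !fctE;congr (_ + _);exact:hx.
Qed.

Lemma lap_res (e : nat -> V -> R) u m : (forall k, H (e k)) -> H u ->
 H (spec_res (lform2 Om) e u m) /\
 aeq (lap Om (spec_res (lform2 Om) e u m)) (fun x=> lap Om u x - \sum_(k < m) lform2 Om u (e k) * lap Om (e k) x).
Proof.
move=> He Hu;rewrite /spec_res.
have [h1 h2] := H4_H20_comb (index_enum 'I_m) (fun k : 'I_m=> lform2 Om u (e k)) (fun k : 'I_m=> He k).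
have [h3 h4 _] := H4_H20_lin oO (-1) h1 Hu.
have E : u - \sum_(k < m) lform2 Om u (e k) *: e k = -1 *: (\sum_(k < m) lform2 Om u (e k) *: e k) + u.
 by rewrite scaleN1r addrC.
rewrite E;split=> //;apply:(ae_eq_trans h4).
apply:filterS h2=> x hx Ox;rewrite !fctE hx// fct_sumE scaleN1r addrC;congr (_ - _).
Qed.

(** An equality at all points, although the arguments of the outer Laplacian agree only almost
    everywhere: see [weak_deriv_ext]. *)
Lemma lap_lap_res (e : nat -> V -> R) u w m : (forall k, H (e k)) -> H u -> sq w -> aeq w (lap Om u) ->
 lap Om (fun x=> w x - \sum_(k < m) lform2 Om u (e k) * lap Om (e k) x) =
 lap Om (lap Om (spec_res (lform2 Om) e u m)).
Proof.
move=> He Hu sw ew;have [Hr er] := lap_res m He Hu;have [_ sr _] := H4_H20_sq oO Hr.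
apply:(lap_ext oO _ sr).
 have -> : (fun x=> w x - \sum_(k < m) lform2 Om u (e k) * lap Om (e k) x) = w - \sum_(k < m) lform2 Om u (e k) *: lap Om (e k).
  by apply/funext=> x;rewrite !fctE fct_sumE.
 apply:(sqiB mO sw);apply:(sqi_sum mO)=> k _;apply:(sqiZ mO).
 by have [] := H4_H20_sq oO (He k).
by apply:filterS2 er ew=> x h1 h2 Ox;rewrite h1// h2.
Qed.

Lemma lap_dotE f g : lap Om f = lap Om (lap Om g) -> lap_dot Om f f = lform2 Om g g.
Proof. by move=> h;rewrite /lap_dot h. Qed.

Lemma weak_solution_form lambda u : weak_solution Om lambda u <->
 forall w, H w -> lform2 Om u w = lambda * lform1 Om u w.
Proof. by []. Qed.

End assembly.

(** The dimension n + 1 has to be at least two: on an interval the harmonic functions are affine. *)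
Lemma kernel_infinite_dim (R : realType) (n : nat) (Om : set 'rV[R]_n.+1) : (0 < n)%N ->
 open Om -> bounded_set Om -> Om !=set0 -> ~ finite_dim Om (pb_eigenspace Om 0).
Proof. by case:n Om=> // n Om _ oO bO O0;exact:kernel_infinite. Qed.

Theorem theorem2p5 (R : realType) (n : nat) (alpha : R)
    (Omega : set 'rV[R]_n.+1) (alpha_gt0 : 0 < alpha) (alpha_lt1 : alpha < 1)
    (Omega_domain : domain Omega) (Omega_bounded : bounded_set Omega)
    (Omega_C4alpha : class_C_kalpha 4 alpha Omega) :
  [/\ forall lambda, pb_eigenvalue Omega lambda -> 0 <= lambda,
      (0 < n)%N -> ~ finite_dim Omega (pb_eigenspace Omega 0),
      forall h, H2h Omega h -> ~ ae_eq_on Omega h (cst 0) ->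
        pb_eigenfunction Omega 0 h,
      exists lam : nat -> R,
        [/\ forall i j, (i < j)%N -> lam i < lam j,
            lam k @[k --> \oo] --> +oo &
            [set lambda | 0 < lambda /\ pb_eigenvalue Omega lambda] = range lam] &
      (forall lambda, 0 < lambda -> pb_eigenvalue Omega lambda ->
         finite_dim Omega (pb_eigenspace Omega lambda)) /\
      exists v : nat -> 'rV[R]_n.+1 -> R,
        (forall k, exists2 lambda, 0 < lambda &
           pb_eigenfunction Omega lambda (v k)) /\
        orthonormal_basis Omega v].
Proof.
case:(Omega_domain)=> O0 oO _.
have mO : measurable Omega:= open_meas oO.
have HL c u v : H4_H20 Omega u -> H4_H20 Omega v -> H4_H20 Omega (c *: u + v).
 by move=> Hu Hv;have [] := H4_H20_lin oO c Hu Hv.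
have pos u : H4_H20 Omega u -> ~ ae_eq_on Omega u (cst 0) -> 0 < lform2 Omega u u.
 move=> Hu nz;rewrite lt_neqAle lform2_ge0 andbT eq_sym;apply/eqP=> z;apply:nz.
 exact:(proj1 (lform2_eq0 oO Omega_bounded Omega_C4alpha Hu) z).
(* The ambient space is the one of all functions, and membership in H^4 and H^2_0 is the predicate
   V. The eigenvalues are the reciprocals of the mu k. *)
have [e [mu [lam [he oe ce ev [lam1 lam2 lam3]]]]] := @spectral_theorem R _ (H4_H20 Omega) (lform2 Omega) (lform1 Omega)
 (H0 oO) HL (lform2L oO) (fun u v _ _=> lform2C Omega u v) (fun u _=> lform2_ge0 Omega u)
 (lform1L oO) (fun u v _ _=> lform1C Omega u v) (fun u _=> lform1_ge0 Omega u)
 (lform1_null oO) (lform_compact oO Omega_bounded Omega_C4alpha)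
 (lform2_complete oO Omega_bounded Omega_C4alpha) (lform_infdim oO Omega_bounded Omega_C4alpha O0).
have He k : H4_H20 Omega (e k) by have [] := he k.
have mp k : 0 < mu k by have [] := he k.
have nz0 l : 0 < l -> (l == 0 :> R) = false by move=> l0;rewrite gt_eqF.
have eigv lambda u : 0 < lambda -> weak_solution Omega lambda u -> eigvec (H4_H20 Omega) (lform2 Omega) (lform1 Omega) u lambda^-1.
 move=> l0 wu w Hw;have h:= proj1 (weak_solution_form _ _ _) wu w Hw.
 move: h;set a:= lform2 _ _ _;set b:= lform1 _ _ _=> ->.
 by rewrite mulrA mulVf ?mul1r// nz0.
have eigf k : pb_eigenfunction Omega (mu k)^-1 (lap Omega (e k)).
 have [s0 s1 _] := H4_H20_sq oO (He k);rewrite /pb_eigenfunction nz0 ?invr_gt0//;split=> //.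
 exists (e k);split=> //.
 - move=> z;have:= proj2 (lform2_eq0 oO Omega_bounded Omega_C4alpha (He k)) z.
  by rewrite oe eqxx=> /eqP;rewrite oner_eq0.
 - apply:(proj2 (weak_solution_form _ _ _))=> w Hw;have [_ _ ek] := he k.
  rewrite ek//;set a:= lform2 _ _ _.
  by rewrite mulrA mulVf ?mul1r// gt_eqF.
 - exact:ae_eq_refl.
split.
- move=> lambda [v];rewrite /pb_eigenfunction;have [->//|l0] := eqVneq lambda 0.
 (* Testing with u itself: 0 < B(u,u) = lambda b(u,u) and b(u,u) >= 0 exclude lambda < 0. *)
 move=> [_ [u [Hu nz wu _]]];have h:= proj1 (weak_solution_form _ _ _) wu u Hu.
 have:= pos u Hu nz;rewrite h leNgt=> h1;apply/negP=> l1.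
 by move: h1;rewrite ltNge mulr_le0_ge0 ?(ltW l1)// lform1_ge0.
- by move=> n0;exact:(kernel_infinite_dim n0 oO Omega_bounded O0).
- by move=> h Hh nz;rewrite /pb_eigenfunction eqxx.
- exists lam;split=> //;rewrite lam3;apply/seteqP;split=> [l [l0 [v]]|_ [k _ <-]].
  rewrite /pb_eigenfunction nz0// => -[_ [u [Hu nz wu _]]].
  have [/(_ (pos u Hu nz))[k hk] _ _] := ev u _ Hu (eigv _ _ l0 wu).
  by exists k=> //;rewrite -hk invrK.
 by split;[rewrite invr_gt0|exists (lap Omega (e k));exact:eigf].
split;last first.
 exists (fun k=> lap Omega (e k));split=> [k|];first by exists (mu k)^-1;[rewrite invr_gt0|exact:eigf].
 have dE w u k : L2 Omega w -> H4_H20 Omega u -> ae_eq_on Omega w (lap Omega u) ->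
   lap_dot Omega w (lap Omega (e k)) = lform2 Omega u (e k).
  move=> sw Hu ew;have [_ su _] := H4_H20_sq oO Hu.
  by rewrite /lap_dot (lap_ext oO sw su ew).
 split=> [k|j k|w [Lw [u Hu ew]] /=].
 - by have [_ s1 _] := H4_H20_sq oO (He k);split=> //;exists (e k)=> //;exact:ae_eq_refl.
 - exact:oe.
 pose r m (x : 'rV[R]_n.+1) := w x - \sum_(k < m) lap_dot Omega w (lap Omega (e k)) * lap Omega (e k) x.
 have E : (fun m=> lap_dot Omega (r m) (r m)) =
   (fun m=> lform2 Omega (spec_res (lform2 Omega) e u m) (spec_res (lform2 Omega) e u m)).
  apply/funext=> m;apply:lap_dotE.
  have rE : r m = (fun x=> w x - \sum_(k < m) lform2 Omega u (e k) * lap Omega (e k) x).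
   apply/funext=> x.
   have e1 : \sum_(k < m) lap_dot Omega w (lap Omega (e k)) * lap Omega (e k) x = \sum_(k < m) lform2 Omega u (e k) * lap Omega (e k) x.
    by apply:eq_bigr=> k _;exact:(congr1 (fun t=> t * lap Omega (e k) x) (dE w u k Lw Hu ew)).
   exact:(congr1 (fun t=> w x - t) e1).
  exact:(etrans (congr1 (lap Omega) rE) (lap_lap_res oO m He Hu Lw ew)).
 change (lap_dot Omega (r m) (r m) @[m --> \oo] --> (0 : R)).
 by rewrite E;exact:ce.
move=> lambda l0 [v];rewrite {1}/pb_eigenfunction nz0// => -[_ [u [Hu nz wu _]]].
have [_ _ /(_ _)[|N hN]] := ev u _ Hu (eigv _ _ l0 wu);first by rewrite invr_gt0.
(* The spanning functions must lie in the eigenspace. Those e i that belong to another eigenvalue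
   are replaced by 0, and by [fz] their coefficients vanish anyway. *)
exists N, (fun i : 'I_N=> if lambda^-1 == mu i then lap Omega (e i) else cst 0);split=> [i|w].
 case:eqP=> [il|_];first by left;rewrite -[lambda]invrK il;exact:eigf.
 by right;split;[exact:(sqi0 (lebesgue_rV R n.+1) Omega)|exact:ae_eq_refl].
case=> [|[_ z]];last first.
 by exists (fun _=> 0);apply:filterS z=> x hx Ox;rewrite hx// big1// => i _;rewrite mul0r.
rewrite /pb_eigenfunction nz0// => -[_ [f [Hf _ wf ew]]].
have ef:= eigv _ _ l0 wf;have [_ fz _] := ev f _ Hf ef.
exists (fun i : 'I_N=> lform2 Omega f (e i)).
(* By the choice of N the residue has B-norm 0, so it vanishes almost everywhere and so does its
   Laplacian. *)
have [Hr er] := lap_res oO N He Hf;have [sr _ _] := H4_H20_sq oO Hr.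
have z:= lap_null oO sr (proj1 (lform2_eq0 oO Omega_bounded Omega_C4alpha Hr) (hN f Hf ef)).
apply:filterS3 er ew z=> x h1 h2 h3 Ox;rewrite h2//.
have:= h3 Ox;rewrite h1// => /eqP;rewrite /cst subr_eq0=> /eqP ->.
apply:eq_bigr=> i _;case:eqP=> // /eqP ni.
by rewrite fz// !mul0r.
Qed.
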